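(* Let $1<p\leq 2$. (i) If $E\subset\ell_p$ and $S_{E,p}(\mathscr{G})<\infty$ for some multiresolution family $\mathscr{G}$ for $E$ with inflation factor $A_{\mathscr{G}}\geq 240$, then $E$ is contained in a curve $\Gamma$ in $\ell_p$ with $\mathcal{H}^1(\Gamma)\leq C(p,A_{\mathscr{G}})\,S_{E,p}(\mathscr{G})$. (ii) If $\Sigma\subset\ell_p$ is connected and $\mathscr{H}$ is a multiresolution family for $\Sigma$ with inflation factor $A_{\mathscr{H}}>1$, then $S_{\Sigma,2}(\mathscr{H})\leq C(p,A_{\mathscr{H}})\,\mathcal{H}^1(\Sigma)$. Let $2\leq p<\infty$. (iii) If $E\subset\ell_p$ and $S_{E,2}(\mathscr{G})<\infty$ for some multiresolution family $\mathscr{G}$ for $E$ with inflation factor $A_{\mathscr{G}}\geq 240$, then $E$ is contained in a curve $\Gamma$ in $\ell_p$ with $\mathcal{H}^1(\Gamma)\leq C(p,A_{\mathscr{G}})\,S_{E,2}(\mathscr{G})$. (iv) If $\Sigma\subset\ell_p$ is connected and $\mathscr{H}$ is a multiresolution family for $\Sigma$ with inflation factor $A_{\mathscr{H}}>1$, then $S_{\Sigma,p}(\mathscr{H})\leq C(p,A_{\mathscr{H}})\,\mathcal{H}^1(\Sigma)$. Here $C(\cdot)$ denotes finite constants depending only on the indicated parameters.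
   Context: All Banach spaces are real. $\ell_p$ is the Banach space of $p$-summable real sequences with norm $|x|_p=(\sum_i|x_i|^p)^{1/p}$. For a Banach space $\mathbb{X}$, a nonempty set $E\subset\mathbb{X}$ and a set $Q\subset\mathbb{X}$ of positive diameter, the Jones beta number is $\beta_E(Q)=\inf_L\sup_{x\in E\cap Q}\mathrm{dist}(x,L)/\mathrm{diam}\,Q$ if $E\cap Q\neq\emptyset$, where $L$ ranges over all one-dimensional affine subspaces (lines) of $\mathbb{X}$, and $\beta_E(Q)=0$ if $E\cap Q=\emptyset$. For $\rho>0$, a $\rho$-net for $E$ is a set $X\subset E$ such that $|y-z|\geq\rho$ for all distinct $y,z\in X$ and $\mathrm{dist}(x,X)<\rho$ for all $x\in E$. A multiresolution family for $E$ with inflation factor $A>1$ is the collection of closed balls $\mathscr{G}=\{B(x,A2^{-k}):x\in X_k,\ k\in\mathbb{Z}\}$ (indexed by the pairs $(k,x)$), where $(X_k)_{k\in\mathbb{Z}}$ is a nested family ($X_k\subset X_{k+1}$) and each $X_k$ is a $2^{-k}$-net for $E$. For $0<r<\infty$, $S_{E,r}(\mathscr{G})=\mathrm{diam}\,E+\sum_{Q\in\mathscr{G}}\beta_E(Q)^r\,\mathrm{diam}\,Q$. A curve is the image of a continuous map from $[0,1]$; $\mathcal{H}^1$ is one-dimensional Hausdorff measure. *)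

(* Defs.v *)
From Stdlib Require Import Reals Lra List ZArith ClassicalEpsilon.
Open Scope R_scope.

(* Nonnegative extended reals [0, +oo]                                 *)
Inductive Rbar : Type := Fin (x : R) | PInf.

Definition Rbar_le (x y : Rbar) : Prop :=
  match x, y with
  | _, PInf => True
  | PInf, Fin _ => False
  | Fin a, Fin b => a <= b
  end.

Definition Eplus (x y : Rbar) : Rbar :=
  match x, y with
  | Fin a, Fin b => Fin (a + b)
  | _, _ => PInf
  end.

Definition Emult (x y : Rbar) : Rbar :=
  match x, y with
  | Fin a, Fin b => Fin (a * b)
  | Fin a, PInf => if Req_EM_T a 0 then Fin 0 else PInf
  | PInf, Fin b => if Req_EM_T b 0 then Fin 0 else PInf
  | PInf, PInf => PInf
  end.

(* x / d, only meaningful for 0 < d < oo *)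
Definition Ediv (x d : Rbar) : Rbar :=
  match x, d with
  | Fin a, Fin b => Fin (a / b)
  | PInf, Fin _ => PInf
  | _, PInf => Fin 0
  end.

(* supremum in [0,+oo] (sup of the empty set is 0) *)
Definition is_sup0 (P : Rbar -> Prop) (s : Rbar) : Prop :=
  Rbar_le (Fin 0) s /\
  (forall x, P x -> Rbar_le x s) /\
  (forall b, Rbar_le (Fin 0) b -> (forall x, P x -> Rbar_le x b) -> Rbar_le s b).

Definition Esup (P : Rbar -> Prop) : Rbar :=
  epsilon (inhabits PInf) (is_sup0 P).

(* infimum in [0,+oo] (inf of the empty set is +oo) *)
Definition is_inf0 (P : Rbar -> Prop) (s : Rbar) : Prop :=
  Rbar_le (Fin 0) s /\
  (forall x, P x -> Rbar_le s x) /\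
  (forall b, Rbar_le (Fin 0) b -> (forall x, P x -> Rbar_le b x) -> Rbar_le b s).

Definition Einf (P : Rbar -> Prop) : Rbar :=
  epsilon (inhabits PInf) (is_inf0 P).

Definition Esum {I : Type} (D : I -> Prop) (f : I -> Rbar) : Rbar :=
  Esup (fun v => exists l : list I,
          NoDup l /\ Forall D l /\ v = fold_right Eplus (Fin 0) (map f l)).

Definition seqR := nat -> R.

(* a^r for a >= 0, r > 0, with 0^r = 0 *)
Definition rpow (a r : R) : R :=
  if Rle_dec a 0 then 0 else Rpower a r.

Definition Epow (x : Rbar) (r : R) : Rbar :=
  match x with Fin a => Fin (rpow a r) | PInf => PInf end.

Definition vadd (x y : seqR) : seqR := fun i => x i + y i.
Definition vsub (x y : seqR) : seqR := fun i => x i - y i.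
Definition vscal (t : R) (x : seqR) : seqR := fun i => t * x i.

Definition lp_sum (p : R) (x : seqR) : Rbar :=
  Esup (fun v => exists n, v = Fin (sum_f_R0 (fun i => rpow (Rabs (x i)) p) n)).

Definition in_lp (p : R) (x : seqR) : Prop := lp_sum p x <> PInf.

(* |x|_p (only meaningful for x in l_p) *)
Definition lp_norm (p : R) (x : seqR) : R :=
  match lp_sum p x with Fin s => rpow s (/ p) | PInf => 0 end.

Definition lp_dist (p : R) (x y : seqR) : R := lp_norm p (vsub x y).

Definition diam (p : R) (S : seqR -> Prop) : Rbar :=
  Esup (fun v => exists y z, S y /\ S z /\ v = Fin (lp_dist p y z)).

Definition ball (p : R) (x : seqR) (r : R) : seqR -> Prop :=
  fun y => in_lp p y /\ lp_dist p y x <= r.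

(* the line {a + t v : t in R} with a, v in l_p, v <> 0 *)
Definition is_line (p : R) (a v : seqR) : Prop :=
  in_lp p a /\ in_lp p v /\ exists i, v i <> 0.

Definition dist_line (p : R) (x a v : seqR) : Rbar :=
  Einf (fun w => exists t, w = Fin (lp_dist p x (vadd a (vscal t v)))).

Definition beta (p : R) (E Q : seqR -> Prop) : Rbar :=
  if excluded_middle_informative (exists x, E x /\ Q x) then
    Einf (fun w => exists a v, is_line p a v /\
      w = Ediv (Esup (fun u => exists x, E x /\ Q x /\ u = dist_line p x a v))
               (diam p Q))
  else Fin 0.

Definition is_net (p : R) (E X : seqR -> Prop) (rho : R) : Prop :=
  (forall x, X x -> E x) /\
  (forall y z, X y -> X z -> y <> z -> rho <= lp_dist p y z) /\
  (forall x, E x -> exists y, X y /\ lp_dist p x y < rho).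

(* (X_k)_{k in Z} defines a multiresolution family for E with inflation
   factor A: the balls B(x, A 2^-k), x in X_k, k in Z *)
Definition is_multires (p : R) (E : seqR -> Prop) (A : R)
    (X : Z -> seqR -> Prop) : Prop :=
  1 < A /\
  (forall k x, X k x -> X (k + 1)%Z x) /\
  (forall k, is_net p E (X k) (powerRZ 2 (- k))).

Definition S_beta (p : R) (E : seqR -> Prop) (r : R) (A : R)
    (X : Z -> seqR -> Prop) : Rbar :=
  Eplus (diam p E)
    (Esum (fun kx : Z * seqR => X (fst kx) (snd kx))
      (fun kx : Z * seqR =>
         let Q := ball p (snd kx) (A * powerRZ 2 (- fst kx)) in
         Emult (Epow (beta p E Q) r) (diam p Q))).

Definition is_curve_param (p : R) (g : R -> seqR) : Prop :=
  (forall t, 0 <= t <= 1 -> in_lp p (g t)) /\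
  (forall t, 0 <= t <= 1 -> forall eps, 0 < eps -> exists delta, 0 < delta /\
     forall s, 0 <= s <= 1 -> Rabs (s - t) < delta -> lp_dist p (g s) (g t) < eps).

Definition image01 (g : R -> seqR) : seqR -> Prop :=
  fun y => exists t, 0 <= t <= 1 /\ y = g t.

Definition H1_delta (p delta : R) (G : seqR -> Prop) : Rbar :=
  Einf (fun v => exists U : nat -> seqR -> Prop,
          (forall i x, U i x -> in_lp p x) /\
          (forall x, G x -> exists i, U i x) /\
          (forall i, Rbar_le (diam p (U i)) (Fin delta)) /\
          v = Esum (fun _ : nat => True) (fun i => diam p (U i))).

Definition H1 (p : R) (G : seqR -> Prop) : Rbar :=
  Esup (fun v => exists delta, 0 < delta /\ v = H1_delta p delta G).

Definition rel_open (p : R) (S A : seqR -> Prop) : Prop :=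
  forall x, A x -> exists r, 0 < r /\ forall y, S y -> lp_dist p y x < r -> A y.

Definition connected (p : R) (S : seqR -> Prop) : Prop :=
  forall A B : seqR -> Prop,
    (forall x, S x <-> (A x \/ B x)) ->
    (forall x, ~ (A x /\ B x)) ->
    rel_open p S A -> rel_open p S B ->
    (forall x, ~ A x) \/ (forall x, ~ B x).

(* Main.v *)
(** Let [s = min (p, 2)] and [r = max (p, 2)]. The norm of l_p has smoothness exponent [s] and convexity exponent [r]:
    if [x, w, z] are [h]-separated and within [b h] of a line, with [w] in the middle, then the excess
    [|x - w| + |w - z| - |x - z|] is at most [C b^s h]; conversely it is at least [c e^r / d^(r-1)] if [w] is at
    distance [e] from the segment [x, z] and [|x - w|, |w - z| <= d].

    Sufficient condition. For radii [r u] comparable to [2^-k], consider on a finite piece of the net [X_k] the potential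
    [2 sum r u - sum (r u + r v - |u - v|)^+], where the second sum is over the pairs with no net point in between; on a
    line it is the length of the union of the intervals [u - r u, u + r u]. Inserting a point increases it by at most the
    excess, that is [C beta^s 2^-k], and shrinking the radii when passing to the next scale releases a fixed proportion
    of [2^-k] at each point with less than two close neighbours, which pays for the edges needed to connect the net.
    So each [X_k] is visited by a closed walk of length [C S]. The arrival times are labels [tau] with
    [|x - y| <= |tau x - tau y|], and the inverse of a limit of these labelings extends to a Lipschitz curve.

    Necessary condition. Replace the connected set by a very fine net visited by a closed walk, and sum over one class
    modulo [J] of the scales at a time. Near a net point [x] at scale [R = 2^-k] there is a point [y] at distance about
    [beta R] from the chord of an arc of the walk through [x]. (1) If many points of [X_k] are close to [x], or if the
    arcs through [x] and [y] are both flat up to a small multiple of [beta R], then merging the sets of a cover of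
    diameter about [beta R] into a single set of diameter about [R] saves [R]; hence the corresponding sum of [R] is
    bounded by an increment of a monotone bounded function of the scale, and these telescope, with a harmless factor
    [log (1 / beta)]. (2) If an arc is at distance [e >= beta R / 8] from its chord, take nested sets of sampling
    times whose polygonal lengths are almost minimal among those with gaps of diameter about [R]. By uniform
    convexity the arc accounts for a drop [c e^r / R^(r-1)] of the length at a scale [R' <= R], up to a factor
    decreasing geometrically with the number of scales between [R'] and [R]. *)

From Stdlib Require Import Reals Lra Lia Psatz List ZArith ClassicalEpsilon Classical ClassicalChoice FunctionalExtensionality ProofIrrelevance Cantor FinFun.
Require Import Defs.
Open Scope R_scope.

(** * Real powers *)

(** Bounded subsets of [l_p] need not be relatively compact, so neither the finiteness of the nets
    nor the limit curve is automatic. Finiteness follows from the finite sum, since a flat ball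
    contains few separated points; for the curve, compactness is applied to the real labels only,
    and the completeness of [l_p] supplies the points. In the necessary direction the walk may run
    along the same strand many times. The content of a cover does not see multiplicity while the
    length of the walk does, so crowded balls and pairs of flat arcs are charged to the content, and
    only the bent arcs to the length. For the flat pairs even the first power of [beta] is summable;
    the exponent [r] enters with the bent arcs alone. There each descent of one level halves the
    deviation, a loss of [2^r], and divides the admissible diameter by at least 8, a gain of
    [8^(r-1)], which is at least [2^(r+1)] because [r >= 2]. The residue classes modulo [J] provide
    this ratio of scales. *)

Lemma Rabs_sq a : Rabs a * Rabs a = a * a.
Proof. rewrite <- Rabs_mult. apply Rabs_right, Rle_ge, Rle_0_sqr. Qed.

Lemma rpow_0 a r : a <= 0 -> rpow a r = 0.
Proof. intros H. unfold rpow. destruct (Rle_dec a 0); [reflexivity | lra]. Qed.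

Lemma rpow_gt a r : 0 < a -> rpow a r = Rpower a r.
Proof. intros H. unfold rpow. destruct (Rle_dec a 0); [lra | reflexivity]. Qed.

Lemma rpow_pos a r : 0 < a -> 0 < rpow a r.
Proof. intros H. rewrite rpow_gt by assumption. apply exp_pos. Qed.

Lemma rpow_ge0 a r : 0 <= rpow a r.
Proof.
  destruct (Rle_dec a 0) as [H|H]; [rewrite rpow_0 by assumption; lra|].
  left. apply rpow_pos. lra.
Qed.

Lemma rpow_1l r : rpow 1 r = 1.
Proof. rewrite rpow_gt by lra. unfold Rpower. rewrite ln_1, Rmult_0_r. apply exp_0. Qed.

Lemma rpow_1 a : 0 <= a -> rpow a 1 = a.
Proof.
  intros [H|H]; [rewrite rpow_gt, Rpower_1 by assumption; reflexivity|].
  rewrite rpow_0; lra.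
Qed.

Lemma rpow_mul a b r : 0 <= a -> 0 <= b -> rpow (a * b) r = rpow a r * rpow b r.
Proof.
  intros [Ha|Ha] [Hb|Hb]; subst; rewrite ?Rmult_0_l, ?Rmult_0_r, ?(rpow_0 0) by lra; try ring.
  rewrite !rpow_gt by (try apply Rmult_lt_0_compat; assumption).
  symmetry. apply Rpower_mult_distr; assumption.
Qed.

Lemma rpow_comp a r q : rpow (rpow a r) q = rpow a (r * q).
Proof.
  destruct (Rle_dec a 0) as [H|H].
  - rewrite !(rpow_0 a) by assumption. apply rpow_0. lra.
  - rewrite (rpow_gt (rpow a r)) by (apply rpow_pos; lra).
    rewrite !rpow_gt by lra. apply Rpower_mult.
Qed.

Lemma rpow_add a r q : rpow a (r + q) = rpow a r * rpow a q.
Proof.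
  destruct (Rle_dec a 0) as [H|H].
  - rewrite !(rpow_0 a) by assumption. ring.
  - rewrite !rpow_gt by lra. apply Rpower_plus.
Qed.

Lemma rpow_2 a : 0 <= a -> rpow a 2 = a * a.
Proof. intros H. replace 2 with (1 + 1) by ring. rewrite rpow_add, !rpow_1 by assumption. reflexivity. Qed.

Lemma rpow_inv a r : 0 <= a -> r <> 0 -> rpow (rpow a r) (/ r) = a.
Proof. intros Ha Hr. rewrite rpow_comp, Rinv_r by assumption. apply rpow_1, Ha. Qed.

Lemma rpow_inv' a r : 0 <= a -> r <> 0 -> rpow (rpow a (/ r)) r = a.
Proof. intros Ha Hr. rewrite rpow_comp, Rinv_l by assumption. apply rpow_1, Ha. Qed.

Lemma rpow_lt a b r : 0 < r -> 0 <= a -> a < b -> rpow a r < rpow b r.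
Proof.
  intros Hr Ha Hab. destruct Ha as [Ha|Ha].
  - rewrite !rpow_gt by lra. apply Rlt_Rpower_l; lra.
  - rewrite (rpow_0 a) by lra. apply rpow_pos. lra.
Qed.

Lemma rpow_le a b r : 0 < r -> a <= b -> rpow a r <= rpow b r.
Proof.
  intros Hr Hab. destruct (Rle_dec a 0) as [H|H].
  - rewrite (rpow_0 a) by assumption. apply rpow_ge0.
  - destruct Hab as [Hab| ->]; [left; apply rpow_lt; lra | lra].
Qed.

Lemma rpow_le_inv a b r : 0 < r -> 0 <= b -> rpow a r <= rpow b r -> a <= b.
Proof.
  intros Hr Hb H. destruct (Rle_dec a b) as [|Hn]; [assumption|].
  assert (rpow b r < rpow a r) by (apply rpow_lt; lra). lra.
Qed.

Lemma rpow_exp_le a q r : a <= 1 -> q <= r -> rpow a r <= rpow a q.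
Proof.
  intros Ha Hq. destruct (Rle_dec a 0) as [H|H].
  - rewrite !rpow_0 by assumption. lra.
  - replace r with (q + (r - q)) by ring. rewrite rpow_add.
    assert (0 < rpow a q) by (apply rpow_pos; lra).
    assert (rpow a (r - q) <= 1).
    { destruct Hq as [Hq| ->].
      - rewrite <- (rpow_1l (r - q)). apply rpow_le; lra.
      - replace (r - r) with 0 by ring. rewrite rpow_gt, Rpower_O by lra. lra. }
    nra.
Qed.

Lemma rpow_exp_ge a q r : 1 <= a -> q <= r -> rpow a q <= rpow a r.
Proof.
  intros Ha Hq. rewrite !rpow_gt by lra.
  destruct Ha as [Ha| <-].
  - apply Rle_Rpower; lra.
  - unfold Rpower. rewrite ln_1, !Rmult_0_r. lra.
Qed.

Lemma derivable_rpow y x : 0 < x ->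
  derivable_pt_lim (fun z => Rpower z y) x (y * Rpower x (y - 1)).
Proof. apply derivable_pt_lim_power. Qed.

Lemma Rpower_mvt q x m : 0 < x -> 0 < m ->
  exists c, Rmin x m <= c <= Rmax x m /\
    Rpower x q - Rpower m q = q * Rpower c (q - 1) * (x - m).
Proof.
  intros Hx Hm. destruct (Rtotal_order x m) as [H|[H|H]].
  - destruct (MVT_cor2 (fun z => Rpower z q) (fun z => q * Rpower z (q - 1)) x m H) as [c [Hc1 Hc2]].
    { intros c Hc. apply derivable_rpow. lra. }
    exists c. rewrite Rmin_left, Rmax_right by lra. split; [lra|].
    simpl in Hc1. lra.
  - subst. exists m. rewrite Rmin_left, Rmax_left by lra. split; [lra|]. ring.
  - destruct (MVT_cor2 (fun z => Rpower z q) (fun z => q * Rpower z (q - 1)) m x H) as [c [Hc1 Hc2]].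
    { intros c Hc. apply derivable_rpow. lra. }
    exists c. rewrite Rmin_right, Rmax_left by lra. split; [lra|].
    simpl in Hc1. lra.
Qed.

Lemma Rpower_ge_1 c q : 0 < c -> c <= 1 -> q <= 0 -> 1 <= Rpower c q.
Proof.
  intros H0 H1 Hq. rewrite <- (Rpower_O c H0) at 1.
  rewrite <- !rpow_gt by assumption. apply rpow_exp_le; assumption.
Qed.

Lemma Rpower_le_1 c q : 0 < c -> c <= 1 -> 0 <= q -> Rpower c q <= 1.
Proof.
  intros H0 H1 Hq. rewrite <- (Rpower_O c H0).
  rewrite <- !rpow_gt by assumption. apply rpow_exp_le; assumption.
Qed.

Lemma Rpower_ge_1' c q : 1 <= c -> 0 <= q -> 1 <= Rpower c q.
Proof.
  intros H1 Hq. assert (H0 : 0 < c) by lra. rewrite <- (Rpower_O c H0) at 1.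
  rewrite <- !rpow_gt by assumption. apply rpow_exp_ge; assumption.
Qed.

Lemma bernoulli_ge p x : 1 <= p -> 0 <= x -> 1 + p * (x - 1) <= rpow x p.
Proof.
  intros Hp [Hx| <-]; [|rewrite rpow_0; lra].
  rewrite rpow_gt by assumption.
  destruct (Rpower_mvt p x 1) as [c [Hc E]]; [lra|lra|].
  replace (Rpower 1 p) with 1 in E by (rewrite <- rpow_gt, rpow_1l by lra; reflexivity).
  destruct (Rle_dec 1 x) as [H|H].
  - rewrite Rmin_right, Rmax_left in Hc by lra.
    assert (1 <= Rpower c (p - 1)) by (apply Rpower_ge_1'; lra).
    assert (0 <= p * (Rpower c (p - 1) - 1) * (x - 1))
      by (apply Rmult_le_pos; [apply Rmult_le_pos|]; lra). nra.
  - rewrite Rmin_left, Rmax_right in Hc by lra.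
    assert (Rpower c (p - 1) <= 1) by (apply Rpower_le_1; lra).
    assert (0 <= p * (1 - Rpower c (p - 1)) * (1 - x))
      by (apply Rmult_le_pos; [apply Rmult_le_pos|]; lra). nra.
Qed.

(** Bernoulli's inequality for the exponent [1 / q >= 1], applied to [x^q]. *)
Lemma bernoulli_le q x : 0 < q <= 1 -> 0 <= x -> rpow x q <= 1 + q * (x - 1).
Proof.
  intros Hq Hx.
  assert (Hi : 1 <= / q) by (rewrite <- Rinv_1; apply Rinv_le_contravar; lra).
  pose proof (bernoulli_ge (/ q) (rpow x q) Hi (rpow_ge0 _ _)) as H.
  rewrite rpow_inv in H by lra.
  apply (Rmult_le_compat_l q) in H; [|lra].
  replace (q * (1 + / q * (rpow x q - 1))) with (q + (rpow x q - 1)) in H by (field; lra). lra.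
Qed.

Lemma rpow_tangent p m x : 1 <= p -> 0 < m -> 0 <= x ->
  rpow m p * (1 + p * (x / m - 1)) <= rpow x p.
Proof.
  intros Hp Hm Hx.
  assert (Hxm : 0 <= x / m) by (apply Rmult_le_pos; [|left; apply Rinv_0_lt_compat]; lra).
  replace x with (m * (x / m)) at 2 by (field; lra).
  rewrite rpow_mul by lra.
  apply Rmult_le_compat_l; [apply rpow_ge0 | apply bernoulli_ge; assumption].
Qed.

Lemma rpow_tangent_le q m x : 0 < q <= 1 -> 0 < m -> 0 <= x ->
  rpow x q <= rpow m q * (1 + q * (x / m - 1)).
Proof.
  intros Hp Hm Hx.
  assert (Hxm : 0 <= x / m) by (apply Rmult_le_pos; [|left; apply Rinv_0_lt_compat]; lra).
  replace x with (m * (x / m)) at 1 by (field; lra).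
  rewrite rpow_mul by lra.
  apply Rmult_le_compat_l; [apply rpow_ge0 | apply bernoulli_le; assumption].
Qed.

Lemma rpow_convex p l a b : 1 <= p -> 0 <= l <= 1 -> 0 <= a -> 0 <= b ->
  rpow (l * a + (1 - l) * b) p <= l * rpow a p + (1 - l) * rpow b p.
Proof.
  intros Hp Hl Ha Hb. set (m := l * a + (1 - l) * b).
  assert (0 <= m) by (unfold m; nra).
  destruct (Req_dec m 0) as [E|E].
  - rewrite E, rpow_0 by lra. pose proof (rpow_ge0 a p). pose proof (rpow_ge0 b p). nra.
  - assert (Hm : 0 < m) by lra.
    pose proof (rpow_tangent p m a Hp Hm Ha) as H1.
    pose proof (rpow_tangent p m b Hp Hm Hb) as H2.
    apply (Rmult_le_compat_l l) in H1; [|lra].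
    apply (Rmult_le_compat_l (1 - l)) in H2; [|lra].
    replace (rpow m p) with
      (l * (rpow m p * (1 + p * (a / m - 1))) + (1 - l) * (rpow m p * (1 + p * (b / m - 1)))).
    { lra. }
    transitivity (rpow m p * (1 + p * ((l * a + (1 - l) * b) / m - 1))).
    { field. lra. }
    fold m. replace (m / m) with 1 by (field; lra). ring.
Qed.

Lemma rpow_concave_mid q a b : 0 < q <= 1 -> 0 <= a -> 0 <= b ->
  rpow a q + rpow b q <= 2 * rpow ((a + b) / 2) q.
Proof.
  intros Hq Ha Hb. set (m := (a + b) / 2).
  assert (0 <= m) by (unfold m; lra).
  destruct (Req_dec m 0) as [E|E].
  - assert (a = 0 /\ b = 0) as [-> ->] by (unfold m in E; lra).
    rewrite E, !rpow_0 by lra. lra.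
  - assert (Hm : 0 < m) by lra.
    pose proof (rpow_tangent_le q m a Hq Hm Ha) as H1.
    pose proof (rpow_tangent_le q m b Hq Hm Hb) as H2.
    replace (2 * rpow m q) with
      (rpow m q * (1 + q * (a / m - 1)) + rpow m q * (1 + q * (b / m - 1))).
    { lra. }
    transitivity (2 * rpow m q * (1 + q * (((a + b) / 2) / m - 1))).
    { field. lra. }
    fold m. replace (m / m) with 1 by (field; lra). ring.
Qed.

Lemma rpow_superadd q a b : 1 <= q -> 0 <= a -> 0 <= b ->
  rpow a q + rpow b q <= rpow (a + b) q.
Proof.
  intros Hq Ha Hb.
  destruct (Req_dec (a + b) 0) as [E|E].
  - rewrite !rpow_0 by lra. lra.
  - assert (Hs : 0 < a + b) by lra.
    assert (K : forall c, 0 <= c <= a + b -> rpow c q <= rpow (a + b) q * (c / (a + b))).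
    { intros c Hc. replace c with ((a + b) * (c / (a + b))) at 1 by (field; lra).
      assert (0 <= c / (a + b)) by (apply Rmult_le_pos; [|left; apply Rinv_0_lt_compat]; lra).
      assert (c / (a + b) <= 1) by (apply (Rmult_le_reg_r (a + b)); [lra|]; field_simplify; lra).
      rewrite rpow_mul by lra. apply Rmult_le_compat_l; [apply rpow_ge0|].
      rewrite <- (rpow_1 (c / (a + b))) at 2 by assumption. apply rpow_exp_le; lra. }
    pose proof (K a ltac:(lra)). pose proof (K b ltac:(lra)).
    replace (rpow (a + b) q) with (rpow (a + b) q * (a / (a + b)) + rpow (a + b) q * (b / (a + b)))
      by (field; lra). lra.
Qed.

Lemma rpow_subadd q a b : 0 < q <= 1 -> 0 <= a -> 0 <= b ->
  rpow (a + b) q <= rpow a q + rpow b q.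
Proof.
  intros Hq Ha Hb.
  assert (Hi : 1 <= / q) by (rewrite <- Rinv_1; apply Rinv_le_contravar; lra).
  pose proof (rpow_superadd (/ q) (rpow a q) (rpow b q) Hi (rpow_ge0 _ _) (rpow_ge0 _ _)) as H.
  rewrite !rpow_inv in H by lra.
  pose proof (rpow_ge0 a q); pose proof (rpow_ge0 b q).
  rewrite <- (rpow_inv' (rpow a q + rpow b q) q) by lra. apply rpow_le; lra.
Qed.

Lemma rpow_abs_sq a p : rpow (Rabs a) p = rpow (a * a) (p / 2).
Proof.
  replace (a * a) with (rpow (Rabs a) 2).
  - rewrite rpow_comp. f_equal. field.
  - rewrite rpow_2 by apply Rabs_pos. apply Rabs_sq.
Qed.

Lemma rpow_convex_mid p a b : 1 <= p -> 0 <= a -> 0 <= b ->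
  2 * rpow ((a + b) / 2) p <= rpow a p + rpow b p.
Proof.
  intros Hp Ha Hb. pose proof (rpow_convex p (1/2) a b Hp ltac:(lra) Ha Hb) as H.
  replace (1/2 * a + (1 - 1/2) * b) with ((a + b) / 2) in H by field. lra.
Qed.

(* Both Clarkson inequalities come from the parallelogram identity and the convexity resp. concavity of [t^(p/2)]. *)
Lemma clarkson_ge p a b : 2 <= p ->
  2 * rpow (Rabs a) p + 2 * rpow (Rabs b) p <= rpow (Rabs (a + b)) p + rpow (Rabs (a - b)) p.
Proof.
  intros Hp. rewrite !rpow_abs_sq.
  pose proof (rpow_convex_mid (p / 2) ((a + b) * (a + b)) ((a - b) * (a - b))
    ltac:(lra) (Rle_0_sqr _) (Rle_0_sqr _)) as H.
  pose proof (rpow_superadd (p / 2) (a * a) (b * b) ltac:(lra) (Rle_0_sqr _) (Rle_0_sqr _)) as H'.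
  replace (((a + b) * (a + b) + (a - b) * (a - b)) / 2) with (a * a + b * b) in H by field.
  lra.
Qed.

Lemma clarkson_le p a b : 0 < p <= 2 ->
  rpow (Rabs (a + b)) p + rpow (Rabs (a - b)) p <= 2 * rpow (Rabs a) p + 2 * rpow (Rabs b) p.
Proof.
  intros Hp. rewrite !rpow_abs_sq.
  pose proof (rpow_concave_mid (p / 2) ((a + b) * (a + b)) ((a - b) * (a - b))
    ltac:(lra) (Rle_0_sqr _) (Rle_0_sqr _)) as H.
  pose proof (rpow_subadd (p / 2) (a * a) (b * b) ltac:(lra) (Rle_0_sqr _) (Rle_0_sqr _)) as H'.
  replace (((a + b) * (a + b) + (a - b) * (a - b)) / 2) with (a * a + b * b) in H by field.
  lra.
Qed.

(** * Second-order inequalities for the function t^p *)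

Lemma sq_le_rpow p x : p <= 2 -> 0 <= x <= 1 -> x * x <= rpow x p.
Proof. intros Hp Hx. rewrite <- rpow_2 by lra. apply rpow_exp_le; lra. Qed.

(** On [(0, 1]] the second derivative of [z^p] is at least [p (p - 1)] because [p <= 2]. So [z^p]
    minus its tangent at [m] and minus the parabola has its minimum at [m]; the proof checks the
    sign of the derivative on both sides of [m]. *)
Lemma rpow_strong_tangent_pos p m x : 1 < p <= 2 -> 0 < m <= 1 -> 0 < x <= 1 ->
  Rpower m p + p * Rpower m (p - 1) * (x - m) + (p - 1) / 2 * (x - m) ^ 2 <= Rpower x p.
Proof.
  intros Hp Hm Hx.
  set (h := fun z => Rpower z p - (p * Rpower m (p - 1) * z + (p - 1) / 2 * (z - m) ^ 2)).
  set (h' := fun z => p * Rpower z (p - 1) - (p * Rpower m (p - 1) + (p - 1) * (z - m))).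
  assert (D : forall z, 0 < z -> derivable_pt_lim h z (h' z)).
  { intros z Hz. unfold h, h'. apply derivable_pt_lim_minus; [apply derivable_rpow, Hz|].
    apply derivable_pt_lim_plus.
    - replace (p * Rpower m (p - 1)) with (p * Rpower m (p - 1) * 1) at 2 by ring.
      apply (derivable_pt_lim_scal (fun z => z)). apply derivable_pt_lim_id.
    - replace ((p - 1) * (z - m)) with ((p - 1) / 2 * (INR 2 * (z - m) ^ 1 * (1 - 0))) by (simpl; field).
      apply (derivable_pt_lim_scal (fun z => (z - m) ^ 2)).
      apply (derivable_pt_lim_comp (fun z => z - m) (fun y => y ^ 2)).
      + apply (derivable_pt_lim_minus (fun z => z) (fun _ => m));
          [apply derivable_pt_lim_id | apply derivable_pt_lim_const].
      + apply (derivable_pt_lim_pow (z - m) 2). }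
  assert (S : forall c, 0 < c <= 1 -> 0 <= h' c * (c - m)).
  { intros c Hc. destruct (Rpower_mvt (p - 1) c m) as [e [He E]]; [lra|lra|].
    assert (0 < e <= 1).
    { unfold Rmin, Rmax in He. destruct (Rle_dec c m); lra. }
    assert (1 <= Rpower e (p - 1 - 1)) by (apply Rpower_ge_1; lra).
    replace (h' c * (c - m)) with
      ((p - 1) * (p * Rpower e (p - 1 - 1) - 1) * ((c - m) * (c - m))).
    { apply Rmult_le_pos; [apply Rmult_le_pos; nra | apply Rle_0_sqr]. }
    unfold h'. replace (Rpower c (p - 1)) with
      (Rpower m (p - 1) + (p - 1) * Rpower e (p - 1 - 1) * (c - m)) by lra. ring. }
  assert (K : h m <= h x).
  { destruct (Rtotal_order x m) as [H|[H|H]].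
    - destruct (MVT_cor2 h h' x m H) as [c [E Hc]].
      { intros c Hc. apply D. lra. }
      pose proof (S c ltac:(lra)). assert (h' c <= 0) by nra. nra.
    - subst; lra.
    - destruct (MVT_cor2 h h' m x H) as [c [E Hc]].
      { intros c Hc. apply D. lra. }
      pose proof (S c ltac:(lra)). assert (0 <= h' c) by nra. nra. }
  unfold h in K. nra.
Qed.

(** For [x <= 0] no derivative is taken: the tangent at [m] is negative enough there, by
    [m <= m^(p-1)], for the crude bound [y^2 <= y^p] to absorb the parabola. *)
Lemma rpow_strong_tangent p m x : 1 < p <= 2 -> 0 < m <= 1 -> -1 <= x <= 1 ->
  rpow m p + p * rpow m (p - 1) * (x - m) + (p - 1) / 2 * (x - m) ^ 2 <= rpow (Rabs x) p.
Proof.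
  intros Hp Hm Hx. destruct (Rle_dec x 0) as [H|H].
  - rewrite Rabs_left1 by assumption. set (y := - x). replace x with (- y) by (unfold y; ring).
    assert (0 <= y <= 1) by (unfold y; lra).
    pose proof (sq_le_rpow p y ltac:(lra) ltac:(lra)).
    pose proof (sq_le_rpow p m ltac:(lra) ltac:(lra)).
    assert (E : rpow m p = rpow m (p - 1) * m).
    { rewrite <- (rpow_1 m) at 3 by lra. rewrite <- rpow_add. f_equal. ring. }
    assert (m <= rpow m (p - 1)).
    { rewrite <- (rpow_1 m) at 1 by lra. apply rpow_exp_le; lra. }
    set (q := rpow m (p - 1)) in *.
    assert (0 <= (p - 1) * m * (q - m)) by (apply Rmult_le_pos; nra).
    assert (0 <= p * y * (q - m)) by (apply Rmult_le_pos; nra).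
    assert (0 <= m * y) by nra.
    assert (0 <= (p - 1) / 2 * (m * m)) by nra.
    assert (0 <= (2 - p) * (y * y)) by nra.
    nra.
  - rewrite Rabs_right by lra. rewrite !rpow_gt by lra.
    apply rpow_strong_tangent_pos; lra.
Qed.

(** Adding the tangent inequalities at the midpoint for [a] and for [b] cancels the linear terms. By
    symmetry the midpoint may be taken nonnegative; the midpoint 0, to which the tangent inequality
    does not apply, is treated apart. *)
Lemma strong_convex_unit p a b : 1 < p <= 2 -> Rabs a <= 1 -> Rabs b <= 1 ->
  (p - 1) / 4 * (a - b) ^ 2 <= rpow (Rabs a) p + rpow (Rabs b) p - 2 * rpow (Rabs ((a + b) / 2)) p.
Proof.
  intros Hp.
  assert (W : forall a b, Rabs a <= 1 -> Rabs b <= 1 -> 0 <= a + b ->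
    (p - 1) / 4 * (a - b) ^ 2 <= rpow (Rabs a) p + rpow (Rabs b) p - 2 * rpow (Rabs ((a + b) / 2)) p).
  { clear a b. intros a b Ha Hb Hab.
    assert (-1 <= a <= 1) by (unfold Rabs in Ha; destruct (Rcase_abs a); lra).
    assert (-1 <= b <= 1) by (unfold Rabs in Hb; destruct (Rcase_abs b); lra).
    destruct (Req_dec (a + b) 0) as [E|E].
    - replace ((a + b) / 2) with 0 by lra. rewrite Rabs_R0, (rpow_0 0) by lra.
      assert (a * a <= rpow (Rabs a) p).
      { replace (a * a) with (Rabs a * Rabs a).
        - apply sq_le_rpow; [lra|]. split; [apply Rabs_pos | lra].
        - apply Rabs_sq. }
      assert (b * b <= rpow (Rabs b) p).
      { replace (b * b) with (Rabs b * Rabs b).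
        - apply sq_le_rpow; [lra|]. split; [apply Rabs_pos | lra].
        - apply Rabs_sq. }
      replace b with (- a) in * by lra. nra.
    - set (m := (a + b) / 2). assert (0 < m <= 1) by (unfold m; lra).
      rewrite (Rabs_right m) by lra.
      pose proof (rpow_strong_tangent p m a Hp ltac:(lra) ltac:(lra)).
      pose proof (rpow_strong_tangent p m b Hp ltac:(lra) ltac:(lra)).
      replace (a - m) with ((a - b) / 2) in * by (unfold m; field).
      replace (b - m) with (- ((a - b) / 2)) in * by (unfold m; field).
      nra. }
  intros Ha Hb. destruct (Rle_dec 0 (a + b)) as [H|H]; [apply W; assumption|].
  pose proof (W (- a) (- b)) as K. rewrite !Rabs_Ropp in K.
  replace ((- a + - b) / 2) with (- ((a + b) / 2)) in K by field. rewrite Rabs_Ropp in K.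
  replace ((- a - - b) ^ 2) with ((a - b) ^ 2) in K by ring. apply K; lra.
Qed.

(* [k] is a free threshold: it separates the coordinates where [a - b] is small compared with [a], [b]. *)
Lemma strong_convex_scalar p k a b : 1 < p <= 2 -> 0 < k ->
  (p - 1) / 4 * rpow k (2 - p) * rpow (Rabs (a - b)) p <=
  (p - 1) / 4 * (k * k) * (rpow (Rabs a) p + rpow (Rabs b) p)
  + (rpow (Rabs a) p + rpow (Rabs b) p - 2 * rpow (Rabs ((a + b) / 2)) p).
Proof.
  intros Hp Hk. set (c := (p - 1) / 4). assert (Hc : 0 < c) by (unfold c; lra).
  pose proof (rpow_ge0 (Rabs a) p). pose proof (rpow_ge0 (Rabs b) p).
  set (M := Rmax (Rabs a) (Rabs b)).
  assert (Ha : Rabs a <= M) by apply Rmax_l. assert (Hb : Rabs b <= M) by apply Rmax_r.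
  assert (HMp : rpow M p <= rpow (Rabs a) p + rpow (Rabs b) p).
  { unfold M, Rmax. destruct (Rle_dec (Rabs a) (Rabs b)); lra. }
  pose proof (Rabs_pos a). pose proof (Rabs_pos b).
  destruct (Req_dec M 0) as [E|E].
  { assert (Ra : Rabs a = 0) by lra. assert (Rb : Rabs b = 0) by lra.
    assert (a = 0) by (destruct (Req_dec a 0) as [|N]; [assumption|]; apply Rabs_no_R0 in N; lra).
    assert (b = 0) by (destruct (Req_dec b 0) as [|N]; [assumption|]; apply Rabs_no_R0 in N; lra).
    subst. replace ((0 + 0) / 2) with 0 by field. rewrite Rminus_0_r, Rabs_R0, !(rpow_0 0) by lra. lra. }
  assert (HM : 0 < M) by lra.
  (* The unit inequality, rescaled by the larger modulus [M]. *)
  assert (Hgap : c * (((a - b) / M) ^ 2 * rpow M p) <=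
     rpow (Rabs a) p + rpow (Rabs b) p - 2 * rpow (Rabs ((a + b) / 2)) p).
  { assert (HaM : Rabs (a / M) <= 1).
    { unfold Rdiv. rewrite Rabs_mult, (Rabs_right (/ M)) by (left; apply Rinv_0_lt_compat; lra).
      apply (Rmult_le_reg_r M); [lra|]. rewrite Rmult_assoc, Rinv_l by lra. lra. }
    assert (HbM : Rabs (b / M) <= 1).
    { unfold Rdiv. rewrite Rabs_mult, (Rabs_right (/ M)) by (left; apply Rinv_0_lt_compat; lra).
      apply (Rmult_le_reg_r M); [lra|]. rewrite Rmult_assoc, Rinv_l by lra. lra. }
    pose proof (strong_convex_unit p (a / M) (b / M) Hp HaM HbM) as K.
    fold c in K. replace (a / M - b / M) with ((a - b) / M) in K by (field; lra).
    apply (Rmult_le_compat_r (rpow M p)) in K; [|apply rpow_ge0].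
    assert (S : forall z, rpow (Rabs z) p = rpow (Rabs (z / M)) p * rpow M p).
    { intros z. rewrite <- rpow_mul by (try apply Rabs_pos; lra). f_equal.
      rewrite <- (Rabs_right M) at 2 by lra. rewrite <- Rabs_mult. f_equal. field. lra. }
    rewrite (S a), (S b), (S ((a + b) / 2)).
    replace ((a + b) / 2 / M) with ((a / M + b / M) / 2) by (field; lra). lra. }
  set (d := Rabs (a - b)) in *. pose proof (Rabs_pos (a - b) : 0 <= d).
  set (q := d / M). assert (Hq : 0 <= q) by (apply Rmult_le_pos; [|left; apply Rinv_0_lt_compat]; lra).
  assert (Ed : rpow d p = rpow q p * rpow M p).
  { rewrite <- rpow_mul by lra. f_equal. unfold q. field. lra. }
  assert (Eq2 : ((a - b) / M) ^ 2 = rpow q (2 - p) * rpow q p).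
  { rewrite <- rpow_add. replace (2 - p + p) with 2 by ring. rewrite rpow_2 by assumption.
    unfold q, d. rewrite <- (pow2_abs ((a - b) / M)). unfold Rdiv at 1.
    rewrite Rabs_mult, (Rabs_right (/ M)) by (left; apply Rinv_0_lt_compat; lra). unfold Rdiv. ring. }
  rewrite Ed. rewrite Eq2 in Hgap.
  pose proof (rpow_ge0 M p). pose proof (rpow_ge0 q p). pose proof (rpow_ge0 k (2 - p)).
  (* If [d <= k M], the [k^2] term dominates the left side; otherwise [k^(2-p) <= q^(2-p)] and the
     convexity gap dominates it. *)
  destruct (Rle_dec q k) as [Hqk|Hqk].
  - assert (Kp : rpow q p <= rpow k p) by (apply rpow_le; lra).
    assert (Ek : k * k = rpow k (2 - p) * rpow k p).
    { rewrite <- rpow_add. replace (2 - p + p) with 2 by ring. rewrite rpow_2 by lra. reflexivity. }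
    assert (0 <= rpow q (2 - p) * rpow q p * rpow M p).
    { pose proof (rpow_ge0 q (2 - p)). apply Rmult_le_pos; [apply Rmult_le_pos|]; assumption. }
    rewrite Ek.
    assert (rpow q p * rpow M p <= rpow k p * (rpow (Rabs a) p + rpow (Rabs b) p)).
    { apply Rmult_le_compat; assumption. }
    assert (0 <= c * rpow k (2 - p)) by (apply Rmult_le_pos; lra).
    assert (c * rpow k (2 - p) * (rpow q p * rpow M p) <=
            c * rpow k (2 - p) * (rpow k p * (rpow (Rabs a) p + rpow (Rabs b) p)))
      by (apply Rmult_le_compat_l; assumption).
    nra.
  - assert (Kp : rpow k (2 - p) <= rpow q (2 - p)).
    { destruct (Req_dec p 2) as [->|].
      - replace (2 - 2) with 0 by ring. rewrite !rpow_gt, !Rpower_O by lra. lra.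
      - apply rpow_le; lra. }
    assert (0 <= c * (k * k) * (rpow (Rabs a) p + rpow (Rabs b) p)).
    { apply Rmult_le_pos; nra. }
    assert (0 <= rpow q p * rpow M p) by (apply Rmult_le_pos; assumption).
    assert (rpow k (2 - p) * (rpow q p * rpow M p) <= rpow q (2 - p) * (rpow q p * rpow M p))
      by (apply Rmult_le_compat_r; assumption).
    nra.
Qed.

(** Taylor's formula of order two, through two applications of the mean value theorem; the
    intermediate points lie in [(0, 2]], whence the factor [2^(p-2)]. When [x + t <= 0], the
    increment [t] is at least [x] in modulus and crude bounds of order [t^2] suffice. *)
Lemma smooth_unit p : 2 <= p -> exists C, 0 < C /\ forall x t, 0 <= x <= 1 -> Rabs t <= 1 ->
  rpow (Rabs (x + t)) p <= rpow x p + p * rpow x (p - 1) * t + C * (t * t).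
Proof.
  intros Hp. set (C := p * (p - 1) * Rpower 2 (p - 2) + p + 1).
  assert (HC2 : 0 < Rpower 2 (p - 2)) by apply exp_pos.
  assert (0 < p * (p - 1) * Rpower 2 (p - 2)) by (apply Rmult_lt_0_compat; nra).
  exists C. split; [unfold C; lra|]. intros x t Hx Ht.
  assert (-1 <= t <= 1) by (unfold Rabs in Ht; destruct (Rcase_abs t); lra).
  assert (Htt : rpow (Rabs t) p <= t * t).
  { replace (t * t) with (rpow (Rabs t) 2).
    - apply rpow_exp_le; lra.
    - rewrite rpow_2 by apply Rabs_pos. apply Rabs_sq. }
  destruct (Req_dec x 0) as [->|Hx0].
  { rewrite Rplus_0_l, !(rpow_0 0) by lra. unfold C. nra. }
  assert (Hxx : rpow x (p - 1) <= x).
  { rewrite <- (rpow_1 x) at 2 by lra. apply rpow_exp_le; lra. }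
  pose proof (rpow_ge0 x p). pose proof (rpow_ge0 x (p - 1)).
  destruct (Rle_dec (x + t) 0) as [Hn|Hn].
  - assert (rpow (Rabs (x + t)) p <= rpow (Rabs t) p).
    { apply rpow_le; [lra|]. rewrite !Rabs_left1 by lra. lra. }
    assert (p * rpow x (p - 1) * (- t) <= p * (- t) * (- t)).
    { replace (p * rpow x (p - 1) * - t) with (p * (- t) * rpow x (p - 1)) by ring.
      apply Rmult_le_compat_l; nra. }
    unfold C. nra.
  - rewrite Rabs_right by lra. rewrite !rpow_gt by lra.
    destruct (Rpower_mvt p (x + t) x) as [c [Hc E]]; [lra|lra|].
    assert (Hcb : 0 < c <= 2 /\ Rabs (c - x) <= Rabs t).
    { unfold Rmin, Rmax in Hc. destruct (Rle_dec (x + t) x).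
      - split; [lra|]. rewrite !Rabs_left1 by lra. lra.
      - split; [lra|]. rewrite !Rabs_right by lra. lra. }
    destruct (Rpower_mvt (p - 1) c x) as [e [He E']]; [lra|lra|].
    assert (Heb : 0 < e <= 2).
    { unfold Rmin, Rmax in He. destruct (Rle_dec c x); lra. }
    replace (x + t - x) with t in E by ring.
    assert (Hpe : 0 < Rpower e (p - 1 - 1) <= Rpower 2 (p - 2)).
    { split; [apply exp_pos|]. replace (p - 1 - 1) with (p - 2) by ring.
      destruct (Req_dec p 2) as [->|].
      - replace (2 - 2) with 0 by ring. rewrite !Rpower_O by lra. lra.
      - rewrite <- !rpow_gt by lra. apply rpow_le; lra. }
    assert (Hct : (c - x) * t <= t * t).
    { apply Rle_trans with (Rabs ((c - x) * t)); [apply Rle_abs|]. rewrite Rabs_mult.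
      replace (t * t) with (Rabs t * Rabs t) by apply Rabs_sq.
      apply Rmult_le_compat_r; [apply Rabs_pos | lra]. }
    assert (Hct0 : 0 <= (c - x) * t).
    { unfold Rmin, Rmax in Hc. destruct (Rle_dec (x + t) x); nra. }
    replace (Rpower (x + t) p) with
      (Rpower x p + p * Rpower x (p - 1) * t + p * (p - 1) * Rpower e (p - 1 - 1) * ((c - x) * t)).
    2:{ assert (Rpower c (p - 1) = Rpower x (p - 1) + (p - 1) * Rpower e (p - 1 - 1) * (c - x)) as Ec by lra.
        rewrite Ec in E. lra. }
    assert (p * (p - 1) * Rpower e (p - 1 - 1) * ((c - x) * t) <=
            p * (p - 1) * Rpower 2 (p - 2) * (t * t)).
    { apply Rmult_le_compat; [apply Rmult_le_pos; nra|assumption| |assumption].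
      apply Rmult_le_compat_l; nra. }
    unfold C. nra.
Qed.

(** The linear terms of the two expansions cancel. The step [k] is kept apart from the direction [f]
    so that, for [f] with the same norm as [x], the sum over the coordinates produces [k^2] times
    the [p]-th power of the norm of [x]. *)
Lemma smooth_scalar p : 2 <= p -> exists C, 0 < C /\ forall k x f, 0 < k <= 1 ->
  rpow (Rabs (x + k * f)) p + rpow (Rabs (x - k * f)) p <=
  2 * rpow (Rabs x) p + C * (k * k) * (rpow (Rabs x) p + rpow (Rabs f) p).
Proof.
  intros Hp. destruct (smooth_unit p Hp) as [C [HC K]].
  exists (2 * C). split; [lra|]. intros k.
  assert (W : forall x f, 0 < k <= 1 -> 0 <= x ->
    rpow (Rabs (x + k * f)) p + rpow (Rabs (x - k * f)) p <=
    2 * rpow (Rabs x) p + 2 * C * (k * k) * (rpow (Rabs x) p + rpow (Rabs f) p)).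
  { intros x f Hk Hx. rewrite (Rabs_right x) by lra.
    set (M := Rmax x (Rabs f)).
    assert (Ha : x <= M) by apply Rmax_l. assert (Hb : Rabs f <= M) by apply Rmax_r.
    pose proof (rpow_ge0 x p). pose proof (rpow_ge0 (Rabs f) p).
    assert (HMp : rpow M p <= rpow x p + rpow (Rabs f) p).
    { unfold M, Rmax. destruct (Rle_dec x (Rabs f)); lra. }
    pose proof (Rabs_pos f).
    destruct (Req_dec M 0) as [E|E].
    { assert (x = 0) by lra. assert (f = 0).
      { destruct (Req_dec f 0) as [|N]; [assumption|]; apply Rabs_no_R0 in N; lra. }
      subst. rewrite Rmult_0_r, Rplus_0_r, Rminus_0_r, Rabs_R0, !(rpow_0 0) by lra. lra. }
    assert (HM : 0 < M) by lra.
    assert (HxM : 0 <= x / M <= 1).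
    { split; [apply Rmult_le_pos; [|left; apply Rinv_0_lt_compat]; lra|].
      apply (Rmult_le_reg_r M); [lra|]. field_simplify; lra. }
    assert (HfM : Rabs (f / M) <= 1).
    { unfold Rdiv. rewrite Rabs_mult, (Rabs_right (/ M)) by (left; apply Rinv_0_lt_compat; lra).
      apply (Rmult_le_reg_r M); [lra|]. rewrite Rmult_assoc, Rinv_l by lra. lra. }
    assert (Ht : Rabs (k * (f / M)) <= k).
    { rewrite Rabs_mult, (Rabs_right k) by lra. nra. }
    pose proof (K (x / M) (k * (f / M)) HxM ltac:(lra)) as K1.
    pose proof (K (x / M) (- (k * (f / M))) HxM ltac:(rewrite Rabs_Ropp; lra)) as K2.
    assert (Htt : k * (f / M) * (k * (f / M)) <= k * k).
    { replace (k * (f / M) * (k * (f / M))) with (Rabs (k * (f / M)) * Rabs (k * (f / M)))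
        by apply Rabs_sq.
      pose proof (Rabs_pos (k * (f / M))). nra. }
    assert (S : forall z, rpow (Rabs z) p = rpow (Rabs (z / M)) p * rpow M p).
    { intros z. rewrite <- rpow_mul by (try apply Rabs_pos; lra). f_equal.
      rewrite <- (Rabs_right M) at 2 by lra. rewrite <- Rabs_mult. f_equal. field. lra. }
    rewrite (S (x + k * f)), (S (x - k * f)).
    replace ((x + k * f) / M) with (x / M + k * (f / M)) by (field; lra).
    replace ((x - k * f) / M) with (x / M + - (k * (f / M))) by (field; lra).
    assert (Ex : rpow x p = rpow (x / M) p * rpow M p).
    { rewrite <- rpow_mul by lra. f_equal. field. lra. }
    pose proof (rpow_ge0 M p).
    assert (KK : rpow (Rabs (x / M + k * (f / M))) p + rpow (Rabs (x / M + - (k * (f / M)))) p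
                 <= 2 * rpow (x / M) p + 2 * C * (k * k)) by nra.
    apply (Rmult_le_compat_r (rpow M p)) in KK; [|assumption].
    assert (2 * C * (k * k) * rpow M p <= 2 * C * (k * k) * (rpow x p + rpow (Rabs f) p)).
    { apply Rmult_le_compat_l; [|assumption]. apply Rmult_le_pos; nra. }
    nra. }
  intros x f Hk. destruct (Rle_dec 0 x) as [H|H]; [apply W; assumption|].
  pose proof (W (- x) f Hk ltac:(lra)) as K1.
  replace (- x + k * f) with (- (x - k * f)) in K1 by ring.
  replace (- x - k * f) with (- (x + k * f)) in K1 by ring. rewrite !Rabs_Ropp in K1. lra.
Qed.

Lemma div_unit a b : 0 < b -> 0 <= a <= b -> 0 <= a / b <= 1.
Proof.
  intros Hb Ha. split.
  - apply Rmult_le_pos; [|left; apply Rinv_0_lt_compat]; lra.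
  - apply (Rmult_le_reg_r b); [assumption|]. unfold Rdiv. rewrite Rmult_assoc, Rinv_l by lra. lra.
Qed.

(** * Suprema and infima in [0,+oo] *)

Lemma Rbar_le_refl x : Rbar_le x x.
Proof. destruct x; simpl; auto. lra. Qed.

Lemma Rbar_le_trans x y z : Rbar_le x y -> Rbar_le y z -> Rbar_le x z.
Proof. destruct x, y, z; simpl; auto; try tauto. lra. Qed.

Lemma Esup_spec P : is_sup0 P (Esup P).
Proof.
  unfold Esup; apply epsilon_spec.
  destruct (excluded_middle_informative (exists B, 0 <= B /\ forall x, P x -> Rbar_le x (Fin B)))
    as [[B [HB H]]|N].
  - destruct (completeness (fun r => r = 0 \/ P (Fin r))) as [m [Hm1 Hm2]].
    + exists B. intros r [->|Hr]; [assumption|]. apply (H _ Hr).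
    + exists 0. left. reflexivity.
    + exists (Fin m). split; [|split].
      * apply Hm1. left. reflexivity.
      * intros [x|] Hx; [|exact (H _ Hx)]. simpl. apply Hm1. right. assumption.
      * intros [b|] Hb Hb'; simpl; [|exact I]. apply Hm2. intros r [->|Hr]; [exact Hb|].
        apply (Hb' _ Hr).
  - exists PInf. split; [exact I|]. split; [intros [x|] _; exact I|].
    intros [b|] Hb Hb'; [|exact I]. exfalso. apply N. exists b. split; assumption.
Qed.

Lemma Esup_ge0 P : Rbar_le (Fin 0) (Esup P).
Proof. exact (proj1 (Esup_spec P)). Qed.

Lemma Esup_ub P x : P x -> Rbar_le x (Esup P).
Proof. apply (proj1 (proj2 (Esup_spec P))). Qed.

Lemma Esup_lub P b : Rbar_le (Fin 0) b -> (forall x, P x -> Rbar_le x b) -> Rbar_le (Esup P) b.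
Proof. apply (proj2 (proj2 (Esup_spec P))). Qed.

Lemma Einf_spec P : (forall x, P x -> Rbar_le (Fin 0) x) -> is_inf0 P (Einf P).
Proof.
  intros H0. unfold Einf; apply epsilon_spec.
  destruct (excluded_middle_informative (exists x, P (Fin x))) as [[x0 Hx0]|N].
  - destruct (completeness (fun r => P (Fin (- r)))) as [m [Hm1 Hm2]].
    + exists 0. intros r Hr. specialize (H0 _ Hr). simpl in H0. lra.
    + exists (- x0). rewrite Ropp_involutive. assumption.
    + exists (Fin (- m)). split; [|split].
      * simpl. cut (m <= 0); [lra|]. apply Hm2. intros r Hr. specialize (H0 _ Hr). simpl in H0. lra.
      * intros [x|] Hx; simpl; [|exact I]. cut (- x <= m); [lra|].
        apply Hm1. rewrite Ropp_involutive. assumption.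
      * intros [b|] Hb Hb'.
        -- simpl. cut (m <= - b); [lra|]. apply Hm2. intros r Hr. specialize (Hb' _ Hr). simpl in Hb'. lra.
        -- exfalso. exact (Hb' _ Hx0).
  - exists PInf. split; [exact I|]. split.
    + intros [x|] Hx; [exfalso; apply N; exists x; assumption | exact I].
    + intros [b|] Hb Hb'; exact I.
Qed.

Lemma Einf_approx P m e : (forall x, P x -> Rbar_le (Fin 0) x) -> Rbar_le (Einf P) (Fin m) -> 0 < e ->
  exists x, P (Fin x) /\ x <= m + e.
Proof.
  intros H0 Hm He. apply NNPP. intros N. pose proof (Einf_spec P H0) as [I0 [_ I2]].
  assert (K : Rbar_le (Fin (m + e)) (Einf P)).
  { apply I2.
    - destruct (Einf P); simpl in *; lra.
    - intros [x|] Hx; simpl; [|exact I]. apply Rnot_lt_le. intros Hl. apply N. exists x. split; [assumption|lra]. }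
  destruct (Einf P); simpl in *; lra.
Qed.

(** * The norm of l_p *)

Definition psum (p : R) (x : seqR) (n : nat) : R := sum_f_R0 (fun i => rpow (Rabs (x i)) p) n.

Definition lsum (p : R) (x : seqR) : R := match lp_sum p x with Fin s => s | PInf => 0 end.

Lemma psum_ge0 p x n : 0 <= psum p x n.
Proof. apply cond_pos_sum. intros. apply rpow_ge0. Qed.

Lemma psum_mono p x n m : (n <= m)%nat -> psum p x n <= psum p x m.
Proof.
  induction 1; [lra|]. unfold psum in *. simpl. pose proof (rpow_ge0 (Rabs (x (S m))) p). lra.
Qed.

Lemma psum_term p x n : rpow (Rabs (x n)) p <= psum p x n.
Proof.
  destruct n; unfold psum; simpl; [lra|].
  pose proof (psum_ge0 p x n). unfold psum in *. lra.
Qed.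

Lemma in_lp_bound p x B : (forall n, psum p x n <= B) -> in_lp p x.
Proof.
  intros H E. unfold in_lp, lp_sum in *.
  assert (K : Rbar_le PInf (Fin B)).
  { rewrite <- E. apply Esup_lub.
    - simpl. apply Rle_trans with (psum p x 0); [apply psum_ge0 | apply H].
    - intros v [n ->]. apply H. }
  exact K.
Qed.

Lemma lsum_spec p x : in_lp p x -> lp_sum p x = Fin (lsum p x).
Proof. unfold in_lp, lsum. destruct (lp_sum p x); [reflexivity | congruence]. Qed.

Lemma psum_le_lsum p x n : in_lp p x -> psum p x n <= lsum p x.
Proof.
  intros H. pose proof (lsum_spec p x H) as E.
  assert (K : Rbar_le (Fin (psum p x n)) (lp_sum p x)) by (apply Esup_ub; exists n; reflexivity).
  rewrite E in K. exact K.
Qed.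

Lemma lsum_lub p x B : in_lp p x -> (forall n, psum p x n <= B) -> lsum p x <= B.
Proof.
  intros H HB. pose proof (lsum_spec p x H) as E.
  assert (K : Rbar_le (lp_sum p x) (Fin B)).
  { apply Esup_lub.
    - simpl. apply Rle_trans with (psum p x 0); [apply psum_ge0 | apply HB].
    - intros v [n ->]. apply HB. }
  rewrite E in K. exact K.
Qed.

Lemma lsum_ge0 p x : 0 <= lsum p x.
Proof.
  unfold lsum. pose proof (Esup_ge0 (fun v => exists n, v = Fin (psum p x n))) as H.
  unfold lp_sum. unfold psum in H. destruct (Esup _); simpl in *; lra.
Qed.

Lemma lsum_approx p x e : in_lp p x -> 0 < e -> exists n, lsum p x - e <= psum p x n.
Proof.
  intros H He. apply NNPP. intros N.
  assert (lsum p x <= lsum p x - e); [|lra].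
  apply lsum_lub; [assumption|]. intros n. apply Rnot_lt_le. intros Hl. apply N. exists n. lra.
Qed.

(** The partial sums are increasing, so both series are nearly exhausted at a common index. *)
Lemma lsum2_le p x y u v B : in_lp p x -> in_lp p y -> 0 <= u -> 0 <= v ->
  (forall n, u * psum p x n + v * psum p y n <= B) -> u * lsum p x + v * lsum p y <= B.
Proof.
  intros Hx Hy Hu Hv H. apply le_epsilon. intros e He.
  set (e' := e / (u + v + 1)). assert (He' : 0 < e') by (apply Rdiv_lt_0_compat; lra).
  assert (Ee : e' * (u + v + 1) = e) by (unfold e'; field; lra).
  destruct (lsum_approx p x e' Hx He') as [n Hn]. destruct (lsum_approx p y e' Hy He') as [m Hm].
  pose proof (psum_mono p x n (max n m) ltac:(lia)). pose proof (psum_mono p y m (max n m) ltac:(lia)).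
  specialize (H (max n m)). nra.
Qed.

Lemma psum_scal p t x n : psum p (vscal t x) n = rpow (Rabs t) p * psum p x n.
Proof.
  unfold psum. rewrite scal_sum. apply sum_eq. intros i _. unfold vscal.
  rewrite Rabs_mult, rpow_mul by apply Rabs_pos. ring.
Qed.

Section Norm.
Variable p : R.
Hypothesis Hp : 1 < p.

Lemma norm_pow x : rpow (lp_norm p x) p = lsum p x.
Proof.
  unfold lp_norm. pose proof (lsum_ge0 p x) as H. unfold lsum in *.
  destruct (lp_sum p x); [|apply rpow_0; lra].
  rewrite rpow_inv'; [reflexivity | assumption | lra].
Qed.

Lemma norm_ge0 x : 0 <= lp_norm p x.
Proof. unfold lp_norm. destruct (lp_sum p x); [apply rpow_ge0 | lra]. Qed.

Lemma norm_le_iff x c : in_lp p x -> 0 <= c -> lp_norm p x <= c <-> forall n, psum p x n <= rpow c p.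
Proof.
  intros H Hc. split.
  - intros Hn n. apply Rle_trans with (lsum p x); [apply psum_le_lsum, H|].
    rewrite <- norm_pow. apply rpow_le; lra.
  - intros Hn. apply rpow_le_inv with p; [lra | assumption|]. rewrite norm_pow.
    apply lsum_lub; assumption.
Qed.

(** Minkowski's inequality: [(x + y) / (a + b)] is the convex combination of [x / a] and [y / b]
    with weight [a / (a + b)]. Positive upper bounds replace the norms to allow the division. *)
Lemma psum_add_le x y a b n : in_lp p x -> in_lp p y -> lp_norm p x <= a -> lp_norm p y <= b ->
  0 < a -> 0 < b -> psum p (vadd x y) n <= rpow (a + b) p.
Proof.
  intros Hx Hy Ha Hb Ha0 Hb0.
  pose proof (proj1 (norm_le_iff x a Hx ltac:(lra)) Ha n) as Kx.
  pose proof (proj1 (norm_le_iff y b Hy ltac:(lra)) Hb n) as Ky.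
  set (l := a / (a + b)).
  assert (Hl : 0 <= l <= 1).
  { unfold l. split; [apply Rmult_le_pos; [|left; apply Rinv_0_lt_compat]; lra|].
    apply (Rmult_le_reg_r (a + b)); [lra|]. field_simplify; lra. }
  apply Rle_trans with (rpow (a + b) p * (l * (psum p (vscal (/ a) x) n)
     + (1 - l) * (psum p (vscal (/ b) y) n))).
  - unfold psum. rewrite (scal_sum _ _ l), (scal_sum _ _ (1 - l)), <- sum_plus, scal_sum.
    apply sum_Rle. intros i _. unfold vadd, vscal.
    rewrite !Rabs_mult, (Rabs_right (/ a)), (Rabs_right (/ b))
      by (left; apply Rinv_0_lt_compat; assumption).
    pose proof (Rabs_pos (x i)). pose proof (Rabs_pos (y i)).
    assert (0 <= / a * Rabs (x i)) by (apply Rmult_le_pos; [left; apply Rinv_0_lt_compat|]; lra).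
    assert (0 <= / b * Rabs (y i)) by (apply Rmult_le_pos; [left; apply Rinv_0_lt_compat|]; lra).
    pose proof (rpow_convex p l (/ a * Rabs (x i)) (/ b * Rabs (y i)) ltac:(lra) Hl ltac:(assumption) ltac:(assumption)) as K.
    apply Rle_trans with (rpow ((a + b) * (l * (/ a * Rabs (x i)) + (1 - l) * (/ b * Rabs (y i)))) p).
    + apply rpow_le; [lra|].
      replace ((a + b) * (l * (/ a * Rabs (x i)) + (1 - l) * (/ b * Rabs (y i)))) with
        (Rabs (x i) + Rabs (y i)) by (unfold l; field; lra).
      apply Rabs_triang.
    + rewrite rpow_mul; [|lra|nra]. pose proof (rpow_ge0 (a + b) p). nra.
  - rewrite !psum_scal. rewrite !(Rabs_right (/ _)) by (left; apply Rinv_0_lt_compat; assumption).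
    assert (Ia : rpow (/ a) p * rpow a p = 1).
    { rewrite <- rpow_mul by (try (left; apply Rinv_0_lt_compat); lra). rewrite Rinv_l by lra. apply rpow_1l. }
    assert (Ib : rpow (/ b) p * rpow b p = 1).
    { rewrite <- rpow_mul by (try (left; apply Rinv_0_lt_compat); lra). rewrite Rinv_l by lra. apply rpow_1l. }
    pose proof (rpow_ge0 (/ a) p). pose proof (rpow_ge0 (/ b) p). pose proof (rpow_ge0 (a + b) p).
    assert (rpow (/ a) p * psum p x n <= 1) by (rewrite <- Ia; apply Rmult_le_compat_l; assumption).
    assert (rpow (/ b) p * psum p y n <= 1) by (rewrite <- Ib; apply Rmult_le_compat_l; assumption).
    rewrite <- (Rmult_1_r (rpow (a + b) p)) at 2. apply Rmult_le_compat_l; [assumption|]. nra.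
Qed.

Lemma in_lp_add x y : in_lp p x -> in_lp p y -> in_lp p (vadd x y).
Proof.
  intros Hx Hy. pose proof (norm_ge0 x). pose proof (norm_ge0 y).
  apply in_lp_bound with (rpow ((lp_norm p x + 1) + (lp_norm p y + 1)) p).
  intros n. apply psum_add_le; auto; lra.
Qed.

Lemma norm_add x y : in_lp p x -> in_lp p y -> lp_norm p (vadd x y) <= lp_norm p x + lp_norm p y.
Proof.
  intros Hx Hy. pose proof (norm_ge0 x). pose proof (norm_ge0 y).
  apply le_epsilon. intros e He. apply norm_le_iff; [apply in_lp_add; assumption | lra|].
  intros n. replace (lp_norm p x + lp_norm p y + e) with
    ((lp_norm p x + e / 2) + (lp_norm p y + e / 2)) by lra.
  apply psum_add_le; auto; lra.
Qed.

Lemma in_lp_scal t x : in_lp p x -> in_lp p (vscal t x).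
Proof.
  intros Hx. apply in_lp_bound with (rpow (Rabs t) p * lsum p x). intros n.
  rewrite psum_scal. apply Rmult_le_compat_l; [apply rpow_ge0 | apply psum_le_lsum, Hx].
Qed.

Lemma norm_scal_le t x : in_lp p x -> lp_norm p (vscal t x) <= Rabs t * lp_norm p x.
Proof.
  intros Hx. pose proof (norm_ge0 x). pose proof (Rabs_pos t).
  apply norm_le_iff; [apply in_lp_scal, Hx | nra|]. intros n.
  rewrite psum_scal, rpow_mul, norm_pow by assumption.
  apply Rmult_le_compat_l; [apply rpow_ge0 | apply psum_le_lsum, Hx].
Qed.

Lemma norm_scal t x : in_lp p x -> lp_norm p (vscal t x) = Rabs t * lp_norm p x.
Proof.
  intros Hx. apply Rle_antisym; [apply norm_scal_le, Hx|].
  destruct (Req_dec t 0) as [->|Ht].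
  - rewrite Rabs_R0, Rmult_0_l. apply norm_ge0.
  - pose proof (norm_scal_le (/ t) (vscal t x) (in_lp_scal t x Hx)) as K.
    replace (vscal (/ t) (vscal t x)) with x in K.
    2:{ apply functional_extensionality. intros i. unfold vscal. field. assumption. }
    rewrite Rabs_inv in K.
    pose proof (Rabs_pos_lt t Ht).
    apply (Rmult_le_compat_l (Rabs t)) in K; [|lra].
    rewrite <- Rmult_assoc, Rinv_r, Rmult_1_l in K by lra. assumption.
Qed.

Lemma in_lp_sub x y : in_lp p x -> in_lp p y -> in_lp p (vsub x y).
Proof.
  intros Hx Hy. replace (vsub x y) with (vadd x (vscal (-1) y)).
  - apply in_lp_add; [|apply in_lp_scal]; assumption.
  - apply functional_extensionality. intros i. unfold vadd, vsub, vscal. ring.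
Qed.

Lemma coord_le_norm x i : in_lp p x -> Rabs (x i) <= lp_norm p x.
Proof.
  intros Hx. apply rpow_le_inv with p; [lra | apply norm_ge0|]. rewrite norm_pow.
  apply Rle_trans with (psum p x i); [apply psum_term | apply psum_le_lsum, Hx].
Qed.

Lemma in_lp_finite x n : (forall i, (n < i)%nat -> x i = 0) -> in_lp p x.
Proof.
  intros H. apply in_lp_bound with (psum p x n). intros m.
  destruct (le_lt_dec m n) as [L|L]; [apply psum_mono, L|].
  induction L.
  - unfold psum. simpl. rewrite H by lia. rewrite Rabs_R0, (rpow_0 0) by lra. unfold psum. lra.
  - unfold psum in *. simpl. rewrite H by lia. rewrite Rabs_R0, (rpow_0 0) by lra. lra.
Qed.

End Norm.

(** * Vectors of l_p *)

Identity Coercion seqR_fun : seqR >-> Funclass.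

Record lp (p : R) := MkLp { crd :> seqR; crd_in : in_lp p crd }.
Arguments MkLp {p}. Arguments crd {p}. Arguments crd_in {p}.

Lemma lp_ext p (x y : lp p) : (forall i, x i = y i) -> x = y.
Proof.
  destruct x as [x Hx], y as [y Hy]. simpl. intros H.
  assert (x = y) by (apply functional_extensionality; assumption). subst.
  f_equal. apply proof_irrelevance.
Qed.

(** A class, so that the operations on vectors find by themselves the proof of [1 < p] behind the
    closure under addition. *)
Class Exponent (p : R) : Prop := exponent_gt1 : 1 < p.

Section Vectors.
Context {p : R} {Hp : Exponent p}.

Definition add (x y : lp p) : lp p := MkLp (vadd x y) (in_lp_add p Hp x y (crd_in x) (crd_in y)).
Definition sub (x y : lp p) : lp p := MkLp (vsub x y) (in_lp_sub p Hp x y (crd_in x) (crd_in y)).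
Definition scal (t : R) (x : lp p) : lp p := MkLp (vscal t x) (in_lp_scal p t x (crd_in x)).
Definition norm (x : lp p) : R := lp_norm p x.
Definition dist (x y : lp p) : R := norm (sub x y).
Definition comb (t : R) (a b : lp p) : lp p := add (scal (1 - t) a) (scal t b).

End Vectors.

Ltac vec :=
  apply lp_ext; intro; unfold comb, add, sub, scal, vadd, vsub, vscal; simpl; unfold vadd, vsub, vscal; first [ring | field; auto].

Section Vectors_theory.
Context {p : R} {Hp : Exponent p}.
Implicit Types x y z a b : lp p.

Lemma norm_nonneg x : 0 <= norm x.
Proof. apply norm_ge0. Qed.

Lemma norm_triangle x y : norm (add x y) <= norm x + norm y.
Proof. apply norm_add; [exact Hp | apply crd_in | apply crd_in]. Qed.

Lemma norm_hom t x : norm (scal t x) = Rabs t * norm x.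
Proof. apply norm_scal; [exact Hp | apply crd_in]. Qed.

Lemma norm_sub_le x y : norm (sub x y) <= norm x + norm y.
Proof.
  replace (sub x y) with (add x (scal (-1) y)) by vec.
  eapply Rle_trans; [apply norm_triangle|]. rewrite norm_hom, Rabs_left1 by lra. lra.
Qed.

Lemma norm_zero x : norm x = 0 -> forall i, x i = 0.
Proof.
  intros H i. pose proof (coord_le_norm p Hp x i (crd_in x)) as K. fold (norm x) in K.
  pose proof (Rabs_pos (x i)). destruct (Req_dec (x i) 0) as [|N]; [assumption|].
  apply Rabs_no_R0 in N. lra.
Qed.

Lemma dist_nonneg x y : 0 <= dist x y.
Proof. apply norm_nonneg. Qed.

Lemma dist_sym x y : dist x y = dist y x.
Proof.
  unfold dist. replace (sub x y) with (scal (-1) (sub y x)) by vec.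
  rewrite norm_hom, Rabs_left1 by lra. lra.
Qed.

Lemma dist_refl x : dist x x = 0.
Proof. unfold dist. replace (sub x x) with (scal 0 x) by vec. rewrite norm_hom, Rabs_R0. ring. Qed.

Lemma dist_triangle x y z : dist x z <= dist x y + dist y z.
Proof.
  unfold dist. replace (sub x z) with (add (sub x y) (sub y z)) by vec. apply norm_triangle.
Qed.

Lemma dist_eq x y : dist x y = 0 -> x = y.
Proof.
  intros H. apply lp_ext. intros i. pose proof (norm_zero _ H i) as K.
  simpl in K. unfold vsub in K. lra.
Qed.

Lemma dist_comb_comb t a b a' b' : 0 <= t <= 1 ->
  dist (comb t a b) (comb t a' b') <= (1 - t) * dist a a' + t * dist b b'.
Proof.
  intros Ht. unfold dist.
  replace (sub (comb t a b) (comb t a' b')) with (add (scal (1 - t) (sub a a')) (scal t (sub b b'))) by vec.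
  eapply Rle_trans; [apply norm_triangle|]. rewrite !norm_hom, !Rabs_right by lra. lra.
Qed.

Lemma dist_comb_l t a b : 0 <= t <= 1 -> dist a (comb t a b) = t * dist a b.
Proof.
  intros Ht. unfold dist. replace (sub a (comb t a b)) with (scal t (sub a b)) by vec.
  rewrite norm_hom, Rabs_right by lra. reflexivity.
Qed.

Lemma dist_comb_r t a b : 0 <= t <= 1 -> dist (comb t a b) b = (1 - t) * dist a b.
Proof.
  intros Ht. unfold dist. replace (sub (comb t a b) b) with (scal (1 - t) (sub a b)) by vec.
  rewrite norm_hom, Rabs_right by lra. reflexivity.
Qed.

Lemma comb_comb t s1 s2 a b : comb t (comb s1 a b) (comb s2 a b) = comb ((1 - t) * s1 + t * s2) a b.
Proof. vec. Qed.

Lemma comb_0 a b : comb 0 a b = a.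
Proof. vec. Qed.

Lemma comb_1 a b : comb 1 a b = b.
Proof. vec. Qed.

Lemma dist_comb2 s t a b : dist (comb s a b) (comb t a b) = Rabs (s - t) * dist a b.
Proof.
  unfold dist. replace (sub (comb s a b) (comb t a b)) with (scal (- (s - t)) (sub a b)) by vec.
  rewrite norm_hom, Rabs_Ropp. reflexivity.
Qed.

Lemma norm_pow_lsum x : rpow (norm x) p = lsum p x.
Proof. apply norm_pow, Hp. Qed.

Lemma norm_add_sub_pow_le (x e : lp p) B :
  (forall n, psum p (vadd x e) n + psum p (vsub x e) n <= B) ->
  rpow (norm (add x e)) p + rpow (norm (sub x e)) p <= B.
Proof.
  intros H. rewrite !norm_pow_lsum.
  pose proof (lsum2_le p (add x e) (sub x e) 1 1 B (crd_in _) (crd_in _) ltac:(lra) ltac:(lra)) as K.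
  rewrite !Rmult_1_l in K. apply K. intros n. rewrite !Rmult_1_l. apply H.
Qed.

(* From a bound on p-th powers to a bound on norms, by concavity of the p-th root. *)
Lemma norm_mean_le (x e : lp p) u : 0 <= u -> 0 < norm x ->
  rpow (norm (add x e)) p + rpow (norm (sub x e)) p <= 2 * (1 + u) * rpow (norm x) p ->
  norm (add x e) + norm (sub x e) - 2 * norm x <= 2 * u * norm x.
Proof.
  intros Hu Hx H. pose proof (Hp : 1 < p) as Hp1.
  assert (Hi : 0 < / p <= 1).
  { split; [apply Rinv_0_lt_compat; lra|]. rewrite <- Rinv_1. apply Rinv_le_contravar; lra. }
  pose proof (rpow_concave_mid (/ p) (rpow (norm (add x e)) p) (rpow (norm (sub x e)) p)
    Hi (rpow_ge0 _ _) (rpow_ge0 _ _)) as K.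
  rewrite !rpow_inv in K by (try apply norm_nonneg; lra).
  assert (K2 : rpow ((rpow (norm (add x e)) p + rpow (norm (sub x e)) p) / 2) (/ p) <=
               rpow ((1 + u) * rpow (norm x) p) (/ p)) by (apply rpow_le; lra).
  rewrite rpow_mul, rpow_inv in K2 by (try apply rpow_ge0; lra).
  pose proof (bernoulli_le (/ p) (1 + u) Hi ltac:(lra)) as K3.
  assert (rpow (1 + u) (/ p) <= 1 + u) by nra. nra.
Qed.

(** * Smoothness and convexity of the norm *)

(** Uniform smoothness of power type [s], in homogeneous form. *)
Definition smooth_norm (s : R) : Prop := exists C, 0 < C /\ forall x e : lp p, 0 < norm x ->
  norm (add x e) + norm (sub x e) - 2 * norm x <= C * rpow (norm e / norm x) s * norm x.

Lemma smooth_trivial (x e : lp p) : norm (add x e) + norm (sub x e) - 2 * norm x <= 2 * norm e.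
Proof. pose proof (norm_triangle x e). pose proof (norm_sub_le x e). lra. Qed.

Lemma smooth_norm_le2 : p <= 2 -> smooth_norm p.
Proof.
  intros Hp2. pose proof (Hp : 1 < p) as Hp1. exists 2. split; [lra|]. intros x e Hx.
  pose proof (norm_nonneg e). set (k := norm e / norm x).
  assert (Hk : 0 <= k) by (apply Rmult_le_pos; [|left; apply Rinv_0_lt_compat]; lra).
  apply norm_mean_le; [apply rpow_ge0 | assumption|].
  apply norm_add_sub_pow_le. intros n.
  apply Rle_trans with (2 * psum p x n + 2 * psum p e n).
  - unfold psum. rewrite !scal_sum, <- !sum_plus. apply sum_Rle. intros i _.
    pose proof (clarkson_le p (x i) (e i) ltac:(lra)) as K. unfold vadd, vsub. lra.
  - pose proof (psum_le_lsum p x n (crd_in x)). pose proof (psum_le_lsum p e n (crd_in e)).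
    replace (2 * (1 + rpow k p) * rpow (norm x) p) with (2 * lsum p x + 2 * lsum p e); [lra|].
    rewrite <- (norm_pow_lsum x), <- (norm_pow_lsum e).
    replace (norm e) with (k * norm x) by (unfold k; field; lra).
    rewrite rpow_mul by lra. ring.
Qed.

Lemma smooth_norm_ge2 : 2 <= p -> smooth_norm 2.
Proof.
  intros Hp2. pose proof (Hp : 1 < p) as Hp1. destruct (smooth_scalar p Hp2) as [C [HC K]].
  exists (2 * C + 2). split; [lra|]. intros x e Hx.
  pose proof (norm_nonneg e). set (k := norm e / norm x).
  assert (Ek : norm e = k * norm x) by (unfold k; field; lra).
  assert (Hk : 0 <= k) by (apply Rmult_le_pos; [|left; apply Rinv_0_lt_compat]; lra).
  rewrite rpow_2 by assumption.
  destruct (Rle_dec k 1) as [Hk1|Hk1].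
  (* For [k > 1] the triangle inequality suffices, since [k <= k^2]. *)
  2:{ pose proof (smooth_trivial x e). assert (1 <= k * k) by nra. rewrite Ek in *.
      assert (0 <= C * (k * k) * norm x) by (apply Rmult_le_pos; nra).
      assert (k * norm x <= k * k * norm x) by (apply Rmult_le_compat_r; nra). nra. }
  destruct (Req_dec k 0) as [Hk0|Hk0].
  { rewrite Hk0 in *. pose proof (smooth_trivial x e). lra. }
  apply Rle_trans with (2 * (C * (k * k)) * norm x); [|nra].
  apply norm_mean_le; [nra | assumption|]. apply norm_add_sub_pow_le. intros n.
  set (f := scal (/ k) e).
  assert (Ef : norm f = norm x).
  { unfold f. rewrite norm_hom, Rabs_right by (left; apply Rinv_0_lt_compat; lra). rewrite Ek. field. assumption. }
  apply Rle_trans with (2 * psum p x n + C * (k * k) * (psum p x n + psum p f n)).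
  - unfold psum. rewrite <- !sum_plus, !scal_sum, <- !sum_plus. apply sum_Rle. intros i _.
    pose proof (K k (x i) (f i) ltac:(lra)) as Ki.
    unfold f in *. simpl in *. unfold vadd, vsub, vscal in *.
    replace (k * (/ k * e i)) with (e i) in Ki by (field; assumption). lra.
  - pose proof (psum_le_lsum p x n (crd_in x)) as Q1. pose proof (psum_le_lsum p f n (crd_in f)) as Q2.
    rewrite <- norm_pow_lsum in Q1. rewrite <- norm_pow_lsum, Ef in Q2.
    assert (0 <= C * (k * k)) by nra.
    assert (C * (k * k) * (psum p x n + psum p f n) <= C * (k * k) * (2 * rpow (norm x) p))
      by (apply Rmult_le_compat_l; lra). lra.
Qed.

(** The symmetric inequality is applied to the shorter part [th x], and the rest [(1 - 2 th) x] of
    the longer part is split off by the triangle inequality. Since [s > 1], the bound decreases with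
    the length of the part, so [m] may replace [th * norm x]. *)
Lemma smooth_excess s : 1 < s -> smooth_norm s -> exists C, 0 < C /\
  forall (x e : lp p) th m, 0 < m -> m <= th * norm x -> m <= (1 - th) * norm x ->
  norm (add (scal th x) e) + norm (sub (scal (1 - th) x) e) - norm x <= C * rpow (norm e / m) s * m.
Proof.
  intros Hs [C [HC K]]. exists C. split; [assumption|].
  assert (W : forall (x e : lp p) th m, th <= 1 / 2 -> 0 < m -> m <= th * norm x ->
    norm (add (scal th x) e) + norm (sub (scal (1 - th) x) e) - norm x <= C * rpow (norm e / m) s * m).
  { intros x e th m Hth Hm H1. pose proof (norm_nonneg x). pose proof (norm_nonneg e).
    assert (Hx : 0 < norm x) by (destruct (Req_dec (norm x) 0) as [E|E]; [rewrite E in *|]; lra).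
    assert (Hth0 : 0 < th) by nra.
    assert (Ex : norm (scal th x) = th * norm x) by (rewrite norm_hom, Rabs_right; lra).
    pose proof (K (scal th x) e ltac:(rewrite Ex; nra)) as K1. rewrite Ex in K1.
    assert (K2 : norm (sub (scal (1 - th) x) e) <= norm (sub (scal th x) e) + (1 - 2 * th) * norm x).
    { replace (sub (scal (1 - th) x) e) with (add (sub (scal th x) e) (scal (1 - 2 * th) x)) by vec.
      eapply Rle_trans; [apply norm_triangle|]. rewrite norm_hom, Rabs_right; lra. }
    set (M := th * norm x) in *.
    assert (K3 : rpow (norm e / M) s * M <= rpow (norm e / m) s * m).
    { assert (E : norm e / M = norm e / m * (m / M)) by (field; unfold M; nra).
      assert (0 <= norm e / m) by (apply Rmult_le_pos; [|left; apply Rinv_0_lt_compat]; lra).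
      assert (0 < m / M) by (apply Rdiv_lt_0_compat; unfold M; nra).
      assert (m / M <= 1).
      { apply (Rmult_le_reg_r M); [unfold M; nra|]. unfold Rdiv. rewrite Rmult_assoc, Rinv_l by (unfold M; nra). lra. }
      rewrite E, rpow_mul by lra.
      assert (rpow (m / M) s <= m / M).
      { rewrite <- (rpow_1 (m / M)) at 2 by lra. apply rpow_exp_le; lra. }
      assert (Em : m = m / M * M) by (field; unfold M; nra).
      pose proof (rpow_ge0 (norm e / m) s).
      rewrite Rmult_assoc. apply Rmult_le_compat_l; [assumption|].
      apply Rle_trans with (m / M * M); [|lra].
      apply Rmult_le_compat_r; [unfold M; nra | assumption]. }
    assert (C * (rpow (norm e / M) s * M) <= C * (rpow (norm e / m) s * m))
      by (apply Rmult_le_compat_l; lra). unfold M in *. nra. }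
  intros x e th m Hm H1 H2. destruct (Rle_dec th (1 / 2)) as [Hth|Hth].
  - apply W; assumption.
  - pose proof (W x (scal (-1) e) (1 - th) m ltac:(lra) Hm H2) as Q.
    rewrite (norm_hom (-1)), (Rabs_left1 (-1)) in Q by lra.
    replace (- -1 * norm e) with (norm e) in Q by ring.
    replace (add (scal (1 - th) x) (scal (-1) e)) with (sub (scal (1 - th) x) e) in Q by vec.
    replace (sub (scal (1 - (1 - th)) x) (scal (-1) e)) with (add (scal th x) e) in Q by vec.
    lra.
Qed.

(** Uniform convexity of power type [r]. *)
Definition convex_norm (r : R) : Prop := exists c, 0 < c /\ forall u w : lp p,
  norm u = 1 -> norm w = 1 -> norm (scal (1 / 2) (add u w)) <= 1 - c * rpow (norm (sub u w)) r.

Lemma root_gap M g : 0 <= M -> 0 <= g <= 1 -> rpow M p <= 1 - g -> M <= 1 - g / p.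
Proof.
  intros HM Hg H. pose proof (Hp : 1 < p) as Hp1.
  assert (Hi : 0 < / p <= 1).
  { split; [apply Rinv_0_lt_compat; lra|]. rewrite <- Rinv_1. apply Rinv_le_contravar; lra. }
  rewrite <- (rpow_inv M p) by lra.
  apply Rle_trans with (rpow (1 - g) (/ p)); [apply rpow_le; lra|].
  pose proof (bernoulli_le (/ p) (1 - g) Hi ltac:(lra)). unfold Rdiv. lra.
Qed.

Lemma convex_norm_ge2 : 2 <= p -> convex_norm p.
Proof.
  intros Hp2. pose proof (Hp : 1 < p) as Hp1.
  exists (rpow (1 / 2) p / p).
  split; [apply Rdiv_lt_0_compat; [apply rpow_pos|]; lra|]. intros u w Hu Hw.
  set (m := scal (1 / 2) (add u w)). set (d := scal (1 / 2) (sub u w)).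
  assert (Ed : norm d = 1 / 2 * norm (sub u w)) by (unfold d; rewrite norm_hom, Rabs_right; lra).
  assert (H : 1 * lsum p m + 1 * lsum p d <= 1).
  { apply lsum2_le; try apply crd_in; try lra. intros n.
    apply Rle_trans with (1 / 2 * psum p u n + 1 / 2 * psum p w n).
    - unfold psum. rewrite !scal_sum, <- !sum_plus. apply sum_Rle. intros i _.
      pose proof (clarkson_ge p (m i) (d i) Hp2) as K.
      replace (m i + d i) with (u i) in K
        by (unfold m, d; simpl; unfold vscal; simpl; unfold vadd, vsub; field).
      replace (m i - d i) with (w i) in K
        by (unfold m, d; simpl; unfold vscal; simpl; unfold vadd, vsub; field). lra.
    - pose proof (psum_le_lsum p u n (crd_in u)) as Q1. pose proof (psum_le_lsum p w n (crd_in w)) as Q2.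
      rewrite <- norm_pow_lsum, Hu, rpow_1l in Q1. rewrite <- norm_pow_lsum, Hw, rpow_1l in Q2. lra. }
  rewrite <- !norm_pow_lsum in H. rewrite Ed in H.
  pose proof (norm_nonneg (sub u w)). rewrite rpow_mul in H by lra.
  pose proof (rpow_ge0 (1 / 2) p). pose proof (rpow_ge0 (norm (sub u w)) p). pose proof (rpow_ge0 (norm m) p).
  replace (rpow (1 / 2) p / p * rpow (norm (sub u w)) p) with
    (rpow (1 / 2) p * rpow (norm (sub u w)) p / p) by (field; lra).
  apply root_gap; [apply norm_nonneg | | lra]. split; [apply Rmult_le_pos; assumption | lra].
Qed.

Lemma convex_norm_le2 : p <= 2 -> convex_norm 2.
Proof.
  intros Hp2. pose proof (Hp : 1 < p) as Hp1. set (c := (p - 1) / 4).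
  assert (Hc : 0 < c <= 1 / 4) by (unfold c; lra).
  exists (c / 16 / p). split; [apply Rdiv_lt_0_compat; lra|]. intros u w Hu Hw.
  set (m := scal (1 / 2) (add u w)). set (D := norm (sub u w)).
  assert (HD : 0 <= D) by apply norm_nonneg.
  assert (HD2 : D <= 2) by (pose proof (norm_sub_le u w); unfold D; lra).
  destruct (Req_dec D 0) as [E|E].
  { rewrite E, rpow_0 by lra. rewrite Rmult_0_r, Rminus_0_r. unfold m. rewrite norm_hom, Rabs_right by lra.
    pose proof (norm_triangle u w). lra. }
  (* With this threshold the loss [2 c k^2] equals [c D^2 / 8], half of the guaranteed gain
     [c D^2 / 4]. *)
  set (k := 1 / 4 * D). assert (Hk : 0 < k) by (unfold k; lra).
  assert (H : c * rpow k (2 - p) * lsum p (sub u w) + 2 * lsum p m <= 2 * c * (k * k) + 2).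
  { pose proof (rpow_ge0 k (2 - p)).
    apply lsum2_le; try apply crd_in; try lra; [apply Rmult_le_pos; lra|]. intros n.
    apply Rle_trans with ((c * (k * k) + 1) * psum p u n + (c * (k * k) + 1) * psum p w n).
    - unfold psum. rewrite !scal_sum, <- !sum_plus. apply sum_Rle. intros i _.
      pose proof (strong_convex_scalar p k (u i) (w i) ltac:(lra) Hk) as K. fold c in K.
      replace ((u i + w i) / 2) with (m i) in K
        by (unfold m; simpl; unfold vscal; simpl; unfold vadd; field).
      change (sub u w i) with (u i - w i). nra.
    - pose proof (psum_le_lsum p u n (crd_in u)) as Q1. pose proof (psum_le_lsum p w n (crd_in w)) as Q2.
      rewrite <- norm_pow_lsum, Hu, rpow_1l in Q1. rewrite <- norm_pow_lsum, Hw, rpow_1l in Q2.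
      assert (0 <= c * (k * k)) by nra. nra. }
  rewrite <- !norm_pow_lsum in H. fold D in H.
  assert (Ek : rpow k (2 - p) * rpow D p = rpow (1 / 4) (2 - p) * (D * D)).
  { unfold k. rewrite rpow_mul by lra. rewrite Rmult_assoc, <- rpow_add.
    replace (2 - p + p) with 2 by ring. rewrite (rpow_2 D) by assumption. reflexivity. }
  assert (Eq : 1 / 4 <= rpow (1 / 4) (2 - p)).
  { rewrite <- (rpow_1 (1 / 4)) at 1 by lra. apply rpow_exp_le; lra. }
  assert (H' : c * (rpow (1 / 4) (2 - p) * (D * D)) + 2 * rpow (norm m) p <= 2 * c * (k * k) + 2).
  { rewrite <- Ek. lra. }
  rewrite rpow_2 by assumption.
  assert (c * (1 / 4 * (D * D)) <= c * (rpow (1 / 4) (2 - p) * (D * D))).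
  { apply Rmult_le_compat_l; [lra|]. apply Rmult_le_compat_r; nra. }
  replace (c / 16 / p * (D * D)) with (c / 16 * (D * D) / p) by (field; lra).
  assert (0 <= c * (D * D)) by nra.
  apply root_gap; [apply norm_nonneg | | unfold k in *; nra]. split; [nra|].
  assert (D * D <= 4) by nra. nra.
Qed.

(** Let [A >= B] be the lengths of the two steps and [u], [w] their unit vectors. As
    [b - a = (A - B) u + B (u + w)], convexity bounds the excess below by [2 c B |u - w|^r], while
    the point dividing the chord in the ratio of [A] to [B] is at distance at most [B |u - w|] from
    [z]. In [B^r] one factor [B] is kept and the others are bounded by [dl]. *)
Lemma convex_excess r : 1 < r -> convex_norm r -> exists c, 0 < c /\
  forall (a z b : lp p) dl, 0 < dl -> dist a z <= dl -> dist z b <= dl ->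
  exists t, 0 <= t <= 1 /\
    c * rpow (dist z (comb t a b)) r <= (dist a z + dist z b - dist a b) * rpow dl (r - 1).
Proof.
  intros Hr [c [Hc K]].
  assert (Hc' : 0 < 2 * c) by lra.
  exists (2 * c). split; [assumption|].
  assert (Z : forall a z b dl, 0 <= (dist a z + dist z b - dist a b) * rpow dl (r - 1)).
  { intros. apply Rmult_le_pos; [|apply rpow_ge0]. pose proof (dist_triangle a z b). lra. }
  assert (W : forall (a z b : lp p) dl, 0 < dl -> dist a z <= dl -> dist z b <= dist a z ->
    exists t, 0 <= t <= 1 /\
    2 * c * rpow (dist z (comb t a b)) r <= (dist a z + dist z b - dist a b) * rpow dl (r - 1)).
  { intros a z b dl Hdl H1 H2.
    pose proof (dist_nonneg z b) as Hb.
    destruct (Req_dec (dist z b) 0) as [E|E].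
    { apply dist_eq in E. subst b. exists 1. split; [lra|]. rewrite comb_1, dist_refl, rpow_0 by lra.
      rewrite Rmult_0_r. pose proof (Z a z z dl) as Q. rewrite dist_refl in Q. assumption. }
    set (A := dist a z) in *. set (B := dist z b) in *.
    assert (HA : 0 < A) by lra. assert (HB : 0 < B) by lra.
    set (x := sub z a). set (y := sub b z).
    assert (Nx : norm x = A) by (unfold x, A; rewrite dist_sym; reflexivity).
    assert (Ny : norm y = B) by (unfold y, B; rewrite dist_sym; reflexivity).
    set (u := scal (/ A) x). set (w := scal (/ B) y).
    assert (Nu : norm u = 1).
    { unfold u. rewrite norm_hom, Rabs_right, Nx by (left; apply Rinv_0_lt_compat; lra). field. lra. }
    assert (Nw : norm w = 1).
    { unfold w. rewrite norm_hom, Rabs_right, Ny by (left; apply Rinv_0_lt_compat; lra). field. lra. }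
    pose proof (K u w Nu Nw) as Q. rewrite norm_hom, Rabs_right in Q by lra.
    set (T := norm (sub u w)) in *. pose proof (norm_nonneg (sub u w) : 0 <= T) as HT.
    assert (Eab : dist a b <= (A - B) + B * norm (add u w)).
    { rewrite dist_sym. unfold dist.
      assert (A <> 0) by lra. assert (B <> 0) by lra.
      replace (sub b a) with (add (scal (A - B) u) (scal B (add u w))).
      - eapply Rle_trans; [apply norm_triangle|]. rewrite !norm_hom, !Rabs_right, Nu by lra. lra.
      - unfold u, w, x, y. vec. }
    exists (A / (A + B)).
    assert (Ht : 0 <= A / (A + B) <= 1).
    { split; [apply Rmult_le_pos; [|left; apply Rinv_0_lt_compat]; lra|].
      apply (Rmult_le_reg_r (A + B)); [lra|]. unfold Rdiv. rewrite Rmult_assoc, Rinv_l by lra. lra. }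
    split; [assumption|].
    assert (Ed : dist z (comb (A / (A + B)) a b) = A * B / (A + B) * T).
    { assert (A <> 0) by lra. assert (B <> 0) by lra. assert (A + B <> 0) by lra.
      unfold dist, T.
      replace (sub z (comb (A / (A + B)) a b)) with (scal (A * B / (A + B)) (sub u w)).
      - rewrite norm_hom, Rabs_right; [reflexivity|]. apply Rle_ge.
        apply Rmult_le_pos; [nra | left; apply Rinv_0_lt_compat; lra].
      - unfold u, w, x, y. vec. }
    assert (Ed' : dist z (comb (A / (A + B)) a b) <= B * T).
    { rewrite Ed. apply Rmult_le_compat_r; [assumption|].
      replace (A * B / (A + B)) with (A / (A + B) * B) by (field; lra). nra. }
    assert (Gap : 2 * c * rpow T r * B <= A + B - dist a b) by nra.
    assert (F : rpow (dist z (comb (A / (A + B)) a b)) r <= rpow T r * B * rpow dl (r - 1)).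
    { apply Rle_trans with (rpow (B * T) r); [apply rpow_le; lra|].
      rewrite rpow_mul by lra.
      assert (rpow B r = B * rpow B (r - 1)) as ->.
      { rewrite <- (rpow_1 B) at 2 by lra. rewrite <- rpow_add. f_equal. ring. }
      assert (rpow B (r - 1) <= rpow dl (r - 1)) by (apply rpow_le; lra).
      pose proof (rpow_ge0 T r). pose proof (rpow_ge0 B (r - 1)).
      replace (B * rpow B (r - 1) * rpow T r) with (rpow T r * B * rpow B (r - 1)) by ring.
      apply Rmult_le_compat_l; [apply Rmult_le_pos; lra | assumption]. }
    pose proof (rpow_ge0 dl (r - 1)).
    apply Rle_trans with (2 * c * rpow T r * B * rpow dl (r - 1)).
    - apply (Rmult_le_compat_l (2 * c)) in F; [|lra]. lra.
    - apply Rmult_le_compat_r; assumption. }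
  intros a z b dl Hdl H1 H2. destruct (Rle_dec (dist z b) (dist a z)) as [H|H].
  - apply W; assumption.
  - destruct (W b z a dl Hdl) as [t [Ht Q]].
    + rewrite dist_sym. assumption.
    + rewrite (dist_sym z a), (dist_sym b z). lra.
    + exists (1 - t). split; [lra|].
      replace (comb (1 - t) a b) with (comb t b a) by vec.
      rewrite (dist_sym b z), (dist_sym z a), (dist_sym b a) in Q. lra.
Qed.

(** The limit is taken coordinate by coordinate. A partial sum is continuous in its finitely many
    coordinates, so the bound on [u i - u j] passes to [u i - l], uniformly in the number of
    terms. *)
Lemma lp_complete (u : nat -> lp p) :
  (forall e, 0 < e -> exists n, forall i j, (n <= i)%nat -> (n <= j)%nat -> dist (u i) (u j) <= e) ->
  exists l, forall e, 0 < e -> exists n, forall i, (n <= i)%nat -> dist (u i) l <= e.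
Proof.
  intros H. pose proof (Hp : 1 < p) as Hp1.
  assert (Hc : forall k, exists l, Un_cv (fun i => u i k) l).
  { intros k. destruct (R_complete (fun i => u i k)) as [l Hl]; [|exists l; exact Hl].
    intros e He. destruct (H (e / 2) ltac:(lra)) as [n Hn]. exists n. intros i j Hi Hj.
    unfold Rdist. pose proof (coord_le_norm p Hp (sub (u i) (u j)) k (crd_in _)) as K.
    change (lp_norm p (sub (u i) (u j))) with (dist (u i) (u j)) in K.
    simpl in K. unfold vsub in K. specialize (Hn i j Hi Hj). lra. }
  destruct (choice _ Hc) as [l Hl].
  assert (Lim : forall n i e, (forall j, (n <= j)%nat -> dist (u i) (u j) <= e) -> 0 <= e ->
     forall N, psum p (vsub (u i) l) N <= rpow e p).
  { intros n i e He He0 N.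
    assert (Cv : Un_cv (fun j => psum p (sub (u i) (u j)) N) (psum p (vsub (u i) l) N)).
    { unfold psum. assert (forall k, Un_cv (fun j => rpow (Rabs (sub (u i) (u j) k)) p) (rpow (Rabs (vsub (u i) l k)) p)).
      { intros k. assert (C1 : Un_cv (fun j => Rabs (sub (u i) (u j) k)) (Rabs (vsub (u i) l k))).
        { intros eps Heps. destruct (Hl k eps Heps) as [m Hm]. exists m. intros j Hj. specialize (Hm j Hj).
          unfold Rdist in *. simpl. unfold vsub.
          eapply Rle_lt_trans; [apply Rabs_triang_inv2|].
          replace (u i k - u j k - (u i k - l k)) with (- (u j k - l k)) by ring. rewrite Rabs_Ropp. assumption. }
        set (a := Rabs (vsub (u i) l k)) in *. assert (Ha : 0 <= a) by apply Rabs_pos.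
        (* The continuity of [Rpower] is available only at a positive limit; the limit 0 is treated
           directly. *)
        destruct (Req_dec a 0) as [E|E].
        - rewrite E, rpow_0 by lra. intros eps Heps.
          destruct (C1 (rpow eps (/ p)) ltac:(apply rpow_pos; lra)) as [m Hm]. exists m. intros j Hj.
          specialize (Hm j Hj). unfold Rdist in *. rewrite E, Rminus_0_r in Hm. rewrite Rminus_0_r.
          rewrite Rabs_Rabsolu in Hm. rewrite Rabs_right by (apply Rle_ge, rpow_ge0).
          rewrite <- (rpow_inv' eps p) by lra. apply rpow_lt; [lra | apply Rabs_pos | assumption].
        - assert (Ha' : 0 < a) by lra.
          assert (CP : continuity_pt (fun q : R => Rpower q p) a).
          { apply derivable_continuous_pt. exists (p * Rpower a (p - 1)). apply derivable_rpow, Ha'. }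
          intros eps Heps. destruct (CP eps Heps) as [al [Hal Q]].
          destruct (C1 (Rmin al a) ltac:(apply Rmin_pos; assumption)) as [m Hm]. exists m. intros j Hj.
          specialize (Hm j Hj). unfold Rdist in Hm.
          set (z := Rabs (sub (u i) (u j) k)) in *.
          assert (Hz : 0 < z).
          { pose proof (Rmin_r al a). unfold Rabs in Hm. destruct (Rcase_abs (z - a)); lra. }
          rewrite !rpow_gt by assumption.
          destruct (Req_dec a z) as [Ez|Ez].
          + rewrite <- Ez. unfold Rdist. rewrite Rminus_diag, Rabs_R0. assumption.
          + apply Q. split; [split; [exact I | assumption]|].
            simpl. unfold Rdist. pose proof (Rmin_l al a). lra. }
      induction N; simpl; [apply H0|]. apply CV_plus; [assumption | apply H0]. }
    apply Rnot_lt_le. intros Hlt. set (g := psum p (vsub (u i) l) N - rpow e p).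
    destruct (Cv g ltac:(unfold g; lra)) as [m Hm]. specialize (Hm (max n m) ltac:(lia)).
    specialize (He (max n m) ltac:(lia)).
    pose proof (proj1 (norm_le_iff p Hp (sub (u i) (u (max n m))) e (crd_in _) He0) He N).
    unfold Rdist, Rabs in Hm. destruct (Rcase_abs _); unfold g in *; lra. }
  assert (Hin : in_lp p l).
  { destruct (H 1 ltac:(lra)) as [n Hn].
    assert (Hd : in_lp p (vsub (u n) l)).
    { apply in_lp_bound with (rpow 1 p). apply (Lim n n 1); [|lra]. intros j Hj. apply Hn; lia. }
    replace l with (vsub (u n) (vsub (u n) l)).
    - apply in_lp_sub; [exact Hp | apply crd_in | assumption].
    - apply functional_extensionality. intros k. unfold vsub. ring. }
  exists (MkLp l Hin). intros e He. destruct (H e He) as [n Hn]. exists n. intros i Hi.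
  unfold dist, norm. apply norm_le_iff; [exact Hp | apply crd_in | lra|].
  intros N. apply (Lim n i e); [|lra]. intros j Hj. apply Hn; lia.
Qed.

End Vectors_theory.

(** * Finite sums *)

Notation dec := excluded_middle_informative.

Ltac splits := repeat match goal with |- _ /\ _ => split end.

Definition ind (P : Prop) : R := if dec P then 1 else 0.

Lemma ind_true (P : Prop) : P -> ind P = 1.
Proof. intros H. unfold ind. destruct (dec P); [reflexivity | contradiction]. Qed.

Lemma ind_false (P : Prop) : ~ P -> ind P = 0.
Proof. intros H. unfold ind. destruct (dec P); [contradiction | reflexivity]. Qed.

Lemma ind_ge0 P : 0 <= ind P.
Proof. unfold ind. destruct (dec P); lra. Qed.

Lemma ind_le1 P : ind P <= 1.
Proof. unfold ind. destruct (dec P); lra. Qed.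

Lemma ind_le (P Q : Prop) : (P -> Q) -> ind P <= ind Q.
Proof. intros H. unfold ind. destruct (dec P), (dec Q); try lra. tauto. Qed.

Fixpoint sumL {T} (f : T -> R) (l : list T) : R :=
  match l with nil => 0 | x :: l => f x + sumL f l end.

Section Sums.
Context {T : Type}.
Implicit Types (f g : T -> R) (l : list T).

Lemma sumL_app f l l' : sumL f (l ++ l') = sumL f l + sumL f l'.
Proof. induction l; simpl; lra. Qed.

Lemma sumL_le f g l : (forall x, In x l -> f x <= g x) -> sumL f l <= sumL g l.
Proof.
  induction l; simpl; intros H; [lra|].
  pose proof (H a (or_introl eq_refl)). pose proof (IHl (fun x Hx => H x (or_intror Hx))). lra.
Qed.

Lemma sumL_ext f g l : (forall x, In x l -> f x = g x) -> sumL f l = sumL g l.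
Proof. intros H. apply Rle_antisym; apply sumL_le; intros x Hx; rewrite H by assumption; lra. Qed.

Lemma sumL_const c l : sumL (fun _ => c) l = c * INR (length l).
Proof. induction l; [simpl; ring|]. simpl sumL. rewrite IHl. simpl length. rewrite S_INR. ring. Qed.

Lemma sumL_0 l : sumL (fun _ => 0) l = 0.
Proof. rewrite sumL_const. ring. Qed.

Lemma sumL_ge0 f l : (forall x, In x l -> 0 <= f x) -> 0 <= sumL f l.
Proof. intros H. rewrite <- (sumL_0 l). apply sumL_le, H. Qed.

Lemma sumL_plus f g l : sumL (fun x => f x + g x) l = sumL f l + sumL g l.
Proof. induction l; simpl; lra. Qed.

Lemma sumL_scal c f l : sumL (fun x => c * f x) l = c * sumL f l.
Proof. induction l; simpl; [ring|]. rewrite IHl. ring. Qed.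

Lemma sumL_minus f g l : sumL (fun x => f x - g x) l = sumL f l - sumL g l.
Proof. induction l; simpl; lra. Qed.

Lemma sumL_in f l x : (forall y, In y l -> 0 <= f y) -> In x l -> f x <= sumL f l.
Proof.
  induction l; simpl; intros H []; [subst|].
  - pose proof (sumL_ge0 f l (fun y Hy => H y (or_intror Hy))). lra.
  - pose proof (IHl (fun y Hy => H y (or_intror Hy)) H0). pose proof (H a (or_introl eq_refl)). lra.
Qed.

Lemma sumL_in2 f l x y : (forall y, In y l -> 0 <= f y) -> In x l -> In y l -> x <> y ->
  f x + f y <= sumL f l.
Proof.
  induction l; simpl; intros H Hx Hy N; [contradiction|].
  assert (H' : forall y, In y l -> 0 <= f y) by (intros; apply H; auto).
  pose proof (H a (or_introl eq_refl)).
  destruct Hx as [Hx|Hx], Hy as [Hy|Hy]; subst; [congruence| | |].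
  - pose proof (sumL_in f l y H' Hy). lra.
  - pose proof (sumL_in f l x H' Hx). lra.
  - pose proof (IHl H' Hx Hy N). lra.
Qed.

Lemma sumL_single f l x : NoDup l -> 0 <= f x -> (forall y, In y l -> y <> x -> f y = 0) -> sumL f l <= f x.
Proof.
  induction l; simpl; intros ND H0 H; [assumption|]. inversion ND as [|? ? Hni ND1]; subst.
  destruct (dec (a = x)) as [->|N].
  - cut (sumL f l = 0); [lra|]. rewrite <- (sumL_0 l). apply sumL_ext. intros y Hy.
    apply H; [auto|]. intros ->. contradiction.
  - rewrite H by auto. pose proof (IHl ND1 H0 (fun y Hy => H y (or_intror Hy))). lra.
Qed.

Lemma sumL_ind_le1 (P : T -> Prop) l : NoDup l -> (forall x y, In x l -> In y l -> P x -> P y -> x = y) ->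
  sumL (fun x => ind (P x)) l <= 1.
Proof.
  intros ND H. destruct (dec (exists x, In x l /\ P x)) as [[x [Hx Px]]|N].
  - rewrite <- (ind_true (P x) Px). apply (sumL_single (fun x => ind (P x))); [assumption | apply ind_ge0|].
    intros y Hy Ny. apply ind_false. intros Py. apply Ny, H; assumption.
  - rewrite (sumL_ext _ (fun _ => 0)); [rewrite sumL_0; lra|].
    intros y Hy. apply ind_false. intros Py. apply N. exists y. auto.
Qed.

Lemma sumL_filter f (P : T -> Prop) l :
  sumL f (filter (fun x => if dec (P x) then true else false) l) = sumL (fun x => ind (P x) * f x) l.
Proof.
  induction l; simpl; [reflexivity|]. unfold ind at 1. destruct (dec (P a)); simpl; rewrite IHl; ring.
Qed.

Lemma sumL_incl f l l' : (forall x, In x l' -> 0 <= f x) -> NoDup l -> incl l l' -> sumL f l <= sumL f l'.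
Proof.
  revert l'. induction l as [|a l IH]; intros l' H ND I; simpl; [apply sumL_ge0, H|].
  inversion ND as [|? ? Hni ND1]; subst. destruct (in_split a l') as [l1 [l2 E]]; [apply I; left; reflexivity|]. subst.
  rewrite sumL_app. simpl.
  assert (K : sumL f l <= sumL f (l1 ++ l2)).
  { apply IH; [|assumption|].
    - intros x Hx. apply H. apply in_app_iff in Hx. apply in_app_iff. simpl. tauto.
    - intros x Hx. specialize (I x (or_intror Hx)). apply in_app_iff in I. apply in_app_iff.
      destruct I as [I|[I|I]]; auto. subst. contradiction. }
  rewrite sumL_app in K. lra.
Qed.

End Sums.

Lemma sumL_map {S T} (f : T -> R) (g : S -> T) l : sumL f (map g l) = sumL (fun x => f (g x)) l.
Proof. induction l; simpl; congruence. Qed.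

Lemma sumL_swap {S T} (f : S -> T -> R) l l' :
  sumL (fun x => sumL (fun y => f x y) l') l = sumL (fun y => sumL (fun x => f x y) l) l'.
Proof.
  induction l; simpl; [symmetry; apply sumL_0|]. rewrite IHl. symmetry. apply sumL_plus.
Qed.

Lemma sumL_prod {S T} (f : S * T -> R) l l' :
  sumL f (list_prod l l') = sumL (fun x => sumL (fun y => f (x, y)) l') l.
Proof. induction l; simpl; [reflexivity|]. rewrite sumL_app, sumL_map, IHl. reflexivity. Qed.

Lemma sumL_concat {T} (f : T -> R) ll : sumL f (concat ll) = sumL (sumL f) ll.
Proof. induction ll; simpl; [reflexivity|]. rewrite sumL_app, IHll. reflexivity. Qed.

Lemma in_filter_dec {T} (P : T -> Prop) l x :
  In x (filter (fun x => if dec (P x) then true else false) l) <-> In x l /\ P x.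
Proof. rewrite filter_In. destruct (dec (P x)); intuition congruence. Qed.

(** * Connected finite graphs *)

Inductive linked {V} (E : V -> V -> Prop) : V -> V -> Prop :=
| linked_refl x : linked E x x
| linked_step x y z : E x y \/ E y x -> linked E y z -> linked E x z.

Section Linked.
Context {V : Type}.
Implicit Types E F : V -> V -> Prop.

Lemma linked_trans E x y z : linked E x y -> linked E y z -> linked E x z.
Proof. induction 1; [auto|]. intros. eapply linked_step; eauto. Qed.

Lemma linked_sym E x y : linked E x y -> linked E y x.
Proof.
  induction 1; [constructor|]. eapply linked_trans; [eassumption|].
  eapply linked_step; [|constructor]. tauto.
Qed.

Lemma linked_edge E x y : E x y -> linked E x y.
Proof. intros H. eapply linked_step; [left; eassumption | constructor]. Qed.

Lemma linked_lift E F x y : (forall a b, E a b -> linked F a b) -> linked E x y -> linked F x y.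
Proof.
  intros H. induction 1; [constructor|]. eapply linked_trans; [|eassumption].
  destruct H0; [|apply linked_sym]; auto.
Qed.

Lemma linked_exit E (P : V -> Prop) x y : linked E x y -> P x -> ~ P y ->
  exists a b, P a /\ ~ P b /\ (E a b \/ E b a).
Proof.
  induction 1; intros Hx Hy; [contradiction|].
  destruct (classic (P y)); [auto|]. exists x, y. auto.
Qed.

Lemma last_cons (l : list V) x y : last (y :: l) x = last l y.
Proof.
  revert x y. induction l as [|z l IH]; intros x y; [reflexivity|].
  change (last (z :: l) x = last (z :: l) y). rewrite !IH. reflexivity.
Qed.

(* A walk from [x] is the list of the vertices visited after [x]. *)
Fixpoint walk_len (d : V -> V -> R) (x : V) (w : list V) : R :=
  match w with nil => 0 | y :: w' => d x y + walk_len d y w' end.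

Fixpoint walk_steps (E : V -> V -> Prop) (x : V) (w : list V) : Prop :=
  match w with nil => True | y :: w' => E x y /\ walk_steps E y w' end.

Lemma walk_detour (d : V -> V -> R) a b : d a b = d b a ->
  forall x w, In a (x :: w) -> exists w', walk_len d x w' = walk_len d x w + 2 * d a b /\
   length w' = (length w + 2)%nat /\ last w' x = last w x /\
   (forall z, In z (x :: w') <-> In z (x :: w) \/ z = b) /\
   (forall E : V -> V -> Prop, E a b -> E b a -> walk_steps E x w -> walk_steps E x w').
Proof.
  intros Hs x w. revert x. induction w as [|y w IH]; intros x Hin.
  - destruct Hin as [->|[]]. exists (b :: a :: nil). simpl.
    split; [rewrite Hs; ring|]. split; [reflexivity|]. split; [reflexivity|].
    split; [intros z; intuition congruence | tauto].
  - destruct (dec (x = a)) as [->|N].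
    + exists (b :: a :: y :: w).
      split; [cbn [walk_len]; rewrite Hs; ring|]. split; [simpl; lia|]. split; [reflexivity|].
      split; [simpl; intros z; intuition congruence | simpl; tauto].
    + destruct Hin as [E|Hin]; [congruence|]. destruct (IH y Hin) as [w' [H1 [H2 [H3 [H4 H5]]]]].
      exists (y :: w').
      split; [cbn [walk_len]; rewrite H1; ring|]. split; [simpl; lia|].
      split; [rewrite !last_cons; assumption|].
      split; [|simpl; intros E Ea Eb [Q1 Q2]; split; [assumption | apply H5; assumption]].
      intros z. change (x = z \/ In z (y :: w') <-> (x = z \/ In z (y :: w)) \/ z = b).
      rewrite H4. tauto.
Qed.

(* Depth-first traversal: every new vertex costs one edge, walked back and forth. *)
Lemma tour_exists (d : V -> V -> R) E (Ed : list (V * V)) (X : list V) x0 :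
  (forall x y, 0 <= d x y) -> (forall x y, d x y = d y x) ->
  NoDup X -> In x0 X ->
  (forall x y, In x X -> In y X -> linked (fun a b => In (a, b) Ed /\ In a X /\ In b X /\ E a b) x y) ->
  (forall a b, E a b -> E b a) ->
  exists w, (forall z, In z (x0 :: w) <-> In z X) /\ last w x0 = x0 /\ walk_steps E x0 w /\
    (length w <= 2 * length X)%nat /\ walk_len d x0 w <= 2 * sumL (fun e => d (fst e) (snd e)) Ed.
Proof.
  intros d0 ds ND Hx0 HL Es.
  assert (K : forall n, (n <= length X)%nat -> exists w (U : list (V * V)) S, NoDup S /\ NoDup U /\ incl U Ed /\
     incl S X /\ In x0 S /\ (forall e, In e U -> In (fst e) S /\ In (snd e) S) /\
     (n <= length S)%nat /\ (length w + 2 <= 2 * length S)%nat /\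
     (forall z, In z (x0 :: w) <-> In z S) /\ last w x0 = x0 /\ walk_steps E x0 w /\
     walk_len d x0 w = 2 * sumL (fun e => d (fst e) (snd e)) U).
  { induction n; intros Hn.
    - exists nil, nil, (x0 :: nil). simpl.
      splits; solve [auto | lia | ring | tauto | intros z [] | intros z [<-|[]]; assumption
                    | constructor | constructor; [auto | constructor]].
    - destruct (IHn ltac:(lia)) as [w [U [S [H1 [H2 [H3 [H4 [H5 [H6 [H7 [H8 [H9 [H10 [H11 H12]]]]]]]]]]]]]].
      destruct (Nat.eq_dec (length S) n) as [El|El].
      2:{ exists w, U, S. splits; auto; lia. }
      destruct (classic (incl X S)) as [I|I].
      { exfalso. pose proof (NoDup_incl_length ND I). lia. }
      assert (exists y, In y X /\ ~ In y S) as [y [Hy1 Hy2]].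
      { apply NNPP. intros N. apply I. intros z Hz. apply NNPP. intros Hz'. apply N. exists z. auto. }
      destruct (linked_exit _ (fun z => In z S) x0 y (HL x0 y Hx0 Hy1) H5 Hy2) as [a [b [Ha [Hb Hab]]]].
      assert (Eab : E a b) by (destruct Hab as [Q|Q]; [|apply Es]; tauto).
      assert (HbX : In b X) by tauto.
      destruct (walk_detour d a b (ds a b) x0 w (proj2 (H9 a) Ha)) as [w' [W1 [W2 [W3 [W4 W5]]]]].
      assert (exists e, In e Ed /\ d (fst e) (snd e) = d a b /\ (e = (a, b) \/ e = (b, a))) as [e [He1 [He2 He3]]].
      { destruct Hab as [Q|Q]; [exists (a, b) | exists (b, a)]; simpl; splits; auto; tauto. }
      assert (HeU : ~ In e U).
      { intros Q. apply H6 in Q. destruct He3; subst; simpl in Q; tauto. }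
      exists w', (e :: U), (b :: S). splits.
      + constructor; assumption.
      + constructor; assumption.
      + intros z [<-|Hz]; auto.
      + intros z [<-|Hz]; auto.
      + right. assumption.
      + intros e' [<-|H]; [destruct He3; subst; simpl; auto|]. split; right; apply H6, H.
      + simpl. lia.
      + simpl. lia.
      + intros z. rewrite W4, H9. simpl. intuition.
      + congruence.
      + apply W5; auto.
      + simpl. rewrite W1, H12, He2. ring. }
  destruct (K (length X) (le_n _)) as [w [U [S [H1 [H2 [H3 [H4 [H5 [H6 [H7 [H8 [H9 [H10 [H11 H12]]]]]]]]]]]]]].
  assert (I : incl X S) by (apply NoDup_length_incl; assumption).
  exists w. splits; auto.
  - intros z. rewrite H9. split; [apply H4 | apply I].
  - pose proof (NoDup_incl_length H1 H4). lia.
  - rewrite H12. apply Rmult_le_compat_l; [lra|]. apply sumL_incl; auto.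
Qed.

End Linked.

(** Greedy colouring: the at most [N] points in conflict with a new point leave one of the colours
    [0, ..., N] free. *)
Lemma coloring {T} (conf : T -> T -> Prop) (N : nat) (l : list T) : NoDup l ->
  (forall x, In x l -> (length (filter (fun y => if dec (conf x y) then true else false) l) <= N)%nat) ->
  exists c : T -> nat, (forall x, In x l -> (c x <= N)%nat) /\
    (forall x y, In x l -> In y l -> x <> y -> conf x y -> conf y x -> c x <> c y).
Proof.
  set (nb := fun x l => filter (fun y => if dec (conf x y) then true else false) l).
  intros ND. induction ND as [|a l Ha ND IH]; intros H.
  - exists (fun _ => O). simpl. tauto.
  - destruct IH as [c [Hc1 Hc2]].
    { intros x Hx. specialize (H x (or_intror Hx)). simpl in H. destruct (dec (conf x a)); simpl in H; lia. }
    assert (exists k, (k <= N)%nat /\ ~ In k (map c (nb a l))) as [k [Hk1 Hk2]].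
    { apply NNPP. intros Q.
      assert (I : incl (seq 0 (S N)) (map c (nb a l))).
      { intros k Hk. apply in_seq in Hk. apply NNPP. intros Hk'. apply Q. exists k. split; [lia | assumption]. }
      pose proof (NoDup_incl_length (seq_NoDup _ _) I) as L. rewrite length_seq, length_map in L.
      specialize (H a (or_introl eq_refl)). simpl in H. fold (nb a l) in H.
      destruct (dec (conf a a)); simpl in H; lia. }
    exists (fun x => if dec (x = a) then k else c x). split.
    + intros x [<-|Hx]; [destruct (dec (a = a)); [assumption | congruence]|].
      destruct (dec (x = a)); auto.
    + intros x y Hx Hy Nxy C1 C2. destruct (dec (x = a)) as [->|Nx], (dec (y = a)) as [->|Ny]; [congruence| | |].
      * destruct Hy as [Hy|Hy]; [congruence|]. intros E. apply Hk2. rewrite E. apply in_map.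
        apply in_filter_dec. auto.
      * destruct Hx as [Hx|Hx]; [congruence|]. intros E. apply Hk2. rewrite <- E. apply in_map.
        apply in_filter_dec. auto.
      * destruct Hx as [Hx|Hx], Hy as [Hy|Hy]; try congruence. apply Hc2; auto.
Qed.

Lemma sum_by_color {T} (g : T -> R) (c : T -> nat) N l : (forall x, In x l -> (c x <= N)%nat) ->
  sumL g l = sumL (fun i => sumL g (filter (fun x => if dec (c x = i) then true else false) l)) (seq 0 (S N)).
Proof.
  intros H. rewrite (sumL_ext (fun i => sumL g (filter (fun x => if dec (c x = i) then true else false) l))
     (fun i => sumL (fun x => ind (c x = i) * g x) l)) by (intros; apply sumL_filter).
  rewrite sumL_swap. apply sumL_ext. intros x Hx. specialize (H x Hx).
  assert (K : forall s n, (s <= c x < s + n)%nat -> sumL (fun i => ind (c x = i) * g x) (seq s n) = g x).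
  { intros s n. revert s. induction n; intros s Hs; [lia|]. cbn [seq sumL].
    destruct (Nat.eq_dec (c x) s) as [E|E].
    - rewrite ind_true by assumption. rewrite (sumL_ext _ (fun _ => 0)); [rewrite sumL_0; ring|].
      intros i Hi. apply in_seq in Hi. rewrite ind_false by lia. ring.
    - rewrite ind_false by assumption. rewrite IHn by lia. ring. }
  symmetry. apply K. lia.
Qed.

(** * Potential of a net *)

Section Nets.
Context {V : Type} (d : V -> V -> R).
Hypothesis d_ge0 : forall x y, 0 <= d x y.
Hypothesis d_sym : forall x y, d x y = d y x.
Hypothesis d_refl : forall x, d x x = 0.
Hypothesis d_tri : forall x y z, d x z <= d x y + d y z.

(** Betweenness expressed by distances alone, so that it makes sense where the set is not flat. *)
Definition btw (u w v : V) : Prop := d u w < d u v /\ d w v < d u v.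

Definition sepd (h : R) (Z : list V) : Prop := forall a b, In a Z -> In b Z -> a <> b -> h <= d a b.

(** Flatness: up to an error [h / 100], the part of [E] in the ball is isometric to a set of
    reals. *)
Definition chart (E : V -> Prop) (c : V) (rho h : R) (t : V -> R) : Prop :=
  forall a b, E a -> E b -> d c a <= rho -> d c b <= rho -> Rabs (Rabs (t a - t b) - d a b) <= h / 100.

(** Consecutive points. In the applications [W] consists of points that have a chart, and only there
    do the edges behave as on a line. *)
Definition Adj (Z : list V) (W : V -> Prop) (u v : V) : Prop :=
  u <> v /\ W u /\ W v /\ forall w, In w Z -> ~ btw u w v.

Definition pr (Z : list V) (W : V -> Prop) (r : V -> R) (u v : V) : R :=
  ind (Adj Z W u v) * Rmax 0 (r u + r v - d u v).

(* In one dimension this is the length of the union of the intervals [u - r u, u + r u]. *)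
Definition Psi (Z : list V) (W : V -> Prop) (r : V -> R) : R :=
  2 * sumL r Z - / 2 * sumL (fun u => sumL (pr Z W r u) Z) Z.

Lemma btw_sym u w v : btw u w v -> btw v w u.
Proof. intros [H1 H2]. split; rewrite (d_sym v u); [rewrite (d_sym v w) | rewrite (d_sym w u)]; assumption. Qed.

Lemma Adj_sym Z W u v : Adj Z W u v -> Adj Z W v u.
Proof.
  intros [H1 [H2 [H3 H4]]]. repeat split; auto. intros w Hw Q. apply (H4 w Hw), btw_sym, Q.
Qed.

Lemma pr_ge0 Z W r u v : 0 <= pr Z W r u v.
Proof. apply Rmult_le_pos; [apply ind_ge0 | apply Rmax_l]. Qed.

Lemma ind_Adj_sym Z W u v : ind (Adj Z W u v) = ind (Adj Z W v u).
Proof. apply Rle_antisym; apply ind_le, Adj_sym. Qed.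

Lemma pr_sym Z W r u v : pr Z W r u v = pr Z W r v u.
Proof. unfold pr. rewrite ind_Adj_sym, d_sym. f_equal. f_equal. ring. Qed.

Section Chart.
Variables (E : V -> Prop) (c : V) (rho h : R) (t : V -> R).
Hypothesis h_pos : 0 < h.
Hypothesis Ht : chart E c rho h t.

Definition inball (a : V) : Prop := E a /\ d c a <= rho.

Lemma chart_bounds a b : inball a -> inball b ->
  d a b - h / 100 <= Rabs (t a - t b) <= d a b + h / 100.
Proof.
  intros [Ha Ha'] [Hb Hb']. pose proof (Ht a b Ha Hb Ha' Hb') as K.
  unfold Rabs at 1 in K. destruct (Rcase_abs _); lra.
Qed.

(** The separation [h] exceeds the errors [h / 100] by far, so the order of the coordinates
    decides. *)
Lemma chart_btw a w b : inball a -> inball w -> inball b -> h <= d a w -> h <= d w b ->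
  (btw a w b <-> t a < t w < t b \/ t b < t w < t a).
Proof.
  intros Ha Hw Hb H1 H2. unfold btw.
  pose proof (chart_bounds a w Ha Hw) as K1. pose proof (chart_bounds w b Hw Hb) as K2.
  pose proof (chart_bounds a b Ha Hb) as K3.
  unfold Rabs in K1, K2, K3.
  destruct (Rcase_abs (t a - t w)), (Rcase_abs (t w - t b)), (Rcase_abs (t a - t b)); split; intros Q; lra.
Qed.

Lemma chart_neq a b : inball a -> inball b -> h <= d a b -> t a < t b \/ t b < t a.
Proof.
  intros Ha Hb H. pose proof (chart_bounds a b Ha Hb) as K.
  destruct (Rtotal_order (t a) (t b)) as [Q|[Q|Q]]; auto.
  rewrite Q, Rminus_diag, Rabs_R0 in K. lra.
Qed.

(** Of two different consecutive pairs around [y], one would have an endpoint inside the other. *)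
Lemma lost_unique_oriented Z W y a b u v : sepd h (y :: Z) -> ~ In y Z ->
  In a Z -> In b Z -> In u Z -> In v Z ->
  inball y -> inball a -> inball b -> inball u -> inball v ->
  Adj Z W a b -> Adj Z W u v -> t a < t y < t b -> t u < t y < t v -> u = a /\ v = b.
Proof.
  intros S Hy Ia Ib Iu Iv By Ba Bb Bu Bv [_ [_ [_ A1]]] [_ [_ [_ A2]]] T1 T2.
  assert (S' : forall x z, In x Z -> In z Z -> x <> z -> h <= d x z).
  { intros x z Hx Hz N. apply S; simpl; auto. }
  split; apply NNPP; intros N.
  - assert (Nb : u <> b) by (intros ->; lra). assert (Nv : a <> v) by (intros ->; lra).
    assert (Na : a <> u) by auto.
    pose proof (proj2 (chart_btw a u b Ba Bu Bb (S' a u Ia Iu Na) (S' u b Iu Ib Nb))) as K1.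
    pose proof (proj2 (chart_btw u a v Bu Ba Bv (S' u a Iu Ia N) (S' a v Ia Iv Nv))) as K2.
    specialize (A1 u Iu). specialize (A2 a Ia).
    destruct (chart_neq a u Ba Bu (S' a u Ia Iu Na)); [apply A1, K1 | apply A2, K2]; left; lra.
  - assert (Nb : b <> u) by (intros ->; lra). assert (Nv : v <> a) by (intros ->; lra).
    assert (Na : b <> v) by auto.
    pose proof (proj2 (chart_btw a v b Ba Bv Bb (S' a v Ia Iv (not_eq_sym Nv)) (S' v b Iv Ib N))) as K1.
    pose proof (proj2 (chart_btw u b v Bu Bb Bv (S' u b Iu Ib (not_eq_sym Nb)) (S' b v Ib Iv Na))) as K2.
    specialize (A1 v Iv). specialize (A2 b Ib).
    destruct (chart_neq b v Bb Bv (S' b v Ib Iv Na)); [apply A2, K2 | apply A1, K1]; left; lra.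
Qed.

Lemma lost_unique Z W y a b u v : sepd h (y :: Z) -> ~ In y Z ->
  In a Z -> In b Z -> In u Z -> In v Z ->
  inball y -> inball a -> inball b -> inball u -> inball v ->
  Adj Z W a b -> btw a y b -> Adj Z W u v -> btw u y v -> u = a /\ v = b \/ u = b /\ v = a.
Proof.
  intros S Hy Ia Ib Iu Iv By Ba Bb Bu Bv A1 B1 A2 B2.
  assert (S' : forall x, In x Z -> h <= d x y /\ h <= d y x).
  { intros x Hx. assert (x <> y) by (intros ->; contradiction). split; apply S; simpl; auto. }
  apply (chart_btw a y b) in B1; [|assumption..|apply S', Ia|apply S', Ib].
  apply (chart_btw u y v) in B2; [|assumption..|apply S', Iu|apply S', Iv].
  destruct B1 as [B1|B1], B2 as [B2|B2].
  - left. eapply lost_unique_oriented; eauto.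
  - right. apply and_comm. eapply lost_unique_oriented; eauto using Adj_sym.
  - right. eapply lost_unique_oriented; eauto using Adj_sym.
  - left. apply and_comm. eapply lost_unique_oriented; eauto using Adj_sym.
Qed.

(** On each side of [c] only the nearest point can be adjacent to it. *)
Lemma deg_le2 Z W D : NoDup Z -> sepd h Z -> (forall z, In z Z -> E z) -> In c Z -> D <= rho -> 0 <= rho ->
  sumL (fun v => ind (Adj Z W c v /\ d c v <= D)) Z <= 2.
Proof.
  intros ND S HE Hc HD Hr.
  assert (Bc : inball c) by (split; [auto | rewrite d_refl; assumption]).
  apply Rle_trans with (sumL (fun v => ind ((Adj Z W c v /\ d c v <= D) /\ t c < t v) +
                                       ind ((Adj Z W c v /\ d c v <= D) /\ t v < t c)) Z).
  { apply sumL_le. intros v Hv. destruct (dec (Adj Z W c v /\ d c v <= D)) as [Q|Q].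
    2:{ rewrite (ind_false _ Q). pose proof (ind_ge0 ((Adj Z W c v /\ d c v <= D) /\ t c < t v)).
        pose proof (ind_ge0 ((Adj Z W c v /\ d c v <= D) /\ t v < t c)). lra. }
    rewrite (ind_true _ Q). destruct Q as [Q Qd].
    assert (Bv : inball v) by (split; [auto | lra]).
    destruct (chart_neq c v Bc Bv) as [T|T].
    - apply S; auto. apply Q.
    - rewrite (ind_true ((Adj Z W c v /\ d c v <= D) /\ t c < t v)) by auto.
      pose proof (ind_ge0 ((Adj Z W c v /\ d c v <= D) /\ t v < t c)). lra.
    - rewrite (ind_true ((Adj Z W c v /\ d c v <= D) /\ t v < t c)) by auto.
      pose proof (ind_ge0 ((Adj Z W c v /\ d c v <= D) /\ t c < t v)). lra. }
  rewrite sumL_plus.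
  assert (K : forall x y, In x Z -> In y Z -> Adj Z W c x -> Adj Z W c y -> d c x <= D -> d c y <= D ->
    (t c < t x /\ t c < t y) \/ (t x < t c /\ t y < t c) -> x = y).
  { intros x y Hx Hy A1 A2 D1 D2 T. apply NNPP. intros N.
    assert (Bx : inball x) by (split; [auto | lra]). assert (By : inball y) by (split; [auto | lra]).
    destruct A1 as [N1 [_ [_ A1]]], A2 as [N2 [_ [_ A2]]].
    pose proof (proj2 (chart_btw c x y Bc Bx By (S c x Hc Hx N1) (S x y Hx Hy N))) as K1.
    pose proof (proj2 (chart_btw c y x Bc By Bx (S c y Hc Hy N2) (S y x Hy Hx (not_eq_sym N)))) as K2.
    destruct (chart_neq x y Bx By (S x y Hx Hy N)), T; try (apply (A2 x Hx), K1; lra); apply (A1 y Hy), K2; lra. }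
  assert (L1 : sumL (fun v => ind ((Adj Z W c v /\ d c v <= D) /\ t c < t v)) Z <= 1).
  { apply sumL_ind_le1; [assumption|]. intros x y Hx Hy [[? ?] ?] [[? ?] ?]. apply K; auto. }
  assert (L2 : sumL (fun v => ind ((Adj Z W c v /\ d c v <= D) /\ t v < t c)) Z <= 1).
  { apply sumL_ind_le1; [assumption|]. intros x y Hx Hy [[? ?] ?] [[? ?] ?]. apply K; auto. }
  lra.
Qed.

End Chart.

Definition lost (Z : list V) W r y u v : R :=
  ind (Adj Z W u v /\ btw u y v) * Rmax 0 (r u + r v - d u v).

Lemma lost_ge0 Z W r y u v : 0 <= lost Z W r y u v.
Proof. apply Rmult_le_pos; [apply ind_ge0 | apply Rmax_l]. Qed.

(** The exact balance of an insertion: the overlaps of [y] with its neighbours are subtracted, and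
    the overlap of a pair separated by [y] is no longer subtracted. *)
Lemma Psi_cons Z W r y : Psi (y :: Z) W r =
  Psi Z W r + (2 * r y - sumL (pr (y :: Z) W r y) Z + / 2 * sumL (fun u => sumL (lost Z W r y u) Z) Z).
Proof.
  assert (E1 : pr (y :: Z) W r y y = 0).
  { unfold pr. rewrite ind_false; [ring|]. intros [N _]. congruence. }
  assert (E2 : sumL (fun u => pr (y :: Z) W r u y) Z = sumL (pr (y :: Z) W r y) Z).
  { apply sumL_ext. intros u _. apply pr_sym. }
  assert (E3 : forall u, sumL (pr (y :: Z) W r u) Z = sumL (pr Z W r u) Z - sumL (lost Z W r y u) Z).
  { intros u. rewrite <- sumL_minus. apply sumL_ext. intros v _. unfold pr, lost.
    rewrite <- Rmult_minus_distr_r. f_equal.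
    destruct (dec (Adj Z W u v)) as [A|A].
    - rewrite (ind_true _ A). destruct (dec (btw u y v)) as [B|B].
      + rewrite (ind_true (Adj Z W u v /\ btw u y v)) by auto. rewrite ind_false; [ring|].
        intros [_ [_ [_ Q]]]. apply (Q y); simpl; auto.
      + rewrite (ind_false (Adj Z W u v /\ btw u y v)) by tauto. rewrite ind_true; [ring|].
        destruct A as [? [? [? A]]]. repeat split; auto. intros w [<-|Hw]; auto.
    - rewrite (ind_false _ A), (ind_false (Adj Z W u v /\ btw u y v)) by tauto. rewrite ind_false; [ring|].
      intros [? [? [? Q]]]. apply A. repeat split; auto. intros w Hw. apply Q. simpl; auto. }
  assert (E4 : sumL (fun u => sumL (pr (y :: Z) W r u) (y :: Z)) Z =
    sumL (pr (y :: Z) W r y) Z + (sumL (fun u => sumL (pr Z W r u) Z) Z - sumL (fun u => sumL (lost Z W r y u) Z) Z)).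
  { rewrite <- sumL_minus, <- E2, <- sumL_plus. apply sumL_ext. intros u _. simpl. rewrite E3. ring. }
  unfold Psi. cbn [sumL]. cbn [sumL] in E4. rewrite E4, E1. field.
Qed.

Lemma lost_sum_le Z W r y a b m : NoDup Z -> 0 <= m ->
  (forall u v, In u Z -> In v Z -> Adj Z W u v -> btw u y v -> 0 < r u + r v - d u v ->
     (u = a /\ v = b \/ u = b /\ v = a) /\ r u + r v - d u v <= m) ->
  sumL (fun u => sumL (lost Z W r y u) Z) Z <= 2 * m.
Proof.
  intros ND Hm H.
  assert (Z0 : forall u v, In u Z -> In v Z -> ~ (u = a /\ v = b \/ u = b /\ v = a) -> lost Z W r y u v = 0).
  { intros u v Hu Hv N. unfold lost. destruct (dec (Adj Z W u v /\ btw u y v)) as [[A B]|Q].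
    - rewrite Rmax_left; [ring|]. apply Rnot_lt_le. intros Q. apply N. apply (H u v); auto.
    - rewrite ind_false by assumption. ring. }
  assert (Zm : forall u v, In u Z -> In v Z -> lost Z W r y u v <= m).
  { intros u v Hu Hv. unfold lost. destruct (dec (Adj Z W u v /\ btw u y v)) as [[A B]|Q].
    - rewrite ind_true by auto. rewrite Rmult_1_l. apply Rmax_lub; [assumption|].
      destruct (Rlt_dec 0 (r u + r v - d u v)) as [Q|Q]; [apply H; auto | lra].
    - rewrite ind_false by assumption. lra. }
  assert (R1 : forall u, In u Z -> u <> a -> u <> b -> sumL (lost Z W r y u) Z = 0).
  { intros u Hu N1 N2. rewrite (sumL_ext _ (fun _ => 0)); [apply sumL_0|].
    intros v Hv. apply Z0; auto. tauto. }
  assert (R2 : forall u w, In u Z -> (forall v, In v Z -> v <> w -> lost Z W r y u v = 0) ->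
    sumL (lost Z W r y u) Z <= m).
  { intros u w Hu Hw. destruct (in_dec (fun x y => excluded_middle_informative (x = y)) w Z) as [Iw|Iw].
    - apply Rle_trans with (lost Z W r y u w); [|auto].
      apply sumL_single; [assumption | apply lost_ge0 | assumption].
    - rewrite (sumL_ext _ (fun _ => 0)); [rewrite sumL_0; lra|].
      intros v Hv. apply Hw; [assumption|]. intros ->. contradiction. }
  assert (R3 : forall u, In u Z -> a <> b -> sumL (lost Z W r y u) Z <= m).
  { intros u Hu N. destruct (dec (u = a)) as [->|Na].
    - apply (R2 a b); auto. intros v Hv Nv. apply Z0; auto. intuition congruence.
    - destruct (dec (u = b)) as [->|Nb].
      + apply (R2 b a); auto. intros v Hv Nv. apply Z0; auto. intuition congruence.
      + rewrite R1 by auto. assumption. }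
  destruct (dec (a = b)) as [->|N].
  { rewrite (sumL_ext _ (fun _ => 0)); [rewrite sumL_0; lra|]. intros u Hu.
    rewrite (sumL_ext _ (fun _ => 0)); [apply sumL_0|]. intros v Hv.
    unfold lost. destruct (dec (Adj Z W u v /\ btw u y v)) as [[A B]|Q].
    - rewrite Rmax_left; [ring|]. apply Rnot_lt_le. intros Q. destruct (H u v Hu Hv A B Q) as [[[-> ->]|[-> ->]] _];
        destruct A; congruence.
    - rewrite ind_false by assumption. ring. }
  set (g := fun u => ind (u = a) * m + ind (u = b) * m).
  apply Rle_trans with (sumL g Z).
  - apply sumL_le. intros u Hu. unfold g. destruct (dec (u = a)) as [->|Na].
    + rewrite ind_true by reflexivity. pose proof (R3 a Hu N). pose proof (ind_ge0 (a = b)). nra.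
    + rewrite (ind_false (u = a)) by assumption. destruct (dec (u = b)) as [->|Nb].
      * rewrite ind_true by reflexivity. pose proof (R3 b Hu N). lra.
      * rewrite R1, ind_false by auto. lra.
  - unfold g. rewrite sumL_plus.
    assert (K : forall x, sumL (fun u => ind (u = x) * m) Z <= m).
    { intros x. rewrite (sumL_ext _ (fun u => m * ind (u = x))) by (intros; ring).
      rewrite sumL_scal.
      assert (sumL (fun u => ind (u = x)) Z <= 1) by (apply sumL_ind_le1; [assumption | congruence]). nra. }
    pose proof (K a). pose proof (K b). lra.
Qed.

Section Insert.
Variables (E W : V -> Prop) (h : R) (Z : list V) (y : V) (r : V -> R).
Hypothesis h_pos : 0 < h.
Hypothesis ND : NoDup (y :: Z).
Hypothesis S : sepd h (y :: Z).
Hypothesis HE : forall z, In z (y :: Z) -> E z.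
Hypothesis HW : forall u, W u -> exists t, chart E u (30 * h) h t.
Hypothesis Hr : forall z, In z (y :: Z) -> 4 * h <= r z <= 6 * h.

(** No flatness at [y] is used: the new point costs [2 r y <= 12 h], and the overlap that is no
    longer subtracted at most [12 h]. That only one pair is affected follows from the chart at one
    of its endpoints, which belongs to [W]; the other points involved are within [24 h] of it. *)
Lemma insert_bad : Psi (y :: Z) W r <= Psi Z W r + 24 * h.
Proof.
  inversion ND as [|? ? Hy NDZ]; subst. rewrite Psi_cons.
  pose proof (Hr y (or_introl eq_refl)).
  assert (0 <= sumL (pr (y :: Z) W r y) Z) by (apply sumL_ge0; intros; apply pr_ge0).
  assert (sumL (fun u => sumL (lost Z W r y u) Z) Z <= 2 * (12 * h)); [|lra].
  destruct (classic (exists a b, In a Z /\ In b Z /\ Adj Z W a b /\ btw a y b /\ 0 < r a + r b - d a b))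
    as [[a [b [Ia [Ib [A [B P]]]]]]|N].
  - apply (lost_sum_le Z W r y a b); [assumption | lra|].
    intros u v Iu Iv A' B' P'.
    assert (Ru : r u <= 6 * h) by (apply Hr; simpl; auto). assert (Rv : r v <= 6 * h) by (apply Hr; simpl; auto).
    assert (Ra : r a <= 6 * h) by (apply Hr; simpl; auto). assert (Rb : r b <= 6 * h) by (apply Hr; simpl; auto).
    pose proof (d_ge0 u v). split; [|lra].
    destruct A as [A1 [A2 [A3 A4]]] eqn:EA. destruct (HW a A2) as [t Ht].
    destruct B as [B1 B2] eqn:EB. destruct B' as [B1' B2'] eqn:EB'.
    pose proof (d_tri a y u). pose proof (d_tri a y v). pose proof (d_sym y u).
    apply (lost_unique E a (30 * h) h t h_pos Ht Z W y a b u v); auto;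
      try (split; [apply HE; simpl; auto | rewrite ?d_refl; lra]).
  - apply (lost_sum_le Z W r y y y); [assumption | lra|].
    intros u v Iu Iv A' B' P'. exfalso. apply N. exists u, v. auto.
Qed.

(** If [y] separates an overlapping pair [a], [b], the two new overlaps and the lost one leave at
    most the excess [|a - y| + |y - b| - |a - b|]. Otherwise nothing is lost, and the overlap with
    [L], whose interval contains that of [y] up to [e], compensates for [2 r y]. *)
Lemma insert_good t e L : 0 <= e -> chart E y (60 * h) h t ->
  (forall u, In u (y :: Z) -> d y u <= 20 * h -> W u) ->
  (forall a b, In a Z -> In b Z -> d y a <= 20 * h -> d y b <= 20 * h -> btw a y b ->
     d a y + d y b - d a b <= e) ->
  In L Z -> d y L <= 20 * h -> (forall w, In w Z -> ~ btw y w L) ->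
  2 * r y - e <= r L + r y - d y L ->
  Psi (y :: Z) W r <= Psi Z W r + e.
Proof.
  intros He Ht HW' HF IL DL AL HL. inversion ND as [|? ? Hy NDZ]; subst. rewrite Psi_cons.
  assert (By : inball E y (60 * h) y) by (split; [apply HE; simpl; auto | rewrite d_refl; lra]).
  assert (Adjy : forall u, In u Z -> d y u <= 20 * h -> (forall w, In w Z -> ~ btw y w u) -> Adj (y :: Z) W y u).
  { intros u Hu Du Q. repeat split.
    - intros <-. contradiction.
    - apply HW'; [simpl; auto | rewrite d_refl; lra].
    - apply HW'; simpl; auto.
    - intros w [<-|Hw]; [|auto]. intros [Q1 Q2]. lra. }
  assert (Pry : forall u, In u Z -> d y u <= 20 * h -> (forall w, In w Z -> ~ btw y w u) ->
     r y + r u - d y u <= pr (y :: Z) W r y u).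
  { intros u Hu Du Q. unfold pr. rewrite ind_true by (apply Adjy; assumption). rewrite Rmult_1_l. apply Rmax_r. }
  destruct (classic (exists a b, In a Z /\ In b Z /\ Adj Z W a b /\ btw a y b /\ 0 < r a + r b - d a b))
    as [[a [b [Ia [Ib [A [B P]]]]]]|N].
  - assert (Ra : r a <= 6 * h) by (apply Hr; simpl; auto). assert (Rb : r b <= 6 * h) by (apply Hr; simpl; auto).
    assert (Dya : d y a <= 12 * h) by (rewrite d_sym; destruct B; lra).
    assert (Dyb : d y b <= 12 * h) by (destruct B; lra).
    assert (Na : y <> a) by (intros <-; contradiction). assert (Nb : y <> b) by (intros <-; contradiction).
    assert (Nab : a <> b) by apply A.
    assert (Ba : inball E y (60 * h) a) by (split; [apply HE; simpl; auto | lra]).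
    assert (Bb : inball E y (60 * h) b) by (split; [apply HE; simpl; auto | lra]).
    assert (Sya : h <= d a y /\ h <= d y a) by (split; apply S; simpl; auto).
    assert (Syb : h <= d b y /\ h <= d y b) by (split; apply S; simpl; auto).
    pose proof (proj1 (chart_btw E y (60 * h) h t h_pos Ht a y b Ba By Bb (proj1 Sya) (proj2 Syb)) B) as T.
    (* [y] is consecutive to both [a] and [b]: a point between [y] and one of them would lie between
       [a] and [b]. *)
    assert (Q : forall u v, In u Z -> In v Z -> (u = a /\ v = b \/ u = b /\ v = a) ->
       forall w, In w Z -> ~ btw y w u).
    { intros u v Iu Iv Huv w Iw Bw.
      assert (Au : Adj Z W u v) by (destruct Huv as [[-> ->]|[-> ->]]; [|apply Adj_sym]; assumption).
      assert (Bu : inball E y (60 * h) u) by (destruct Huv as [[-> ->]|[-> ->]]; assumption).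
      assert (Bv : inball E y (60 * h) v) by (destruct Huv as [[-> ->]|[-> ->]]; assumption).
      assert (Tu : t u < t y < t v \/ t v < t y < t u) by (destruct Huv as [[-> ->]|[-> ->]]; tauto).
      assert (Du : d y u <= 12 * h) by (destruct Huv as [[-> ->]|[-> ->]]; assumption).
      assert (Bww : inball E y (60 * h) w) by (split; [apply HE; simpl; auto | destruct Bw; lra]).
      assert (Nwu : w <> u) by (intros ->; destruct Bw; lra).
      assert (Nwy : y <> w) by (intros <-; contradiction).
      apply (chart_btw E y (60 * h) h t h_pos Ht y w u By Bww Bu) in Bw;
        [|apply S; simpl; auto | apply S; simpl; auto].
      assert (Nwv : w <> v) by (intros ->; lra).
      apply (proj2 (proj2 (proj2 Au)) w Iw).
      apply (chart_btw E y (60 * h) h t h_pos Ht u w v Bu Bww Bv); [apply S; simpl; auto..|]. lra. }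
    pose proof (Pry a Ia ltac:(lra) (Q a b Ia Ib ltac:(auto))) as P1.
    pose proof (Pry b Ib ltac:(lra) (Q b a Ib Ia ltac:(auto))) as P2.
    pose proof (sumL_in2 (pr (y :: Z) W r y) Z a b (fun u _ => pr_ge0 _ _ _ _ _) Ia Ib Nab) as P3.
    assert (P4 : sumL (fun u => sumL (lost Z W r y u) Z) Z <= 2 * (r a + r b - d a b)).
    { apply (lost_sum_le Z W r y a b); [assumption | lra|].
      intros u v Iu Iv A' B' P'.
      assert (Ru : r u <= 6 * h) by (apply Hr; simpl; auto). assert (Rv : r v <= 6 * h) by (apply Hr; simpl; auto).
      assert (K : u = a /\ v = b \/ u = b /\ v = a).
      { destruct B' as [B1' B2'] eqn:EB'. pose proof (d_sym u y).
        apply (lost_unique E y (60 * h) h t h_pos Ht Z W y a b u v); auto;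
          split; try (apply HE; simpl; auto); lra. }
      split; [assumption|]. destruct K as [[-> ->]|[-> ->]]; [|rewrite (d_sym b a)]; lra. }
    pose proof (HF a b Ia Ib ltac:(lra) ltac:(lra) B). rewrite (d_sym a y) in *. lra.
  - assert (P4 : sumL (fun u => sumL (lost Z W r y u) Z) Z <= 2 * 0).
    { apply (lost_sum_le Z W r y y y); [assumption | lra|].
      intros u v Iu Iv A' B' P'. exfalso. apply N. exists u, v. auto. }
    pose proof (sumL_in (pr (y :: Z) W r y) Z L (fun u _ => pr_ge0 _ _ _ _ _) IL).
    pose proof (Pry L IL DL AL). lra.
Qed.

End Insert.

(** Only overlaps with an endpoint outside [W'] can be lost. A point of [W] has at most two
    neighbours within [12 h], each overlap is at most [12 h], and either endpoint of the pair may be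
    the one outside. *)
Lemma Psi_switch (W W' : V -> Prop) E h Z : 0 < h -> NoDup Z -> sepd (2 * h) Z -> (forall z, In z Z -> E z) ->
  (forall u, W u -> exists t, chart E u (60 * h) (2 * h) t) ->
  Psi Z W' (fun _ => 6 * h) <= Psi Z W (fun _ => 6 * h) + 24 * h * sumL (fun u => ind (~ W' u)) Z.
Proof.
  intros Hh ND S HE HW. unfold Psi. set (r := fun _ : V => 6 * h).
  assert (H2h : 0 < 2 * h) by lra.
  set (A := fun u v => ind (Adj Z W u v) * Rmax 0 (r u + r v - d u v)).
  assert (K : sumL (fun u => sumL (pr Z W r u) Z) Z <= sumL (fun u => sumL (pr Z W' r u) Z) Z +
     (sumL (fun u => sumL (fun v => ind (~ W' u) * A u v) Z) Z + sumL (fun u => sumL (fun v => ind (~ W' v) * A u v) Z) Z)).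
  { rewrite <- !sumL_plus. apply sumL_le. intros u _. rewrite <- !sumL_plus. apply sumL_le. intros v _.
    unfold pr, A. pose proof (Rmax_l 0 (r u + r v - d u v)) as M0. set (m := Rmax 0 _) in *.
    destruct (dec (Adj Z W u v)) as [Q|Q]; [rewrite (ind_true _ Q)|rewrite (ind_false _ Q); pose proof (ind_ge0 (Adj Z W' u v)); nra].
    destruct (dec (W' u)) as [Qu|Qu].
    - destruct (dec (W' v)) as [Qv|Qv].
      + rewrite (ind_true (Adj Z W' u v)); [|destruct Q as [? [? [? ?]]]; repeat split; auto].
        pose proof (ind_ge0 (~ W' u)). pose proof (ind_ge0 (~ W' v)). nra.
      + rewrite (ind_true (~ W' v)) by assumption. pose proof (ind_ge0 (Adj Z W' u v)). pose proof (ind_ge0 (~ W' u)). nra.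
    - rewrite (ind_true (~ W' u)) by assumption. pose proof (ind_ge0 (Adj Z W' u v)). pose proof (ind_ge0 (~ W' v)). nra. }
  assert (K1 : sumL (fun u => sumL (fun v => ind (~ W' u) * A u v) Z) Z <= 24 * h * sumL (fun u => ind (~ W' u)) Z).
  { rewrite <- sumL_scal. apply sumL_le. intros u Hu. rewrite sumL_scal. rewrite (Rmult_comm (24 * h)).
    apply Rmult_le_compat_l; [apply ind_ge0|].
    destruct (dec (W u)) as [Wu|Wu].
    - destruct (HW u Wu) as [t Ht].
      pose proof (deg_le2 E u (60 * h) (2 * h) t H2h Ht Z W (12 * h) ND S HE Hu ltac:(lra) ltac:(lra)) as Q.
      apply Rle_trans with (12 * h * sumL (fun v => ind (Adj Z W u v /\ d u v <= 12 * h)) Z); [|nra].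
      rewrite <- sumL_scal. apply sumL_le. intros v _. unfold A, r. pose proof (d_ge0 u v).
      destruct (dec (Adj Z W u v)) as [Q1|Q1]; [|rewrite (ind_false _ Q1); pose proof (ind_ge0 (Adj Z W u v /\ d u v <= 12 * h)); nra].
      rewrite (ind_true _ Q1). destruct (Rle_dec (d u v) (12 * h)) as [Q2|Q2].
      + rewrite ind_true by auto. assert (Rmax 0 (6 * h + 6 * h - d u v) <= 12 * h) by (apply Rmax_lub; lra). lra.
      + rewrite Rmax_left by lra. pose proof (ind_ge0 (Adj Z W u v /\ d u v <= 12 * h)). nra.
    - rewrite (sumL_ext _ (fun _ => 0)); [rewrite sumL_0; nra|]. intros v _. unfold A.
      rewrite ind_false; [ring|]. intros [_ [Q _]]. contradiction. }
  assert (K2 : sumL (fun u => sumL (fun v => ind (~ W' v) * A u v) Z) Z = sumL (fun u => sumL (fun v => ind (~ W' u) * A u v) Z) Z).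
  { rewrite sumL_swap. apply sumL_ext. intros u _. apply sumL_ext. intros v _. f_equal. apply (pr_sym Z W r). }
  lra.
Qed.

(* The points of degree less than 2 pay for the edges across the gaps. *)
Definition deg (Z : list V) W h u : R := sumL (fun v => ind (Adj Z W u v /\ d u v < 12 * h)) Z.

(** Lowering [r u] by [q u] releases [2 q u], and each neighbour within [12 h] takes back at most
    [q u]. As [q u >= h], at least [(2 - deg) h] remains. Pairs farther apart have no overlap,
    because [r <= 6 h]. *)
Lemma Psi_shrink (W E : V -> Prop) h Z r : 0 < h -> NoDup Z -> sepd h Z -> (forall z, In z Z -> E z) ->
  (forall u, W u -> exists t, chart E u (30 * h) h t) ->
  (forall z, In z Z -> 4 * h <= r z <= 6 * h) ->
  Psi Z W (fun _ => 3 * h) + h * sumL (fun u => 2 - deg Z W h u) Z <= Psi Z W r.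
Proof.
  intros Hh ND S HE HW Hr. unfold Psi.
  set (B := fun u v => ind (Adj Z W u v /\ d u v < 12 * h)).
  set (q := fun u => r u - 3 * h).
  assert (K : sumL (fun u => sumL (pr Z W r u) Z) Z <= sumL (fun u => sumL (pr Z W (fun _ => 3 * h) u) Z) Z +
     (sumL (fun u => sumL (fun v => q u * B u v) Z) Z + sumL (fun u => sumL (fun v => q v * B u v) Z) Z)).
  { rewrite <- !sumL_plus. apply sumL_le. intros u Hu. rewrite <- !sumL_plus. apply sumL_le. intros v Hv.
    unfold pr, B, q. pose proof (Hr u Hu). pose proof (Hr v Hv).
    pose proof (Rmax_l 0 (3 * h + 3 * h - d u v)). pose proof (Rmax_r 0 (3 * h + 3 * h - d u v)).
    destruct (dec (Adj Z W u v)) as [Q|Q].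
    - rewrite (ind_true _ Q). destruct (Rlt_dec (d u v) (12 * h)) as [Q1|Q1].
      + rewrite ind_true by auto. rewrite !Rmult_1_l, !Rmult_1_r.
        apply Rmax_lub; lra.
      + rewrite (Rmax_left 0 (r u + r v - d u v)) by lra.
        rewrite (ind_false (_ /\ _)) by tauto. lra.
    - rewrite (ind_false _ Q), (ind_false (_ /\ _)) by tauto. lra. }
  assert (K2 : sumL (fun u => sumL (fun v => q v * B u v) Z) Z = sumL (fun u => sumL (fun v => q u * B u v) Z) Z).
  { rewrite sumL_swap. apply sumL_ext. intros u _. apply sumL_ext. intros v _. f_equal. unfold B.
    apply Rle_antisym; apply ind_le; rewrite d_sym; intros [? ?]; split; auto using Adj_sym. }
  rewrite K2 in K.
  assert (K3 : sumL (fun u => sumL (fun v => q u * B u v) Z) Z + h * sumL (fun u => 2 - deg Z W h u) Z <=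
     2 * sumL r Z - 2 * sumL (fun _ => 3 * h) Z).
  { rewrite <- !sumL_scal, <- sumL_minus, <- sumL_plus. apply sumL_le. intros u Hu. rewrite sumL_scal.
    change (sumL (B u) Z) with (deg Z W h u). pose proof (Hr u Hu).
    assert (deg Z W h u <= 2).
    { destruct (dec (W u)) as [Wu|Wu].
      - destruct (HW u Wu) as [t Ht].
        pose proof (deg_le2 E u (30 * h) h t Hh Ht Z W (12 * h) ND S HE Hu ltac:(lra) ltac:(lra)) as Q.
        eapply Rle_trans; [|exact Q]. apply sumL_le. intros v _. apply ind_le. intros [? ?]. split; [auto | lra].
      - unfold deg. rewrite (sumL_ext _ (fun _ => 0)); [rewrite sumL_0; lra|]. intros v _.
        apply ind_false. intros [[_ [Q _]] _]. contradiction. }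
    unfold q. set (D := deg Z W h u) in *.
    assert (0 <= (r u - 4 * h) * (2 - D)) by (apply Rmult_le_pos; lra). lra. }
  lra.
Qed.

(** Each point contributes [6 h]; half of at most two overlaps is subtracted, each of them at most
    [6 h - h] by the separation. *)
Lemma Psi_lower (W E : V -> Prop) h Z : 0 < h -> NoDup Z -> sepd h Z -> (forall z, In z Z -> E z) ->
  (forall u, W u -> exists t, chart E u (30 * h) h t) ->
  h * INR (length Z) <= Psi Z W (fun _ => 3 * h).
Proof.
  intros Hh ND S HE HW. unfold Psi. rewrite sumL_const.
  assert (sumL (fun u => sumL (pr Z W (fun _ => 3 * h) u) Z) Z <= sumL (fun _ => 10 * h) Z).
  { apply sumL_le. intros u Hu. destruct (dec (W u)) as [Wu|Wu].
    - destruct (HW u Wu) as [t Ht].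
      pose proof (deg_le2 E u (30 * h) h t Hh Ht Z W (6 * h) ND S HE Hu ltac:(lra) ltac:(lra)) as Q.
      apply Rle_trans with (5 * h * sumL (fun v => ind (Adj Z W u v /\ d u v <= 6 * h)) Z); [|nra].
      rewrite <- sumL_scal. apply sumL_le. intros v Hv. unfold pr.
      destruct (dec (Adj Z W u v)) as [Q1|Q1]; [|rewrite (ind_false _ Q1); pose proof (ind_ge0 (Adj Z W u v /\ d u v <= 6 * h)); nra].
      rewrite (ind_true _ Q1). destruct (Rle_dec (d u v) (6 * h)) as [Q2|Q2].
      + rewrite ind_true by auto. assert (h <= d u v) by (apply S; auto; apply Q1).
        assert (Rmax 0 (3 * h + 3 * h - d u v) <= 5 * h) by (apply Rmax_lub; lra). lra.
      + rewrite Rmax_left by lra. pose proof (ind_ge0 (Adj Z W u v /\ d u v <= 6 * h)). nra.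
    - rewrite (sumL_ext _ (fun _ => 0)); [rewrite sumL_0; lra|]. intros v _. unfold pr.
      rewrite ind_false; [ring|]. intros [_ [Q _]]. contradiction. }
  rewrite sumL_const in H. lra.
Qed.

End Nets.

Lemma argmin {T} (f : T -> R) (l : list T) x0 : In x0 l -> exists x, In x l /\ forall y, In y l -> f x <= f y.
Proof.
  revert x0. induction l as [|a l IH]; intros x0 H; [destruct H|].
  destruct l as [|b l].
  - exists a. split; [left; reflexivity|]. intros y [<-|[]]. lra.
  - destruct (IH b (or_introl eq_refl)) as [x [Hx Q]].
    destruct (Rle_dec (f a) (f x)).
    + exists a. split; [left; reflexivity|]. intros y [<-|Hy]; [lra|]. specialize (Q y Hy). lra.
    + exists x. split; [right; assumption|]. intros y [<-|Hy]; [lra|]. apply Q, Hy.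
Qed.

(** * From one net to the next, and the tour of each net *)

Section Levels.
Context {V : Type} (d : V -> V -> R).
Hypothesis d_ge0 : forall x y, 0 <= d x y.
Hypothesis d_sym : forall x y, d x y = d y x.
Hypothesis d_refl : forall x, d x x = 0.
Hypothesis d_tri : forall x y z, d x z <= d x y + d y z.

Variables (E : V -> Prop) (X N : nat -> list V) (h : nat -> R) (x0 : V).
Variable par : nat -> V -> V.
Variable good : nat -> V -> Prop.
Variable err : nat -> V -> R.
Hypothesis h_pos : forall k, 0 < h k.
Hypothesis h_half : forall k, h k = 2 * h (S k).
Hypothesis X0 : X 0%nat = x0 :: nil.
Hypothesis XS : forall k, X (S k) = N k ++ X k.
Hypothesis X_nodup : forall k, NoDup (X k).
Hypothesis X_sep : forall k, sepd d (h k) (X k).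
Hypothesis X_E : forall k x, In x (X k) -> E x.
Hypothesis par_X : forall k y, In y (X (S k)) -> In (par k y) (X k) /\ d y (par k y) < h k.
Hypothesis good_err : forall k y, 0 <= err k y.
Hypothesis good_chart : forall k y, In y (X (S k)) -> good (S k) y ->
  exists t, chart d E y (100 * h (S k)) (h (S k)) t.
Hypothesis good_excess : forall k y, In y (X (S k)) -> good (S k) y -> forall a w c,
  In a (X (S k)) -> In w (X (S k)) -> In c (X (S k)) ->
  d y a <= 20 * h (S k) -> d y w <= 20 * h (S k) -> d y c <= 20 * h (S k) ->
  btw d a w c -> d a w + d w c - d a c <= err (S k) y.

Definition wf (k : nat) (u : V) : Prop := exists t, chart d E u (30 * h k) (h k) t.

Definition pot (k : nat) : R := Psi d (X k) (wf k) (fun _ => 3 * h k).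

Definition cost1 (k : nat) (y : V) : R := if dec (good k y) then err k y else 48 * h k.

Lemma good_wf k y u : In y (X (S k)) -> good (S k) y -> d y u <= 60 * h (S k) -> wf (S k) u.
Proof.
  intros Hy G Du. destruct (good_chart k y Hy G) as [t Ht]. exists t. intros a b Ea Eb Da Db.
  pose proof (h_pos (S k)). pose proof (d_tri y u a). pose proof (d_tri y u b).
  apply Ht; auto; lra.
Qed.

Lemma Psi_ext Z W r r' : (forall z, In z Z -> r z = r' z) -> Psi d Z W r = Psi d Z W r'.
Proof.
  intros H. unfold Psi. rewrite (sumL_ext r r' Z H).
  rewrite (sumL_ext (fun u => sumL (pr d Z W r u) Z) (fun u => sumL (pr d Z W r' u) Z)); [reflexivity|].
  intros u Hu. apply sumL_ext. intros v Hv. unfold pr. rewrite !H by assumption. reflexivity.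
Qed.

Lemma chart_mono y rho rho' hh t : rho <= rho' -> chart d E y rho' hh t -> chart d E y rho hh t.
Proof. intros H Ht a b Ea Eb Da Db. apply Ht; auto; lra. Qed.

(** With the radius [3 h k - d z (near z)], on a line the interval around a new point is contained
    in the interval around its nearest old point, so that the union does not grow; off a line the
    growth is an excess. *)
Lemma insert_all k near : (forall z, In (near z) (X k) /\ forall x, In x (X k) -> d z (near z) <= d z x) ->
  forall l l', N k = l' ++ l ->
  let r := fun z => 3 * h k - d z (near z) in
  Psi d (l ++ X k) (wf (S k)) r <= Psi d (X k) (wf (S k)) r +
    sumL (fun y => if dec (good (S k) y) then err (S k) y else 24 * h (S k)) l.
Proof.
  intros Hn l. induction l as [|y l IH]; intros l' El r; [simpl; lra|].
  specialize (IH (l' ++ y :: nil)). rewrite <- app_assoc in IH. specialize (IH El). fold r in IH. cbv zeta in IH.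
  cbn [sumL app].
  assert (EX : X (S k) = l' ++ (y :: l ++ X k)) by (rewrite XS, El, <- app_assoc; reflexivity).
  set (Z := l ++ X k) in *.
  assert (Inc : incl (y :: Z) (X (S k))) by (rewrite EX; intros z Hz; apply in_app_iff; auto).
  assert (ND : NoDup (y :: Z)).
  { pose proof (X_nodup (S k)) as Q. rewrite EX in Q. apply NoDup_app_remove_l in Q. assumption. }
  assert (Sp : sepd d (h (S k)) (y :: Z)) by (intros a b Ha Hb; apply X_sep; apply Inc; assumption).
  assert (HE : forall z, In z (y :: Z) -> E z) by (intros z Hz; apply (X_E (S k)), Inc, Hz).
  pose proof (h_pos (S k)) as Hh. pose proof (h_half k) as H2.
  assert (Hy : In y (X (S k))) by (apply Inc; left; reflexivity).
  assert (Hnear : forall z, In z (X (S k)) -> d z (near z) < h k).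
  { intros z Hz. destruct (par_X k z Hz) as [P1 P2]. destruct (Hn z) as [_ Q]. specialize (Q _ P1). lra. }
  assert (Hr : forall z, In z (y :: Z) -> 4 * h (S k) <= r z <= 6 * h (S k)).
  { intros z Hz. specialize (Hnear z (Inc z Hz)). pose proof (d_ge0 z (near z)). unfold r. lra. }
  assert (HXk : incl (X k) Z) by (intros z Hz; apply in_app_iff; auto).
  destruct (dec (good (S k) y)) as [G|G].
  2:{ pose proof (insert_bad d d_ge0 d_sym d_refl d_tri E (wf (S k)) (h (S k)) Z y r Hh ND Sp HE (fun u W => W) Hr). lra. }
  destruct (good_chart k y Hy G) as [t Ht].
  assert (Ht60 : chart d E y (60 * h (S k)) (h (S k)) t) by (eapply chart_mono; [|exact Ht]; lra).
  inversion ND as [|? ? HyZ NDZ]; subst.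
  assert (HS : forall z, In z Z -> h (S k) <= d y z /\ h (S k) <= d z y).
  { intros z Hz. assert (y <> z) by (intros <-; contradiction). split; apply Sp; simpl; auto. }
  destruct (Hn y) as [Hu Hmin]. set (u := near y) in *.
  pose proof (Hnear y Hy) as Du. fold u in Du.
  assert (By : inball d E y (60 * h (S k)) y) by (split; [apply HE; left; reflexivity | rewrite d_refl; lra]).
  assert (BZ : forall z, In z Z -> d y z <= 20 * h (S k) -> inball d E y (60 * h (S k)) z).
  { intros z Hz Dz. split; [apply HE; right; assumption | lra]. }
  (* [L] will be the neighbour of [y] on the side of its nearest old point [u]. *)
  set (side := fun z => d y z <= 20 * h (S k) /\ 0 < (t z - t y) * (t u - t y)).
  assert (Hside : In u (filter (fun x => if dec (side x) then true else false) Z)).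
  { apply in_filter_dec. split; [apply HXk, Hu|]. split; [lra|].
    destruct (chart_neq d E y (60 * h (S k)) (h (S k)) t Hh Ht60 y u By (BZ u (HXk u Hu) ltac:(lra))
      (proj1 (HS u (HXk u Hu)))); nra. }
  destruct (argmin (fun z => Rabs (t z - t y)) _ u Hside) as [L [HL HLmin]].
  apply in_filter_dec in HL. destruct HL as [ILZ [DL SL]].
  pose proof (HLmin u Hside) as HLu.
  pose proof (BZ L ILZ DL) as BL. pose proof (BZ u (HXk u Hu) ltac:(lra)) as Bu.
  pose proof (insert_good d d_sym d_refl E (wf (S k)) (h (S k)) Z y r Hh ND Sp HE Hr t (err (S k) y) L
     (good_err _ _) Ht60) as K.
  assert (Psi d (y :: Z) (wf (S k)) r <= Psi d Z (wf (S k)) r + err (S k) y); [|lra].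
  apply K; clear K; auto.
  - intros v Hv Dv. apply (good_wf k y); auto. lra.
  - intros a b Ia Ib Da Db B.
    apply (good_excess k y Hy G); auto; try (apply Inc; right; assumption). rewrite d_refl. lra.
  - intros w Iw Bw. assert (Dw : d y w <= 20 * h (S k)) by (destruct Bw; lra).
    pose proof (BZ w Iw Dw) as Bwb.
    assert (NwL : w <> L) by (intros ->; destruct Bw; lra).
    apply (chart_btw d E y (60 * h (S k)) (h (S k)) t Hh Ht60 y w L By Bwb BL) in Bw;
      [|apply HS, Iw | apply Sp; simpl; auto].
    assert (Hw : In w (filter (fun x => if dec (side x) then true else false) Z)).
    { apply in_filter_dec. split; [assumption|]. split; [assumption|]. nra. }
    specialize (HLmin w Hw). unfold Rabs in HLmin.
    destruct (Rcase_abs (t L - t y)), (Rcase_abs (t w - t y)); lra.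
  (* The claim amounts to [r y + d y L <= r L + err]. As [near L] is at most as far from [L] as [u]
     is, it follows from the small excess of [L], which lies between [u] and [y]. *)
  - assert (KL : d L (near L) <= d L u) by (apply Hn, Hu).
    unfold r. fold u. destruct (dec (L = u)) as [E1|E1].
    + pose proof (good_err (S k) y). rewrite E1 in *. rewrite d_refl in KL. lra.
    + assert (B : btw d u L y).
      { assert (SuL : h (S k) <= d u L) by (apply Sp; [right; apply HXk, Hu | right; assumption | congruence]).
        apply (chart_btw d E y (60 * h (S k)) (h (S k)) t Hh Ht60 u L y Bu BL By SuL (proj2 (HS L ILZ))).
        destruct (chart_neq d E y (60 * h (S k)) (h (S k)) t Hh Ht60 u L Bu BL SuL);
        unfold Rabs in HLu; destruct (Rcase_abs (t L - t y)), (Rcase_abs (t u - t y)); nra. }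
      pose proof (good_excess k y Hy G u L y) as Q.
      rewrite (d_sym L u) in KL. rewrite (d_sym y L), (d_sym y u).
      assert (d u L + d L y - d u y <= err (S k) y); [|lra].
      apply Q; auto; try (apply Inc; right; auto; fail); try (rewrite d_refl); lra.
Qed.

(** An old point is at distance 0 from the nearest old one, so its radius is [3 h k = 6 h (S k)],
    and the potential of level [k] is the value before the insertions, apart from the change of
    charts. Shrinking all radii to [3 h (S k)] gives the next potential. *)
Lemma pot_step k : pot (S k) + h (S k) * sumL (fun u => 2 - deg d (X (S k)) (wf (S k)) (h (S k)) u) (X (S k)) <=
  pot k + sumL (cost1 (S k)) (X (S k)).
Proof.
  pose proof (h_pos (S k)) as Hh. pose proof (h_half k) as H2.
  assert (Hx0 : exists x, In x (X k)).
  { clear -X0 XS. induction k; [rewrite X0; exists x0; left; reflexivity|].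
    destruct IHk as [x Hx]. exists x. rewrite XS. apply in_app_iff. auto. }
  destruct Hx0 as [x1 Hx1].
  destruct (choice (fun z n => In n (X k) /\ forall x, In x (X k) -> d z n <= d z x)) as [near Hn].
  { intros z. apply (argmin (fun x => d z x) (X k) x1 Hx1). }
  set (r := fun z => 3 * h k - d z (near z)).
  pose proof (insert_all k near Hn (N k) nil eq_refl) as K1. cbv zeta in K1. fold r in K1.
  rewrite <- XS in K1.
  assert (K0 : Psi d (X k) (wf (S k)) r = Psi d (X k) (wf (S k)) (fun _ => 6 * h (S k))).
  { apply Psi_ext. intros z Hz. unfold r. destruct (Hn z) as [_ Q]. specialize (Q z Hz).
    rewrite d_refl in Q. pose proof (d_ge0 z (near z)). lra. }
  pose proof (Psi_switch d d_ge0 d_sym d_refl (wf k) (wf (S k)) E (h (S k)) (X k) Hh (X_nodup k)) as K2.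
  rewrite <- H2 in K2. specialize (K2 (X_sep k) (X_E k)).
  assert (K2' : forall u, wf k u -> exists t, chart d E u (60 * h (S k)) (h k) t).
  { intros u [t Ht]. exists t. replace (60 * h (S k)) with (30 * h k) by lra. assumption. }
  specialize (K2 K2').
  pose proof (Psi_shrink d d_sym d_refl (wf (S k)) E (h (S k)) (X (S k)) r Hh (X_nodup _) (X_sep _) (X_E _)
    (fun u W => W)) as K3.
  assert (Hr : forall z, In z (X (S k)) -> 4 * h (S k) <= r z <= 6 * h (S k)).
  { intros z Hz. destruct (par_X k z Hz) as [P1 P2]. destruct (Hn z) as [_ Q]. specialize (Q _ P1).
    pose proof (d_ge0 z (near z)). unfold r. lra. }
  specialize (K3 Hr).
  assert (K4 : sumL (fun y => if dec (good (S k) y) then err (S k) y else 24 * h (S k)) (N k) +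
     24 * h (S k) * sumL (fun u => ind (~ wf (S k) u)) (X k) <= sumL (cost1 (S k)) (X (S k))).
  { rewrite XS, sumL_app. apply Rplus_le_compat.
    - apply sumL_le. intros y _. unfold cost1. destruct (dec _); lra.
    - rewrite <- sumL_scal. apply sumL_le. intros y Hy. unfold cost1. pose proof (good_err (S k) y).
      destruct (dec (good (S k) y)) as [G|G].
      + rewrite ind_false; [lra|]. intros Q. apply Q. apply (good_wf k y); auto.
        * rewrite XS. apply in_app_iff. auto.
        * rewrite d_refl. lra.
      + pose proof (ind_le1 (~ wf (S k) y)). nra. }
  unfold pot at 2. replace (3 * h k) with (6 * h (S k)) by lra. unfold pot. lra.
Qed.

Definition Short (k : nat) (a b : V) : Prop :=
  (In a (X k) /\ In b (X k)) /\ Adj d (X k) (wf k) a b /\ d a b < 12 * h k.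
Definition Gap (k : nat) (a b : V) : Prop :=
  (In a (X k) /\ In b (X k)) /\ Adj d (X k) (wf k) a b /\ 12 * h k <= d a b <= 26 * h k.

(** If a net point lies between [a] and [c], both parts are shorter by at least half of the scale,
    whence the induction on the number of these units; otherwise [a] and [c] are consecutive. The
    bounds on [t] persist, because the coordinate of an intermediate point is intermediate. *)
Lemma good_path k y t : In y (X (S k)) -> good (S k) y -> chart d E y (100 * h (S k)) (h (S k)) t ->
  forall n a c, In a (X (S k)) -> In c (X (S k)) -> d y a <= 60 * h (S k) -> d y c <= 60 * h (S k) ->
  Rabs (t a - t y) <= 30 * h (S k) -> Rabs (t c - t y) <= 30 * h (S k) ->
  d a c <= 26 * h (S k) -> d a c <= INR n * (h (S k) / 2) ->
  linked (fun a b => Short (S k) a b \/ Gap (S k) a b) a c.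
Proof.
  intros Hy G Ht n. pose proof (h_pos (S k)) as Hh.
  assert (By : inball d E y (100 * h (S k)) y) by (split; [eapply X_E; eauto | rewrite d_refl; lra]).
  induction n; intros a c Ha Hc Da Dc Ta Tc D1 D2.
  { simpl in D2. destruct (dec (a = c)) as [->|Nac]; [constructor|].
    pose proof (X_sep (S k) a c Ha Hc Nac). lra. }
  destruct (dec (a = c)) as [->|Nac]; [constructor|].
  destruct (classic (exists w, In w (X (S k)) /\ btw d a w c)) as [[w [Hw Bw]]|Nw].
  - assert (Naw : a <> w) by (intros ->; destruct Bw; lra).
    assert (Nwc : w <> c) by (intros ->; destruct Bw; lra).
    pose proof (X_sep (S k) a w Ha Hw Naw) as S1. pose proof (X_sep (S k) w c Hw Hc Nwc) as S2.
    assert (Ba : inball d E y (100 * h (S k)) a) by (split; [eapply X_E; eauto | lra]).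
    assert (Bc : inball d E y (100 * h (S k)) c) by (split; [eapply X_E; eauto | lra]).
    assert (Bw' : inball d E y (100 * h (S k)) w).
    { split; [eapply X_E; eauto|]. pose proof (d_tri y a w). destruct Bw. lra. }
    pose proof (proj1 (chart_btw d E y _ _ t Hh Ht a w c Ba Bw' Bc S1 S2) Bw) as T.
    pose proof (chart_bounds d E y _ _ t Hh Ht a w Ba Bw') as K1.
    pose proof (chart_bounds d E y _ _ t Hh Ht w c Bw' Bc) as K2.
    pose proof (chart_bounds d E y _ _ t Hh Ht a c Ba Bc) as K3.
    pose proof (chart_bounds d E y _ _ t Hh Ht w y Bw' By) as K4.
    assert (Tw : Rabs (t w - t y) <= 30 * h (S k)).
    { unfold Rabs in Ta, Tc |- *. destruct (Rcase_abs (t a - t y)), (Rcase_abs (t c - t y)), (Rcase_abs (t w - t y)); lra. }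
    rewrite (d_sym w y) in K4.
    assert (Dw : d y w <= 60 * h (S k)) by lra.
    assert (Q : d a w <= d a c - h (S k) / 2 /\ d w c <= d a c - h (S k) / 2).
    { unfold Rabs in K1, K2, K3.
      destruct (Rcase_abs (t a - t w)), (Rcase_abs (t w - t c)), (Rcase_abs (t a - t c)); lra. }
    rewrite S_INR in D2.
    apply linked_trans with w; apply IHn; auto; lra.
  - apply linked_edge.
    assert (A : Adj d (X (S k)) (wf (S k)) a c).
    { repeat split; auto; [apply (good_wf k y) | apply (good_wf k y)|]; auto. intros w Hw Bw. apply Nw. exists w. auto. }
    destruct (Rlt_dec (d a c) (12 * h (S k))); [left | right]; (split; [auto | split; [assumption | lra]]).
Qed.

Lemma good_path' k y c : In y (X (S k)) -> good (S k) y -> In c (X (S k)) -> d y c <= 26 * h (S k) ->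
  linked (fun a b => Short (S k) a b \/ Gap (S k) a b) y c.
Proof.
  intros Hy G Hc D. pose proof (h_pos (S k)) as Hh. destruct (good_chart k y Hy G) as [t Ht].
  assert (By : inball d E y (100 * h (S k)) y) by (split; [eapply X_E; eauto | rewrite d_refl; lra]).
  assert (Bc : inball d E y (100 * h (S k)) c) by (split; [eapply X_E; eauto | lra]).
  pose proof (chart_bounds d E y _ _ t Hh Ht c y Bc By) as K. rewrite (d_sym c y) in K.
  (* The distance of 26 scales consists of 52 units of half a scale. *)
  apply (good_path k y t Hy G Ht 52); auto; try (rewrite d_refl; lra).
  - lra.
  - rewrite Rminus_diag, Rabs_R0. lra.
  - lra.
  - replace (INR 52) with 52 by (simpl; lra). lra.
Qed.

(** At a bad point [1298 = 26 * 48 + 50]: the potential enters with the weight 26, and 50 pays for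
    new edges, 2 for the edge to the parent and 48 for the short edges of the previous level, whose
    scale is twice as large. *)
Definition cost2 (k : nat) (y : V) : R := if dec (good k y) then 26 * err k y else 1298 * h k.

Lemma deg26 k u : In u (X k) -> sumL (fun v => ind (Adj d (X k) (wf k) u v /\ d u v <= 26 * h k)) (X k) <= 2.
Proof.
  intros Hu. pose proof (h_pos k) as Hh. destruct (dec (wf k u)) as [[t Ht]|W].
  - apply (deg_le2 d d_refl E u (30 * h k) (h k) t); auto; try lra. apply X_E.
  - rewrite (sumL_ext _ (fun _ => 0)); [rewrite sumL_0; lra|]. intros v _.
    apply ind_false. intros [[_ [Q _]] _]. contradiction.
Qed.

Lemma short_cost k u : In u (X k) -> sumL (fun v => ind (Short k u v) * d u v) (X k) <= 24 * h k.
Proof.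
  intros Hu. pose proof (h_pos k) as Hh.
  apply Rle_trans with (12 * h k * sumL (fun v => ind (Adj d (X k) (wf k) u v /\ d u v <= 26 * h k)) (X k)).
  - rewrite <- sumL_scal. apply sumL_le. intros v _.
    destruct (dec (Short k u v)) as [Q|Q].
    + rewrite (ind_true _ Q). destruct Q as [_ [Q1 Q2]]. rewrite ind_true; [lra|]. split; [assumption | lra].
    + rewrite (ind_false _ Q). pose proof (ind_ge0 (Adj d (X k) (wf k) u v /\ d u v <= 26 * h k)). nra.
  - pose proof (deg26 k u Hu). nra.
Qed.

Lemma gap_cost k u : In u (X k) ->
  sumL (fun v => ind (Gap k u v) * d u v) (X k) <= 26 * h k * (2 - deg d (X k) (wf k) (h k) u).
Proof.
  intros Hu. pose proof (h_pos k) as Hh.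
  apply Rle_trans with (26 * h k * sumL (fun v => ind (Adj d (X k) (wf k) u v /\ d u v <= 26 * h k) -
     ind (Adj d (X k) (wf k) u v /\ d u v < 12 * h k)) (X k)).
  - rewrite <- sumL_scal. apply sumL_le. intros v _.
    destruct (dec (Gap k u v)) as [Q|Q].
    + rewrite (ind_true _ Q). destruct Q as [_ [Q1 Q2]].
      rewrite (ind_true (_ /\ _)) by (split; [assumption | lra]). rewrite ind_false by (intros [_ Q3]; lra). lra.
    + rewrite (ind_false _ Q).
      assert (ind (Adj d (X k) (wf k) u v /\ d u v < 12 * h k) <= ind (Adj d (X k) (wf k) u v /\ d u v <= 26 * h k))
        by (apply ind_le; intros [? ?]; split; [assumption | lra]). nra.
  - rewrite sumL_minus. unfold deg. pose proof (deg26 k u Hu). nra.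
Qed.

(** Edges in [P] are kept for ever, while short edges are recomputed at every level; a short edge at
    a bad point may disappear and is therefore transferred to [P]. With the weight 26 the amount
    [h (2 - deg)] released at a point pays for its gaps, of length at most [26 h]. The initial
    potential is at most [6 h 0], whence 156. *)
Lemma connect k : exists P : list (V * V),
  (forall e, In e P -> In (fst e) (X k) /\ In (snd e) (X k)) /\
  (forall x y, In x (X k) -> In y (X k) -> linked (fun a b => In (a, b) P \/ Short k a b) x y) /\
  sumL (fun e => d (fst e) (snd e)) P + 26 * pot k <= 156 * h 0%nat +
    sumL (fun j => sumL (cost2 j) (X j)) (seq 1 k).
Proof.
  induction k as [|k [P [HP1 [HP2 HP3]]]].
  { exists nil. split; [intros e []|]. split.
    - rewrite X0. intros x y [<-|[]] [<-|[]]. constructor.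
    - simpl. unfold pot, Psi. rewrite X0. simpl.
      pose proof (pr_ge0 d (x0 :: nil) (wf 0) (fun _ => 3 * h 0%nat) x0 x0). lra. }
  pose proof (h_pos (S k)) as Hh. pose proof (h_half k) as H2.
  assert (Inc : incl (X k) (X (S k))) by (intros z Hz; rewrite XS; apply in_app_iff; auto).
  set (P1 := map (fun y => (y, par k y)) (filter (fun y => if dec (~ good (S k) y) then true else false) (X (S k)))).
  set (P2 := filter (fun e : V * V => if dec (~ good (S k) (fst e) /\ Short k (fst e) (snd e)) then true else false)
     (list_prod (X k) (X k))).
  set (P3 := filter (fun e : V * V => if dec (Gap (S k) (fst e) (snd e)) then true else false)
     (list_prod (X (S k)) (X (S k)))).
  exists (P ++ P1 ++ P2 ++ P3).
  assert (InP1 : forall a b, In (a, b) P1 <-> (In a (X (S k)) /\ ~ good (S k) a) /\ b = par k a).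
  { intros a b. unfold P1. rewrite in_map_iff. split.
    - intros [y [Ey Hy]]. inversion Ey; subst. apply in_filter_dec in Hy. auto.
    - intros [Ha ->]. exists a. split; [reflexivity|]. apply in_filter_dec. assumption. }
  assert (InP2 : forall a b, In (a, b) P2 <-> (In a (X k) /\ In b (X k)) /\ ~ good (S k) a /\ Short k a b).
  { intros a b. unfold P2. rewrite in_filter_dec, in_prod_iff. simpl. tauto. }
  assert (InP3 : forall a b, In (a, b) P3 <-> (In a (X (S k)) /\ In b (X (S k))) /\ Gap (S k) a b).
  { intros a b. unfold P3. rewrite in_filter_dec, in_prod_iff. simpl. tauto. }
  split; [|split].
  - intros [a b]. rewrite !in_app_iff, InP1, InP2, InP3. simpl. intros [Q|[[[Q1 Q2] ->]|[[[Q1 Q2] _]|[Q _]]]]; auto.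
    + apply HP1 in Q. simpl in Q. split; apply Inc, Q.
    + split; [assumption | apply Inc, par_X, Q1].
  - set (F := fun a b => In (a, b) (P ++ P1 ++ P2 ++ P3) \/ Short (S k) a b).
    assert (FSG : forall a b, linked (fun a b => Short (S k) a b \/ Gap (S k) a b) a b -> linked F a b).
    { intros a b. apply linked_lift. intros a' b' [Q|Q]; apply linked_edge; [right; assumption|].
      left. rewrite !in_app_iff, InP3. pose proof (proj1 Q). tauto. }
    assert (Fpar : forall y, In y (X (S k)) -> linked F y (par k y)).
    { intros y Hy. destruct (par_X k y Hy) as [Q1 Q2]. destruct (classic (good (S k) y)) as [G|G].
      - apply FSG, (good_path' k); auto. lra.
      - apply linked_edge. left. rewrite !in_app_iff, InP1. tauto. }
    assert (FX : forall a b, linked (fun a b => In (a, b) P \/ Short k a b) a b -> linked F a b).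
    { intros a b. apply linked_lift. intros a' b' [Q|Q].
      - apply linked_edge. left. rewrite !in_app_iff. auto.
      - destruct (classic (good (S k) a')) as [G|G].
        + destruct Q as [[Q1 Q2] [Q3 Q4]]. apply FSG, (good_path' k); auto. lra.
        + apply linked_edge. left. rewrite !in_app_iff, InP2. pose proof (proj1 Q). tauto. }
    intros x y Hx Hy. apply linked_trans with (par k x); [apply Fpar, Hx|].
    apply linked_trans with (par k y); [|apply linked_sym, Fpar, Hy].
    apply FX, HP2; apply par_X; assumption.
  - rewrite seq_S, !sumL_app. simpl (1 + k)%nat. cbn [sumL]. rewrite Rplus_0_r.
    set (bad := fun y => ind (~ good (S k) y)).
    assert (K1 : sumL (fun e => d (fst e) (snd e)) P1 <= 2 * h (S k) * sumL bad (X (S k))).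
    { unfold P1. rewrite sumL_map, sumL_filter. rewrite <- sumL_scal. apply sumL_le. intros y Hy. simpl.
      pose proof (par_X k y Hy) as [_ Q]. unfold bad. pose proof (ind_ge0 (~ good (S k) y)). nra. }
    assert (K2 : sumL (fun e => d (fst e) (snd e)) P2 <= 48 * h (S k) * sumL bad (X (S k))).
    { apply Rle_trans with (48 * h (S k) * sumL bad (X k)).
      - unfold P2. rewrite sumL_filter, sumL_prod. rewrite <- sumL_scal. apply sumL_le. intros u Hu. simpl.
        pose proof (short_cost k u Hu) as Q. unfold bad.
        apply Rle_trans with (ind (~ good (S k) u) * sumL (fun v => ind (Short k u v) * d u v) (X k)).
        + rewrite <- sumL_scal. apply sumL_le. intros v _. pose proof (d_ge0 u v).
          destruct (dec (~ good (S k) u /\ Short k u v)) as [[Q1 Q2]|Q'].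
          * rewrite (ind_true (_ /\ _)), (ind_true _ Q1), (ind_true _ Q2) by auto. lra.
          * rewrite (ind_false _ Q'). pose proof (ind_ge0 (~ good (S k) u)). pose proof (ind_ge0 (Short k u v)).
            assert (0 <= ind (Short k u v) * d u v) by (apply Rmult_le_pos; assumption). nra.
        + pose proof (ind_ge0 (~ good (S k) u)). nra.
      - apply Rmult_le_compat_l; [lra|]. apply sumL_incl; auto. intros; apply ind_ge0. }
    assert (K3 : sumL (fun e => d (fst e) (snd e)) P3 <=
       26 * h (S k) * sumL (fun u => 2 - deg d (X (S k)) (wf (S k)) (h (S k)) u) (X (S k))).
    { unfold P3. rewrite sumL_filter, sumL_prod. rewrite <- sumL_scal. apply sumL_le. intros u Hu. simpl.
      apply (gap_cost (S k) u Hu). }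
    pose proof (pot_step k) as K4.
    assert (K5 : 26 * sumL (cost1 (S k)) (X (S k)) + 50 * h (S k) * sumL bad (X (S k)) <= sumL (cost2 (S k)) (X (S k))).
    { rewrite <- !sumL_scal, <- sumL_plus. apply sumL_le. intros y _. unfold cost1, cost2, bad.
      destruct (dec (good (S k) y)) as [G|G]; [rewrite ind_false by tauto | rewrite ind_true by assumption]; lra. }
    lra.
Qed.

(** The short edges of the last level cost at most [24 h k] per point. The remaining potential is at
    least [h k] per point and has the weight 26, so it covers them. *)
Lemma net_tour k : exists w, (forall z, In z (x0 :: w) <-> In z (X k)) /\
  walk_len d x0 w <= 2 * (156 * h 0%nat + sumL (fun j => sumL (cost2 j) (X j)) (seq 1 k)).
Proof.
  destruct (connect k) as [P [HP1 [HP2 HP3]]].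
  set (Q := filter (fun e : V * V => if dec (Short k (fst e) (snd e)) then true else false) (list_prod (X k) (X k))).
  assert (InQ : forall a b, In (a, b) Q <-> Short k a b).
  { intros a b. unfold Q. rewrite in_filter_dec, in_prod_iff. simpl. split; [tauto|].
    intros H. split; [apply H | assumption]. }
  assert (Hx0 : In x0 (X k)).
  { clear -X0 XS. induction k; [rewrite X0; left; reflexivity|]. rewrite XS. apply in_app_iff. auto. }
  destruct (tour_exists d (fun _ _ => True) (P ++ Q) (X k) x0 d_ge0 d_sym (X_nodup k) Hx0) as [w [H1 [_ [_ [_ H2]]]]].
  - intros x y Hx Hy. eapply linked_lift; [|apply (HP2 x y Hx Hy)].
    intros a b [Hab|Hab]; apply linked_edge; rewrite in_app_iff, InQ.
    + pose proof (HP1 _ Hab). simpl in *. tauto.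
    + pose proof (proj1 Hab). tauto.
  - auto.
  - exists w. split; [assumption|]. rewrite sumL_app in H2.
    assert (K : sumL (fun e => d (fst e) (snd e)) Q <= 24 * h k * INR (length (X k))).
    { unfold Q. rewrite sumL_filter, sumL_prod, <- sumL_const. apply sumL_le. intros u Hu. apply (short_cost k u Hu). }
    pose proof (h_pos k).
    pose proof (Psi_lower d d_refl (wf k) E (h k) (X k) (h_pos k) (X_nodup k) (X_sep k) (X_E k) (fun u W => W)) as L.
    fold (pot k) in L. pose proof (pos_INR (length (X k))). nra.
Qed.

End Levels.

(** * Limit curves *)

(** The label of a point is the length of the walk up to the last visit to it. *)
Lemma walk_label {V} (d : V -> V -> R) (x : V) (w : list V) :
  (forall x y, 0 <= d x y) -> (forall x y, d x y = d y x) -> (forall x, d x x = 0) ->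
  (forall x y z, d x z <= d x y + d y z) ->
  exists th : V -> R, forall z, In z (x :: w) -> 0 <= th z <= walk_len d x w /\ d x z <= th z /\
    forall z', In z' (x :: w) -> d z z' <= Rabs (th z - th z').
Proof.
  intros d0 ds dr dt. revert x. induction w as [|y w IH]; intros x.
  - exists (fun _ => 0). intros z [<-|[]]. simpl. rewrite dr. splits; try lra.
    intros z' [<-|[]]. rewrite dr, Rminus_diag, Rabs_R0. lra.
  - destruct (IH y) as [th Hth]. exists (fun z => if dec (In z (y :: w)) then d x y + th z else 0).
    pose proof (d0 x y) as Hxy.
    assert (Hw : 0 <= walk_len d y w) by (destruct (Hth y (or_introl eq_refl)) as [? _]; lra).
    assert (K : forall z, In z (y :: w) -> d x z <= d x y + th z).
    { intros z Hz. destruct (Hth z Hz) as [_ [Q _]]. pose proof (dt x y z). lra. }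
    intros z Hz. cbn [walk_len]. destruct (dec (In z (y :: w))) as [I|I].
    + destruct (Hth z I) as [Q1 [Q2 Q3]]. splits; [lra | lra | apply K, I|].
      intros z' Hz'. destruct (dec (In z' (y :: w))) as [I'|I'].
      * replace (d x y + th z - (d x y + th z')) with (th z - th z') by ring. apply Q3, I'.
      * destruct Hz' as [<-|Hz']; [|contradiction]. rewrite ds, Rabs_right by lra. pose proof (K z I). lra.
    + destruct Hz as [<-|Hz]; [|contradiction]. rewrite dr. splits; [lra | lra | lra|].
      intros z' Hz'. destruct (dec (In z' (y :: w))) as [I'|I'].
      * pose proof (K z' I'). destruct (Hth z' I') as [Q1 _]. rewrite Rabs_left1 by lra. lra.
      * destruct Hz' as [<-|Hz']; [|contradiction]. rewrite dr, Rminus_diag, Rabs_R0. lra.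
Qed.

Lemma cluster_exists (u : nat -> R) M : (forall n, 0 <= u n <= M) ->
  exists l, forall e N, 0 < e -> exists n, (N <= n)%nat /\ Rabs (u n - l) < e.
Proof.
  intros H. destruct (Bolzano_Weierstrass u (fun c => 0 <= c <= M)) as [l Hl].
  - apply compact_P3.
  - exact H.
  - exists l. intros e N He.
    destruct (Hl (disc l (mkposreal e He)) N) as [n [Hn Q]].
    + exists (mkposreal e He). intros x Hx. exact Hx.
    + exists n. split; [assumption|]. exact Q.
Qed.

(* Simultaneous cluster values; this replaces the extraction of a diagonal subsequence. *)
Lemma joint_cluster (u : nat -> nat -> R) M : (forall j n, 0 <= u j n <= M) ->
  exists l : nat -> R, forall j e N, 0 < e -> exists n, (N <= n)%nat /\
    forall i, (i <= j)%nat -> Rabs (u i n - l i) < e.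
Proof.
  intros H.
  set (C := fun L : list R => forall e N, 0 < e -> exists n, (N <= n)%nat /\
     forall i, (i < length L)%nat -> Rabs (u i n - nth i L 0) < e).
  assert (Step : forall L, C L -> exists l, C (L ++ l :: nil)).
  { intros L HC.
    (* Along [s] the earlier values already converge to [L]; the next one is a cluster value along
       [s]. *)
    destruct (choice (fun m n => (m <= n)%nat /\ forall i, (i < length L)%nat -> Rabs (u i n - nth i L 0) < / INR (S m)))
      as [s Hs].
    { intros m. apply HC. apply Rinv_0_lt_compat, lt_0_INR. lia. }
    destruct (cluster_exists (fun m => u (length L) (s m)) M) as [l Hl]; [intros; apply H|].
    exists l. intros e N He.
    destruct (archimed_cor1 e He) as [m0 [Hm0 Hm0']].
    destruct (Hl e (max N m0) He) as [m [Hm Q]]. destruct (Hs m) as [Hs1 Hs2].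
    exists (s m). split; [lia|]. intros i Hi. rewrite length_app in Hi. simpl in Hi.
    destruct (Nat.eq_dec i (length L)) as [->|Ni].
    - rewrite nth_middle. assumption.
    - rewrite app_nth1 by lia. eapply Rlt_trans; [apply Hs2; lia|].
      eapply Rle_lt_trans; [|exact Hm0]. apply Rinv_le_contravar; [apply lt_0_INR; lia|].
      apply le_INR. lia. }
  set (next := fun L => epsilon (inhabits 0) (fun l => C (L ++ l :: nil))).
  set (f := fix f n := match n with O => nil | S n => f n ++ next (f n) :: nil end).
  assert (Lf : forall n, length (f n) = n) by (induction n; simpl; [reflexivity | rewrite length_app, IHn; simpl; lia]).
  assert (Cf : forall n, C (f n)).
  { induction n; [intros e N He; exists N; split; [lia | simpl; lia]|]. simpl.
    unfold next. apply (epsilon_spec (inhabits 0) (fun l => C (f n ++ l :: nil))). apply Step, IHn. }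
  assert (St : forall n i, (i < n)%nat -> nth i (f n) 0 = next (f i)).
  { induction n; intros i Hi; [lia|]. simpl. destruct (Nat.eq_dec i n) as [->|Ni].
    - rewrite <- (Lf n) at 1. apply nth_middle.
    - rewrite app_nth1 by (rewrite Lf; lia). apply IHn. lia. }
  exists (fun j => next (f j)). intros j e N He.
  destruct (Cf (S j) e N He) as [n [Hn Q]]. exists n. split; [assumption|]. intros i Hi.
  rewrite <- (St (S j) i) by lia. apply Q. rewrite Lf. lia.
Qed.

Section Curve.
Context {p : R} {Hp : Exponent p}.
Variables (e : nat -> lp p) (tau : nat -> R) (M : R).
Hypothesis tau_bd : forall j, 0 <= tau j <= M.
Hypothesis tau_lip : forall i j, dist (e i) (e j) <= Rabs (tau i - tau j).

(* [at_time s x]: the curve defined by [tau j -> e j] extends by continuity to [s], with value [x]. *)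
Definition at_time (s : R) (x : lp p) : Prop := forall eps, 0 < eps -> exists j, Rabs (tau j - s) < eps /\ dist (e j) x < eps.

Lemma at_time_lip s x s' x' : at_time s x -> at_time s' x' -> dist x x' <= Rabs (s - s').
Proof.
  intros H H'. apply le_epsilon. intros eps He.
  destruct (H (eps / 4) ltac:(lra)) as [i [I1 I2]]. destruct (H' (eps / 4) ltac:(lra)) as [j [J1 J2]].
  pose proof (dist_triangle x (e i) x'). pose proof (dist_triangle (e i) (e j) x').
  pose proof (tau_lip i j). rewrite (dist_sym x (e i)) in *.
  assert (Rabs (tau i - tau j) <= Rabs (s - s') + eps / 2); [|lra].
  replace (tau i - tau j) with ((tau i - s) + (s - s') + - (tau j - s')) by ring.
  eapply Rle_trans; [apply Rabs_triang|]. rewrite Rabs_Ropp.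
  pose proof (Rabs_triang (tau i - s) (s - s')). lra.
Qed.

Lemma at_time_closed s : (forall eps, 0 < eps -> exists j, Rabs (tau j - s) < eps) -> exists x, at_time s x.
Proof.
  intros H. destruct (choice (fun m j => Rabs (tau j - s) < / INR (S m))) as [q Hq].
  { intros m. apply H, Rinv_0_lt_compat, lt_0_INR. lia. }
  destruct (lp_complete (fun m => e (q m))) as [x Hx].
  { intros eps He. destruct (archimed_cor1 (eps / 2) ltac:(lra)) as [m0 [Hm0 Hm0']]. exists m0.
    assert (K : forall i, (m0 <= i)%nat -> Rabs (tau (q i) - s) < eps / 2).
    { intros i Hi. eapply Rlt_trans; [apply Hq|]. eapply Rle_lt_trans; [|exact Hm0].
      apply Rinv_le_contravar; [apply lt_0_INR; lia | apply le_INR; lia]. }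
    intros i j Hi Hj. eapply Rle_trans; [apply tau_lip|].
    replace (tau (q i) - tau (q j)) with ((tau (q i) - s) + - (tau (q j) - s)) by ring.
    eapply Rle_trans; [apply Rabs_triang|]. rewrite Rabs_Ropp. pose proof (K i Hi). pose proof (K j Hj). lra. }
  exists x. intros eps He. destruct (Hx (eps / 2) ltac:(lra)) as [n Hn].
  destruct (archimed_cor1 eps He) as [m0 [Hm0 Hm0']].
  exists (q (max n m0)). split.
  - eapply Rlt_trans; [apply Hq|]. eapply Rle_lt_trans; [|exact Hm0].
    apply Rinv_le_contravar; [apply lt_0_INR; lia | apply le_INR; lia].
  - specialize (Hn (max n m0) ltac:(lia)). lra.
Qed.

Definition adherent (s : R) : Prop := exists x, at_time s x.

Lemma adherent_limit s : (forall eps, 0 < eps -> exists s', adherent s' /\ Rabs (s' - s) < eps) -> adherent s.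
Proof.
  intros H. apply at_time_closed. intros eps He. destruct (H (eps / 2) ltac:(lra)) as [s' [[x Hx] Hs]].
  destruct (Hx (eps / 2) ltac:(lra)) as [j [Hj _]]. exists j.
  replace (tau j - s) with ((tau j - s') + (s' - s)) by ring.
  eapply Rle_lt_trans; [apply Rabs_triang|]. lra.
Qed.

Lemma adherent_tau j : adherent (tau j).
Proof. exists (e j). intros eps He. exists j. rewrite Rminus_diag, Rabs_R0, dist_refl. auto. Qed.

Lemma adherent_bd s : adherent s -> 0 <= s <= M.
Proof.
  intros [x Hx]. split; apply le_epsilon; intros eps He; destruct (Hx eps He) as [j [Hj _]];
  pose proof (tau_bd j); unfold Rabs in Hj; destruct (Rcase_abs _); lra.
Qed.

Lemma adherent_below s : (exists s0, adherent s0 /\ s0 <= s) ->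
  exists l, adherent l /\ l <= s /\ forall s', adherent s' -> s' <= s -> s' <= l.
Proof.
  intros [s0 [H0 H0']].
  destruct (completeness (fun q => adherent q /\ q <= s)) as [l [L1 L2]].
  - exists s. intros q [_ Q]. exact Q.
  - exists s0. auto.
  - exists l. splits.
    + apply adherent_limit. intros eps He. apply NNPP. intros N.
      assert (l <= l - eps); [|lra]. apply L2. intros q [Q1 Q2]. apply Rnot_lt_le. intros Q3. apply N.
      exists q. split; [assumption|]. assert (q <= l) by (apply L1; auto). rewrite Rabs_left1; lra.
    + apply L2. intros q [_ Q]. exact Q.
    + intros s' H1 H2. apply L1. auto.
Qed.

Lemma adherent_above s : (exists s0, adherent s0 /\ s <= s0) ->
  exists l, adherent l /\ s <= l /\ forall s', adherent s' -> s <= s' -> l <= s'.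
Proof.
  intros [s0 [H0 H0']].
  destruct (completeness (fun q => adherent (- q) /\ s <= - q)) as [l [L1 L2]].
  - exists (- s). intros q [_ Q]. lra.
  - exists (- s0). rewrite Ropp_involutive. auto.
  - exists (- l). splits.
    + apply adherent_limit. intros eps He. apply NNPP. intros N.
      assert (l <= l - eps); [|lra]. apply L2. intros q [Q1 Q2]. apply Rnot_lt_le. intros Q3. apply N.
      exists (- q). split; [assumption|]. assert (q <= l) by (apply L1; auto). rewrite Rabs_right; lra.
    + cut (l <= - s); [lra|]. apply L2. intros q [_ Q]. lra.
    + intros s' H1 H2. cut (- s' <= l); [lra|]. apply L1. rewrite Ropp_involutive. auto.
Qed.

(* Affine interpolation in the gaps of the set of adherent times. *)
Definition on_curve (s : R) (x : lp p) : Prop := exists l r xl xr, at_time l xl /\ at_time r xr /\ l <= s <= r /\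
  (forall s', adherent s' -> s' <= l \/ r <= s') /\ x = comb ((s - l) / (r - l)) xl xr.

Lemma on_curve_exists s a b : adherent a -> adherent b -> a <= s <= b -> exists x, on_curve s x.
Proof.
  intros Ha Hb Hs.
  destruct (adherent_below s) as [l [[xl L1] [L2 L3]]]; [exists a; split; [assumption | lra]|].
  destruct (adherent_above s) as [r [[xr R1] [R2 R3]]]; [exists b; split; [assumption | lra]|].
  exists (comb ((s - l) / (r - l)) xl xr). exists l, r, xl, xr. splits; auto.
  intros s' Hs'. destruct (Rle_dec s' s); [left; auto | right; apply R3; [assumption | lra]].
Qed.

Lemma on_curve_ends s l r xl xr : at_time l xl -> at_time r xr -> l <= s <= r ->
  dist xl (comb ((s - l) / (r - l)) xl xr) <= s - l /\ dist (comb ((s - l) / (r - l)) xl xr) xr <= r - s.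
Proof.
  intros H1 H2 Hs. pose proof (at_time_lip _ _ _ _ H1 H2) as D. rewrite Rabs_left1 in D by lra.
  destruct (Req_dec l r) as [E|E].
  - subst r. assert (s = l) by lra. subst s. assert (xl = xr) by (apply dist_eq; pose proof (dist_nonneg xl xr); lra).
    subst xr. replace (comb ((l - l) / (l - l)) xl xl) with xl by vec. rewrite dist_refl. lra.
  - set (t := (s - l) / (r - l)). assert (Et : t * (r - l) = s - l) by (unfold t; field; lra).
    assert (Ht : 0 <= t <= 1) by (apply div_unit; lra).
    rewrite dist_comb_l, dist_comb_r by assumption. pose proof (dist_nonneg xl xr). split; nra.
Qed.

Lemma on_curve_lip s x s' x' : on_curve s x -> on_curve s' x' -> dist x x' <= Rabs (s - s').
Proof.
  assert (W : forall s x s' x', s <= s' -> on_curve s x -> on_curve s' x' -> dist x x' <= s' - s).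
  { clear s x s' x'. intros s x s' x' Hss [l [r [xl [xr [A1 [A2 [A3 [A4 A5]]]]]]]]
      [l' [r' [xl' [xr' [B1 [B2 [B3 [B4 B5]]]]]]]].
    pose proof (on_curve_ends s l r xl xr A1 A2 A3) as [E1 E2]. rewrite <- A5 in E1, E2.
    pose proof (on_curve_ends s' l' r' xl' xr' B1 B2 B3) as [F1 F2]. rewrite <- B5 in F1, F2.
    (* Either the first gap ends before the second begins, or the two gaps coincide, or one of them
       is degenerate. *)
    destruct (Rle_dec r l') as [Q|Q].
    - pose proof (at_time_lip _ _ _ _ A2 B1) as D. rewrite Rabs_left1 in D by lra.
      pose proof (dist_triangle x xr x'). pose proof (dist_triangle xr xl' x'). lra.
    - destruct (A4 l' (ex_intro _ _ B1)) as [Q1|Q1]; [|lra].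
      destruct (B4 l (ex_intro _ _ A1)) as [Q2|Q2].
      + assert (l = l') by lra. subst l'.
        assert (xl = xl').
        { apply dist_eq. pose proof (at_time_lip _ _ _ _ A1 B1) as D. rewrite Rminus_diag, Rabs_R0 in D.
          pose proof (dist_nonneg xl xl'). lra. }
        subst xl'. destruct (A4 r' (ex_intro _ _ B2)) as [Q3|Q3].
        * assert (s = s') by lra. assert (s = l) by lra.
          pose proof (dist_triangle x xl x'). rewrite (dist_sym x xl) in *. lra.
        * destruct (B4 r (ex_intro _ _ A2)) as [Q4|Q4]; [lra|].
          assert (r = r') by lra. subst r'.
          assert (xr = xr').
          { apply dist_eq. pose proof (at_time_lip _ _ _ _ A2 B2) as D. rewrite Rminus_diag, Rabs_R0 in D.
            pose proof (dist_nonneg xr xr'). lra. }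
          subst xr' x x'. rewrite dist_comb2.
          pose proof (at_time_lip _ _ _ _ A1 A2) as D. rewrite Rabs_left1 in D by lra.
          replace ((s - l) / (r - l) - (s' - l) / (r - l)) with (- ((s' - s) / (r - l))) by (field; lra).
          assert (0 <= (s' - s) / (r - l)) by (apply Rmult_le_pos; [|left; apply Rinv_0_lt_compat]; lra).
          rewrite Rabs_Ropp, Rabs_right by lra.
          replace (s' - s) with ((s' - s) / (r - l) * (r - l)) at 2 by (field; lra).
          apply Rmult_le_compat_l; lra.
      + assert (s = l) by lra. assert (s' = r') by lra. assert (s = s') by lra.
        pose proof (at_time_lip _ _ _ _ A1 B2) as D. replace (l - r') with 0 in D by lra. rewrite Rabs_R0 in D.
        pose proof (dist_triangle x xl x'). pose proof (dist_triangle xl xr' x').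
        rewrite (dist_sym x xl), (dist_sym xr' x') in *. lra. }
  intros H H'. destruct (Rle_dec s s').
  - rewrite Rabs_left1 by lra. pose proof (W _ _ _ _ r H H'). lra.
  - rewrite Rabs_right by lra. rewrite dist_sym. apply W; auto. lra.
Qed.

(** [[0, 1]] is mapped affinely onto the interval between the least and the greatest adherent time.
    A limit of points [e j] is reached because the times of the approximating points have a cluster
    value, which is then a time of the limit. *)
Lemma curve_exists : exists g : R -> lp p,
  (forall s t, 0 <= s <= 1 -> 0 <= t <= 1 -> dist (g s) (g t) <= M * Rabs (s - t)) /\
  (forall x, (forall eps, 0 < eps -> exists j, dist (e j) x < eps) -> exists t, 0 <= t <= 1 /\ g t = x).
Proof.
  destruct (adherent_above (-1)) as [m [Hm [_ Hm2]]].
  { exists (tau 0%nat). split; [apply adherent_tau|]. pose proof (tau_bd 0). lra. }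
  destruct (adherent_below (M + 1)) as [m' [Hm' [_ Hm2']]].
  { exists (tau 0%nat). split; [apply adherent_tau|]. pose proof (tau_bd 0). lra. }
  pose proof (adherent_bd m Hm) as B. pose proof (adherent_bd m' Hm') as B'.
  assert (Hmm : m <= m') by (apply Hm2; [assumption | lra]).
  assert (Hsp : forall t, 0 <= t <= 1 -> m <= m + t * (m' - m) <= m') by (intros; nra).
  set (g := fun t => epsilon (inhabits (e 0%nat)) (on_curve (m + t * (m' - m)))).
  assert (Hg : forall t, 0 <= t <= 1 -> on_curve (m + t * (m' - m)) (g t)).
  { intros t Ht. apply epsilon_spec. apply (on_curve_exists _ m m'); auto. }
  exists g. split.
  - intros s t Hs Ht. eapply Rle_trans; [apply (on_curve_lip _ _ _ _ (Hg s Hs) (Hg t Ht))|].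
    replace (m + s * (m' - m) - (m + t * (m' - m))) with ((m' - m) * (s - t)) by ring.
    rewrite Rabs_mult, (Rabs_right (m' - m)) by lra. apply Rmult_le_compat_r; [apply Rabs_pos | lra].
  - intros x Hx.
    destruct (choice (fun n j => dist (e j) x < / INR (S n))) as [q Hq].
    { intros n. apply Hx, Rinv_0_lt_compat, lt_0_INR. lia. }
    destruct (cluster_exists (fun n => tau (q n)) M) as [s Hs]; [intros; apply tau_bd|].
    assert (At : at_time s x).
    { intros eps He. destruct (archimed_cor1 eps He) as [n0 [Hn0 Hn0']].
      destruct (Hs eps n0 He) as [n [Hn Q]]. exists (q n). split; [assumption|].
      eapply Rlt_trans; [apply Hq|]. eapply Rle_lt_trans; [|exact Hn0].
      apply Rinv_le_contravar; [apply lt_0_INR; lia | apply le_INR; lia]. }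
    assert (As : adherent s) by (exists x; assumption).
    pose proof (adherent_bd s As).
    assert (m <= s) by (apply Hm2; [assumption | lra]). assert (s <= m') by (apply Hm2'; [assumption | lra]).
    assert (exists t, 0 <= t <= 1 /\ m + t * (m' - m) = s) as [t [Ht Et]].
    { destruct (Req_dec m m') as [E|E].
      - exists 0. split; lra.
      - exists ((s - m) / (m' - m)).
        assert (Q : (s - m) / (m' - m) * (m' - m) = s - m) by (field; lra).
        split; [apply div_unit; lra | lra]. }
    exists t. split; [assumption|]. apply dist_eq.
    (* An adherent time is a degenerate gap; the quotient by 0 in [comb] is harmless, since both
       ends are [x]. *)
    assert (Os : on_curve s x).
    { exists s, s, x, x. splits; auto; try lra; [intros; lra|]. symmetry.
      apply lp_ext. intros i. unfold comb, add, scal; simpl. unfold vadd, vscal; simpl. unfold vscal. ring. }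
    pose proof (on_curve_lip _ _ _ _ (Hg t Ht) Os) as Q. rewrite Et, Rminus_diag, Rabs_R0 in Q.
    pose proof (dist_nonneg (g t) x). lra.
Qed.

End Curve.

Lemma fold_Eplus_le {I} (f : I -> Rbar) (b : I -> R) l : (forall i, In i l -> Rbar_le (f i) (Fin (b i))) ->
  Rbar_le (fold_right Eplus (Fin 0) (map f l)) (Fin (sumL b l)).
Proof.
  induction l as [|a l IH]; intros H; simpl; [lra|].
  pose proof (H a (or_introl eq_refl)) as Ha. specialize (IH (fun i Hi => H i (or_intror Hi))).
  destruct (f a), (fold_right Eplus (Fin 0) (map f l)); simpl in *; try tauto. lra.
Qed.

Lemma fold_Eplus_ge {I} (f : I -> Rbar) (b : I -> R) l : (forall i, In i l -> Rbar_le (Fin (b i)) (f i)) ->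
  Rbar_le (Fin (sumL b l)) (fold_right Eplus (Fin 0) (map f l)).
Proof.
  induction l as [|a l IH]; intros H; simpl; [lra|].
  pose proof (H a (or_introl eq_refl)) as Ha. specialize (IH (fun i Hi => H i (or_intror Hi))).
  destruct (f a), (fold_right Eplus (Fin 0) (map f l)); simpl in *; try tauto. lra.
Qed.

Lemma Esum_ge0 {I} D (f : I -> Rbar) : Rbar_le (Fin 0) (Esum D f).
Proof. apply Esup_ge0. Qed.

Lemma H1_delta_le p dl G (U : nat -> seqR -> Prop) M :
  (forall i x, U i x -> in_lp p x) -> (forall x, G x -> exists i, U i x) ->
  (forall i, Rbar_le (diam p (U i)) (Fin dl)) ->
  Rbar_le (Esum (fun _ : nat => True) (fun i => diam p (U i))) M -> Rbar_le (H1_delta p dl G) M.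
Proof.
  intros H1 H2 H3 H4. eapply Rbar_le_trans; [|exact H4]. unfold H1_delta.
  apply Einf_spec.
  - intros x [U' [_ [_ [_ ->]]]]. apply Esum_ge0.
  - exists U. auto.
Qed.

(** The images of [n] intervals of length [1 / n] have diameter at most [M / n]; the other sets of
    the sequence are empty. *)
Lemma H1_lipschitz {p} {Hp : Exponent p} (g : R -> lp p) M : 0 <= M ->
  (forall s t, 0 <= s <= 1 -> 0 <= t <= 1 -> dist (g s) (g t) <= M * Rabs (s - t)) ->
  Rbar_le (H1 p (image01 (fun t => g t))) (Fin M).
Proof.
  intros HM Hg. apply Esup_lub; [exact HM|]. intros v [dl [Hdl ->]].
  assert (exists n, (0 < n)%nat /\ M * / INR n <= dl) as [n [Hn Hn']].
  { destruct (archimed_cor1 (dl / (M + 1))) as [n [Q1 Q2]]; [apply Rdiv_lt_0_compat; lra|].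
    exists n. split; [assumption|]. assert (0 < / INR n) by (apply Rinv_0_lt_compat, lt_0_INR, Q2).
    assert ((M + 1) * / INR n <= dl); [|nra]. apply Rlt_le, (Rmult_le_compat_l (M + 1)) in Q1; try lra.
    replace ((M + 1) * (dl / (M + 1))) with dl in Q1 by (field; lra). lra. }
  assert (HnR : 0 < INR n) by (apply lt_0_INR, Hn).
  set (U := fun (i : nat) (x : seqR) => (i < n)%nat /\ exists t, 0 <= t <= 1 /\ INR i <= t * INR n <= INR i + 1 /\ x = g t).
  set (b := fun i => if lt_dec i n then M / INR n else 0).
  assert (HU : forall i, Rbar_le (diam p (U i)) (Fin (b i))).
  { intros i. assert (Hb : 0 <= b i).
    { unfold b. destruct (lt_dec i n); [|lra]. apply Rmult_le_pos; [|left; apply Rinv_0_lt_compat]; lra. }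
    apply Esup_lub; [exact Hb|]. intros v [y [z [[Hi [t [T1 [T2 ->]]]] [[_ [s [S1 [S2 ->]]]] ->]]]].
    simpl. change (lp_dist p (g t) (g s)) with (dist (g t) (g s)).
    eapply Rle_trans; [apply Hg; assumption|]. unfold b. destruct (lt_dec i n); [|contradiction].
    apply Rmult_le_compat_l; [assumption|]. apply (Rmult_le_reg_r (INR n)); [assumption|]. rewrite Rinv_l by lra.
    rewrite <- (Rabs_right (INR n)) by lra. rewrite <- Rabs_mult.
    unfold Rabs. destruct (Rcase_abs _); lra. }
  apply H1_delta_le with U.
  - intros i x [_ [t [_ [_ ->]]]]. apply crd_in.
  - intros x [t [Ht ->]].
    (* The endpoint 1 belongs to the last interval; rounding down would give the index [n]. *)
    destruct (Req_dec t 1) as [->|Ht1].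
    + exists (n - 1)%nat. split; [lia|]. exists 1. rewrite minus_INR by lia. simpl. splits; try lra. reflexivity.
    + destruct (archimed (t * INR n)) as [A1 A2].
      assert (0 <= t * INR n) by nra.
      assert (Hz : (1 <= up (t * INR n))%Z) by (apply Z.le_succ_l with (n := 0%Z); apply lt_IZR; simpl; lra).
      set (i := Z.to_nat (up (t * INR n) - 1)).
      assert (Ei : INR i = IZR (up (t * INR n)) - 1).
      { unfold i. rewrite INR_IZR_INZ, Z2Nat.id by lia. rewrite minus_IZR. reflexivity. }
      exists i. split.
      * apply INR_lt. rewrite Ei. nra.
      * exists t. splits; try lra. reflexivity.
  - intros i. eapply Rbar_le_trans; [apply HU|]. simpl. unfold b, Rdiv. destruct (lt_dec i n); lra.
  - apply Esup_lub; [exact HM|]. intros v [l [ND [_ ->]]].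
    eapply Rbar_le_trans; [apply (fold_Eplus_le _ b); intros; apply HU|]. simpl.
    apply Rle_trans with (sumL b (filter (fun i => if dec (i < n)%nat then true else false) l)).
    + rewrite sumL_filter. apply sumL_le. intros i _. unfold b. destruct (lt_dec i n) as [Q|Q].
      * rewrite ind_true by assumption. lra.
      * pose proof (ind_ge0 (i < n)%nat). lra.
    + apply Rle_trans with (sumL b (seq 0 n)).
      * apply sumL_incl; [|apply NoDup_filter, ND|].
        -- intros i _. unfold b. destruct (lt_dec i n); [|lra]. apply Rmult_le_pos; [|left; apply Rinv_0_lt_compat]; lra.
        -- intros i Hi. apply in_filter_dec in Hi. apply in_seq. lia.
      * rewrite (sumL_ext b (fun _ => M / INR n)).
        -- rewrite sumL_const, length_seq. right. field. lra.
        -- intros i Hi. apply in_seq in Hi. unfold b. destruct (lt_dec i n); [reflexivity | lia].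
Qed.

(** * Flat balls *)

Section Flat.
Context {p : R} {Hp : Exponent p}.

Lemma flat_chart (E : lp p -> Prop) y a v (tt : lp p -> R) h b : 0 < h -> b <= 1 / 400 ->
  (forall z, E z -> dist y z <= 100 * h -> dist z (add a (scal (tt z) v)) <= b * h) ->
  chart dist E y (100 * h) h (fun z => tt z * norm v).
Proof.
  intros Hh Hb H x w Ex Ew Dx Dw. pose proof (H x Ex Dx) as Hx. pose proof (H w Ew Dw) as Hw.
  set (Lx := add a (scal (tt x) v)) in *. set (Lw := add a (scal (tt w) v)) in *.
  assert (K : dist Lx Lw = Rabs (tt x * norm v - tt w * norm v)).
  { unfold dist, Lx, Lw.
    replace (sub (add a (scal (tt x) v)) (add a (scal (tt w) v))) with (scal (tt x - tt w) v) by vec.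
    rewrite norm_hom. rewrite <- Rmult_minus_distr_r, Rabs_mult, (Rabs_right (norm v)); [reflexivity|].
    apply Rle_ge, norm_nonneg. }
  rewrite <- K. pose proof (dist_triangle x Lx w). pose proof (dist_triangle Lx Lw w).
  pose proof (dist_triangle Lx x Lw). pose proof (dist_triangle x w Lw).
  rewrite (dist_sym Lx x) in *. rewrite (dist_sym Lw w) in *.
  assert (b * h <= 1 / 400 * h) by (apply Rmult_le_compat_r; lra).
  unfold Rabs. destruct (Rcase_abs _); lra.
Qed.

(** [w] is compared with the point of the chord whose weight [th] is read off from the parameters on
    the line. The distance is at most [2 b h] and both parts of the chord are at least [h / 2] long,
    whence the factor [4^s]. *)
Lemma flat_excess s : 1 < s -> @smooth_norm p Hp s -> exists C, 0 < C /\
  forall (a v x w z : lp p) tx tw tz h b, 0 < h -> 0 <= b <= 1 / 400 ->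
  dist x (add a (scal tx v)) <= b * h -> dist w (add a (scal tw v)) <= b * h ->
  dist z (add a (scal tz v)) <= b * h ->
  h <= dist x w -> h <= dist w z -> (tx < tw < tz \/ tz < tw < tx) ->
  dist x w + dist w z - dist x z <= C * rpow b s * h.
Proof.
  intros Hs HS. destruct (smooth_excess s Hs HS) as [C [HC K]].
  exists (C * rpow 4 s). split; [apply Rmult_lt_0_compat; [assumption | apply rpow_pos; lra]|].
  intros a v x w z tx tw tz h b Hh Hb Dx Dw Dz H1 H2 T.
  set (th := (tw - tx) / (tz - tx)).
  assert (Hth : 0 <= th <= 1).
  { unfold th. destruct T.
    - apply div_unit; lra.
    - replace ((tw - tx) / (tz - tx)) with ((tx - tw) / (tx - tz)) by (field; lra). apply div_unit; lra. }
  assert (Eth : th * (tz - tx) = tw - tx) by (unfold th; field; lra).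
  assert (Bh : b * h <= 1 / 400 * h) by (apply Rmult_le_compat_r; lra).
  assert (De : dist w (comb th x z) <= 2 * b * h).
  { pose proof (dist_triangle w (add a (scal tw v)) (comb th x z)).
    assert (E : add a (scal tw v) = comb th (add a (scal tx v)) (add a (scal tz v))).
    { replace tw with (tx + th * (tz - tx)) by lra. vec. }
    pose proof (dist_comb_comb th (add a (scal tx v)) (add a (scal tz v)) x z Hth) as Q. rewrite <- E in Q.
    rewrite (dist_sym _ x), (dist_sym _ z) in Q. nra. }
  set (e := sub w (comb th x z)). change (norm e <= 2 * b * h) in De.
  set (X := sub z x).
  assert (EX : norm X = dist x z) by (unfold X; rewrite dist_sym; reflexivity).
  assert (M1 : h / 2 <= th * norm X).
  { rewrite EX, <- (dist_comb_l th x z Hth). pose proof (dist_triangle x (comb th x z) w) as Q.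
    rewrite (dist_sym (comb th x z) w) in Q. change (dist w (comb th x z)) with (norm e) in Q. lra. }
  assert (M2 : h / 2 <= (1 - th) * norm X).
  { rewrite EX, <- (dist_comb_r th x z Hth). pose proof (dist_triangle w (comb th x z) z) as Q.
    change (dist w (comb th x z)) with (norm e) in Q. lra. }
  pose proof (K X e th (h / 2) ltac:(lra) M1 M2) as Q.
  replace (norm (add (scal th X) e)) with (dist x w) in Q.
  2:{ rewrite dist_sym. unfold dist. f_equal. unfold X, e. vec. }
  replace (norm (sub (scal (1 - th) X) e)) with (dist w z) in Q.
  2:{ rewrite dist_sym. unfold dist. f_equal. unfold X, e. vec. }
  rewrite EX in Q. eapply Rle_trans; [exact Q|].
  pose proof (norm_nonneg e).
  assert (R1 : rpow (norm e / (h / 2)) s <= rpow 4 s * rpow b s).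
  { rewrite <- rpow_mul by lra. apply rpow_le; [lra|].
    apply (Rmult_le_reg_r (h / 2)); [lra|]. unfold Rdiv at 1. rewrite Rmult_assoc, Rinv_l by lra. lra. }
  assert (C * rpow (norm e / (h / 2)) s <= C * (rpow 4 s * rpow b s)) by (apply Rmult_le_compat_l; lra).
  pose proof (rpow_ge0 4 s). pose proof (rpow_ge0 b s).
  assert (0 <= C * (rpow 4 s * rpow b s)) by (apply Rmult_le_pos; [lra | apply Rmult_le_pos; assumption]).
  pose proof (rpow_ge0 (norm e / (h / 2)) s). nra.
Qed.

Lemma nonzero_vector : exists v : lp p, v 0%nat <> 0.
Proof.
  assert (H : in_lp p (fun i => if Nat.eq_dec i 0 then 1 else 0)).
  { apply (in_lp_finite p _ 0). intros i Hi. destruct (Nat.eq_dec i 0); [lia | reflexivity]. }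
  exists (MkLp _ H). simpl. lra.
Qed.

Lemma ball_diam (x : lp p) rho : 0 < rho -> exists D, diam p (ball p x rho) = Fin D /\ rho <= D <= 2 * rho.
Proof.
  intros Hr. destruct nonzero_vector as [u Hu0].
  assert (Hu : 0 < norm u).
  { destruct (norm_nonneg u) as [Q|Q]; [assumption|]. exfalso. apply Hu0, norm_zero. lra. }
  set (z := add x (scal (rho / norm u) u)).
  assert (Dz : dist z x = rho).
  { unfold dist, z. replace (sub (add x (scal (rho / norm u) u)) x) with (scal (rho / norm u) u) by vec.
    rewrite norm_hom, Rabs_right; [field; lra|]. apply Rle_ge, Rmult_le_pos; [|left; apply Rinv_0_lt_compat]; lra. }
  assert (U : Rbar_le (diam p (ball p x rho)) (Fin (2 * rho))).
  { apply Esup_lub; [simpl; lra|]. intros v [y [w [[Iy Dy] [[Iw Dw] ->]]]]. simpl.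
    change (dist (MkLp y Iy) (MkLp w Iw) <= 2 * rho).
    change (dist (MkLp y Iy) x <= rho) in Dy. change (dist (MkLp w Iw) x <= rho) in Dw.
    pose proof (dist_triangle (MkLp y Iy) x (MkLp w Iw)) as Q. rewrite (dist_sym x) in Q. lra. }
  assert (L : Rbar_le (Fin rho) (diam p (ball p x rho))).
  { apply Rbar_le_trans with (Fin (lp_dist p z x)).
    - change (Rbar_le (Fin rho) (Fin (dist z x))). rewrite Dz. apply Rbar_le_refl.
    - apply Esup_ub. exists z, x. splits; [| |reflexivity].
      + split; [apply crd_in|]. change (dist z x <= rho). lra.
      + split; [apply crd_in|]. change (dist x x <= rho). rewrite dist_refl. lra. }
  destruct (diam p (ball p x rho)) as [D|]; simpl in *; [|tauto]. exists D. auto.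
Qed.

Lemma dist_line_ge0 (x a v : seqR) w : (exists t, w = Fin (lp_dist p x (vadd a (vscal t v)))) -> Rbar_le (Fin 0) w.
Proof. intros [t ->]. apply norm_ge0. Qed.

Lemma beta_ge0 (E Q : seqR -> Prop) D : diam p Q = Fin D -> 0 < D -> forall w,
  (exists a v, is_line p a v /\
      w = Ediv (Esup (fun u => exists x, E x /\ Q x /\ u = dist_line p x a v)) (diam p Q)) -> Rbar_le (Fin 0) w.
Proof.
  intros ED HD w [a [v [_ ->]]]. rewrite ED.
  pose proof (Esup_ge0 (fun u => exists x, E x /\ Q x /\ u = dist_line p x a v)) as S.
  destruct (Esup _); simpl in *; [|exact I].
  apply Rmult_le_pos; [assumption | left; apply Rinv_0_lt_compat; assumption].
Qed.

(** Half of the slack [e] is spent on an almost optimal line, the other half on almost nearest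
    points of it. *)
Lemma beta_line (E : seqR -> Prop) (x : lp p) rho b e : E x -> 0 < rho -> beta p E (ball p x rho) = Fin b -> 0 < e ->
  exists (a v : lp p) (tt : lp p -> R), forall z : lp p, E z -> dist z x <= rho ->
    dist z (add a (scal (tt z) v)) <= 2 * rho * (b + e).
Proof.
  intros Ex Hr Hb He. destruct (ball_diam x rho Hr) as [D [ED HD]].
  unfold beta in Hb. destruct (excluded_middle_informative _) as [_|N].
  2:{ exfalso. apply N. exists x. split; [assumption|]. split; [apply crd_in|].
      change (dist x x <= rho). rewrite dist_refl. lra. }
  pose proof (beta_ge0 E (ball p x rho) D ED ltac:(lra)) as P0.
  destruct (Einf_approx _ b (e / 2) P0 ltac:(rewrite Hb; apply Rbar_le_refl) ltac:(lra)) as [w [[a [v [[La [Lv _]] Ew]]] Hw]].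
  rewrite ED in Ew.
  destruct (Esup (fun u => exists x0, E x0 /\ ball p x rho x0 /\ u = dist_line p x0 a v)) as [S|] eqn:ES; [|discriminate Ew].
  simpl in Ew. injection Ew as Ew.
  assert (HS : S <= (b + e / 2) * D).
  { apply (Rmult_le_reg_r (/ D)); [apply Rinv_0_lt_compat; lra|]. rewrite Rmult_assoc, Rinv_r by lra.
    unfold Rdiv in Ew. lra. }
  exists (MkLp a La), (MkLp v Lv).
  destruct (choice (fun (z : lp p) t => E z -> dist z x <= rho ->
     dist z (add (MkLp a La) (scal t (MkLp v Lv))) <= 2 * rho * (b + e))) as [tt Htt]; [|exists tt; exact Htt].
  intros z. destruct (dec (E z /\ dist z x <= rho)) as [[Ez Dz]|N]; [|exists 0; tauto].
  assert (K : Rbar_le (dist_line p z a v) (Fin S)).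
  { rewrite <- ES. apply Esup_ub. exists z. splits; auto. split; [apply crd_in | exact Dz]. }
  destruct (Einf_approx _ S (e / 2 * D) (dist_line_ge0 z a v) K ltac:(nra)) as [q [[t Eq] Hq]].
  injection Eq as Eq. exists t. intros _ _. change (lp_dist p z (vadd a (vscal t v)) <= 2 * rho * (b + e)).
  rewrite <- Eq.
  assert (b + e >= 0).
  { assert (0 <= S) by (pose proof (Esup_ge0 (fun u => exists x0, E x0 /\ ball p x rho x0 /\ u = dist_line p x0 a v)) as Q;
      rewrite ES in Q; exact Q). nra. }
  nra.
Qed.

End Flat.

(** * Finite sets *)

Definition finite {T} (P : T -> Prop) : Prop := exists l : list T, forall x, P x -> In x l.

Lemma finite_of_bound {T} (P : T -> Prop) M :
  (forall l, NoDup l -> (forall x, In x l -> P x) -> (length l <= M)%nat) -> finite P.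
Proof.
  intros H. apply NNPP. intros N.
  assert (K : forall n, exists l, NoDup l /\ (forall x, In x l -> P x) /\ length l = n).
  { induction n as [|n [l [H1 [H2 H3]]]].
    - exists nil. splits; [constructor | intros x [] | reflexivity].
    - destruct (classic (exists x, P x /\ ~ In x l)) as [[x [Px Hx]]|Q].
      + exists (x :: l). splits; [constructor; assumption | intros y [<-|Hy]; auto | simpl; congruence].
      + exfalso. apply N. exists l. intros x Px. apply NNPP. intros Hx. apply Q. exists x. auto. }
  destruct (K (S M)) as [l [H1 [H2 H3]]]. specialize (H l H1 H2). lia.
Qed.

Lemma finite_union {S T} (Q : S -> T -> Prop) l : (forall x, In x l -> finite (Q x)) ->
  finite (fun y => exists x, In x l /\ Q x y).
Proof.
  induction l as [|a l IH]; intros H.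
  - exists nil. intros y [x [[] _]].
  - destruct (H a (or_introl eq_refl)) as [l1 H1]. destruct IH as [l2 H2]; [intros; apply H; right; assumption|].
    exists (l1 ++ l2). intros y [x [[<-|Hx] Hy]]; apply in_app_iff; [left; auto | right; apply H2; exists x; auto].
Qed.

Lemma finite_nodup {T} (P : T -> Prop) : finite P -> exists l, NoDup l /\ forall x, In x l <-> P x.
Proof.
  intros [l H]. exists (nodup (fun x y => dec (x = y)) (filter (fun x => if dec (P x) then true else false) l)).
  split; [apply NoDup_nodup|]. intros x. rewrite nodup_In, in_filter_dec. split; [tauto|]. auto.
Qed.

Lemma finite_incl {T} (P Q : T -> Prop) : (forall x, P x -> Q x) -> finite Q -> finite P.
Proof. intros H [l Hl]. exists l. auto. Qed.

Lemma finite_or {T} (P Q : T -> Prop) : finite P -> finite Q -> finite (fun x => P x \/ Q x).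
Proof.
  intros [l H] [l' H']. exists (l ++ l'). intros x [Hx|Hx]; apply in_app_iff; auto.
Qed.

Lemma NoDup_map_in {S T} (f : S -> T) l : (forall x y, In x l -> In y l -> f x = f y -> x = y) ->
  NoDup l -> NoDup (map f l).
Proof.
  intros H ND. induction ND as [|a l Ha ND IH]; simpl; [constructor|]. constructor.
  - rewrite in_map_iff. intros [y [Ey Hy]]. apply Ha. rewrite <- (H y a); simpl; auto.
  - apply IH. intros; apply H; simpl; auto.
Qed.

Lemma separated_reals_bound {T} (f : T -> R) (l : list T) K : NoDup l ->
  (forall x y, In x l -> In y l -> x <> y -> 1 <= Rabs (f x - f y)) ->
  (forall x, In x l -> Rabs (f x) <= INR K) -> (length l <= 2 * K + 2)%nat.
Proof.
  intros ND Hs Hb.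
  set (g := fun x => up (f x)).
  assert (NDm : NoDup (map g l)).
  { apply NoDup_map_in; [|assumption]. intros x y Hx Hy E. apply NNPP. intros N. specialize (Hs x y Hx Hy N).
    destruct (archimed (f x)) as [A1 A2], (archimed (f y)) as [B1 B2]. unfold g in E. rewrite E in A1, A2.
    unfold Rabs in Hs. destruct (Rcase_abs _); lra. }
  assert (Inc : incl (map g l) (map (fun n => (Z.of_nat n - Z.of_nat K)%Z) (seq 0 (2 * K + 2)))).
  { intros z Hz. apply in_map_iff in Hz. destruct Hz as [x [<- Hx]]. specialize (Hb x Hx).
    destruct (archimed (f x)) as [A1 A2].
    assert (- INR K <= f x <= INR K) by (unfold Rabs in Hb; destruct (Rcase_abs _); lra).
    rewrite INR_IZR_INZ in *.
    assert ((- Z.of_nat K < up (f x))%Z) by (apply lt_IZR; rewrite opp_IZR; lra).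
    assert ((up (f x) <= Z.of_nat K + 1)%Z) by (apply le_IZR; rewrite plus_IZR; lra).
    apply in_map_iff. exists (Z.to_nat (up (f x) + Z.of_nat K)). split; [unfold g; lia|]. apply in_seq. lia. }
  pose proof (NoDup_incl_length NDm Inc) as L. rewrite !length_map, length_seq in L. exact L.
Qed.

Lemma chart_finite {V} (d : V -> V -> R) E c h t (P : V -> Prop) : 0 < h -> E c -> d c c = 0 ->
  chart d E c (100 * h) h t -> (forall x, P x -> E x /\ d c x <= 100 * h) ->
  (forall x y, P x -> P y -> x <> y -> h <= d x y) -> finite P.
Proof.
  intros Hh Ec Dc Ht HP Sp. apply finite_of_bound with (2 * 202 + 2)%nat. intros l ND Hl.
  apply (separated_reals_bound (fun x => (t x - t c) * (2 / h))); [assumption| |].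
  - intros x y Hx Hy N. pose proof (HP x (Hl x Hx)) as [Q1 Q2]. pose proof (HP y (Hl y Hy)) as [Q3 Q4].
    pose proof (Ht x y Q1 Q3 Q2 Q4) as K. pose proof (Sp x y (Hl x Hx) (Hl y Hy) N).
    replace ((t x - t c) * (2 / h) - (t y - t c) * (2 / h)) with ((t x - t y) * (2 / h)) by ring.
    rewrite Rabs_mult, (Rabs_right (2 / h)) by (left; apply Rdiv_lt_0_compat; lra).
    assert (h / 2 <= Rabs (t x - t y)) by (unfold Rabs at 1 in K; destruct (Rcase_abs _); lra).
    apply (Rmult_le_reg_r (h / 2)); [lra|]. replace (Rabs (t x - t y) * (2 / h) * (h / 2)) with (Rabs (t x - t y)) by (field; lra). lra.
  - intros x Hx. pose proof (HP x (Hl x Hx)) as [Q1 Q2]. pose proof (Ht x c Q1 Ec Q2 ltac:(lra)) as K.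
    pose proof (Ht c x Ec Q1 ltac:(lra) Q2) as K'. rewrite (Rabs_minus_sym (t c)) in K'.
    rewrite Rabs_mult, (Rabs_right (2 / h)) by (left; apply Rdiv_lt_0_compat; lra).
    assert (Rabs (t x - t c) <= 101 * h) by (unfold Rabs at 1 in K'; destruct (Rcase_abs _); lra).
    replace (INR 202) with 202 by (simpl; lra).
    apply (Rmult_le_reg_r (h / 2)); [lra|]. replace (Rabs (t x - t c) * (2 / h) * (h / 2)) with (Rabs (t x - t c)) by (field; lra). lra.
Qed.

(** * Dyadic scales *)

Notation pw k := (powerRZ 2 (- k)).

Lemma pw_pos k : 0 < pw k.
Proof. apply powerRZ_lt. lra. Qed.

Lemma pw_succ k : pw k = 2 * pw (k + 1).
Proof. replace (- k)%Z with (1 + - (k + 1))%Z by lia. rewrite powerRZ_add by lra. simpl. ring. Qed.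

Lemma pw_add k j : pw (k + Z.of_nat j) = pw k * (1 / 2) ^ j.
Proof.
  induction j.
  - simpl. rewrite Z.add_0_r. ring.
  - replace (k + Z.of_nat (S j))%Z with ((k + Z.of_nat j) + 1)%Z by lia.
    pose proof (pw_succ (k + Z.of_nat j)) as Q. rewrite IHj in Q. simpl. lra.
Qed.

Lemma half_pow_lt D : 0 < D -> exists n, (1 / 2) ^ n < D.
Proof.
  intros HD. destruct (pow_lt_1_zero (1 / 2) ltac:(rewrite Rabs_right; lra) D HD) as [n Hn].
  exists n. specialize (Hn n (le_n _)). rewrite Rabs_right in Hn; [assumption|]. apply Rle_ge, pow_le. lra.
Qed.

Lemma dyadic_scale D : 0 < D -> exists k, D < pw k <= 2 * D.
Proof.
  intros HD.
  destruct (half_pow_lt D HD) as [n Hn]. destruct (half_pow_lt (/ D)) as [m Hm]; [apply Rinv_0_lt_compat, HD|].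
  assert (P0 : D < pw (- Z.of_nat m)).
  { pose proof (pw_add (- Z.of_nat m) m) as Q. replace (- Z.of_nat m + Z.of_nat m)%Z with 0%Z in Q by lia. simpl in Q.
    pose proof (pw_pos (- Z.of_nat m)) as P.
    assert (0 < (1 / 2) ^ m) by (apply pow_lt; lra).
    assert (D * (1 / 2) ^ m < 1).
    { apply (Rmult_lt_compat_l D) in Hm; [|assumption]. rewrite Rinv_r in Hm by lra. exact Hm. }
    apply (Rmult_lt_reg_r ((1 / 2) ^ m)); [assumption|]. simpl in *. lra. }
  assert (K : forall j, ~ D < pw (- Z.of_nat m + Z.of_nat j) -> exists i, D < pw (- Z.of_nat m + Z.of_nat i) /\ ~ D < pw (- Z.of_nat m + Z.of_nat (S i))).
  { induction j; intros Hj.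
    - exfalso. apply Hj. rewrite Z.add_0_r. assumption.
    - destruct (classic (D < pw (- Z.of_nat m + Z.of_nat j))) as [Q|Q]; [exists j; auto | auto]. }
  destruct (K (m + n)%nat) as [i [I1 I2]].
  { replace (- Z.of_nat m + Z.of_nat (m + n))%Z with (0 + Z.of_nat n)%Z by lia. rewrite pw_add. simpl. lra. }
  exists (- Z.of_nat m + Z.of_nat i)%Z. split; [assumption|].
  pose proof (pw_succ (- Z.of_nat m + Z.of_nat i)) as Q.
  replace (- Z.of_nat m + Z.of_nat i + 1)%Z with (- Z.of_nat m + Z.of_nat (S i))%Z in Q by lia. lra.
Qed.

Lemma half_pow_sum n : sumL (fun j => (1 / 2) ^ j) (seq 1 n) <= 1.
Proof.
  assert (K : sumL (fun j => (1 / 2) ^ j) (seq 1 n) = 1 - (1 / 2) ^ n).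
  { induction n; [simpl; ring|]. rewrite seq_S, sumL_app, IHn. simpl. lra. }
  rewrite K. assert (0 <= (1 / 2) ^ n) by (apply pow_le; lra). lra.
Qed.

Lemma NoDup_concat_map {S T} (f : S -> list T) (l : list S) : NoDup l -> (forall x, In x l -> NoDup (f x)) ->
  (forall x y z, In x l -> In y l -> In z (f x) -> In z (f y) -> x = y) -> NoDup (concat (map f l)).
Proof.
  intros ND. induction ND as [|a l Ha ND IH]; intros H1 H2; simpl; [constructor|].
  apply NoDup_app.
  - apply H1; simpl; auto.
  - apply IH; [intros; apply H1; simpl; auto|]. intros x y z Hx Hy. apply H2; simpl; auto.
  - intros z Hz Hz'. apply in_concat in Hz'. destruct Hz' as [q [Hq Hzq]]. apply in_map_iff in Hq.
    destruct Hq as [y [<- Hy]]. apply Ha. rewrite (H2 a y z); simpl; auto.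
Qed.

(** * The sufficient condition: from a finite sum to a Lipschitz curve *)

Section Sufficiency.
Context {p : R} {Hp : Exponent p}.
Variables (s A : R).
Hypothesis Hs : 1 < s.
Hypothesis Hsm : @smooth_norm p Hp s.
Hypothesis HA : 240 <= A.

Section Set_E.
Variables (E : seqR -> Prop) (X : Z -> seqR -> Prop) (s0 D0 : R).
Hypothesis E_lp : forall x, E x -> in_lp p x.
Hypothesis HX : is_multires p E A X.
Hypothesis HS : S_beta p E s A X = Fin s0.
Hypothesis HD : diam p E = Fin D0.

Definition betaR (k : Z) (x : seqR) : R :=
  match beta p E (ball p x (A * pw k)) with Fin b => b | PInf => 0 end.

Lemma net_in_E k x : X k x -> E x.
Proof. intros H. apply (proj2 (proj2 HX) k). exact H. Qed.

Lemma rad_pos k : 0 < A * pw k.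
Proof. pose proof (pw_pos k). nra. Qed.

Lemma diam_dist (x y : lp p) : E x -> E y -> dist x y <= D0.
Proof.
  intros Hx Hy. assert (K : Rbar_le (Fin (dist x y)) (diam p E)) by (apply Esup_ub; exists x, y; auto).
  rewrite HD in K. exact K.
Qed.

Lemma D0_ge0 : 0 <= D0.
Proof. pose proof (Esup_ge0 (fun v => exists y z, E y /\ E z /\ v = Fin (lp_dist p y z))) as K.
  change (Rbar_le (Fin 0) (diam p E)) in K. rewrite HD in K. exact K. Qed.

Lemma S_split : exists sg, Esum (fun kx : Z * seqR => X (fst kx) (snd kx))
      (fun kx : Z * seqR => Emult (Epow (beta p E (ball p (snd kx) (A * powerRZ 2 (- fst kx)))) s)
         (diam p (ball p (snd kx) (A * powerRZ 2 (- fst kx))))) = Fin sg /\ 0 <= sg /\ s0 = D0 + sg.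
Proof.
  unfold S_beta in HS. rewrite HD in HS. cbv zeta in HS.
  destruct (Esum _ _) as [sg|] eqn:Es; [|discriminate HS]. exists sg. split; [reflexivity|].
  simpl in HS. injection HS as HS'. split; [|lra].
  pose proof (Esum_ge0 (fun kx : Z * seqR => X (fst kx) (snd kx))
      (fun kx : Z * seqR => Emult (Epow (beta p E (ball p (snd kx) (A * powerRZ 2 (- fst kx)))) s)
         (diam p (ball p (snd kx) (A * powerRZ 2 (- fst kx)))))) as K. rewrite Es in K. exact K.
Qed.

Lemma term_lower k x : X k x -> Rbar_le (Fin (rpow (betaR k x) s * (A * pw k)))
  (Emult (Epow (beta p E (ball p x (A * pw k))) s) (diam p (ball p x (A * pw k)))).
Proof.
  intros Hx. pose proof (E_lp x (net_in_E k x Hx)) as Lx.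
  destruct (ball_diam (MkLp x Lx) (A * pw k) (rad_pos k)) as [D [ED HD']]. simpl in ED. rewrite ED.
  pose proof (rad_pos k). unfold betaR. destruct (beta p E (ball p x (A * pw k))) as [b|]; simpl.
  - apply Rmult_le_compat_l; [apply rpow_ge0 | lra].
  - destruct (Req_EM_T D 0); [lra | exact I].
Qed.

Lemma items_sum l : NoDup l -> (forall kx, In kx l -> X (fst kx) (snd kx)) ->
  sumL (fun kx => rpow (betaR (fst kx) (snd kx)) s * (A * pw (fst kx))) l <= s0.
Proof.
  intros ND Hl. destruct S_split as [sg [Es [Hsg E0]]].
  assert (K : Rbar_le (Fin (sumL (fun kx => rpow (betaR (fst kx) (snd kx)) s * (A * pw (fst kx))) l)) (Fin sg)).
  { rewrite <- Es. eapply Rbar_le_trans; [|apply Esup_ub; exists l; splits; [exact ND | apply Forall_forall, Hl | reflexivity]].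
    apply fold_Eplus_ge. intros [k x] Hkx. apply (term_lower k x), (Hl _ Hkx). }
  pose proof D0_ge0. simpl in K. lra.
Qed.

Lemma beta_fin k x : X k x -> exists b, beta p E (ball p x (A * pw k)) = Fin b /\ 0 <= b.
Proof.
  intros Hx. pose proof (E_lp x (net_in_E k x Hx)) as Lx. pose proof (rad_pos k) as Hr.
  destruct (ball_diam (MkLp x Lx) (A * pw k) Hr) as [D [ED HD']]. simpl in ED.
  destruct (beta p E (ball p x (A * pw k))) as [b|] eqn:Eb.
  - exists b. split; [reflexivity|]. unfold beta in Eb.
    destruct (excluded_middle_informative _) as [_|N].
    + pose proof (proj1 (Einf_spec _ (beta_ge0 E (ball p x (A * pw k)) D ED ltac:(lra)))) as K.
      rewrite Eb in K. exact K.
    + injection Eb as Eb. lra.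
  - exfalso. destruct S_split as [sg [Es _]].
    assert (K : Rbar_le PInf (Fin sg)); [|exact K].
    rewrite <- Es. eapply Rbar_le_trans; [|apply Esup_ub; exists ((k, x) :: nil); splits; [| |reflexivity]].
    + cbn [map fold_right fst snd]. rewrite Eb, ED. simpl. destruct (Req_EM_T D 0); [lra | exact I].
    + constructor; [intros [] | constructor].
    + constructor; [exact Hx | constructor].
Qed.

Lemma betaR_ge0 k x : X k x -> 0 <= betaR k x.
Proof. intros Hx. destruct (beta_fin k x Hx) as [b [Eb Hb]]. unfold betaR. rewrite Eb. assumption. Qed.

Lemma net_line k (x : lp p) e : X k x -> 0 < e -> exists (a v : lp p) (tt : lp p -> R), forall z : lp p, E z ->
  dist x z <= 100 * pw k -> dist z (add a (scal (tt z) v)) <= 2 * A * (betaR k x + e) * pw k.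
Proof.
  intros Hx He. destruct (beta_fin k x Hx) as [b [Eb Hb]].
  destruct (beta_line E x (A * pw k) b e (net_in_E k x Hx) (rad_pos k) Eb He) as [a [v [tt H]]].
  exists a, v, tt. intros z Ez Dz. unfold betaR. rewrite Eb. pose proof (pw_pos k).
  eapply Rle_trans; [apply H; auto|]; [|lra]. rewrite dist_sym. nra.
Qed.

Lemma net_sep k (x y : lp p) : X k x -> X k y -> x <> y -> pw k <= dist x y.
Proof.
  intros Hx Hy N. apply (proj1 (proj2 (proj2 (proj2 HX) k))); auto. intros Q. apply N, lp_ext. congruence.
Qed.

Lemma net_dense k (x : lp p) : E x -> exists y : lp p, X k y /\ dist x y < pw k.
Proof.
  intros Hx. destruct (proj2 (proj2 (proj2 (proj2 HX) k)) x Hx) as [y [Hy D]].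
  exists (MkLp y (E_lp y (net_in_E k y Hy))). auto.
Qed.

Lemma net_nested k x : X k x -> X (k + 1)%Z x.
Proof. apply (proj1 (proj2 HX)). Qed.

(** Induction on the level. Points with [betaR > c] are finitely many, because each contributes a
    fixed amount to a finite sum. A point with [betaR <= c] is close to one of the finitely many
    points of the previous level, and a flat ball contains only finitely many separated points. *)
Lemma net_finite k0 : finite (fun x : lp p => X k0 x) -> forall j, finite (fun x : lp p => X (k0 + Z.of_nat j) x).
Proof.
  intros H0 j. induction j; [rewrite Z.add_0_r; assumption|].
  set (k := (k0 + Z.of_nat j)%Z) in *. replace (k0 + Z.of_nat (S j))%Z with (k + 1)%Z by lia.
  (* Together with the slack [1 / (2000 A)], this brings the set within [9 / 4000] of the scale from
     a line, which is below the [1 / 400] needed for a chart. *)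
  set (c := / (1600 * A)). assert (Hc : 0 < c) by (apply Rinv_0_lt_compat; lra).
  pose proof (pw_pos (k + 1)) as Hh. pose proof (pw_succ k) as H2.
  apply finite_incl with (fun x : lp p => (X (k + 1)%Z x /\ c < betaR (k + 1) x) \/
     (X (k + 1)%Z x /\ betaR (k + 1) x <= c)).
  { intros x Hx. destruct (Rle_dec (betaR (k + 1) x) c); [right | left]; split; auto. lra. }
  apply finite_or.
  - set (g := rpow c s * (A * pw (k + 1))).
    assert (Hg : 0 < g) by (apply Rmult_lt_0_compat; [apply rpow_pos, Hc | apply rad_pos]).
    destruct (archimed (s0 / g)) as [Ha _].
    apply finite_of_bound with (Z.to_nat (up (s0 / g))). intros l ND Hl.
    assert (K : sumL (fun kx => rpow (betaR (fst kx) (snd kx)) s * (A * pw (fst kx))) (map (fun x : lp p => ((k + 1)%Z, crd x)) l) <= s0).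
    { apply items_sum.
      - apply NoDup_map_in; [|assumption]. intros x y _ _ Q. injection Q as Q. apply lp_ext. congruence.
      - intros kx Hkx. apply in_map_iff in Hkx. destruct Hkx as [x [<- Hx]]. apply (Hl x Hx). }
    rewrite sumL_map in K. simpl in K.
    assert (K2 : g * INR (length l) <= s0).
    { rewrite <- sumL_const. eapply Rle_trans; [|exact K]. apply sumL_le. intros x Hx. unfold g.
      apply Rmult_le_compat_r; [left; apply rad_pos|]. apply rpow_le; [lra|]. destruct (Hl x Hx). lra. }
    apply INR_le. rewrite INR_IZR_INZ, INR_IZR_INZ.
    assert (K3 : INR (length l) <= s0 / g).
    { apply (Rmult_le_reg_l g); [assumption|]. replace (g * (s0 / g)) with s0 by (field; lra). assumption. }
    rewrite INR_IZR_INZ in K3.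
    destruct (Z_le_gt_dec 0 (up (s0 / g))) as [Q|Q].
    + rewrite Z2Nat.id by assumption. lra.
    + exfalso. assert (IZR (up (s0 / g)) <= 0) by (apply IZR_le; lia).
      assert (0 <= IZR (Z.of_nat (length l))) by (apply IZR_le; lia). lra.
  - destruct IHj as [L HL].
    apply finite_incl with (fun y : lp p => exists x : lp p, In x L /\ ((X (k + 1)%Z y /\ betaR (k + 1) y <= c) /\ dist y x < pw k)).
    { intros y [Hy By]. destruct (net_dense k y (net_in_E _ _ Hy)) as [x [Hx Dx]]. exists x. auto. }
    apply (finite_union (fun x y => (X (k + 1)%Z (crd y) /\ betaR (k + 1) y <= c) /\ dist y x < pw k)).
    intros x Hx.
    destruct (classic (exists y : lp p, (X (k + 1)%Z y /\ betaR (k + 1) y <= c) /\ dist y x < pw k)) as [[y [[Hy By] Dy]]|N].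
    2:{ exists nil. intros y Hy. exfalso. apply N. exists y. exact Hy. }
    destruct (net_line (k + 1) y (/ (2000 * A)) Hy) as [a [v [tt Ht]]]; [apply Rinv_0_lt_compat; lra|].
    assert (Bd : 2 * A * (betaR (k + 1) y + / (2000 * A)) <= 1 / 400).
    { apply Rle_trans with (2 * A * (c + / (2000 * A))); [apply Rmult_le_compat_l; lra|].
      unfold c. replace (2 * A * (/ (1600 * A) + / (2000 * A))) with (9 / 4000) by (field; lra). lra. }
    apply (chart_finite dist (fun z => E (crd z)) y (pw (k + 1)) (fun z => tt z * norm v)); auto.
    + apply (net_in_E _ _ Hy).
    + apply dist_refl.
    + apply (flat_chart _ y a v tt (pw (k + 1)) _ Hh Bd). exact Ht.
    + intros z [[Hz _] Dz]. split; [apply (net_in_E _ _ Hz)|].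
      pose proof (dist_triangle y x z). rewrite (dist_sym x z) in *. lra.
    + intros z w [[Hz _] _] [[Hw _] _]. apply net_sep; assumption.
Qed.

End Set_E.

Lemma sufficiency : exists C, 0 < C /\
  forall (E : seqR -> Prop) (X : Z -> seqR -> Prop),
      (exists x, E x) -> (forall x, E x -> in_lp p x) ->
      is_multires p E A X -> S_beta p E s A X <> PInf ->
      exists g, is_curve_param p g /\ (forall x, E x -> image01 g x) /\
        Rbar_le (H1 p (image01 g)) (Emult (Fin C) (S_beta p E s A X)).
Proof.
  destruct (flat_excess s Hs Hsm) as [C0 [HC0 Kex]].
  set (C2 := 26 * C0 + 1298 * rpow 400 s).
  assert (HC2 : 0 < C2) by (unfold C2; pose proof (rpow_ge0 400 s); lra).
  set (C3 := C2 * (rpow (2 * A) s * rpow 2 s)).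
  assert (HC3 : 0 < C3) by (unfold C3; apply Rmult_lt_0_compat; [lra|]; apply Rmult_lt_0_compat; apply rpow_pos; lra).
  (* The tours have length at most [2 (156 h 0 + C3 (s0 + D0))], where [h 0 <= 2 D0] and
     [D0 <= s0]. *)
  exists (2 * (312 + 2 * C3)). split; [lra|].
  intros E X [x1 Ex1] E_lp HX HS.
  destruct (S_beta p E s A X) as [s0|] eqn:ES; [|congruence]. clear HS.
  assert (exists D0, diam p E = Fin D0) as [D0 HD].
  { unfold S_beta in ES. destruct (diam p E) as [D0|]; [exists D0; reflexivity | discriminate ES]. }
  pose proof (D0_ge0 E D0 HD) as HD0.
  destruct (S_split E X s0 D0 ES HD) as [sg [_ [Hsg Es0]]].
  set (y1 := MkLp x1 (E_lp x1 Ex1)).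
  assert (Main : exists g : R -> lp p, exists M, 0 <= M <= 2 * (312 + 2 * C3) * s0 /\
    (forall a b, 0 <= a <= 1 -> 0 <= b <= 1 -> dist (g a) (g b) <= M * Rabs (a - b)) /\
    (forall x : lp p, E x -> exists t, 0 <= t <= 1 /\ g t = x)).
  2:{ destruct Main as [g [M [HM [Hg1 Hg2]]]]. exists (fun t => crd (g t)). splits.
      - split; [intros; apply crd_in|]. intros t Ht eps He. exists (eps / (M + 1)).
        split; [apply Rdiv_lt_0_compat; lra|]. intros q Hq Hqt.
        change (dist (g q) (g t) < eps). eapply Rle_lt_trans; [apply Hg1; assumption|].
        pose proof (Rabs_pos (q - t)).
        apply Rle_lt_trans with ((M + 1) * Rabs (q - t)); [nra|].
        apply (Rmult_lt_compat_l (M + 1)) in Hqt; [|lra].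
        replace ((M + 1) * (eps / (M + 1))) with eps in Hqt by (field; lra). assumption.
      - intros x Ex. destruct (Hg2 (MkLp x (E_lp x Ex)) Ex) as [t [Ht Et]]. exists t. split; [assumption|].
        rewrite Et. reflexivity.
      - eapply Rbar_le_trans; [apply (H1_lipschitz g M); [lra | assumption]|]. simpl. lra. }
  (* A single point has no scale comparable to its diameter; a constant curve serves. *)
  destruct (Req_dec D0 0) as [Ez|Ez].
  { exists (fun _ => y1), 0. splits.
    - lra.
    - apply Rmult_le_pos; lra.
    - intros. rewrite dist_refl. lra.
    - intros x Ex. exists 0. split; [lra|]. apply dist_eq.
      pose proof (diam_dist E D0 HD y1 x Ex1 Ex). pose proof (dist_nonneg y1 x). lra. }
  assert (HD0' : 0 < D0) by lra.
  (* As [2^-k0] exceeds the diameter, the net of level [k0] is a single point, the root of all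
     tours. *)
  destruct (dyadic_scale D0 HD0') as [k0 Hk0].
  destruct (net_dense E X E_lp HX k0 y1 Ex1) as [x0 [Hx0 _]].
  assert (Net0 : forall x : lp p, X k0 x -> x = x0).
  { intros x Hx. apply NNPP. intros N. pose proof (net_sep E X HX k0 x x0 Hx Hx0 N) as Q.
    pose proof (diam_dist E D0 HD x x0 (net_in_E E X HX _ _ Hx) (net_in_E E X HX _ _ Hx0)). lra. }
  set (kk := fun j => (k0 + Z.of_nat j)%Z).
  assert (Fin0 : finite (fun x : lp p => X k0 x)).
  { exists (x0 :: nil). intros x Hx. left. symmetry. apply Net0, Hx. }
  destruct (choice (fun j (l : list (lp p)) => NoDup l /\ forall x, In x l <-> X (kk j) x)) as [L HL].
  { intros j. apply finite_nodup. apply (net_finite E X s0 D0 E_lp HX ES HD k0 Fin0 j). }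
  (* Each list consists of the new points followed by the previous list, the form in which the
     potential is updated. *)
  set (Xs := fix Xs j := match j with O => x0 :: nil
     | S j => filter (fun y => if dec (~ In y (Xs j)) then true else false) (L (S j)) ++ Xs j end).
  assert (kkS : forall j, kk (S j) = (kk j + 1)%Z) by (intros; unfold kk; lia).
  assert (InXs : forall j x, In x (Xs j) <-> X (kk j) x).
  { induction j; intros x.
    - unfold kk. rewrite Z.add_0_r. simpl. split; [intros [<-|[]]; assumption|]. intros Hx. left. symmetry. apply Net0, Hx.
    - simpl. rewrite in_app_iff, in_filter_dec, (proj2 (HL (S j))), IHj. rewrite kkS.
      split; [intros [[Q _]|Q]; [assumption | apply (net_nested E X HX), Q]|].
      intros Q. destruct (classic (X (kk j) x)); [right; assumption | left; auto]. }
  assert (NDXs : forall j, NoDup (Xs j)).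
  { induction j; [simpl; constructor; [intros [] | constructor]|]. simpl. apply NoDup_app; [apply NoDup_filter, HL | assumption|].
    intros x Hx Hx'. apply in_filter_dec in Hx. tauto. }
  set (h := fun j => pw (kk j)).
  assert (h_pos : forall j, 0 < h j) by (intros; apply pw_pos).
  assert (h_half : forall j, h j = 2 * h (S j)) by (intros j; unfold h; rewrite kkS; apply pw_succ).
  (* The slack of level [j]: its [s]-th power times [h j], summed over the points of the level, is
     at most [D0 / 2^j]. *)
  set (e := fun j => rpow (D0 * (1 / 2) ^ j / (h j * (INR (length (Xs j)) + 1))) (/ s)).
  assert (He0 : forall j, 0 < D0 * (1 / 2) ^ j / (h j * (INR (length (Xs j)) + 1))).
  { intros j. pose proof (pos_INR (length (Xs j))). apply Rdiv_lt_0_compat.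
    - apply Rmult_lt_0_compat; [assumption|]. apply pow_lt; lra.
    - apply Rmult_lt_0_compat; [apply h_pos | lra]. }
  assert (He : forall j, 0 < e j) by (intros; apply rpow_pos, He0).
  set (bb := fun j (x : lp p) => 2 * A * (betaR E (kk j) x + e j)).
  assert (Hbb : forall j x, In x (Xs j) -> 0 <= bb j x).
  { intros j x Hx. apply InXs in Hx. pose proof (betaR_ge0 E X s0 D0 E_lp HX ES HD (kk j) x Hx). pose proof (He j).
    unfold bb. apply Rmult_le_pos; lra. }
  set (good := fun j x => bb j x <= 1 / 400).
  set (err := fun j x => C0 * rpow (bb j x) s * h j).
  assert (Line : forall j x, In x (Xs j) -> exists (a v : lp p) (tt : lp p -> R), forall z : lp p, E z ->
     dist x z <= 100 * h j -> dist z (add a (scal (tt z) v)) <= bb j x * h j).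
  { intros j x Hx. apply InXs in Hx. apply (net_line E X s0 D0 E_lp HX ES HD); [assumption | apply He]. }
  assert (XsE : forall j x, In x (Xs j) -> E x) by (intros j x Hx; apply InXs in Hx; apply (net_in_E E X HX _ _ Hx)).
  assert (XsSep : forall j, sepd dist (h j) (Xs j)).
  { intros j a b Ha Hb. apply InXs in Ha, Hb. apply (net_sep E X HX); assumption. }
  destruct (choice (fun (jy : nat * lp p) z => In (snd jy) (Xs (S (fst jy))) -> In z (Xs (fst jy)) /\ dist (snd jy) z < h (fst jy))) as [par Hpar].
  { intros [j y]. simpl. destruct (classic (In y (Xs (S j)))) as [Hy|Hy]; [|exists y; tauto].
    destruct (net_dense E X E_lp HX (kk j) y (XsE _ _ Hy)) as [z [Hz Dz]]. exists z. intros _. split; [apply InXs, Hz | exact Dz]. }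
  assert (Tour := net_tour dist dist_nonneg dist_sym dist_refl dist_triangle (fun z : lp p => E z) Xs
    (fun j => filter (fun y => if dec (~ In y (Xs j)) then true else false) (L (S j))) h x0 (fun j y => par (j, y)) good err
    h_pos h_half eq_refl (fun j => eq_refl) NDXs XsSep XsE (fun j y => Hpar (j, y))).
  assert (Tour' : forall k, exists w, (forall z, In z (x0 :: w) <-> In z (Xs k)) /\
    walk_len dist x0 w <= 2 * (156 * h 0%nat + sumL (fun j => sumL (cost2 h good err j) (Xs j)) (seq 1 k))).
  { apply Tour.
    - intros j y. unfold err. pose proof (h_pos j). pose proof (rpow_ge0 (bb j y) s).
      apply Rmult_le_pos; [apply Rmult_le_pos|]; lra.
    - intros j y Hy G. destruct (Line (S j) y Hy) as [a [v [tt Ht]]].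
      exists (fun z => tt z * norm v). apply (flat_chart _ y a v tt (h (S j)) (bb (S j) y) (h_pos _) G). exact Ht.
    - intros j y Hy G x w z Hx Hw Hz Dx Dw Dz B. destruct (Line (S j) y Hy) as [a [v [tt Ht]]].
      pose proof (h_pos (S j)) as Hh.
      pose proof (flat_chart _ y a v tt (h (S j)) (bb (S j) y) Hh G Ht) as Ch.
      assert (Nxw : x <> w) by (intros ->; destruct B; lra). assert (Nwz : w <> z) by (intros ->; destruct B; lra).
      pose proof (XsSep (S j) x w Hx Hw Nxw) as S1. pose proof (XsSep (S j) w z Hw Hz Nwz) as S2.
      assert (Bx : inball dist (fun z : lp p => E z) y (100 * h (S j)) x) by (split; [apply (XsE _ _ Hx) | lra]).
      assert (Bw : inball dist (fun z : lp p => E z) y (100 * h (S j)) w) by (split; [apply (XsE _ _ Hw) | lra]).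
      assert (Bz : inball dist (fun z : lp p => E z) y (100 * h (S j)) z) by (split; [apply (XsE _ _ Hz) | lra]).
      pose proof (proj1 (chart_btw dist _ y _ _ _ Hh Ch x w z Bx Bw Bz S1 S2) B) as T.
      unfold err. apply (Kex a v x w z (tt x) (tt w) (tt z)); auto.
      + apply Ht; [apply Bx | lra].
      + apply Ht; [apply Bw | lra].
      + apply Ht; [apply Bz | lra].
      + pose proof (norm_nonneg v). destruct T; [left | right]; nra. }
  clear Tour.
  assert (Cost : forall k, sumL (fun j => sumL (cost2 h good err j) (Xs j)) (seq 1 k) <= C3 * (s0 + D0)).
  { intros k.
    apply Rle_trans with (sumL (fun j => sumL (fun x : lp p => C3 * (rpow (betaR E (kk j) x) s * (A * h j)) + C3 * (rpow (e j) s * h j)) (Xs j)) (seq 1 k)).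
    - apply sumL_le. intros j _. apply sumL_le. intros x Hx. pose proof (h_pos j) as Hh.
      pose proof (Hbb j x Hx) as Hb0. pose proof (rpow_ge0 (bb j x) s) as Hb1.
      apply Rle_trans with (C2 * rpow (bb j x) s * h j).
      + unfold cost2, err, C2. pose proof (rpow_ge0 400 s). destruct (dec (good j x)) as [G|G].
        * assert (0 <= 1298 * rpow 400 s * rpow (bb j x) s * h j)
            by (apply Rmult_le_pos; [apply Rmult_le_pos; [apply Rmult_le_pos|]|]; lra). nra.
        (* At a bad point [400 bb > 1], so its fixed cost is also bounded by a multiple of
           [bb^s]. *)
        * unfold good in G.
          assert (1 <= rpow 400 s * rpow (bb j x) s).
          { rewrite <- rpow_mul by lra. rewrite <- (rpow_1l s). apply rpow_le; lra. }
          assert (0 <= 26 * C0 * rpow (bb j x) s * h j)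
            by (apply Rmult_le_pos; [apply Rmult_le_pos; [apply Rmult_le_pos|]|]; lra). nra.
      + apply InXs in Hx. pose proof (betaR_ge0 E X s0 D0 E_lp HX ES HD (kk j) x Hx) as Hb. pose proof (He j).
        set (b := betaR E (kk j) x) in *. unfold bb. fold b.
        rewrite rpow_mul by lra.
        assert (K : rpow (b + e j) s <= rpow 2 s * (rpow b s + rpow (e j) s)).
        { pose proof (rpow_ge0 b s). pose proof (rpow_ge0 (e j) s). pose proof (rpow_ge0 2 s).
          destruct (Rle_dec b (e j)).
          - apply Rle_trans with (rpow (2 * e j) s); [apply rpow_le; lra|]. rewrite rpow_mul by lra. nra.
          - apply Rle_trans with (rpow (2 * b) s); [apply rpow_le; lra|]. rewrite rpow_mul by lra. nra. }
        unfold C3. pose proof (rpow_ge0 (2 * A) s). pose proof (rpow_ge0 b s). pose proof (rpow_ge0 (e j) s). pose proof (rpow_ge0 2 s).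
        apply Rle_trans with (C2 * (rpow (2 * A) s * (rpow 2 s * (rpow b s + rpow (e j) s))) * h j).
        * apply Rmult_le_compat_r; [lra|]. apply Rmult_le_compat_l; [lra|]. apply Rmult_le_compat_l; assumption.
        * set (P := C2 * (rpow (2 * A) s * rpow 2 s)).
          assert (0 <= P) by (unfold P; apply Rmult_le_pos; [lra | apply Rmult_le_pos; assumption]).
          replace (C2 * (rpow (2 * A) s * (rpow 2 s * (rpow b s + rpow (e j) s))) * h j) with
            (P * (rpow b s * h j) + P * (rpow (e j) s * h j)) by (unfold P; ring).
          apply Rplus_le_compat_r. apply Rmult_le_compat_l; [assumption|]. apply Rmult_le_compat_l; [assumption|]. nra.
    - rewrite (sumL_ext _ (fun j => C3 * sumL (fun x : lp p => rpow (betaR E (kk j) x) s * (A * h j)) (Xs j) +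
         C3 * (rpow (e j) s * h j * INR (length (Xs j))))).
      2:{ intros j _. rewrite sumL_plus, !sumL_scal, sumL_const. ring. }
      rewrite sumL_plus, !sumL_scal.
      assert (K1 : sumL (fun j => sumL (fun x : lp p => rpow (betaR E (kk j) x) s * (A * h j)) (Xs j)) (seq 1 k) <= s0).
      { set (it := concat (map (fun j => map (fun x : lp p => (kk j, crd x)) (Xs j)) (seq 1 k))).
        pose proof (items_sum E X s0 D0 E_lp HX ES HD it) as Q.
        unfold it in Q at 3. rewrite sumL_concat, sumL_map in Q.
        rewrite (sumL_ext _ (fun j => sumL (fun x : lp p => rpow (betaR E (kk j) x) s * (A * h j)) (Xs j))) in Q
          by (intros j _; rewrite sumL_map; reflexivity).
        apply Q; unfold it.
        - apply NoDup_concat_map; [apply seq_NoDup| |].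
          + intros j _. apply NoDup_map_in; [|apply NDXs]. intros x y _ _ Q'. injection Q' as Q'. apply lp_ext. congruence.
          + intros j j' z _ _ Hz Hz'. apply in_map_iff in Hz, Hz'. destruct Hz as [x [<- _]], Hz' as [y [Q' _]].
            injection Q' as Q'. unfold kk in Q'. lia.
        - intros kx Hkx. apply in_concat in Hkx. destruct Hkx as [q [Hq Hkx]]. apply in_map_iff in Hq.
          destruct Hq as [j [<- _]]. apply in_map_iff in Hkx. destruct Hkx as [x [<- Hx]]. simpl. apply InXs, Hx. }
      assert (K2 : sumL (fun j => rpow (e j) s * h j * INR (length (Xs j))) (seq 1 k) <= D0).
      { apply Rle_trans with (sumL (fun j => D0 * (1 / 2) ^ j) (seq 1 k)).
        - apply sumL_le. intros j _. unfold e. rewrite rpow_inv' by (try (left; apply He0); lra).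
          pose proof (pos_INR (length (Xs j))). pose proof (h_pos j). set (n := INR (length (Xs j))) in *.
          assert (0 < D0 * (1 / 2) ^ j) by (apply Rmult_lt_0_compat; [lra | apply pow_lt; lra]).
          replace (D0 * (1 / 2) ^ j / (h j * (n + 1)) * h j * n) with (D0 * (1 / 2) ^ j * (n / (n + 1))) by (field; lra).
          assert (0 <= n / (n + 1) <= 1) by (apply div_unit; lra). nra.
        - rewrite sumL_scal. rewrite <- (Rmult_1_r D0) at 2. apply Rmult_le_compat_l; [lra | apply half_pow_sum]. }
      nra. }
  set (M := 2 * (312 + 2 * C3) * s0).
  destruct (choice (fun n (th : lp p -> R) => forall z, In z (Xs n) -> 0 <= th z <= M /\
     forall z', In z' (Xs n) -> dist z z' <= Rabs (th z - th z'))) as [th Hth].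
  { intros n. destruct (Tour' n) as [w [W1 W2]].
    destruct (walk_label dist x0 w dist_nonneg dist_sym dist_refl dist_triangle) as [t Ht].
    exists t. intros z Hz. apply W1 in Hz. destruct (Ht z Hz) as [Q1 [_ Q3]]. split.
    - split; [lra|]. pose proof (Cost n). unfold h in W2 at 1. unfold kk in W2 at 1.
      replace (k0 + Z.of_nat 0)%Z with k0 in W2 by lia. unfold M. nra.
    - intros z' Hz'. apply Q3, W1, Hz'. }
  (* Cantor's pairing decodes a level and an index, so [en] runs through the points of all nets; an
     index out of range gives [x0]. *)
  set (en := fun m => let (n, i) := of_nat m in nth i (Xs n) x0).
  assert (Mono : forall n m, (n <= m)%nat -> incl (Xs n) (Xs m)).
  { intros n m Hnm. induction Hnm; [intros z Hz; assumption|]. intros z Hz. simpl. apply in_app_iff. right. apply IHHnm, Hz. }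
  assert (Enj : forall j, exists n, forall m, (n <= m)%nat -> In (en j) (Xs m)).
  { intros j. unfold en. destruct (of_nat j) as [n i]. exists n. intros m Hm. apply (Mono n m Hm).
    destruct (nth_in_or_default i (Xs n) x0) as [Q|Q]; [assumption|]. rewrite Q. apply (Mono 0%nat n ltac:(lia)). left. reflexivity. }
  (* The label in the tour of level [n], with the value 0 as long as the point has not entered the
     net. *)
  set (u := fun j n => if dec (In (en j) (Xs n)) then th n (en j) else 0).
  assert (HM : 0 <= M) by (unfold M; apply Rmult_le_pos; lra).
  destruct (joint_cluster u M) as [tau Htau].
  { intros j n. unfold u. destruct (dec _) as [Q|Q]; [apply Hth, Q | lra]. }
  destruct (curve_exists en tau M) as [g [G1 G2]].
  - intros j. split; apply le_epsilon; intros eps Heps; destruct (Htau j eps 0%nat Heps) as [n [_ Q]]; specialize (Q j (le_n _));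
      assert (0 <= u j n <= M) by (unfold u; destruct (dec _) as [Q'|Q']; [apply Hth, Q' | lra]);
      unfold Rabs in Q; destruct (Rcase_abs _); lra.
  - intros i j. apply le_epsilon. intros eps Heps.
    destruct (Enj i) as [ni Hi]. destruct (Enj j) as [nj Hj].
    destruct (Htau (max i j) (eps / 2) (max ni nj) ltac:(lra)) as [n [Hn Q]].
    pose proof (Q i ltac:(lia)) as Qi. pose proof (Q j ltac:(lia)) as Qj. unfold u in Qi, Qj.
    specialize (Hi n ltac:(lia)). specialize (Hj n ltac:(lia)).
    destruct (dec (In (en i) (Xs n))) as [_|N]; [|contradiction]. destruct (dec (In (en j) (Xs n))) as [_|N]; [|contradiction].
    eapply Rle_trans; [apply (proj2 (Hth n _ Hi) _ Hj)|].
    replace (th n (en i) - th n (en j)) with ((th n (en i) - tau i) + (tau i - tau j) + - (th n (en j) - tau j)) by ring.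
    eapply Rle_trans; [apply Rabs_triang|]. rewrite Rabs_Ropp.
    pose proof (Rabs_triang (th n (en i) - tau i) (tau i - tau j)). lra.
  - exists g, M. splits; [assumption | unfold M; lra | assumption|].
    intros x Ex. apply G2. intros eps Heps.
    destruct (half_pow_lt (eps / pw k0)) as [n Hn]; [apply Rdiv_lt_0_compat; [assumption | apply pw_pos]|].
    assert (Hhn : h n < eps).
    { unfold h, kk. rewrite pw_add. pose proof (pw_pos k0). apply (Rmult_lt_compat_l (pw k0)) in Hn; [|assumption].
      replace (pw k0 * (eps / pw k0)) with eps in Hn by (field; lra). assumption. }
    destruct (net_dense E X E_lp HX (kk n) x Ex) as [y [Hy Dy]]. apply InXs in Hy.
    destruct (In_nth _ _ x0 Hy) as [i [_ Hi]]. exists (to_nat (n, i)). unfold en. rewrite cancel_of_to, Hi, dist_sym.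
    fold (h n) in Dy. lra.
Qed.

End Sufficiency.

(** * Content of a finite set at a given scale *)

Lemma nat_last (P : nat -> Prop) a b : (a <= b)%nat -> P a ->
  exists m, (a <= m <= b)%nat /\ P m /\ forall t, (m < t <= b)%nat -> ~ P t.
Proof.
  intros Hab Pa. induction Hab as [|b Hab [m [H1 [H2 H3]]]].
  - exists a. splits; [lia.. | assumption | intros; lia].
  - destruct (classic (P (S b))) as [Q|Q].
    + exists (S b). splits; [lia.. | assumption | intros; lia].
    + exists m. splits; [lia.. | assumption|]. intros t Ht. destruct (Nat.eq_dec t (S b)) as [->|]; [assumption|].
      apply H3. lia.
Qed.

Lemma nat_first (P : nat -> Prop) a b : (a <= b)%nat -> P b ->
  exists m, (a <= m <= b)%nat /\ P m /\ forall t, (a <= t < m)%nat -> ~ P t.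
Proof.
  intros Hab Pb. induction b as [b IH] using lt_wf_ind.
  destruct (classic (exists t, (a <= t < b)%nat /\ P t)) as [[t [Ht Pt]]|N].
  - destruct (IH t ltac:(lia) ltac:(lia) Pt) as [m [H1 [H2 H3]]]. exists m. splits; [lia.. | assumption | assumption].
  - exists b. splits; [lia.. | assumption|]. intros t Ht Pt. apply N. exists t. auto.
Qed.

Section Content.
Context {V : Type} (d : V -> V -> R).
Hypothesis d_ge0 : forall x y, 0 <= d x y.
Hypothesis d_sym : forall x y, d x y = d y x.
Hypothesis d_refl : forall x, d x x = 0.
Hypothesis d_tri : forall x y z, d x z <= d x y + d y z.

(** The chain may return to a set several times. From the start one jumps to the last visit to a set
    containing it; that set is not met again, so each set is used at most once. *)
Lemma chain_cover {T} (B : T -> V -> Prop) (w : T -> R) (f : nat -> V) (I : list T) i j : (i <= j)%nat ->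
  (forall b, In b I -> 0 <= w b) ->
  (forall b y z, In b I -> B b y -> B b z -> d y z <= w b) ->
  (forall t, (i <= t < j)%nat -> exists b, In b I /\ B b (f t) /\ B b (f (S t))) ->
  d (f i) (f j) <= sumL w I.
Proof.
  remember (length I) as n eqn:En. revert I i En. induction n; intros I i En Hij Hw HB Hc.
  - destruct I; [|discriminate]. destruct (Nat.eq_dec i j) as [->|N]; [rewrite d_refl; simpl; lra|].
    destruct (Hc i ltac:(lia)) as [b [[] _]].
  - destruct (Nat.eq_dec i j) as [->|N]; [rewrite d_refl; apply sumL_ge0, Hw|].
    destruct (Hc i ltac:(lia)) as [b [Ib [B1 B2]]].
    destruct (nat_last (fun t => B b (f t)) (S i) j ltac:(lia) B2) as [m [Hm1 [Hm2 Hm3]]].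
    destruct (in_split b I Ib) as [I1 [I2 ->]].
    assert (K : d (f m) (f j) <= sumL w (I1 ++ I2)).
    { apply IHn.
      - rewrite length_app in *. simpl in En. lia.
      - lia.
      - intros c Hc'. apply Hw. apply in_app_iff in Hc'. apply in_app_iff. simpl. tauto.
      - intros c y z Hc'. apply HB. apply in_app_iff in Hc'. apply in_app_iff. simpl. tauto.
      - intros t Ht. destruct (Hc t ltac:(lia)) as [c [Ic [C1 C2]]]. exists c. splits; auto.
        apply in_app_iff in Ic. apply in_app_iff. destruct Ic as [Ic|[<-|Ic]]; auto.
        exfalso. apply (Hm3 (S t)); [lia | assumption]. }
    pose proof (HB b (f i) (f m) Ib B1 Hm2). pose proof (d_tri (f i) (f m) (f j)).
    rewrite sumL_app in *. simpl. lra.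
Qed.

Lemma greedy r (l : list V) : 0 <= r -> exists Y, incl Y l /\ NoDup Y /\
  (forall a b, In a Y -> In b Y -> a <> b -> r < d a b) /\ (forall x, In x l -> exists y, In y Y /\ d x y <= r).
Proof.
  intros Hr. induction l as [|a l [Y [H1 [H2 [H3 H4]]]]].
  - exists nil. splits; [intros x [] | constructor | intros a b [] | intros x []].
  - destruct (classic (exists y, In y Y /\ d a y <= r)) as [Q|Q].
    + exists Y. splits; auto; [intros x Hx; right; auto|]. intros x [<-|Hx]; auto.
    + assert (N : forall y, In y Y -> r < d a y).
      { intros y Hy. apply Rnot_le_lt. intros Q'. apply Q. exists y. auto. }
      exists (a :: Y). splits.
      * intros x [<-|Hx]; [left; reflexivity | right; auto].
      * constructor; [|assumption]. intros Q'. specialize (N a Q'). rewrite d_refl in N. lra.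
      * intros x y [<-|Hx] [<-|Hy] Nxy; [congruence | auto | rewrite d_sym; auto | auto].
      * intros x [<-|Hx]; [exists a; rewrite d_refl; simpl; auto|]. destruct (H4 x Hx) as [y [Hy Dy]].
        exists y. simpl. auto.
Qed.

(* [rho] is the mesh of the set [F]: its points are visited by [f] with steps at most [2 * rho]. *)
Variables (F : list V) (rho : R) (f : nat -> V).
Hypothesis rho_pos : 0 < rho.
Hypothesis f_step : forall t, d (f t) (f (S t)) <= 2 * rho.
Hypothesis f_in : forall t, In (f t) F.

(* A block of a cover is a set with an upper bound of its diameter. *)
Definition block : Type := ((V -> Prop) * R)%type.

Definition cover (dl : R) (P : list block) : Prop :=
  (forall z, In z F -> exists b, In b P /\ fst b z) /\
  (forall b, In b P -> 0 <= snd b <= dl /\ forall y z, fst b y -> fst b z -> d y z <= snd b).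

(** [F] is discrete, and consecutive points of the walk may lie in different blocks. Thickening a
    block by the step length [2 rho] adds at most [4 rho] to its diameter and makes the blocks along
    the walk overlap. *)
Definition bcost (b : block) : R := snd b + 4 * rho.
Definition cost (P : list block) : R := sumL bcost P.

Lemma bcost_ge0 dl P b : cover dl P -> In b P -> 0 <= bcost b.
Proof. intros [_ H] Hb. destruct (H b Hb) as [Q _]. unfold bcost. lra. Qed.

Lemma cost_ge0 dl P : cover dl P -> 0 <= cost P.
Proof. intros H. apply sumL_ge0. intros b Hb. eapply bcost_ge0; eauto. Qed.

Definition is_content (dl c : R) : Prop :=
  (forall P, cover dl P -> c <= cost P) /\ (forall m, (forall P, cover dl P -> m <= cost P) -> m <= c).

(** The analogue for [F] of the premeasure at mesh [dl] from which one-dimensional Hausdorff measure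
    is built. *)
Definition content (dl : R) : R := epsilon (inhabits 0) (is_content dl).

Definition singletons : list block := map (fun x => (fun z => z = x, 0)) F.

Lemma singletons_cover dl : 0 <= dl -> cover dl singletons.
Proof.
  intros Hd. split.
  - intros z Hz. exists (fun y => y = z, 0). split; [|reflexivity]. apply in_map_iff. exists z. auto.
  - intros b Hb. apply in_map_iff in Hb. destruct Hb as [x [<- Hx]]. simpl. split; [lra|].
    intros y z -> ->. rewrite d_refl. lra.
Qed.

Lemma content_spec dl : 0 <= dl -> is_content dl (content dl).
Proof.
  intros Hd. unfold content. apply epsilon_spec.
  destruct (completeness (fun q => exists P, cover dl P /\ q = - cost P)) as [m [M1 M2]].
  - exists 0. intros q [P [HP ->]]. pose proof (cost_ge0 dl P HP). lra.
  - exists (- cost singletons), singletons. split; [apply singletons_cover, Hd | reflexivity].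
  - exists (- m). split.
    + intros P HP. assert (- cost P <= m); [|lra]. apply M1. exists P. auto.
    + intros c Hc. assert (m <= - c); [|lra]. apply M2. intros q [P [HP ->]]. specialize (Hc P HP). lra.
Qed.

Lemma content_ge0 dl : 0 <= dl -> 0 <= content dl.
Proof. intros Hd. apply (content_spec dl Hd). apply cost_ge0. Qed.

Lemma content_le dl : 0 <= dl -> content dl <= 4 * rho * INR (length F).
Proof.
  intros Hd. eapply Rle_trans; [apply (proj1 (content_spec dl Hd)), singletons_cover, Hd|].
  unfold cost, singletons. rewrite sumL_map, <- sumL_const. apply sumL_le. intros. unfold bcost. simpl. lra.
Qed.

Lemma content_antitone dl dl' : 0 <= dl -> dl <= dl' -> content dl' <= content dl.
Proof.
  intros Hd Hdd. apply (content_spec dl Hd). intros P [H1 H2]. apply (content_spec dl' ltac:(lra)).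
  split; [assumption|]. intros b Hb. destruct (H2 b Hb). split; [lra | assumption].
Qed.

(** All blocks of a family [Bj j] are replaced by their union, a single block of diameter [D]. The
    families are disjoint, so the savings [g j] add up. *)
Lemma merge {T} (J : list T) (Bj : T -> block -> Prop) (g : T -> R) dl D P : 0 <= dl -> dl <= D -> cover dl P ->
  (forall b j j', In b P -> In j J -> In j' J -> Bj j b -> Bj j' b -> j = j') -> NoDup J ->
  (forall j b b' y y', In j J -> In b P -> In b' P -> Bj j b -> Bj j b' -> fst b y -> fst b' y' -> d y y' <= D) ->
  (forall j, In j J -> D + 4 * rho + g j <= sumL (fun b => ind (Bj j b) * bcost b) P) ->
  content D <= cost P - sumL g J.
Proof.
  intros Hdl HD HP Hdis ND Hdiam Hg.
  set (none := fun b => forall j, In j J -> ~ Bj j b).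
  set (P' := filter (fun b => if dec (none b) then true else false) P ++
     map (fun j => (fun z => exists b, In b P /\ Bj j b /\ fst b z, D)) J).
  assert (HP' : cover D P').
  { destruct HP as [H1 H2]. split.
    - intros z Hz. destruct (H1 z Hz) as [b [Hb Bz]]. destruct (classic (none b)) as [Q|Q].
      + exists b. split; [|assumption]. apply in_app_iff. left. apply in_filter_dec. auto.
      + assert (exists j, In j J /\ Bj j b) as [j [Hj Bb]].
        { apply NNPP. intros N. apply Q. intros j Hj Bb. apply N. exists j. auto. }
        eexists. split; [apply in_app_iff; right; apply in_map_iff; exists j; split; [reflexivity | assumption]|].
        simpl. exists b. auto.
    - intros b Hb. apply in_app_iff in Hb. destruct Hb as [Hb|Hb].
      + apply in_filter_dec in Hb. destruct Hb as [Hb _]. destruct (H2 b Hb). split; [lra | assumption].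
      + apply in_map_iff in Hb. destruct Hb as [j [<- Hj]]. simpl. split; [lra|].
        intros y z [b [Ib [Bb By]]] [b' [Ib' [Bb' Bz]]]. apply (Hdiam j b b'); auto. }
  eapply Rle_trans; [apply (proj1 (content_spec D ltac:(lra)) P' HP')|].
  unfold cost, P'. rewrite sumL_app, sumL_filter, sumL_map.
  assert (K1 : sumL (fun j => bcost (fun z => exists b, In b P /\ Bj j b /\ fst b z, D)) J + sumL g J <=
     sumL (fun j => sumL (fun b => ind (Bj j b) * bcost b) P) J).
  { rewrite <- sumL_plus. apply sumL_le. intros j Hj. specialize (Hg j Hj). unfold bcost at 1. simpl. lra. }
  assert (K2 : sumL (fun b => ind (none b) * bcost b) P + sumL (fun j => sumL (fun b => ind (Bj j b) * bcost b) P) J <=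
     sumL bcost P).
  { rewrite sumL_swap, <- sumL_plus. apply sumL_le. intros b Hb. pose proof (bcost_ge0 dl P b HP Hb) as C0.
    rewrite (sumL_ext (fun j => ind (Bj j b) * bcost b) (fun j => bcost b * ind (Bj j b))) by (intros; ring).
    rewrite sumL_scal.
    assert (ind (none b) + sumL (fun j => ind (Bj j b)) J <= 1).
    { destruct (classic (none b)) as [Q|Q].
      - rewrite ind_true by assumption. rewrite (sumL_ext _ (fun _ => 0)); [rewrite sumL_0; lra|].
        intros j Hj. apply ind_false, Q, Hj.
      - rewrite ind_false by assumption. rewrite Rplus_0_l. apply sumL_ind_le1; [assumption|].
        intros j j' Hj Hj'. apply (Hdis b j j'); assumption. }
    nra. }
  lra.
Qed.

Lemma cross dl P (Q : block -> Prop) i j : (i <= j)%nat -> cover dl P ->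
  (forall b t, In b P -> (i <= t <= j)%nat -> fst b (f t) -> Q b) ->
  d (f i) (f j) <= sumL (fun b => ind (Q b) * bcost b) P.
Proof.
  intros Hij HP HQ. rewrite <- sumL_filter.
  apply (chain_cover (fun b y => exists u, fst b u /\ d u y <= 2 * rho)); [assumption| | |].
  - intros b Hb. apply in_filter_dec in Hb. apply (bcost_ge0 dl P); tauto.
  - intros b y z Hb [u [U1 U2]] [u' [U1' U2']]. apply in_filter_dec in Hb. destruct Hb as [Hb _].
    destruct (proj2 HP b Hb) as [_ Hd]. specialize (Hd u u' U1 U1').
    pose proof (d_tri y u z). pose proof (d_tri u u' z). rewrite (d_sym y u) in *. unfold bcost. lra.
  - intros t Ht. destruct (proj1 HP (f t) (f_in t)) as [b [Hb Bt]]. exists b. splits.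
    + apply in_filter_dec. split; [assumption|]. apply (HQ b t); auto. lia.
    + exists (f t). rewrite d_refl. split; [assumption | lra].
    + exists (f t). auto.
Qed.

(** Up to its first exit from the ball of radius [r] the walk covers the distance [r]; the last step
    overshoots by at most [2 rho]. *)
Lemma ball_content dl P i j r : (i <= j)%nat -> cover dl P -> r <= d (f i) (f j) ->
  r <= sumL (fun b => ind (exists z, fst b z /\ d (f i) z < r + 2 * rho) * bcost b) P.
Proof.
  intros Hij HP Hr.
  destruct (Rle_dec r 0) as [Q|Q].
  { apply Rle_trans with 0; [assumption|]. apply sumL_ge0. intros b Hb. apply Rmult_le_pos; [apply ind_ge0|].
    eapply bcost_ge0; eauto. }
  destruct (nat_first (fun t => r <= d (f i) (f t)) i j Hij Hr) as [m [M1 [M2 M3]]].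
  eapply Rle_trans; [exact M2|]. apply (cross dl); [lia | assumption|].
  intros b t Hb Ht Bt. exists (f t). split; [assumption|].
  destruct (Nat.eq_dec t m) as [->|N].
  - destruct m as [|m]; [assert (i = 0%nat) by lia; subst; rewrite d_refl in M2; lra|].
    destruct (Nat.eq_dec i (S m)) as [->|N']; [rewrite d_refl in M2; lra|].
    pose proof (M3 m ltac:(lia)). pose proof (f_step m). pose proof (d_tri (f i) (f m) (f (S m))). lra.
  - pose proof (M3 t ltac:(lia)). lra.
Qed.

(** * Crowded places of a net *)

Section Dense.
Variables (Lam Rk : R) (N0 : nat) (X : list V).
Hypothesis Lam_ge1 : 1 <= Lam.
Hypothesis Rk_pos : 0 < Rk.
Hypothesis N0_big : 16 * (4 * Lam + 2) <= INR N0.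
Hypothesis rho_small : rho <= Rk / 100.
Hypothesis X_nodup : NoDup X.
Hypothesis X_sep : forall a b, In a X -> In b X -> a <> b -> Rk / 2 <= d a b.
Hypothesis X_far : forall x, In x X -> exists i j, (i <= j)%nat /\ f i = x /\ Rk / 8 <= d x (f j).

Definition near_count (x : V) : nat := length (filter (fun y => if dec (d x y <= Lam * Rk) then true else false) X).

Definition dense (x : V) : Prop := (N0 <= near_count x)%nat.

(** Blocks near different net points are different, and those near one net point cost at least
    [Rk / 8]. A cluster has at least [N0] net points: half of their cost pays for a merged block of
    diameter [(4 Lam + 1) Rk], the other half is the gain. *)
Lemma dense_gain : Rk / 16 * sumL (fun x => ind (dense x)) X <= content (Rk / 32) - content ((4 * Lam + 1) * Rk).
Proof.
  set (D := (4 * Lam + 1) * Rk).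
  assert (LR : Rk <= Lam * Rk) by nra.
  cut (content D + Rk / 16 * sumL (fun x => ind (dense x)) X <= content (Rk / 32)); [lra|].
  apply (content_spec (Rk / 32) ltac:(lra)). intros P HP.
  destruct (greedy (2 * Lam * Rk) (filter (fun x => if dec (dense x) then true else false) X) ltac:(nra))
    as [Y [Y1 [Y2 [Y3 Y4]]]].
  assert (YX : forall y, In y Y -> In y X /\ dense y) by (intros y Hy; apply in_filter_dec, Y1, Hy).
  (* Every point within [Lam Rk] of a centre goes to that centre, so that its cluster is large; the
     other dense points go to some centre within [2 Lam Rk]. *)
  set (member := fun x => (exists y, In y Y /\ d x y <= Lam * Rk) \/ (In x X /\ dense x)).
  destruct (choice (fun x y => member x -> In y Y /\ d x y <= 2 * Lam * Rk /\
     forall y', In y' Y -> d x y' <= Lam * Rk -> y = y')) as [ow How].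
  { intros x. destruct (classic (exists y, In y Y /\ d x y <= Lam * Rk)) as [[y [Hy Dy]]|N].
    - exists y. intros _. splits; [assumption | lra|]. intros y' Hy' Dy'. apply NNPP. intros Nyy.
      pose proof (Y3 y y' Hy Hy' Nyy). pose proof (d_tri y x y'). rewrite (d_sym y x) in *. lra.
    - destruct (classic (In x X /\ dense x)) as [[Hx Dx]|N'].
      + destruct (Y4 x) as [y [Hy Dy]]; [apply in_filter_dec; auto|]. exists y. intros _. splits; auto.
        intros y' Hy' Dy'. exfalso. apply N. exists y'. auto.
      + exists x. intros [Q|Q]; contradiction. }
  set (meets := fun x (b : block) => exists z, fst b z /\ d x z < Rk / 8 + 2 * rho).
  assert (Muniq : forall b x x', In b P -> In x X -> In x' X -> meets x b -> meets x' b -> x = x').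
  { intros b x x' Hb Hx Hx' [z [Bz Dz]] [z' [Bz' Dz']]. apply NNPP. intros N.
    pose proof (X_sep x x' Hx Hx' N). destruct (proj2 HP b Hb) as [Hs Hd]. specialize (Hd z z' Bz Bz').
    pose proof (d_tri x z x'). pose proof (d_tri z z' x'). rewrite (d_sym z' x') in *. lra. }
  set (cl := fun j x => In x X /\ member x /\ ow x = j).
  set (Bj := fun j b => exists x, cl j x /\ meets x b).
  set (num := fun j => sumL (fun x => ind (cl j x)) X).
  assert (Big : forall j, In j Y -> INR N0 <= num j).
  { intros j Hj. destruct (YX j Hj) as [JX JD]. apply Rle_trans with (INR (near_count j)); [apply le_INR, JD|].
    unfold near_count. rewrite <- (Rmult_1_l (INR _)), <- sumL_const, sumL_filter. apply sumL_le. intros x Hx.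
    rewrite Rmult_1_r. apply ind_le. intros Dx. rewrite d_sym in Dx.
    assert (Mx : member x) by (left; exists j; auto). destruct (How x Mx) as [_ [_ W]].
    split; [assumption | split; [assumption | apply W; assumption]]. }
  assert (Hm : content D <= cost P - sumL (fun j => Rk / 16 * num j) Y).
  { apply (merge Y Bj _ (Rk / 32)); [lra | unfold D; nra | assumption | | assumption | |].
    - intros b j j' Hb _ _ [x [[Q1 [Q2 Q3]] Q4]] [x' [[Q1' [Q2' Q3']] Q4']].
      rewrite <- Q3, <- Q3'. f_equal. apply (Muniq b); assumption.
    - intros j b b' y y' Hj Hb Hb' [x [[Q1 [Q2 Q3]] [z [Bz Dz]]]] [x' [[Q1' [Q2' Q3']] [z' [Bz' Dz']]]] By By'.
      destruct (How x Q2) as [_ [Dx _]]. destruct (How x' Q2') as [_ [Dx' _]]. rewrite Q3 in Dx. rewrite Q3' in Dx'.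
      destruct (proj2 HP b Hb) as [Hs Hd]. specialize (Hd y z By Bz).
      destruct (proj2 HP b' Hb') as [Hs' Hd']. specialize (Hd' z' y' Bz' By').
      pose proof (d_tri y z y'). pose proof (d_tri z x y'). pose proof (d_tri x j y').
      pose proof (d_tri j x' y'). pose proof (d_tri x' z' y'). rewrite (d_sym z x), (d_sym j x') in *. unfold D. lra.
    - intros j Hj.
      assert (K : Rk / 8 * num j <= sumL (fun b => ind (Bj j b) * bcost b) P).
      { unfold num. rewrite <- sumL_scal.
        apply Rle_trans with (sumL (fun x => sumL (fun b => ind (cl j x) * (ind (meets x b) * bcost b)) P) X).
        - apply sumL_le. intros x Hx. rewrite sumL_scal. destruct (X_far x Hx) as [i [t [Hit [Ei Dt]]]].
          rewrite <- Ei in Dt. pose proof (ball_content (Rk / 32) P i t (Rk / 8) Hit HP Dt) as Q. rewrite Ei in Q.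
          rewrite (Rmult_comm (Rk / 8)). apply Rmult_le_compat_l; [apply ind_ge0 | exact Q].
        - rewrite sumL_swap. apply sumL_le. intros b Hb. pose proof (bcost_ge0 _ P b HP Hb) as C0.
          rewrite (sumL_ext _ (fun x => bcost b * ind (cl j x /\ meets x b))).
          2:{ intros x _. destruct (classic (cl j x)), (classic (meets x b));
              rewrite ?(ind_true (cl j x)), ?(ind_false (cl j x)), ?(ind_true (meets x b)), ?(ind_false (meets x b)) by assumption;
              try (rewrite ind_true by auto; ring); rewrite ind_false by tauto; ring. }
          rewrite sumL_scal, Rmult_comm. apply Rmult_le_compat_r; [assumption|].
          destruct (classic (Bj j b)) as [Q|Q].
          + rewrite (ind_true (Bj j b)) by assumption. apply sumL_ind_le1; [assumption|].
            intros x x' Hx Hx' [_ Q1] [_ Q2]. apply (Muniq b); assumption.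
          + rewrite (ind_false (Bj j b)) by assumption. rewrite (sumL_ext _ (fun _ => 0)); [rewrite sumL_0; lra|].
            intros x Hx. apply ind_false. intros Q'. apply Q. exists x. exact Q'. }
      pose proof (Big j Hj). assert (D + 4 * rho <= Rk / 16 * num j); [|lra].
      apply Rle_trans with (Rk / 16 * (16 * (4 * Lam + 2))); [unfold D; lra|]. apply Rmult_le_compat_l; lra. }
  assert (Tot : sumL (fun x => ind (dense x)) X <= sumL num Y).
  { unfold num. rewrite sumL_swap. apply sumL_le. intros x Hx. destruct (classic (dense x)) as [Q|Q].
    - rewrite (ind_true (dense x)) by assumption. assert (Mx : member x) by (right; auto).
      destruct (How x Mx) as [W1 _].
      rewrite <- (ind_true (cl (ow x) x)) by (unfold cl; auto).
      apply (sumL_in (fun j => ind (cl j x))); [intros; apply ind_ge0 | assumption].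
    - rewrite (ind_false (dense x)) by assumption. apply sumL_ge0. intros; apply ind_ge0. }
  rewrite sumL_scal in Hm. apply (Rmult_le_compat_l (Rk / 16)) in Tot; lra.
Qed.

End Dense.
End Content.

(** The indices are distinct, so each unit increment of [k] occurs in at most [m] of the
    differences. *)
Lemma telescope (k : Z -> R) B (m : nat) (l : list Z) : (forall i, k i <= k (i + 1)%Z) -> (forall i, 0 <= k i <= B) ->
  NoDup l -> sumL (fun i => k (i + Z.of_nat m)%Z - k i) l <= INR m * B.
Proof.
  intros Hm Hb ND.
  assert (K1 : forall l, NoDup l -> sumL (fun i => k (i + 1)%Z - k i) l <= B).
  { clear l ND. intros l ND.
    assert (exists a n, forall i, In i l -> (a <= i < a + Z.of_nat n)%Z) as [a [n Ha]].
    { clear ND. induction l as [|z l [a [n IH]]]; [exists 0%Z, 0%nat; intros i []|].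
      exists (Z.min a z), (n + Z.to_nat (Z.abs (z - a)) + 1)%nat.
      intros i [<-|Hi]; [lia|]. specialize (IH i Hi). lia. }
    apply Rle_trans with (sumL (fun i => k (i + 1)%Z - k i) (map (fun j => (a + Z.of_nat j)%Z) (seq 0 n))).
    - apply sumL_incl; [intros i _; pose proof (Hm i); lra | assumption|]. intros i Hi. specialize (Ha i Hi).
      apply in_map_iff. exists (Z.to_nat (i - a)). split; [lia|]. apply in_seq. lia.
    - rewrite sumL_map. assert (Q : sumL (fun x => k (a + Z.of_nat x + 1)%Z - k (a + Z.of_nat x)%Z) (seq 0 n) = k (a + Z.of_nat n)%Z - k a).
      { clear. induction n; [simpl; rewrite Z.add_0_r; ring|]. rewrite seq_S, sumL_app, IHn. simpl (0 + n)%nat. cbn [sumL].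
        replace (a + Z.of_nat (S n))%Z with (a + Z.of_nat n + 1)%Z by lia. ring. }
      rewrite Q. pose proof (Hb (a + Z.of_nat n)%Z). pose proof (Hb a). lra. }
  induction m.
  - rewrite (sumL_ext _ (fun _ => 0)); [rewrite sumL_0; simpl; lra|]. intros i _. simpl. rewrite Z.add_0_r. ring.
  - rewrite (sumL_ext _ (fun i => (k (i + Z.of_nat m + 1)%Z - k (i + Z.of_nat m)%Z) + (k (i + Z.of_nat m)%Z - k i))).
    2:{ intros i _. replace (i + Z.of_nat (S m))%Z with (i + Z.of_nat m + 1)%Z by lia. ring. }
    rewrite sumL_plus, S_INR.
    pose proof (K1 (map (fun i => (i + Z.of_nat m)%Z) l)) as Q. rewrite sumL_map in Q.
    assert (NoDup (map (fun i => (i + Z.of_nat m)%Z) l)).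
    { clear -ND. induction ND; simpl; constructor; [|assumption]. rewrite in_map_iff. intros [y [E Hy]].
      apply H. replace x with y by lia. assumption. }
    specialize (Q H). lra.
Qed.

(** * Deviation of arcs *)

Lemma walk_len_app {V} (d : V -> V -> R) x w1 w2 : walk_len d x (w1 ++ w2) = walk_len d x w1 + walk_len d (last w1 x) w2.
Proof.
  revert x. induction w1 as [|y w1 IH]; intros x; [simpl; ring|].
  cbn [app walk_len]. rewrite IH, last_cons. ring.
Qed.

Lemma sumL_nested (w : nat -> R) n : (forall i, 0 <= w i) ->
  sumL (fun i => sumL (fun i' => (1 / 2) ^ (i - i') * w i') (seq 0 (S i))) (seq 0 n) <= 2 * sumL w (seq 0 n).
Proof.
  intros Hw.
  (* The additional term is the part of the geometric series that is still to come. *)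
  assert (K : sumL (fun i => sumL (fun i' => (1 / 2) ^ (i - i') * w i') (seq 0 (S i))) (seq 0 n) +
    sumL (fun i' => (1 / 2) ^ (n - i') * w i') (seq 0 n) * 2 <= 2 * sumL w (seq 0 n)).
  { induction n; [simpl; lra|]. rewrite (seq_S n), !sumL_app. simpl (0 + n)%nat.
    set (L := sumL (fun i => sumL (fun i' => (1 / 2) ^ (i - i') * w i') (seq 0 (S i))) (seq 0 n)) in *.
    cbn [sumL]. rewrite (seq_S n), sumL_app. simpl (0 + n)%nat. cbn [sumL].
    assert (E : sumL (fun i' => (1 / 2) ^ (S n - i') * w i') (seq 0 n) = 1 / 2 * sumL (fun i' => (1 / 2) ^ (n - i') * w i') (seq 0 n)).
    { rewrite <- sumL_scal. apply sumL_ext. intros i Hi. apply in_seq in Hi. replace (S n - i)%nat with (S (n - i)) by lia. simpl. ring. }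
    rewrite E. replace (S n - n)%nat with 1%nat by lia. rewrite Nat.sub_diag. simpl. lra. }
  assert (0 <= sumL (fun i' => (1 / 2) ^ (n - i') * w i') (seq 0 n)).
  { apply sumL_ge0. intros i _. apply Rmult_le_pos; [apply pow_le; lra | apply Hw]. }
  lra.
Qed.

Section Arcs.
Context {p : R} {Hp : Exponent p}.
Variables (f : nat -> lp p) (T : nat).

(** The time [u] is left out because a walk from [f u] lists only the later vertices. *)
Definition pts (S : nat -> Prop) u v : list nat := filter (fun t => if dec (S t) then true else false) (seq (u + 1) (v - u)).
Definition plen (S : nat -> Prop) u v : R := walk_len dist (f u) (map f (pts S u v)).

Lemma pts_last S u v : (u <= v)%nat -> S v -> last (map f (pts S u v)) (f u) = f v.
Proof.
  intros Huv Sv. unfold pts. destruct (Nat.eq_dec u v) as [->|N]; [rewrite Nat.sub_diag; reflexivity|].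
  replace (v - u)%nat with ((v - u - 1) + 1)%nat by lia. rewrite seq_app, filter_app.
  replace (u + 1 + (v - u - 1))%nat with v by lia. simpl. destruct (dec (S v)); [|contradiction].
  rewrite map_app. simpl. apply last_last.
Qed.

Lemma plen_split S u w v : (u <= w <= v)%nat -> S w -> plen S u v = plen S u w + plen S w v.
Proof.
  intros H Sw. unfold plen.
  replace (pts S u v) with (pts S u w ++ pts S w v).
  - rewrite map_app, walk_len_app, pts_last by (auto; lia). reflexivity.
  - unfold pts. replace (v - u)%nat with ((w - u) + (v - w))%nat by lia. rewrite seq_app, filter_app.
    replace (u + 1 + (w - u))%nat with (w + 1)%nat by lia. reflexivity.
Qed.

Lemma walk_len_ge x w : dist x (last w x) <= walk_len dist x w.
Proof.
  revert x. induction w as [|y w IH]; intros x; [simpl; rewrite dist_refl; lra|].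
  cbn [walk_len]. specialize (IH y). pose proof (dist_triangle x y (last w y)).
  rewrite last_cons. lra.
Qed.

Lemma plen_ge S u v : (u <= v)%nat -> S v -> dist (f u) (f v) <= plen S u v.
Proof. intros H Sv. rewrite <- (pts_last S u v H Sv). apply walk_len_ge. Qed.

Lemma plen_ge0 S u v : 0 <= plen S u v.
Proof.
  unfold plen. generalize (f u). induction (map f (pts S u v)) as [|y w IH]; intros x; simpl; [lra|].
  pose proof (IH y). pose proof (dist_nonneg x y). lra.
Qed.

Lemma plen_ext S S' u v : (forall t, (u < t <= v)%nat -> (S t <-> S' t)) -> plen S u v = plen S' u v.
Proof.
  intros H. unfold plen. replace (pts S u v) with (pts S' u v); [reflexivity|].
  apply filter_ext_in. intros t Ht. apply in_seq in Ht. specialize (H t ltac:(lia)).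
  destruct (dec (S t)), (dec (S' t)); tauto.
Qed.

Lemma plen_gap S u v : (u < v)%nat -> S v -> (forall t, (u < t < v)%nat -> ~ S t) -> plen S u v = dist (f u) (f v).
Proof.
  intros H Sv N. rewrite (plen_ext S (fun t => t = v)).
  2:{ intros t Ht. split; [|intros ->; assumption]. intros St. destruct (Nat.eq_dec t v); [assumption|].
      exfalso. apply (N t); [lia | assumption]. }
  unfold plen, pts. replace (v - u)%nat with ((v - u - 1) + 1)%nat by lia. rewrite seq_app, filter_app.
  replace (u + 1 + (v - u - 1))%nat with v by lia. simpl. destruct (dec (v = v)); [|congruence].
  replace (filter (fun t => if dec (t = v) then true else false) (seq (u + 1) (v - u - 1))) with (@nil nat).
  - simpl. ring.
  - symmetry. destruct (filter _ _) as [|z l] eqn:E; [reflexivity|].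
    assert (Q : In z (z :: l)) by (left; reflexivity). rewrite <- E in Q. apply in_filter_dec in Q.
    destruct Q as [Q ->]. apply in_seq in Q. lia.
Qed.

(** The diameter of the whole arc rather than the distance of its ends, so that a long excursion
    returning to its start is not skipped. *)
Definition okgap (dl : R) a b : Prop := forall s s', (a <= s <= b)%nat -> (a <= s' <= b)%nat -> dist (f s) (f s') <= dl.

Definition valid (dl : R) (S : nat -> Prop) : Prop := S 0%nat /\ S T /\
  forall u v, (u < v <= T)%nat -> S u -> S v -> (forall t, (u < t < v)%nat -> ~ S t) -> okgap dl u v.

Section Windows.
Context {W : Type}.
Variables (S : nat -> Prop) (a b : W -> nat).

Definition window (x : W) : Prop := (a x < b x <= T)%nat /\ S (a x) /\ S (b x).
Definition apart (x y : W) : Prop := (b x <= a y)%nat \/ (b y <= a x)%nat.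
Definition gain (x : W) : R := plen S (a x) (b x) - dist (f (a x)) (f (b x)).
Definition cut (l : list W) (t : nat) : Prop := S t /\ forall x, In x l -> ~ (a x < t < b x)%nat.

Lemma cut_len l : S 0%nat -> S T -> NoDup l -> (forall x, In x l -> window x) ->
  (forall x y, In x l -> In y l -> x <> y -> apart x y) ->
  plen (cut l) 0 T + sumL gain l = plen S 0 T.
Proof.
  intros S0 ST ND. induction ND as [|x l Hx ND IH]; intros Hw Hd.
  - simpl. rewrite Rplus_0_r. apply plen_ext. intros t _. unfold cut. simpl. tauto.
  - specialize (IH (fun y Hy => Hw y (or_intror Hy)) (fun y z Hy Hz => Hd y z (or_intror Hy) (or_intror Hz))).
    destruct (Hw x (or_introl eq_refl)) as [W1 [W2 W3]].
    assert (Dx : forall y, In y l -> apart x y).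
    { intros y Hy. apply Hd; simpl; auto. intros ->. contradiction. }
    assert (Inner : forall t y, In y l -> (a x <= t <= b x)%nat -> ~ (a y < t < b y)%nat).
    { intros t y Hy Ht. destruct (Dx y Hy); lia. }
    assert (Ca : cut l (a x)) by (split; [assumption | intros y Hy; apply (Inner _ y Hy); lia]).
    assert (Cb : cut l (b x)) by (split; [assumption | intros y Hy; apply (Inner _ y Hy); lia]).
    assert (Ca' : cut (x :: l) (a x)) by (split; [assumption | intros y [<-|Hy]; [lia | apply (Inner _ y Hy); lia]]).
    assert (Cb' : cut (x :: l) (b x)) by (split; [assumption | intros y [<-|Hy]; [lia | apply (Inner _ y Hy); lia]]).
    rewrite (plen_split (cut (x :: l)) 0 (a x) T), (plen_split (cut (x :: l)) (a x) (b x) T) by (auto; lia).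
    rewrite (plen_split (cut l) 0 (a x) T), (plen_split (cut l) (a x) (b x) T) in IH by (auto; lia).
    rewrite (plen_gap (cut (x :: l)) (a x) (b x)); [|lia | assumption | intros t Ht [_ Q]; apply (Q x (or_introl eq_refl)); lia].
    rewrite (plen_ext (cut l) S (a x) (b x)) in IH.
    2:{ intros t Ht. unfold cut. split; [tauto|]. intros St. split; [assumption|]. intros y Hy. apply (Inner t y Hy). lia. }
    rewrite (plen_ext (cut (x :: l)) (cut l) 0 (a x)).
    2:{ intros t Ht. unfold cut. simpl. split; intros [Q1 Q2]; (split; [assumption|]); [auto|].
        intros y [<-|Hy]; [lia | auto]. }
    rewrite (plen_ext (cut (x :: l)) (cut l) (b x) T).
    2:{ intros t Ht. unfold cut. simpl. split; intros [Q1 Q2]; (split; [assumption|]); [auto|].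
        intros y [<-|Hy]; [lia | auto]. }
    cbn [sumL]. unfold gain at 1. lra.
Qed.

Lemma cut_valid dl dl' l : valid dl S -> dl <= dl' -> (forall x, In x l -> window x) ->
  (forall x, In x l -> okgap dl' (a x) (b x)) -> (forall x y, In x l -> In y l -> x <> y -> apart x y) ->
  valid dl' (cut l).
Proof.
  intros [S0 [ST HS]] Hdl Hw Hg Hd. unfold valid. splits.
  - split; [assumption|]. intros. lia.
  - split; [assumption|]. intros x Hx. pose proof (Hw x Hx) as [? _]. lia.
  - intros u v Huv [Su Cu] [Sv Cv] N.
    destruct (classic (exists t, (u < t < v)%nat /\ S t)) as [[t [Ht St]]|Q].
    + assert (exists x, In x l /\ (a x < t < b x)%nat) as [x [Hx Hxt]].
      { apply NNPP. intros Q. apply (N t Ht). split; [assumption|]. intros x Hx Hxt. apply Q. exists x. auto. }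
      destruct (Hw x Hx) as [W1 [W2 W3]].
      assert (Inner : forall t, (t = a x \/ t = b x) -> cut l t).
      { intros q Hq. split; [destruct Hq; subst; assumption|]. intros y Hy. destruct (dec (x = y)) as [<-|Nxy]; [lia|].
        destruct (Hd x y Hx Hy Nxy); lia. }
      pose proof (Cu x Hx). pose proof (Cv x Hx).
      assert (~ (u < a x < v)%nat) by (intros Q; apply (N (a x) Q), Inner; auto).
      assert (~ (u < b x < v)%nat) by (intros Q; apply (N (b x) Q), Inner; auto).
      replace u with (a x) by lia. replace v with (b x) by lia. apply Hg, Hx.
    + intros s s' Hs Hs'. eapply Rle_trans; [|exact Hdl]. apply (HS u v); auto. intros t Ht St. apply Q. exists t. auto.
Qed.

End Windows.

Variables (eps : nat -> R) (zeta : R).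
Hypothesis zeta_pos : 0 < zeta.
Hypothesis eps_mono : forall i, eps i <= eps (S i).
Hypothesis eps0_valid : valid (eps 0%nat) (fun _ => True).

(* Nested sets of sampling times, from the finest to the coarsest; each one has almost minimal length among the
   admissible subsets of the previous one, so that any admissible shortcut has been taken into account. *)
Definition sampling (Q : nat -> nat -> Prop) : Prop := Q 0%nat = (fun _ => True) /\ forall i,
  (forall t, Q (S i) t -> Q i t) /\ valid (eps i) (Q i) /\
  forall S', (forall t, S' t -> Q i t) -> valid (eps (S i)) S' -> plen (Q (S i)) 0 T <= plen S' 0 T + zeta.

Lemma sampling_exists : exists Q, sampling Q.
Proof.
  set (good := fun i (S0 S1 : nat -> Prop) => (forall t, S1 t -> S0 t) /\ valid (eps (S i)) S1 /\
    forall S', (forall t, S' t -> S0 t) -> valid (eps (S i)) S' -> plen S1 0 T <= plen S' 0 T + zeta).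
  assert (Step : forall i S0, valid (eps i) S0 -> exists S1, good i S0 S1).
  { intros i S0 [V1 [V2 V3]].
    assert (V : valid (eps (S i)) S0).
    { unfold valid. splits; auto. intros u v Huv Su Sv N s s' Hs Hs'. eapply Rle_trans; [|apply eps_mono]. apply (V3 u v); auto. }
    destruct (completeness (fun q => exists S', (forall t, S' t -> S0 t) /\ valid (eps (S i)) S' /\ q = - plen S' 0 T)) as [m [M1 M2]].
    - exists 0. intros q [S' [_ [_ ->]]]. pose proof (plen_ge0 S' 0 T). lra.
    - exists (- plen S0 0 T), S0. auto.
    - apply NNPP. intros N. assert (m <= m - zeta); [|lra]. apply M2. intros q [S' [H1 [H2 ->]]].
      apply Rnot_lt_le. intros Hlt. apply N. exists S'. split; [assumption | split; [assumption|]].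
      intros S'' H1' H2'. assert (- plen S'' 0 T <= m) by (apply M1; exists S''; auto). lra. }
  set (next := fun i S0 => epsilon (inhabits (fun _ : nat => True)) (good i S0)).
  set (Q := fix Q i := match i with O => fun _ : nat => True | S i => next i (Q i) end).
  assert (HQ : forall i, valid (eps i) (Q i)).
  { induction i; [exact eps0_valid|]. simpl. unfold next.
    apply (epsilon_spec (inhabits (fun _ : nat => True)) (good i (Q i)) (Step i (Q i) IHi)). }
  exists Q. split; [reflexivity|]. intros i.
  destruct (epsilon_spec (inhabits (fun _ : nat => True)) (good i (Q i)) (Step i (Q i) (HQ i))) as [G1 [G2 G3]].
  splits; [exact G1 | apply HQ | exact G3].
Qed.

Section Sampled.
Variable Q : nat -> nat -> Prop.
Hypothesis HQ : sampling Q.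

Definition drop (i : nat) : R := plen (Q i) 0 T - plen (Q (S i)) 0 T + zeta.

(** Taking all the shortcuts at once gives an admissible subset of [Q i], and [Q (S i)] is almost as
    short as any of these. *)
Lemma window_gain {W} i (a b : W -> nat) (l : list W) : NoDup l -> (forall x, In x l -> window (Q i) a b x) ->
  (forall x, In x l -> okgap (eps (S i)) (a x) (b x)) -> (forall x y, In x l -> In y l -> x <> y -> apart a b x y) ->
  sumL (gain (Q i) a b) l <= drop i.
Proof.
  intros ND Hw Hg Hd. destruct (proj2 HQ i) as [_ [HV Hmin]].
  pose proof (Hmin (cut (Q i) a b l) (fun t Ht => proj1 Ht) (cut_valid (Q i) a b _ _ l HV (eps_mono i) Hw Hg Hd)) as K.
  destruct HV as [V1 [V2 _]].
  pose proof (cut_len (Q i) a b l V1 V2 ND Hw Hd). unfold drop. lra.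
Qed.

Lemma drop_ge0 i : 0 <= drop i.
Proof.
  pose proof (window_gain (W := nat) i (fun x => x) (fun x => x) nil (NoDup_nil _)) as K. simpl in K.
  apply K; tauto.
Qed.

Lemma drop_sum n : sumL drop (seq 0 n) <= plen (fun _ => True) 0 T + INR n * zeta.
Proof.
  rewrite <- (proj1 HQ).
  assert (E : sumL drop (seq 0 n) = plen (Q 0%nat) 0 T - plen (Q n) 0 T + INR n * zeta).
  { induction n; [simpl; ring|]. rewrite seq_S, sumL_app, IHn, S_INR. simpl (0 + n)%nat. cbn [sumL]. unfold drop. ring. }
  rewrite E. pose proof (plen_ge0 (Q n) 0 T). lra.
Qed.

Lemma Q_mono i j t : (i <= j)%nat -> Q j t -> Q i t.
Proof. intros H. induction H; [auto|]. intros K. apply IHle, (proj1 (proj2 HQ m)), K. Qed.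

Definition off (e : R) t a b : Prop := forall l, 0 <= l <= 1 -> e <= dist (f t) (comb l (f a) (f b)).

(* If a deviation [e] is not seen at the scale of the window it is seen, up to a geometric factor, at a finer one. *)
Lemma deviation_window i a b t e : (a < b <= T)%nat -> Q i a -> Q i b -> okgap (eps (S i)) a b -> (a <= t <= b)%nat ->
  0 < e -> off e t a b ->
  exists i' u v s, (i' <= i)%nat /\ (a <= u /\ u < s < v /\ v <= b)%nat /\ Q i' u /\ Q i' v /\ Q i' s /\
    okgap (eps (S i')) u v /\ off (e * (1 / 2) ^ (i - i' + 1)) s u v.
Proof.
  intros Hab Qa Qb Hg Ht He Hoff. apply NNPP. intros N.
  assert (Near : forall i' u v s, (i' <= i)%nat -> (a <= u)%nat -> (u < s < v)%nat -> (v <= b)%nat -> Q i' u -> Q i' v ->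
     Q i' s -> okgap (eps (S i')) u v -> exists l, 0 <= l <= 1 /\ dist (f s) (comb l (f u) (f v)) < e * (1 / 2) ^ (i - i' + 1)).
  { intros i' u v s H1 H2 H3 H4 H5 H6 H7 H8. apply NNPP. intros N'. apply N. exists i', u, v, s.
    splits; auto; try lia. intros l Hl. apply Rnot_lt_le. intros Hlt. apply N'. exists l. auto. }
  (* If the deviation is seen nowhere, the points of [Q (i - k)] stay within [e (1 - 2^-(k+1))] of
     the chord, since the next descent adds at most [e / 2^(k+2)]. At level 0 all times are sampled,
     which contradicts the deviation [e] at [t]. *)
  assert (K : forall k, (k <= i)%nat -> forall s, (a <= s <= b)%nat -> Q (i - k)%nat s ->
     exists l, 0 <= l <= 1 /\ dist (f s) (comb l (f a) (f b)) < e * (1 - (1 / 2) ^ (k + 1))).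
  { assert (Hends : forall k s, (s = a \/ s = b) -> exists l, 0 <= l <= 1 /\ dist (f s) (comb l (f a) (f b)) < e * (1 - (1 / 2) ^ (k + 1))).
    { intros k s Hs. assert (0 < (1 / 2) ^ k <= 1).
      { split; [apply pow_lt; lra|]. pose proof (pow_incr (1 / 2) 1 k ltac:(lra)) as Q0. rewrite pow1 in Q0. exact Q0. }
      assert (0 < e * (1 - (1 / 2) ^ (k + 1))) by (rewrite pow_add; simpl; apply Rmult_lt_0_compat; lra).
      destruct Hs as [->| ->]; [exists 0; rewrite comb_0 | exists 1; rewrite comb_1]; rewrite dist_refl; split; lra. }
    induction k; intros Hk s Hs Qs.
    - destruct (Nat.eq_dec s a) as [->|Na]; [apply (Hends 0%nat); auto|].
      destruct (Nat.eq_dec s b) as [->|Nb]; [apply (Hends 0%nat); auto|].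
      rewrite Nat.sub_0_r in Qs.
      destruct (Near i a b s (le_n _) (le_n _) ltac:(lia) (le_n _) Qa Qb Qs Hg) as [l [Hl D]].
      exists l. split; [assumption|]. rewrite Nat.sub_diag in D. simpl in *. lra.
    - destruct (classic (Q (i - k)%nat s)) as [Q1|Q1].
      { destruct (IHk ltac:(lia) s Hs Q1) as [l [Hl D]]. exists l. split; [assumption|]. eapply Rlt_le_trans; [exact D|].
        apply Rmult_le_compat_l; [lra|]. replace (S k + 1)%nat with (S (k + 1)) by lia. simpl.
        assert (0 < (1 / 2) ^ (k + 1)) by (apply pow_lt; lra). lra. }
      pose proof (Q_mono (i - k) i a ltac:(lia) Qa) as Qa'. pose proof (Q_mono (i - k) i b ltac:(lia) Qb) as Qb'.
      destruct (nat_last (Q (i - k)%nat) a s ltac:(lia) Qa') as [u [U1 [U2 U3]]].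
      destruct (nat_first (Q (i - k)%nat) s b ltac:(lia) Qb') as [v [V1 [V2 V3]]].
      assert (Nu : u <> s) by (intros ->; contradiction). assert (Nv : s <> v) by (intros ->; contradiction).
      assert (Ei : S (i - S k) = (i - k)%nat) by lia.
      assert (Og : okgap (eps (S (i - S k))) u v).
      { rewrite Ei. apply (proj2 (proj2 (proj1 (proj2 (proj2 HQ (i - k)%nat))))); auto; [lia|].
        intros q Hq Hq'. destruct (Nat.lt_ge_cases s q); [apply (V3 q); [lia | assumption]|]. apply (U3 q); [lia | assumption]. }
      destruct (Near (i - S k)%nat u v s ltac:(lia) ltac:(lia) ltac:(lia) ltac:(lia)
        (Q_mono (i - S k) (i - k) u ltac:(lia) U2) (Q_mono (i - S k) (i - k) v ltac:(lia) V2) Qs Og) as [l [Hl D]].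
      destruct (IHk ltac:(lia) u ltac:(lia) U2) as [lu [Hlu Du]]. destruct (IHk ltac:(lia) v ltac:(lia) V2) as [lv [Hlv Dv]].
      exists ((1 - l) * lu + l * lv). split; [split; nra|].
      rewrite <- comb_comb.
      pose proof (dist_triangle (f s) (comb l (f u) (f v)) (comb l (comb lu (f a) (f b)) (comb lv (f a) (f b)))) as Tr.
      pose proof (dist_comb_comb l (f u) (f v) (comb lu (f a) (f b)) (comb lv (f a) (f b)) Hl) as Q2.
      set (w := e * (1 - (1 / 2) ^ (k + 1))) in *.
      assert (Q3 : (1 - l) * dist (f u) (comb lu (f a) (f b)) + l * dist (f v) (comb lv (f a) (f b)) <= (1 - l) * w + l * w).
      { apply Rplus_le_compat; apply Rmult_le_compat_l; lra. }
      replace (i - (i - S k) + 1)%nat with (S (k + 1)) in D by lia. simpl in D.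
      replace (e * (1 - (1 / 2) ^ (S k + 1))) with (w + e * (1 / 2 * (1 / 2) ^ (k + 1))); [lra|].
      unfold w. replace (S k + 1)%nat with (S (k + 1)) by lia. rewrite <- tech_pow_Rmult. field. }
  destruct (K i (le_n _) t Ht) as [l [Hl D]].
  { rewrite Nat.sub_diag, (proj1 HQ). exact I. }
  specialize (Hoff l Hl). assert (0 < (1 / 2) ^ (i + 1)) by (apply pow_lt; lra). nra.
Qed.

Section Sum.
Variables (r c G : R).
Hypothesis r_ge2 : 2 <= r.
Hypothesis c_pos : 0 < c.
Hypothesis G_ge8 : 8 <= G.
Hypothesis eps_pos : forall i, 0 < eps i.
Hypothesis eps_geom : forall i, eps (S i) = G * eps i.
Hypothesis excess : forall (a z b : lp p) dl, 0 < dl -> dist a z <= dl -> dist z b <= dl ->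
  exists t, 0 <= t <= 1 /\ c * rpow (dist z (comb t a b)) r <= (dist a z + dist z b - dist a b) * rpow dl (r - 1).

Lemma eps_pow i j : (j <= i)%nat -> eps (S i) = G ^ j * eps (S (i - j)).
Proof.
  intros H. induction j; [rewrite Nat.sub_0_r; simpl; ring|]. rewrite IHj by lia.
  replace (i - j)%nat with (S (i - S j)) by lia. rewrite eps_geom, <- tech_pow_Rmult. ring.
Qed.

(** For [j = 1] and [G = 8] the left side is [2^(3 - 2 r)], at most [1 / 2] because [r >= 2]. *)
Lemma scale_factor j : rpow (2 ^ j) r * rpow (/ G ^ j) (r - 1) <= (1 / 2) ^ j.
Proof.
  assert (HG : 0 < / G) by (apply Rinv_0_lt_compat; lra).
  assert (K1 : rpow 2 r * rpow (/ G) (r - 1) <= 1 / 2).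
  { assert (rpow (/ G) (r - 1) <= rpow (/ 8) (r - 1)).
    { apply rpow_le; [lra|]. apply Rinv_le_contravar; lra. }
    assert (E1 : rpow (/ 8) (r - 1) = rpow (1 / 2) (3 * (r - 1))).
    { rewrite <- rpow_comp. f_equal. replace 3 with (2 + 1) by ring. rewrite rpow_add, rpow_2, rpow_1 by lra. lra. }
    assert (E2 : rpow 2 r * rpow (1 / 2) r = 1).
    { rewrite <- rpow_mul by lra. replace (2 * (1 / 2)) with 1 by lra. apply rpow_1l. }
    assert (E3 : rpow (1 / 2) (3 * (r - 1)) <= rpow (1 / 2) r * (1 / 2)).
    { rewrite <- (rpow_1 (1 / 2)) at 3 by lra. rewrite <- rpow_add. apply rpow_exp_le; lra. }
    pose proof (rpow_ge0 2 r). rewrite E1 in H.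
    apply Rle_trans with (rpow 2 r * (rpow (1 / 2) r * (1 / 2))); [apply Rmult_le_compat_l; lra | lra]. }
  induction j.
  - simpl. rewrite Rinv_1, !rpow_1l. lra.
  - simpl. assert (0 < G ^ j) by (apply pow_lt; lra). assert (0 < 2 ^ j) by (apply pow_lt; lra).
    rewrite Rinv_mult, !rpow_mul by (try (left; apply Rinv_0_lt_compat); lra).
    pose proof (rpow_ge0 2 r). pose proof (rpow_ge0 (/ G) (r - 1)).
    pose proof (rpow_ge0 (2 ^ j) r). pose proof (rpow_ge0 (/ G ^ j) (r - 1)).
    replace (rpow 2 r * rpow (2 ^ j) r * (rpow (/ G) (r - 1) * rpow (/ G ^ j) (r - 1))) with
      ((rpow 2 r * rpow (/ G) (r - 1)) * (rpow (2 ^ j) r * rpow (/ G ^ j) (r - 1))) by ring.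
    apply Rmult_le_compat; [apply Rmult_le_pos; assumption | apply Rmult_le_pos; assumption | assumption | assumption].
Qed.

(** Uniform convexity at the finer level [i'] bounds the gain there from below. Returning to level
    [i] multiplies the deviation by [2^(i - i' + 1)] and the diameter by [G^(i - i')], and
    [scale_factor] compares the two. *)
Lemma window_cost i a b t e : (a < b <= T)%nat -> Q i a -> Q i b -> okgap (eps (S i)) a b -> (a <= t <= b)%nat ->
  0 < e -> off e t a b -> exists i' u v, (i' <= i)%nat /\ (a <= u /\ u < v /\ v <= b)%nat /\ Q i' u /\ Q i' v /\
    okgap (eps (S i')) u v /\
    c * rpow e r <= rpow 2 r * (1 / 2) ^ (i - i') * (plen (Q i') u v - dist (f u) (f v)) * rpow (eps (S i)) (r - 1).
Proof.
  intros Hab Qa Qb Hg Ht He Hoff.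
  destruct (deviation_window i a b t e Hab Qa Qb Hg Ht He Hoff) as [i' [u [v [s [H1 [H2 [Qu [Qv [Qs [Og Of]]]]]]]]]].
  exists i', u, v. splits; auto; try lia.
  set (j := (i - i')%nat) in *.
  destruct (excess (f u) (f s) (f v) (eps (S i')) (eps_pos _)) as [l [Hl Ex]]; [apply Og; lia | apply Og; lia|].
  specialize (Of l Hl). set (g := plen (Q i') u v - dist (f u) (f v)).
  assert (Hgn : dist (f u) (f s) + dist (f s) (f v) - dist (f u) (f v) <= g).
  { unfold g. rewrite (plen_split (Q i') u s v) by (auto; lia).
    pose proof (plen_ge (Q i') u s ltac:(lia) Qs). pose proof (plen_ge (Q i') s v ltac:(lia) Qv). lra. }
  assert (Hg0 : 0 <= g) by (pose proof (dist_triangle (f u) (f s) (f v)); lra).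
  pose proof (rpow_ge0 (eps (S i')) (r - 1)) as E0.
  assert (K1 : c * rpow (e * (1 / 2) ^ (j + 1)) r <= g * rpow (eps (S i')) (r - 1)).
  { apply Rle_trans with (c * rpow (dist (f s) (comb l (f u) (f v))) r).
    - apply Rmult_le_compat_l; [lra|]. apply rpow_le; lra.
    - eapply Rle_trans; [exact Ex|]. apply Rmult_le_compat_r; assumption. }
  assert (P2 : 0 < 2 ^ j) by (apply pow_lt; lra). assert (PG : 0 < G ^ j) by (apply pow_lt; lra).
  assert (Ee : e = 2 * 2 ^ j * (e * (1 / 2) ^ (j + 1))).
  { rewrite pow_add. simpl. replace (2 * 2 ^ j * (e * ((1 / 2) ^ j * (1 / 2 * 1)))) with (e * (2 ^ j * (1 / 2) ^ j)) by field.
    rewrite <- Rpow_mult_distr. replace (2 * (1 / 2)) with 1 by lra. rewrite pow1. ring. }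
  assert (Eeps : eps (S i') = / G ^ j * eps (S i)).
  { rewrite (eps_pow i j) by (unfold j; lia). replace (i - j)%nat with i' by (unfold j; lia). field. lra. }
  assert (0 <= e * (1 / 2) ^ (j + 1)) by (apply Rmult_le_pos; [lra | apply pow_le; lra]).
  rewrite Ee, !rpow_mul by lra.
  assert (HGj : 0 <= / G ^ j) by (left; apply Rinv_0_lt_compat; assumption).
  assert (HEi : 0 <= eps (S i)) by (left; apply eps_pos).
  rewrite Eeps, (rpow_mul (/ G ^ j) (eps (S i))) in K1 by assumption.
  pose proof (scale_factor j) as SF. pose proof (rpow_ge0 2 r). pose proof (rpow_ge0 (2 ^ j) r).
  pose proof (rpow_ge0 (/ G ^ j) (r - 1)). pose proof (rpow_ge0 (eps (S i)) (r - 1)).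
  apply Rle_trans with (rpow 2 r * rpow (2 ^ j) r * (g * (rpow (/ G ^ j) (r - 1) * rpow (eps (S i)) (r - 1)))).
  - replace (c * (rpow 2 r * rpow (2 ^ j) r * rpow (e * (1 / 2) ^ (j + 1)) r)) with
      (rpow 2 r * rpow (2 ^ j) r * (c * rpow (e * (1 / 2) ^ (j + 1)) r)) by ring.
    apply Rmult_le_compat_l; [apply Rmult_le_pos; assumption | assumption].
  - replace (rpow 2 r * rpow (2 ^ j) r * (g * (rpow (/ G ^ j) (r - 1) * rpow (eps (S i)) (r - 1)))) with
      ((rpow 2 r * g * rpow (eps (S i)) (r - 1)) * (rpow (2 ^ j) r * rpow (/ G ^ j) (r - 1))) by ring.
    replace (rpow 2 r * (1 / 2) ^ j * g * rpow (eps (S i)) (r - 1)) with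
      ((rpow 2 r * g * rpow (eps (S i)) (r - 1)) * (1 / 2) ^ j) by ring.
    apply Rmult_le_compat_l; [|assumption]. apply Rmult_le_pos; [apply Rmult_le_pos|]; assumption.
Qed.

(** The windows of one level are sorted by the finer level at which their deviation is seen and
    coloured with [N + 1] colours; those of one class are disjoint, and their gains are bounded by
    one drop. The geometric factor permits the sum over the levels. *)
Lemma arcs_sum {W} (I : nat -> list W) (a b t : W -> nat) (e : W -> R) (N n : nat) :
  (forall i, NoDup (I i)) ->
  (forall i x, In x (I i) -> window (Q i) a b x /\ okgap (eps (S i)) (a x) (b x) /\ (a x <= t x <= b x)%nat /\
     0 < e x /\ off (e x) (t x) (a x) (b x)) ->
  (forall i x, In x (I i) -> (length (filter (fun y => if dec (~ apart a b x y) then true else false) (I i)) <= N)%nat) ->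
  c * sumL (fun i => sumL (fun x => rpow (e x) r / rpow (eps (S i)) (r - 1)) (I i)) (seq 0 n) <=
  rpow 2 r * INR (S N) * (2 * (plen (fun _ => True) 0 T + INR n * zeta)).
Proof.
  intros ND HI HN.
  assert (Lev : forall i, c * sumL (fun x => rpow (e x) r / rpow (eps (S i)) (r - 1)) (I i) <=
     rpow 2 r * INR (S N) * sumL (fun i' => (1 / 2) ^ (i - i') * drop i') (seq 0 (S i))).
  { intros i.
    destruct (choice (fun x (q : nat * (nat * nat)) => In x (I i) -> let '(i', (u, v)) := q in (i' <= i)%nat /\
       (a x <= u /\ u < v /\ v <= b x)%nat /\ Q i' u /\ Q i' v /\ okgap (eps (S i')) u v /\
       c * rpow (e x) r <= rpow 2 r * (1 / 2) ^ (i - i') * (plen (Q i') u v - dist (f u) (f v)) * rpow (eps (S i)) (r - 1))) as [q Hq].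
    { intros x. destruct (classic (In x (I i))) as [Hx|Hx]; [|exists (0, (0, 0))%nat; tauto].
      destruct (HI i x Hx) as [[W1 [W2 W3]] [W4 [W5 [W6 W7]]]].
      destruct (window_cost i (a x) (b x) (t x) (e x) W1 W2 W3 W4 W5 W6 W7) as [i' [u [v H]]]. exists (i', (u, v)). auto. }
    set (lv := fun x => fst (q x)). set (ua := fun x => fst (snd (q x))). set (vb := fun x => snd (snd (q x))).
    assert (Hq' : forall x, In x (I i) -> (lv x <= i)%nat /\ (a x <= ua x /\ ua x < vb x /\ vb x <= b x)%nat /\ Q (lv x) (ua x) /\
       Q (lv x) (vb x) /\ okgap (eps (S (lv x))) (ua x) (vb x) /\
       c * rpow (e x) r <= rpow 2 r * (1 / 2) ^ (i - lv x) * gain (Q (lv x)) ua vb x * rpow (eps (S i)) (r - 1)).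
    { intros x Hx. specialize (Hq x Hx). unfold lv, gain, ua, vb. destruct (q x) as [i' [u v]]. exact Hq. }
    destruct (coloring (fun x y => ~ apart a b x y) N (I i) (ND i) (HN i)) as [col [C1 C2]].
    pose proof (rpow_ge0 2 r) as R2.
    apply Rle_trans with (sumL (fun x => rpow 2 r * ((1 / 2) ^ (i - lv x) * gain (Q (lv x)) ua vb x)) (I i)).
    { rewrite <- sumL_scal. apply sumL_le. intros x Hx. destruct (Hq' x Hx) as [_ [_ [_ [_ [_ K]]]]].
      assert (0 < rpow (eps (S i)) (r - 1)) by (apply rpow_pos, eps_pos).
      apply (Rmult_le_reg_r (rpow (eps (S i)) (r - 1))); [assumption|].
      replace (c * (rpow (e x) r / rpow (eps (S i)) (r - 1)) * rpow (eps (S i)) (r - 1)) with (c * rpow (e x) r) by (field; lra). lra. }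
    rewrite sumL_scal, Rmult_assoc. apply Rmult_le_compat_l; [assumption|].
    rewrite (sum_by_color _ lv i (I i)) by (intros x Hx; apply Hq', Hx).
    rewrite <- sumL_scal. apply sumL_le. intros i' Hi'. apply in_seq in Hi'.
    set (J := filter (fun x => if dec (lv x = i') then true else false) (I i)).
    rewrite (sumL_ext _ (fun x => (1 / 2) ^ (i - i') * gain (Q i') ua vb x)).
    2:{ intros x Hx. apply in_filter_dec in Hx. destruct Hx as [_ E]. rewrite E. reflexivity. }
    rewrite sumL_scal. replace (INR (S N) * ((1 / 2) ^ (i - i') * drop i')) with ((1 / 2) ^ (i - i') * (drop i' * INR (S N))) by ring.
    apply Rmult_le_compat_l; [apply pow_le; lra|].
    rewrite (sum_by_color _ col N J) by (intros x Hx; apply in_filter_dec in Hx; apply C1, Hx).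
    replace (S N) with (length (seq 0 (S N))) at 2 by apply length_seq. rewrite <- sumL_const.
    apply sumL_le. intros k _. apply window_gain.
    - apply NoDup_filter, NoDup_filter, ND.
    - intros x Hx. apply in_filter_dec in Hx. destruct Hx as [Hx _]. apply in_filter_dec in Hx. destruct Hx as [Hx El].
      destruct (Hq' x Hx) as [_ [P [Q1 [Q2 _]]]]. rewrite El in *. destruct (HI i x Hx) as [[? _] _].
      split; [lia | split; assumption].
    - intros x Hx. apply in_filter_dec in Hx. destruct Hx as [Hx _]. apply in_filter_dec in Hx. destruct Hx as [Hx El].
      destruct (Hq' x Hx) as [_ [_ [_ [_ [Q3 _]]]]]. rewrite El in Q3. exact Q3.
    - intros x y Hx Hy Nxy. apply in_filter_dec in Hx, Hy. destruct Hx as [Hx Ex], Hy as [Hy Ey].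
      apply in_filter_dec in Hx, Hy. destruct Hx as [Hx _], Hy as [Hy _].
      assert (A : apart a b x y).
      { apply NNPP. intros NA. apply (C2 x y Hx Hy Nxy NA); [|congruence]. unfold apart in *. lia. }
      destruct (Hq' x Hx) as [_ [Px _]]. destruct (Hq' y Hy) as [_ [Py _]]. unfold apart in *. lia. }
  rewrite <- sumL_scal.
  eapply Rle_trans; [apply sumL_le; intros i _; apply Lev|].
  rewrite sumL_scal. pose proof (rpow_ge0 2 r). pose proof (pos_INR (S N)).
  apply Rmult_le_compat_l; [apply Rmult_le_pos; assumption|].
  pose proof (sumL_nested drop n drop_ge0). pose proof (drop_sum n). lra.
Qed.

End Sum.
End Sampled.
End Arcs.

(** * Balls crossed by two strands *)

Section Junction.
Context {p : R} {Hp : Exponent p}.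

Definition far_line (D : R) (z P Q : lp p) : Prop := forall t, D <= dist z (comb t P Q).

(** The distance to a line is convex along the chord, so it cannot be less than [D] on both sides of
    a point where it is at least [D]. *)
Lemma line_convex D (A B P Q : lp p) mu : 0 <= mu <= 1 -> far_line D (comb mu A B) P Q ->
  (forall l, 0 <= l <= mu -> far_line D (comb l A B) P Q) \/ (forall l, mu <= l <= 1 -> far_line D (comb l A B) P Q).
Proof.
  intros Hmu H. apply NNPP. intros N. apply not_or_and in N. destruct N as [N1 N2].
  apply not_all_ex_not in N1. destruct N1 as [l1 N1]. apply imply_to_and in N1. destruct N1 as [L1 N1].
  apply not_all_ex_not in N1. destruct N1 as [t1 N1]. apply Rnot_le_lt in N1.
  apply not_all_ex_not in N2. destruct N2 as [l2 N2]. apply imply_to_and in N2. destruct N2 as [L2 N2].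
  apply not_all_ex_not in N2. destruct N2 as [t2 N2]. apply Rnot_le_lt in N2.
  destruct (Rle_lt_dec l2 l1) as [E|E].
  - assert (l1 = mu) by lra. subst l1. specialize (H t1). lra.
  - set (th := (mu - l1) / (l2 - l1)).
    assert (Hth : 0 <= th <= 1) by (apply div_unit; lra).
    assert (Eth : (1 - th) * l1 + th * l2 = mu) by (unfold th; field; lra).
    specialize (H ((1 - th) * t1 + th * t2)). rewrite <- Eth, <- !comb_comb in H.
    pose proof (dist_comb_comb th (comb l1 A B) (comb l2 A B) (comb t1 P Q) (comb t2 P Q) Hth) as K.
    set (d1 := dist (comb l1 A B) (comb t1 P Q)) in *. set (d2 := dist (comb l2 A B) (comb t2 P Q)) in *.
    assert ((1 - th) * d1 + th * d2 < D); [|lra].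
    destruct (Req_dec th 1) as [E1|E1]; [rewrite E1; lra|].
    assert ((1 - th) * d1 < (1 - th) * D) by (apply Rmult_lt_compat_l; lra).
    assert (th * d2 <= th * D) by (apply Rmult_le_compat_l; lra). lra.
Qed.

Variable rho : R.
Hypothesis rho_pos : 0 < rho.

(* A flat arc may first run backwards; [c] is the time from which it stays ahead of its starting point. *)
Lemma half_far (g : nat -> lp p) n (A B : lp p) (lam : nat -> R) h Dst :
  (forall s, dist (g s) (g (S s)) <= 2 * rho \/ (n <= s)%nat) ->
  (forall s, (s <= n)%nat -> 0 <= lam s <= 1 /\ dist (g s) (comb (lam s) A B) <= h) -> g n = B ->
  2 * h < Dst -> Dst <= dist (g 0%nat) B ->
  exists c, (c <= n)%nat /\ (forall s, (c <= s <= n)%nat -> lam 0%nat <= lam s) /\ Dst - (2 * rho + 4 * h) <= dist (g c) B.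
Proof.
  intros Hstep Hlam HB HD HDst.
  destruct (nat_last (fun s => lam s <= lam 0%nat) 0 n ltac:(lia) (Rle_refl _)) as [s1 [S1 [S2 S3]]].
  destruct (Hlam 0%nat ltac:(lia)) as [L0 D0]. pose proof (dist_nonneg A B) as Len.
  destruct (Nat.eq_dec s1 n) as [->|N].
  - exfalso. destruct (Hlam n (le_n _)) as [Ln Dn]. rewrite HB, dist_sym, dist_comb_r in Dn by assumption.
    pose proof (dist_triangle (g 0%nat) (comb (lam 0%nat) A B) B) as Tr. rewrite dist_comb_r in Tr by assumption. nra.
  - exists (S s1). split; [lia|]. split.
    + intros s Hs. assert (~ lam s <= lam 0%nat) by (apply S3; lia). lra.
    + destruct (Hlam s1 ltac:(lia)) as [Ls Ds]. destruct (Hlam (S s1) ltac:(lia)) as [Lc Dc].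
      assert (Q : ~ lam (S s1) <= lam 0%nat) by (apply S3; lia).
      destruct (Hstep s1) as [St|St]; [|lia].
      pose proof (dist_triangle (comb (lam s1) A B) (g s1) (comb (lam (S s1)) A B)) as T1.
      pose proof (dist_triangle (g s1) (g (S s1)) (comb (lam (S s1)) A B)) as T2.
      rewrite (dist_sym (comb (lam s1) A B) (g s1)) in T1.
      rewrite dist_comb2, Rabs_left1 in T1 by lra.
      pose proof (dist_triangle (g 0%nat) (comb (lam 0%nat) A B) B) as T3.
      pose proof (dist_triangle (comb (lam 0%nat) A B) (comb (lam (S s1)) A B) B) as T4.
      pose proof (dist_triangle (comb (lam (S s1)) A B) (g (S s1)) B) as T5.
      rewrite dist_comb2, Rabs_left1 in T4 by lra. rewrite (dist_sym (comb (lam (S s1)) A B) (g (S s1))) in T5.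
      assert (- (lam 0%nat - lam (S s1)) * dist A B <= - (lam s1 - lam (S s1)) * dist A B) by (apply Rmult_le_compat_r; lra).
      lra.
Qed.

Variables (F : list (lp p)) (f : nat -> lp p) (T : nat).
Hypothesis f_step : forall t, dist (f t) (f (S t)) <= 2 * rho.
Hypothesis f_in : forall t, In (f t) F.

(** The last time before [t0] and the first time after it at distance at least [r] are moved
    outwards to sampling times; this changes distances by at most [eps]. *)
Lemma exit_window S eps t0 tl tr r : valid f T eps S -> (tl <= t0 <= tr)%nat -> (tr <= T)%nat -> 0 < r ->
  r <= dist (f t0) (f tl) -> r <= dist (f t0) (f tr) ->
  exists a b, (a < b <= T)%nat /\ (a <= t0 <= b)%nat /\ S a /\ S b /\
    (forall t, (a <= t <= b)%nat -> dist (f t0) (f t) <= r + 2 * rho + eps) /\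
    r - eps <= dist (f t0) (f a) /\ r - eps <= dist (f t0) (f b).
Proof.
  intros [V0 [VT V]] Ht HtrT Hr Hl Hrr. set (x := f t0).
  assert (Hx : ~ r <= dist x (f t0)) by (unfold x; rewrite dist_refl; lra).
  destruct (nat_last (fun t => r <= dist x (f t)) tl t0 ltac:(lia) Hl) as [a0 [A1 [A2 A3]]].
  destruct (nat_first (fun t => r <= dist x (f t)) t0 tr ltac:(lia) Hrr) as [b0 [B1 [B2 B3]]].
  assert (Na : a0 <> t0) by (intros ->; contradiction). assert (Nb : b0 <> t0) by (intros ->; contradiction).
  destruct (nat_last S 0 a0 ltac:(lia) V0) as [a [C1 [C2 C3]]].
  destruct (nat_first S b0 T ltac:(lia) VT) as [b [E1 [E2 E3]]].
  (* With the next sampling times [a'] and [b'] on the inner side, [[a, a']] and [[b', b]] are gaps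
     of [S]. *)
  destruct (nat_first S (Datatypes.S a0) T ltac:(lia) VT) as [a' [G1 [G2 G3]]].
  destruct (nat_last S 0 (b0 - 1) ltac:(lia) V0) as [b' [K1 [K2 K3]]].
  assert (Oa : okgap f eps a a').
  { apply V; auto; [lia|]. intros t Htt St. destruct (Nat.le_gt_cases t a0); [apply (C3 t); [lia | assumption]|].
    apply (G3 t); [lia | assumption]. }
  assert (Ob : okgap f eps b' b).
  { apply V; auto; [lia|]. intros t Htt St. destruct (Nat.lt_ge_cases t b0); [apply (K3 t); [lia | assumption]|].
    apply (E3 t); [lia | assumption]. }
  assert (In0 : forall t, (a0 < t < b0)%nat -> dist x (f t) < r).
  { intros t Htt. destruct (Nat.eq_dec t t0) as [->|]; [lra|]. apply Rnot_le_lt. destruct (Nat.lt_ge_cases t t0).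
    - apply (A3 t). lia.
    - apply (B3 t). lia. }
  assert (Da : dist x (f a0) <= r + 2 * rho).
  { pose proof (In0 (Datatypes.S a0) ltac:(lia)). pose proof (f_step a0).
    pose proof (dist_triangle x (f (Datatypes.S a0)) (f a0)) as Q. rewrite (dist_sym (f (Datatypes.S a0))) in Q. lra. }
  assert (Db : dist x (f b0) <= r + 2 * rho).
  { pose proof (In0 (b0 - 1)%nat ltac:(lia)). pose proof (f_step (b0 - 1)%nat) as Q0.
    replace (Datatypes.S (b0 - 1)) with b0 in Q0 by lia.
    pose proof (dist_triangle x (f (b0 - 1)%nat) (f b0)). lra. }
  exists a, b. splits; try lia; auto.
  - intros t Htt. destruct (Nat.le_gt_cases t a0).
    + pose proof (Oa a0 t ltac:(lia) ltac:(lia)). pose proof (dist_triangle x (f a0) (f t)). lra.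
    + destruct (Nat.lt_ge_cases t b0).
      * pose proof (In0 t ltac:(lia)). pose proof (Oa a a ltac:(lia) ltac:(lia)) as Q. rewrite dist_refl in Q. lra.
      * pose proof (Ob b0 t ltac:(lia) ltac:(lia)). pose proof (dist_triangle x (f b0) (f t)). lra.
  - pose proof (Oa a0 a ltac:(lia) ltac:(lia)). pose proof (dist_triangle x (f a) (f a0)) as Q.
    rewrite (dist_sym (f a)) in Q. lra.
  - pose proof (Ob b0 b ltac:(lia) ltac:(lia)). pose proof (dist_triangle x (f b) (f b0)) as Q.
    rewrite (dist_sym (f b)) in Q. lra.
Qed.

Definition near_seg (h : R) (a b : nat) : Prop := forall t, (a <= t <= b)%nat -> exists l, 0 <= l <= 1 /\ dist (f t) (comb l (f a) (f b)) <= h.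

Definition visits (a b : nat) (B : block (V := lp p)) : Prop := exists t, (a <= t <= b)%nat /\ fst B (f t).

(** The point [f t0] is near the first chord and at distance [k1] from both of its ends, so this
    chord has length at least [2 (k1 - h)]. A large part of the second arc stays at distance at
    least [D - 2 h] from the line of the first, and a block of diameter less than [D - 3 h] cannot
    meet both; hence the crossing costs add. *)
Lemma junction_content dl P a t0 b a' t1 b' h k1 k2 D :
  cover dist F dl P -> (a <= t0 <= b)%nat -> (a' <= t1 <= b')%nat -> near_seg h a b -> near_seg h a' b' ->
  k1 <= dist (f t0) (f a) -> k1 <= dist (f t0) (f b) -> k2 <= dist (f t1) (f a') -> k2 <= dist (f t1) (f b') ->
  far_line D (f t1) (f a) (f b) -> dl < D - 3 * h -> 2 * h < k2 ->
  2 * (k1 - h) + (k2 - (2 * rho + 4 * h)) <= sumL (fun B => ind (visits a b B \/ visits a' b' B) * bcost rho B) P.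
Proof.
  intros HP Ht0 Ht1 N1 N2 Ka Kb Ka' Kb' HL Hdl Hk2.
  assert (C1 : 2 * (k1 - h) <= sumL (fun B => ind (visits a b B) * bcost rho B) P).
  { apply Rle_trans with (dist (f a) (f b)).
    - destruct (N1 t0 Ht0) as [l [Hl Dl]].
      pose proof (dist_comb_l l (f a) (f b) Hl). pose proof (dist_comb_r l (f a) (f b) Hl).
      pose proof (dist_triangle (f t0) (comb l (f a) (f b)) (f a)) as T1.
      pose proof (dist_triangle (f t0) (comb l (f a) (f b)) (f b)).
      rewrite (dist_sym (comb l (f a) (f b)) (f a)) in T1. lra.
    - apply (cross dist dist_sym dist_refl dist_triangle F rho f rho_pos f_step f_in dl); [lia | assumption|].
      intros B t _ Ht Bt. exists t. auto. }
  (* A chord leaves a convex neighbourhood of the line at most once, so that half of it stays away. *)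
  assert (Far : exists c e, (a' <= c <= e)%nat /\ (e <= b')%nat /\ k2 - (2 * rho + 4 * h) <= dist (f c) (f e) /\
     forall s, (c <= s <= e)%nat -> far_line (D - 2 * h) (f s) (f a) (f b)).
  { destruct (choice (fun t l => (a' <= t <= b')%nat -> 0 <= l <= 1 /\ dist (f t) (comb l (f a') (f b')) <= h)) as [lam Hlam].
    { intros t. destruct (classic (a' <= t <= b')%nat) as [Q|Q]; [|exists 0; tauto]. destruct (N2 t Q) as [l Hl]. exists l. auto. }
    destruct (Hlam t1 Ht1) as [L1 D1].
    assert (FL : far_line (D - h) (comb (lam t1) (f a') (f b')) (f a) (f b)).
    { intros t. pose proof (HL t). pose proof (dist_triangle (f t1) (comb (lam t1) (f a') (f b')) (comb t (f a) (f b))). lra. }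
    assert (FS : forall s, (a' <= s <= b')%nat -> far_line (D - h) (comb (lam s) (f a') (f b')) (f a) (f b) ->
       far_line (D - 2 * h) (f s) (f a) (f b)).
    { intros s Hs Q t. specialize (Q t). destruct (Hlam s Hs) as [_ Ds].
      pose proof (dist_triangle (comb (lam s) (f a') (f b')) (f s) (comb t (f a) (f b))) as Tr.
      rewrite (dist_sym _ (f s)) in Tr. lra. }
    destruct (line_convex (D - h) (f a') (f b') (f a) (f b) (lam t1) L1 FL) as [Q|Q].
    - destruct (half_far (fun s => f (t1 - s)%nat) (t1 - a') (f b') (f a') (fun s => 1 - lam (t1 - s)%nat) h k2) as [c [H1 [H2 H3]]].
      + intros s. destruct (Nat.lt_ge_cases s (t1 - a')) as [Hs|Hs]; [left | right; lia].
        pose proof (f_step (t1 - S s)%nat) as St. replace (S (t1 - S s)) with (t1 - s)%nat in St by lia. rewrite dist_sym. exact St.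
      + intros s Hs. destruct (Hlam (t1 - s)%nat ltac:(lia)) as [L2 D2]. split; [lra|].
        replace (comb (1 - lam (t1 - s)%nat) (f b') (f a')) with (comb (lam (t1 - s)%nat) (f a') (f b')) by vec. exact D2.
      + f_equal. lia.
      + assumption.
      + rewrite Nat.sub_0_r. assumption.
      + exists a', (t1 - c)%nat. splits; try lia.
        * rewrite dist_sym. exact H3.
        * intros s Hs. apply FS; [lia|]. apply Q. destruct (Hlam s ltac:(lia)) as [L2 _].
          specialize (H2 (t1 - s)%nat ltac:(lia)). replace (t1 - (t1 - s))%nat with s in H2 by lia. rewrite Nat.sub_0_r in H2. lra.
    - destruct (half_far (fun s => f (t1 + s)%nat) (b' - t1) (f a') (f b') (fun s => lam (t1 + s)%nat) h k2) as [c [H1 [H2 H3]]].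
      + intros s. left. pose proof (f_step (t1 + s)%nat) as St. rewrite <- plus_n_Sm. exact St.
      + intros s Hs. apply Hlam. lia.
      + f_equal. lia.
      + assumption.
      + rewrite Nat.add_0_r. assumption.
      + exists (t1 + c)%nat, b'. splits; try lia.
        * exact H3.
        * intros s Hs. apply FS; [lia|]. apply Q. destruct (Hlam s ltac:(lia)) as [L2 _].
          specialize (H2 (s - t1)%nat ltac:(lia)). replace (t1 + (s - t1))%nat with s in H2 by lia. rewrite Nat.add_0_r in H2. lra. }
  destruct Far as [c [e [Hc [He [Hd Hfar]]]]].
  assert (C2 : k2 - (2 * rho + 4 * h) <= sumL (fun B => ind (visits c e B) * bcost rho B) P).
  { eapply Rle_trans; [exact Hd|].
    apply (cross dist dist_sym dist_refl dist_triangle F rho f rho_pos f_step f_in dl); [lia | assumption|].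
    intros B t _ Ht Bt. exists t. auto. }
  eapply Rle_trans; [apply Rplus_le_compat; [exact C1 | exact C2]|]. rewrite <- sumL_plus. apply sumL_le. intros B HB.
  pose proof (bcost_ge0 dist F rho rho_pos dl P B HP HB) as B0. rewrite <- Rmult_plus_distr_r.
  apply Rmult_le_compat_r; [assumption|].
  destruct (classic (visits a b B)) as [V1|V1].
  - rewrite (ind_true _ V1), (ind_true (visits a b B \/ visits a' b' B)) by auto. rewrite ind_false; [lra|].
    intros [s [Hs Bs]]. destruct V1 as [t [Ht Bt]]. destruct (N1 t Ht) as [l [Hl Dl]].
    destruct (proj2 HP B HB) as [HB1 HB2]. specialize (HB2 (f s) (f t) Bs Bt).
    pose proof (Hfar s Hs l) as Q. pose proof (dist_triangle (f s) (f t) (comb l (f a) (f b))). lra.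
  - rewrite (ind_false _ V1). destruct (classic (visits c e B)) as [V2|V2].
    + rewrite (ind_true _ V2), ind_true; [lra|]. right. destruct V2 as [t [Ht Bt]]. exists t. split; [lia | assumption].
    + rewrite (ind_false _ V2). pose proof (ind_ge0 (visits a b B \/ visits a' b' B)). lra.
Qed.

(** Around each centre the blocks are merged into one of diameter [(2 K + 4) Rk]; the allowance
    [4 rho] and the gain [Rk] fit into the remaining [2 Rk]. *)
Lemma junction_gain {W} (Y : list W) (ctr : W -> lp p) (a b a' b' : W -> nat) K Rk dl : 0 < Rk -> 1 <= K -> 0 <= dl <= Rk ->
  rho <= Rk / 100 -> NoDup Y ->
  (forall x y, In x Y -> In y Y -> x <> y -> (2 * K + 4) * Rk < dist (ctr x) (ctr y)) ->
  (forall x t, In x Y -> (a x <= t <= b x \/ a' x <= t <= b' x)%nat -> dist (ctr x) (f t) <= (K + 1) * Rk) ->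
  (forall x P, In x Y -> cover dist F dl P ->
     (2 * K + 6) * Rk <= sumL (fun B => ind (visits (a x) (b x) B \/ visits (a' x) (b' x) B) * bcost rho B) P) ->
  Rk * INR (length Y) <= content dist F rho dl - content dist F rho ((2 * K + 4) * Rk).
Proof.
  intros HR HK Hdl Hrho ND Hsep Hball Hcont.
  cut (content dist F rho ((2 * K + 4) * Rk) + Rk * INR (length Y) <= content dist F rho dl); [lra|].
  assert (D1 : Rk <= (2 * K + 4) * Rk) by nra.
  apply (content_spec dist dist_refl F rho rho_pos dl ltac:(lra)). intros P HP.
  set (Bj := fun x (B : block (V := lp p)) => visits (a x) (b x) B \/ visits (a' x) (b' x) B).
  assert (Pt : forall x B y, In x Y -> In B P -> Bj x B -> fst B y -> dist (ctr x) y <= (K + 2) * Rk).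
  { intros x B y Hx HB HBj By.
    assert (exists t, (a x <= t <= b x \/ a' x <= t <= b' x)%nat /\ fst B (f t)) as [t [Ht Bt]].
    { destruct HBj as [[t [Ht Bt]]|[t [Ht Bt]]]; exists t; auto. }
    destruct (proj2 HP B HB) as [HB1 HB2]. specialize (HB2 (f t) y Bt By). specialize (Hball x t Hx Ht).
    pose proof (dist_triangle (ctr x) (f t) y). lra. }
  pose proof (merge dist dist_refl F rho rho_pos Y Bj (fun _ => Rk) dl ((2 * K + 4) * Rk) P) as M.
  rewrite sumL_const in M. cut (content dist F rho ((2 * K + 4) * Rk) <= cost rho P - Rk * INR (length Y)); [lra|].
  apply M; auto; try lra.
  - intros B x y HB Hx Hy Bx By. apply NNPP. intros N.
    assert (exists z, fst B z) as [z Bz].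
    { destruct Bx as [[t [Ht Bt]]|[t [Ht Bt]]]; exists (f t); assumption. }
    pose proof (Pt x B z Hx HB Bx Bz). pose proof (Pt y B z Hy HB By Bz). specialize (Hsep x y Hx Hy N).
    pose proof (dist_triangle (ctr x) z (ctr y)) as Q. rewrite (dist_sym z (ctr y)) in Q. lra.
  - intros x B B' y y' Hx HB HB' Bx Bx' By By'. pose proof (Pt x B y Hx HB Bx By). pose proof (Pt x B' y' Hx HB' Bx' By').
    pose proof (dist_triangle y (ctr x) y') as Q. rewrite (dist_sym y (ctr x)) in Q. lra.
  - intros x Hx. apply Rle_trans with ((2 * K + 6) * Rk); [lra | exact (Hcont x P Hx HP)].
Qed.

End Junction.

(** * One residue class of scales *)

Section Residue_class.
Context {p : R} {Hp : Exponent p}.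
Variables (A : R) (J N0 : nat) (k0 : Z) (rho : R) (F : list (lp p)) (f : nat -> lp p) (M : nat) (X : nat -> list (lp p)).
(** Level 0 is the finest scale [2^-k0]; each level multiplies it by [2^J]. *)
Definition scale (i : nat) : R := pw (k0 - Z.of_nat J * Z.of_nat i).
Let K := 2 * A + 10.
Let Lam := 2 * K + 10.
(** Three periods of the walk: a visit in the middle one has visits to every other point of [F]
    before and after it. *)
Let T := (3 * M)%nat.
Hypothesis A_gt1 : 1 < A.
Hypothesis J_pos : (1 <= J)%nat.
Hypothesis N0_big : 16 * (4 * Lam + 2) <= INR N0.
Hypothesis rho_pos : 0 < rho.
Hypothesis rho_small : rho <= scale 0 / 100.
Hypothesis f_step : forall t, dist (f t) (f (S t)) <= 2 * rho.
Hypothesis f_in : forall t, In (f t) F.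
Hypothesis f_periodic : forall t, f (t + M)%nat = f t.
Hypothesis f_onto : forall z, In z F -> exists t, (t < M)%nat /\ f t = z.
Hypothesis X_nodup : forall i, NoDup (X i).
Hypothesis X_incl : forall i, incl (X i) F.
Hypothesis X_sep : forall i x y, In x (X i) -> In y (X i) -> x <> y -> scale i / 2 <= dist x y.
Hypothesis X_far : forall i x, In x (X i) -> exists z, In z F /\ K * scale i <= dist x z.

Lemma scale_pos i : 0 < scale i.
Proof. apply pw_pos. Qed.

Lemma scale_succ i : scale (S i) = 2 ^ J * scale i.
Proof.
  unfold scale at 2. replace (k0 - Z.of_nat J * Z.of_nat i)%Z with ((k0 - Z.of_nat J * Z.of_nat (S i)) + Z.of_nat J)%Z by lia.
  rewrite pw_add. fold (scale (S i)). replace (2 ^ J * (scale (S i) * (1 / 2) ^ J)) with (scale (S i) * (2 ^ J * (1 / 2) ^ J)) by ring.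
  rewrite <- Rpow_mult_distr. replace (2 * (1 / 2)) with 1 by lra. rewrite pow1. ring.
Qed.

Lemma rho_le_scale i : rho <= scale i / 100.
Proof.
  induction i; [assumption|]. rewrite scale_succ. assert (1 <= 2 ^ J) by (apply pow_R1_Rle; lra). pose proof (scale_pos i). nra.
Qed.

Let cont := content dist F rho.

(** Distinct levels are distinct dyadic scales, so the increments over [m] dyadic steps telescope
    with multiplicity at most [m]. *)
Lemma content_scales b m n : 0 <= b ->
  sumL (fun i => cont (b * (1 / 2) ^ m * scale i) - cont (b * scale i)) (seq 0 n) <= INR m * (4 * rho * INR (length F)).
Proof.
  intros Hb.
  assert (B0 : forall z, 0 <= b * pw z) by (intros z; apply Rmult_le_pos; [assumption | left; apply pw_pos]).
  pose proof (telescope (fun z => cont (b * pw z)) (4 * rho * INR (length F)) m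
    (map (fun i => (k0 - Z.of_nat J * Z.of_nat i)%Z) (seq 0 n))) as H.
  rewrite sumL_map in H. eapply Rle_trans; [|apply H].
  - apply Req_le. apply sumL_ext. intros i _. rewrite pw_add. unfold scale.
    replace (b * (pw (k0 - Z.of_nat J * Z.of_nat i) * (1 / 2) ^ m)) with (b * (1 / 2) ^ m * pw (k0 - Z.of_nat J * Z.of_nat i)) by ring.
    reflexivity.
  - intros z. apply (content_antitone dist dist_refl F rho rho_pos); [apply B0|]. apply Rmult_le_compat_l; [assumption|].
    rewrite (pw_succ z). pose proof (pw_pos (z + 1)). lra.
  - intros z. split; [apply (content_ge0 dist dist_refl F rho rho_pos), B0 | apply (content_le dist dist_refl F rho rho_pos), B0].
  - apply FinFun.Injective_map_NoDup; [|apply seq_NoDup]. intros x y E. nia.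
Qed.

Lemma dense_total m n : (4 * Lam + 1) * (1 / 2) ^ m <= 1 / 32 ->
  sumL (fun i => scale i * sumL (fun x => ind (dense dist Lam (scale i) N0 (X i) x)) (X i)) (seq 0 n) <=
  64 * INR m * rho * INR (length F).
Proof.
  intros Hm. assert (HK : 12 <= K) by (unfold K; lra). assert (HL : 34 <= Lam) by (unfold Lam; lra).
  pose proof (content_scales (4 * Lam + 1) m n ltac:(lra)) as H.
  apply Rle_trans with (16 * sumL (fun i => cont ((4 * Lam + 1) * (1 / 2) ^ m * scale i) - cont ((4 * Lam + 1) * scale i)) (seq 0 n)); [|lra].
  rewrite <- sumL_scal. apply sumL_le. intros i _. pose proof (scale_pos i) as R0.
  assert (D : scale i / 16 * sumL (fun x => ind (dense dist Lam (scale i) N0 (X i) x)) (X i) <= cont (scale i / 32) - cont ((4 * Lam + 1) * scale i)).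
  { apply (dense_gain dist dist_sym dist_refl dist_triangle F rho f rho_pos f_step f_in Lam (scale i) N0 (X i)); auto; try lra.
    - apply rho_le_scale.
    - intros x Hx. destruct (f_onto x (X_incl i x Hx)) as [t [Ht Ex]]. destruct (X_far i x Hx) as [z [Hz Dz]].
      destruct (f_onto z Hz) as [t' [Ht' Ez]]. exists t, (t' + M)%nat. splits; [lia | assumption|].
      rewrite f_periodic, Ez. nra. }
  assert (cont (scale i / 32) <= cont ((4 * Lam + 1) * (1 / 2) ^ m * scale i)); [|lra].
  apply (content_antitone dist dist_refl F rho rho_pos).
  - apply Rmult_le_pos; [|lra]. apply Rmult_le_pos; [lra | apply pow_le; lra].
  - nra.
Qed.

Lemma trivially_valid : valid f T (scale 0 / 4) (fun _ => True).
Proof.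
  unfold valid. splits; auto. intros u v Huv _ _ N s s' Hs Hs'. pose proof (scale_pos 0).
  destruct (Nat.eq_dec v (S u)) as [->|Nv]; [|exfalso; apply (N (S u)); [lia | exact I]].
  assert (Cs : s = u \/ s = S u) by lia. assert (Cs' : s' = u \/ s' = S u) by lia. pose proof (f_step u).
  destruct Cs as [->| ->], Cs' as [->| ->]; rewrite ?dist_refl, 1?(dist_sym (f (S u)) (f u)); lra.
Qed.

Lemma walk_plen : plen f (fun _ => True) 0 T <= 2 * rho * INR T.
Proof.
  generalize T. intros n. induction n as [|t IH]; [unfold plen, pts; simpl; lra|].
  rewrite (plen_split f _ 0 t (S t)) by (auto; lia). rewrite (plen_gap f 0 _ t (S t)) by (auto; lia).
  rewrite S_INR. pose proof (f_step t). lra.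
Qed.

(* Applied with [y] the net point [x] itself, then with [y] a point far from the chord of the first arc. *)
Lemma arc_around Q zeta i x y : sampling f T (fun i => scale i / 4) zeta Q -> In x (X i) -> In y F -> forall r,
  0 < r -> dist x y + r + 1 / 2 * scale i <= (K + 1) * scale i -> (exists z, In z F /\ r <= dist y z) -> exists a t b,
  (a < b <= T)%nat /\ (a <= t <= b)%nat /\ Q i a /\ Q i b /\ f t = y /\
  (forall s, (a <= s <= b)%nat -> dist x (f s) <= (K + 1) * scale i) /\
  r - scale i / 4 <= dist y (f a) /\ r - scale i / 4 <= dist y (f b).
Proof.
  intros [_ HQ] Hx Hy r Hr Hxy [z [Hz Dz]]. destruct (f_onto y Hy) as [t0 [Ht0 E0]]. destruct (f_onto z Hz) as [t1 [Ht1 E1]].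
  assert (Ey : f (t0 + M)%nat = y) by (rewrite f_periodic; assumption).
  destruct (exit_window rho rho_pos f T f_step (Q i) (scale i / 4) (t0 + M) t1 (t1 + M + M) r) as [a [b [H1 [H2 [H3 [H4 [H5 [H6 H7]]]]]]]].
  - apply (proj1 (proj2 (HQ i))).
  - lia.
  - unfold T. lia.
  - assumption.
  - rewrite Ey, E1. assumption.
  - rewrite Ey, !f_periodic, E1. assumption.
  - rewrite Ey in *. exists a, (t0 + M)%nat, b. splits; auto; try lia.
    intros s Hs. specialize (H5 s Hs). pose proof (dist_triangle x y (f s)). pose proof (rho_le_scale i). pose proof (scale_pos i). lra.
Qed.

Section Arc_family.
Variables (r c : R) (n : nat) (Q : nat -> nat -> Prop).
Hypothesis r_ge2 : 2 <= r.
Hypothesis c_pos : 0 < c.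
Hypothesis J_big : 8 * (K + 2) <= 2 ^ J.
Hypothesis excess : forall (a z b : lp p) dl, 0 < dl -> dist a z <= dl -> dist z b <= dl ->
  exists t, 0 <= t <= 1 /\ c * rpow (dist z (comb t a b)) r <= (dist a z + dist z b - dist a b) * rpow dl (r - 1).
Hypothesis HQ : sampling f T (fun i => scale i / 4) (rho / (INR n + 1)) Q.

(** Two windows overlap only if their net points are within [Lam] scales, so a net point that is not
    dense has at most [N0] conflicts. A window has diameter at most [2 (K + 1)] scales, an
    admissible gap at the next level by the choice of [J]. *)
Lemma arc_total (I : nat -> list (lp p)) (a t b : nat -> lp p -> nat) (bt : nat -> lp p -> R) :
  (forall i, NoDup (I i)) -> (forall i, incl (I i) (X i)) ->
  (forall i x, In x (I i) -> ~ dense dist Lam (scale i) N0 (X i) x) ->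
  (forall i x, In x (I i) -> (a i x < b i x <= T)%nat /\ Q i (a i x) /\ Q i (b i x) /\ (a i x <= t i x <= b i x)%nat /\
     (forall s, (a i x <= s <= b i x)%nat -> dist x (f s) <= (K + 1) * scale i) /\ 0 < bt i x /\
     off f (bt i x * scale i / 8) (t i x) (a i x) (b i x)) ->
  c * (rpow (1 / 8) r / rpow (2 ^ J / 4) (r - 1)) * sumL (fun i => sumL (fun x => rpow (bt i x) r * scale i) (I i)) (seq 0 n) <=
  rpow 2 r * INR (S N0) * (2 * (2 * rho * INR T + rho)).
Proof.
  intros ND HI Hsp Hw. assert (HK : 12 <= K) by (unfold K; lra).
  set (fa := fun x : nat * lp p => a (fst x) (snd x)). set (fb := fun x : nat * lp p => b (fst x) (snd x)).
  assert (Common : forall i x y, In x (I i) -> In y (I i) -> ~ apart fa fb (i, x) (i, y) -> dist x y <= Lam * scale i).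
  { intros i x y Hx Hy NA. destruct (Hw i x Hx) as [W1 [_ [_ [_ [W5 _]]]]]. destruct (Hw i y Hy) as [V1 [_ [_ [_ [V5 _]]]]].
    unfold apart, fa, fb in NA. simpl in NA.
    specialize (W5 (Nat.max (a i x) (a i y)) ltac:(lia)). specialize (V5 (Nat.max (a i x) (a i y)) ltac:(lia)).
    pose proof (dist_triangle x (f (Nat.max (a i x) (a i y))) y) as Tr. rewrite (dist_sym (f _) y) in Tr.
    pose proof (scale_pos i). unfold Lam. lra. }
  assert (J8 : 8 <= 2 ^ J) by lra.
  pose proof (arcs_sum f T (fun i => scale i / 4) (rho / (INR n + 1))
    (fun i => ltac:(cbv beta; rewrite scale_succ; pose proof (scale_pos i); nra)) Q HQ r c (2 ^ J) r_ge2 c_pos J8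
    (fun i => ltac:(pose proof (scale_pos i); lra)) (fun i => ltac:(cbv beta; rewrite scale_succ; lra)) excess
    (fun i => map (pair i) (I i)) fa fb (fun x => t (fst x) (snd x))
    (fun x => bt (fst x) (snd x) * scale (fst x) / 8) N0 n) as S.
  assert (S' := fun H1 H2 H3 => S H1 H2 H3). clear S.
  eapply Rle_trans; [eapply Rle_trans; [|apply S']|].
  - rewrite Rmult_assoc. apply Req_le. f_equal. rewrite <- sumL_scal. apply sumL_ext. intros i _.
    rewrite sumL_map, <- sumL_scal. apply sumL_ext. intros x Hx. simpl.
    destruct (Hw i x Hx) as [_ [_ [_ [_ [_ [W6 _]]]]]]. pose proof (scale_pos i) as R0.
    rewrite scale_succ. replace (bt i x * scale i / 8) with (bt i x * (1 / 8 * scale i)) by lra.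
    replace (2 ^ J * scale i / 4) with (2 ^ J / 4 * scale i) by lra. rewrite !rpow_mul by lra.
    replace (rpow (scale i) r) with (scale i * rpow (scale i) (r - 1)).
    2:{ rewrite <- (rpow_1 (scale i)) at 1 by lra. rewrite <- rpow_add. f_equal. lra. }
    pose proof (rpow_pos (scale i) (r - 1) R0). pose proof (rpow_pos (2 ^ J / 4) (r - 1) ltac:(lra)). field. lra.
  - intros i. apply FinFun.Injective_map_NoDup; [intros x y E; congruence | apply ND].
  - intros i x Hx. apply in_map_iff in Hx. destruct Hx as [y [<- Hy]]. simpl.
    destruct (Hw i y Hy) as [W1 [W2 [W3 [W4 [W5 [W6 W7]]]]]]. pose proof (scale_pos i) as R0.
    unfold window, fa, fb. simpl. splits; auto; try lia.
    + intros s s' Hs Hs'. pose proof (W5 s Hs). pose proof (W5 s' Hs'). pose proof (dist_triangle (f s) y (f s')) as Tr.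
      rewrite (dist_sym (f s) y) in Tr. rewrite scale_succ. nra.
    + nra.
  - intros i x Hx. apply in_map_iff in Hx. destruct Hx as [y [<- Hy]].
    pose proof (Hsp i y Hy) as Sp. unfold dense, near_count in Sp. apply Nat.nle_gt in Sp.
    eapply Nat.le_trans; [|apply Nat.lt_le_incl, Sp].
    rewrite <- (length_map snd). apply NoDup_incl_length.
    + apply NoDup_map_in; [|apply NoDup_filter, FinFun.Injective_map_NoDup; [intros u v E; congruence | apply ND]].
      intros u v Hu Hv E. apply in_filter_dec in Hu, Hv. destruct Hu as [Hu _], Hv as [Hv _].
      apply in_map_iff in Hu, Hv. destruct Hu as [u' [<- _]], Hv as [v' [<- _]]. simpl in E. congruence.
    + intros z Hz. apply in_map_iff in Hz. destruct Hz as [u [<- Hu]]. apply in_filter_dec in Hu. destruct Hu as [Hu NA].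
      apply in_map_iff in Hu. destruct Hu as [z [<- Hz]]. simpl. apply in_filter_dec. split; [apply (HI i), Hz|].
      apply Common; assumption.
  - pose proof (rpow_ge0 2 r). pose proof (pos_INR (S N0)). pose proof walk_plen. pose proof (pos_INR n).
    apply Rmult_le_compat_l; [apply Rmult_le_pos; assumption|].
    assert (INR n * (rho / (INR n + 1)) <= rho); [|lra].
    replace (INR n * (rho / (INR n + 1))) with (rho - rho / (INR n + 1)) by (field; lra).
    assert (0 < rho / (INR n + 1)) by (apply Rdiv_lt_0_compat; lra). lra.
Qed.

End Arc_family.

(** * Pairs of flat arcs *)

Section Flat.
Variables (a t b a' t' b' : nat -> lp p -> nat) (bt : nat -> lp p -> R).

Definition flat_arcs i x : Prop :=
  ((a i x <= t i x <= b i x)%nat /\ (a' i x <= t' i x <= b' i x)%nat) /\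
  (forall s, (a i x <= s <= b i x \/ a' i x <= s <= b' i x)%nat -> dist x (f s) <= (K + 1) * scale i) /\
  (K * scale i - scale i / 4 <= dist (f (t i x)) (f (a i x)) /\ K * scale i - scale i / 4 <= dist (f (t i x)) (f (b i x))) /\
  (8 * scale i - scale i / 4 <= dist (f (t' i x)) (f (a' i x)) /\ 8 * scale i - scale i / 4 <= dist (f (t' i x)) (f (b' i x))) /\
  (near_seg f (bt i x * scale i / 8) (a i x) (b i x) /\ near_seg f (bt i x * scale i / 8) (a' i x) (b' i x)) /\
  far_line (bt i x * scale i) (f (t' i x)) (f (a i x)) (f (b i x)).

Lemma flat_level i m L : NoDup L -> incl L (X i) ->
  (forall x, In x L -> flat_arcs i x /\ ~ dense dist Lam (scale i) N0 (X i) x /\ (1 / 2) ^ (m + 1) < bt i x <= (1 / 2) ^ m) ->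
  scale i * INR (length L) <= INR N0 * (cont ((1 / 2) ^ m * scale i / 4) - cont ((2 * K + 4) * scale i)).
Proof.
  intros ND HI HL. assert (HK : 12 <= K) by (unfold K; lra). pose proof (scale_pos i) as R0.
  assert (Pm : 0 < (1 / 2) ^ m <= 1).
  { split; [apply pow_lt; lra|]. pose proof (pow_incr (1 / 2) 1 m ltac:(lra)) as Q0. rewrite pow1 in Q0. exact Q0. }
  (* Blocks must be smaller than [5/8] of [bt i x * scale i], where [bt i x > 2^-(m+1)]; a quarter
     of [2^-m] scales is admissible since [1/4 < 5/16]. *)
  set (dl := (1 / 2) ^ m * scale i / 4).
  assert (Hdl : 0 < dl <= scale i / 4) by (unfold dl; nra).
  destruct (greedy dist dist_sym dist_refl (Lam * scale i) L ltac:(unfold Lam; nra)) as [Y [Y1 [Y2 [Y3 Y4]]]].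
  assert (Gain : scale i * INR (length Y) <= cont dl - cont ((2 * K + 4) * scale i)).
  { apply (junction_gain rho rho_pos F f Y (fun x => x) (a i) (b i) (a' i) (b' i) K (scale i) dl); auto; try lra.
    - apply rho_le_scale.
    - intros x y Hx Hy N. specialize (Y3 x y Hx Hy N). unfold Lam in Y3. nra.
    - intros x s Hx. destruct (HL x (Y1 x Hx)) as [[_ [W _]] _]. apply W.
    - intros x P Hx HP. destruct (HL x (Y1 x Hx)) as [[[W1 W2] [_ [[W3 W4] [[W5 W6] [[W7 W8] W9]]]]] [_ [B1 B2]]].
      rewrite pow_add in B1. simpl in B1.
      assert (Hh : dl < bt i x * scale i - 3 * (bt i x * scale i / 8)).
      { assert ((1 / 2) ^ m * (1 / 2 * 1) * scale i < bt i x * scale i) by (apply Rmult_lt_compat_r; lra).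
        assert (0 < (1 / 2) ^ m * scale i) by (apply Rmult_lt_0_compat; lra). unfold dl. lra. }
      assert (Hb : bt i x * scale i <= scale i) by nra.
      pose proof (junction_content rho rho_pos F f f_step f_in dl P _ _ _ _ _ _ _ _ _ _ HP W1 W2 W7 W8 W3 W4 W5 W6 W9 Hh ltac:(nra)) as JC.
      eapply Rle_trans; [|exact JC]. pose proof (rho_le_scale i). lra. }
  (* Each point of [L] is within [Lam] scales of [Y], and a point that is not dense has fewer than
     [N0] net points that close. *)
  apply Rle_trans with (scale i * (INR N0 * INR (length Y))).
  - apply Rmult_le_compat_l; [lra|]. rewrite <- (Rmult_1_l (INR (length L))), <- sumL_const.
    apply Rle_trans with (sumL (fun x => sumL (fun y => ind (dist y x <= Lam * scale i)) Y) L).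
    + apply sumL_le. intros x Hx. destruct (Y4 x Hx) as [y [Hy Dy]]. rewrite dist_sym in Dy.
      rewrite <- (ind_true (dist y x <= Lam * scale i) Dy).
      apply (sumL_in (fun y => ind (dist y x <= Lam * scale i))); [intros; apply ind_ge0 | assumption].
    + rewrite sumL_swap, <- sumL_const. apply sumL_le. intros y Hy.
      destruct (HL y (Y1 y Hy)) as [_ [Nd _]]. unfold dense, near_count in Nd. apply Nat.nle_gt, Nat.lt_le_incl, le_INR in Nd.
      eapply Rle_trans; [|exact Nd]. rewrite <- (Rmult_1_l (INR _)), <- sumL_const, sumL_filter.
      rewrite (sumL_ext _ (fun x => ind (dist y x <= Lam * scale i) * 1)) by (intros; ring).
      apply sumL_incl; [intros; apply Rmult_le_pos; [apply ind_ge0 | lra] | assumption | assumption].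
  - replace (scale i * (INR N0 * INR (length Y))) with (INR N0 * (scale i * INR (length Y))) by ring.
    apply Rmult_le_compat_l; [apply pos_INR | exact Gain].
Qed.

Lemma weighted_half_sum q n : 0 <= q -> sumL (fun m => (1 / 2) ^ m * (INR m + q)) (seq 0 n) <= 2 * (q + 1).
Proof.
  intros Hq. assert (E : sumL (fun m => (1 / 2) ^ m * (INR m + q)) (seq 0 n) = 2 * (q + 1) - 2 * (1 / 2) ^ n * (INR n + q + 1)).
  { induction n; [simpl; ring|]. rewrite seq_S, sumL_app, IHn, S_INR. simpl. field. }
  rewrite E. assert (0 <= (1 / 2) ^ n * (INR n + q + 1)); [|lra].
  apply Rmult_le_pos; [apply pow_le; lra | pose proof (pos_INR n); lra].
Qed.

Lemma dyadic_mesh v : 0 < v <= 1 -> exists m, (1 / 2) ^ (m + 1) < v <= (1 / 2) ^ m.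
Proof.
  intros [H0 H1]. destruct (half_pow_lt v H0) as [n Hn].
  destruct (nat_first (fun m => (1 / 2) ^ m < v) 0 n ltac:(lia) Hn) as [m [M1 [M2 M3]]].
  destruct m as [|m]; [simpl in M2; lra|]. exists m. replace (m + 1)%nat with (S m) by lia.
  split; [assumption|]. apply Rnot_lt_le, M3. lia.
Qed.

(** For the points with [bt] between [2^-(m+1)] and [2^-m], the content increments span [m + q]
    dyadic steps; the weight [2^-m] makes the series in [m] converge. *)
Lemma flat_total q n (I : nat -> list (lp p)) : (2 * K + 4) * (1 / 2) ^ q <= 1 / 4 ->
  (forall i, NoDup (I i)) -> (forall i, incl (I i) (X i)) ->
  (forall i x, In x (I i) -> flat_arcs i x /\ ~ dense dist Lam (scale i) N0 (X i) x /\ 0 < bt i x <= 1) ->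
  sumL (fun i => sumL (fun x => bt i x * scale i) (I i)) (seq 0 n) <= INR N0 * (4 * rho * INR (length F)) * (2 * (INR q + 1)).
Proof.
  intros Hq ND HI HL. assert (HK : 12 <= K) by (unfold K; lra).
  destruct (choice (fun (z : nat * lp p) m => In (snd z) (I (fst z)) -> (1 / 2) ^ (m + 1) < bt (fst z) (snd z) <= (1 / 2) ^ m)) as [mu Hmu].
  { intros [i x]. simpl. destruct (classic (In x (I i))) as [Hx|Hx]; [|exists 0%nat; tauto].
    destruct (dyadic_mesh (bt i x)) as [m Hm]; [apply HL, Hx|]. exists m. auto. }
  set (mx := list_max (concat (map (fun i => map (fun x => mu (i, x)) (I i)) (seq 0 n)))).
  assert (Hmx : forall i x, In i (seq 0 n) -> In x (I i) -> (mu (i, x) <= mx)%nat).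
  { intros i x Hi Hx. pose proof (proj1 (list_max_le _ mx) (le_n _)) as Q. rewrite Forall_forall in Q. apply Q.
    apply in_concat. exists (map (fun x => mu (i, x)) (I i)). split.
    - apply in_map_iff. exists i. auto.
    - apply in_map_iff. exists x. auto. }
  set (grp := fun i m => filter (fun x => if dec (mu (i, x) = m) then true else false) (I i)).
  assert (Lev : forall m, sumL (fun i => sumL (fun x => bt i x * scale i) (grp i m)) (seq 0 n) <=
     INR N0 * (4 * rho * INR (length F)) * ((1 / 2) ^ m * (INR m + INR q))).
  { intros m. assert (Pm : 0 < (1 / 2) ^ m) by (apply pow_lt; lra).
    apply Rle_trans with ((1 / 2) ^ m * INR N0 * sumL (fun i => cont ((2 * K + 4) * (1 / 2) ^ (m + q) * scale i) - cont ((2 * K + 4) * scale i)) (seq 0 n)).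
    - rewrite <- sumL_scal. apply sumL_le. intros i _. pose proof (scale_pos i) as R0.
      assert (G : forall x, In x (grp i m) -> In x (I i) /\ (1 / 2) ^ (m + 1) < bt i x <= (1 / 2) ^ m).
      { intros x Hx. apply in_filter_dec in Hx. destruct Hx as [Hx E]. split; [assumption|]. pose proof (Hmu (i, x) Hx) as Q. simpl in Q.
        rewrite E in Q. exact Q. }
      apply Rle_trans with ((1 / 2) ^ m * (scale i * INR (length (grp i m)))).
      + rewrite <- Rmult_assoc, <- sumL_const. apply sumL_le. intros x Hx. destruct (G x Hx) as [_ [_ Q]]. apply Rmult_le_compat_r; lra.
      + rewrite (Rmult_assoc ((1 / 2) ^ m)). apply Rmult_le_compat_l; [lra|].
        eapply Rle_trans; [apply (flat_level i m)|].
        * apply NoDup_filter, ND.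
        * intros x Hx. apply (HI i), G, Hx.
        * intros x Hx. destruct (G x Hx) as [G1 G2]. destruct (HL i x G1) as [W1 [W2 _]]. auto.
        * apply Rmult_le_compat_l; [apply pos_INR|].
          assert (cont ((1 / 2) ^ m * scale i / 4) <= cont ((2 * K + 4) * (1 / 2) ^ (m + q) * scale i)); [|lra].
          apply (content_antitone dist dist_refl F rho rho_pos).
          -- apply Rmult_le_pos; [|lra]. apply Rmult_le_pos; [lra | apply pow_le; lra].
          -- rewrite pow_add. assert (0 <= (1 / 2) ^ m * scale i) by nra. nra.
    - pose proof (content_scales (2 * K + 4) (m + q) n ltac:(lra)) as CS. rewrite plus_INR in CS.
      apply Rle_trans with ((1 / 2) ^ m * INR N0 * ((INR m + INR q) * (4 * rho * INR (length F)))).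
      + apply Rmult_le_compat_l; [apply Rmult_le_pos; [lra | apply pos_INR] | exact CS].
      + apply Req_le. ring. }
  rewrite (sumL_ext _ (fun i => sumL (fun m => sumL (fun x => bt i x * scale i) (grp i m)) (seq 0 (S mx)))).
  2:{ intros i Hi. apply (sum_by_color _ (fun x => mu (i, x)) mx). intros x Hx. apply Hmx; assumption. }
  rewrite sumL_swap.
  eapply Rle_trans; [apply sumL_le; intros m _; apply Lev|]. rewrite sumL_scal. apply Rmult_le_compat_l.
  - apply Rmult_le_pos; [apply pos_INR|]. apply Rmult_le_pos; [lra | apply pos_INR].
  - apply weighted_half_sum, pos_INR.
Qed.

End Flat.

Section Class.
Variables (r c : R) (bt : nat -> lp p -> R) (m q n : nat).
Hypothesis r_ge2 : 2 <= r.
Hypothesis c_pos : 0 < c.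
Hypothesis J_big : 8 * (K + 2) <= 2 ^ J.
Hypothesis excess : forall (a z b : lp p) dl, 0 < dl -> dist a z <= dl -> dist z b <= dl ->
  exists t, 0 <= t <= 1 /\ c * rpow (dist z (comb t a b)) r <= (dist a z + dist z b - dist a b) * rpow dl (r - 1).
Hypothesis bt_unit : forall i x, In x (X i) -> 0 <= bt i x <= 1.
Hypothesis bt_line : forall i x, In x (X i) -> 0 < bt i x -> forall P Q, exists y, In y F /\ dist x y <= 2 * A * scale i /\
  far_line (bt i x * scale i) y P Q.
Hypothesis m_big : (4 * Lam + 1) * (1 / 2) ^ m <= 1 / 32.
Hypothesis q_big : (2 * K + 4) * (1 / 2) ^ q <= 1 / 4.

(** A net point is dense, or its first arc is bent, or its second arc is bent, or both are flat.
    Since [bt <= 1], the first and the last case are bounded with exponents 0 and 1. *)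
Lemma class_sum : sumL (fun i => sumL (fun x => rpow (bt i x) r * scale i) (X i)) (seq 0 n) <=
  (64 * INR m + 28 * rpow 2 r * INR (S N0) / (c * (rpow (1 / 8) r / rpow (2 ^ J / 4) (r - 1))) + 8 * INR N0 * (INR q + 1)) *
  (rho * (INR (length F) + INR M)).
Proof.
  assert (HK : 12 <= K) by (unfold K; lra).
  destruct (sampling_exists f T (fun i => scale i / 4) (rho / (INR n + 1))) as [Q HQ].
  { apply Rdiv_lt_0_compat; [assumption | pose proof (pos_INR n); lra]. }
  { intros i. rewrite scale_succ. assert (1 <= 2 ^ J) by (apply pow_R1_Rle; lra). pose proof (scale_pos i). nra. }
  { apply trivially_valid. }
  (* [s] is a time of deviation if there is one, and [t] otherwise. *)
  assert (Aux : forall i a t b e, (a <= t <= b)%nat -> exists s, (a <= s <= b)%nat /\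
     (off f (e * scale i / 8) s a b \/ near_seg f (e * scale i / 8) a b)).
  { intros i a t b e Ht. destruct (classic (exists s, (a <= s <= b)%nat /\ off f (e * scale i / 8) s a b)) as [[s [H1 H2]]|N].
    - exists s. auto.
    - exists t. split; [assumption|]. right. intros s Hs. apply NNPP. intros N'. apply N. exists s. split; [assumption|].
      intros l Hl. apply Rnot_lt_le. intros Hlt. apply N'. exists l. split; [assumption | lra]. }
  set (wnd := fun i x a t b s => (a < b <= T)%nat /\ (a <= t <= b)%nat /\ (a <= s <= b)%nat /\ Q i a /\ Q i b /\
     (forall s, (a <= s <= b)%nat -> dist x (f s) <= (K + 1) * scale i) /\
     (off f (bt i x * scale i / 8) s a b \/ near_seg f (bt i x * scale i / 8) a b)).
  destruct (choice (fun (z : nat * lp p) (w : nat -> nat) => let (i, x) := z in In x (X i) -> 0 < bt i x ->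
     wnd i x (w 0%nat) (w 1%nat) (w 2%nat) (w 3%nat) /\ wnd i x (w 4%nat) (w 5%nat) (w 6%nat) (w 7%nat) /\
     (K * scale i - scale i / 4 <= dist (f (w 1%nat)) (f (w 0%nat)) /\ K * scale i - scale i / 4 <= dist (f (w 1%nat)) (f (w 2%nat))) /\
     (8 * scale i - scale i / 4 <= dist (f (w 5%nat)) (f (w 4%nat)) /\ 8 * scale i - scale i / 4 <= dist (f (w 5%nat)) (f (w 6%nat))) /\
     far_line (bt i x * scale i) (f (w 5%nat)) (f (w 0%nat)) (f (w 2%nat)))) as [w Hw].
  { intros [i x]. destruct (classic (In x (X i) /\ 0 < bt i x)) as [[Hx Bx]|N]; [|exists (fun _ => 0%nat); tauto].
    pose proof (scale_pos i) as R0. destruct (X_far i x Hx) as [z [Hz Dz]].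
    destruct (arc_around Q _ i x x HQ Hx (X_incl i x Hx) (K * scale i)) as [a [t [b [A1 [A2 [A3 [A4 [A5 [A6 [A7 A8]]]]]]]]]].
    { nra. } { rewrite dist_refl. lra. } { exists z. auto. }
    (* [y] is chosen after the first arc, far from the line through the ends of that arc. *)
    destruct (bt_line i x Hx Bx (f a) (f b)) as [y [Hy [Dy Fy]]].
    (* With the radius of 8 scales the two arcs together cost at least [2 K + 6] scales, as merging
       requires. *)
    destruct (arc_around Q _ i x y HQ Hx Hy (8 * scale i)) as [a' [t' [b' [B1 [B2 [B3 [B4 [B5 [B6 [B7 B8]]]]]]]]]].
    { lra. } { unfold K. lra. }
    { exists z. split; [assumption|]. pose proof (dist_triangle x y z). unfold K in Dz. lra. }
    destruct (Aux i a t b (bt i x) A2) as [s [S1 S2]]. destruct (Aux i a' t' b' (bt i x) B2) as [s' [S1' S2']].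
    exists (fun k => match k with 0 => a | 1 => t | 2 => b | 3 => s | 4 => a' | 5 => t' | 6 => b' | _ => s' end)%nat.
    intros _ _. cbv beta iota. rewrite A5, B5. unfold wnd. splits; auto; lia. }
  set (g := fun k i x => w (i, x) k).
  assert (Hg : forall i x, In x (X i) -> 0 < bt i x -> wnd i x (g 0%nat i x) (g 1%nat i x) (g 2%nat i x) (g 3%nat i x) /\
     wnd i x (g 4%nat i x) (g 5%nat i x) (g 6%nat i x) (g 7%nat i x) /\
     (K * scale i - scale i / 4 <= dist (f (g 1%nat i x)) (f (g 0%nat i x)) /\ K * scale i - scale i / 4 <= dist (f (g 1%nat i x)) (f (g 2%nat i x))) /\
     (8 * scale i - scale i / 4 <= dist (f (g 5%nat i x)) (f (g 4%nat i x)) /\ 8 * scale i - scale i / 4 <= dist (f (g 5%nat i x)) (f (g 6%nat i x))) /\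
     far_line (bt i x * scale i) (f (g 5%nat i x)) (f (g 0%nat i x)) (f (g 2%nat i x))).
  { intros i x Hx Bx. exact (Hw (i, x) Hx Bx). }
  clear Hw. set (dn := fun i x => dense dist Lam (scale i) N0 (X i) x).
  set (P1 := fun i x => ~ dn i x /\ 0 < bt i x /\ off f (bt i x * scale i / 8) (g 3%nat i x) (g 0%nat i x) (g 2%nat i x)).
  set (P2 := fun i x => ~ dn i x /\ 0 < bt i x /\ off f (bt i x * scale i / 8) (g 7%nat i x) (g 4%nat i x) (g 6%nat i x)).
  set (P3 := fun i x => ~ dn i x /\ 0 < bt i x /\ near_seg f (bt i x * scale i / 8) (g 0%nat i x) (g 2%nat i x) /\
     near_seg f (bt i x * scale i / 8) (g 4%nat i x) (g 6%nat i x)).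
  set (fl := fun (P : nat -> lp p -> Prop) i => filter (fun x => if dec (P i x) then true else false) (X i)).
  assert (NDf : forall P i, NoDup (fl P i)) by (intros; apply NoDup_filter, X_nodup).
  assert (Inf : forall P i, incl (fl P i) (X i)).
  { intros P i x Hx. apply in_filter_dec in Hx. apply Hx. }
  assert (Inp : forall P i x, In x (fl P i) -> P i x).
  { intros P i x Hx. apply in_filter_dec in Hx. apply Hx. }
  pose proof (dense_total m n m_big) as T0.
  assert (T1 := arc_total r c n Q r_ge2 c_pos J_big excess HQ (fl P1) (g 0%nat) (g 3%nat) (g 2%nat) bt (NDf P1) (Inf P1)
    (fun i x Hx => proj1 (Inp P1 i x Hx))).
  assert (T2 := arc_total r c n Q r_ge2 c_pos J_big excess HQ (fl P2) (g 4%nat) (g 7%nat) (g 6%nat) bt (NDf P2) (Inf P2)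
    (fun i x Hx => proj1 (Inp P2 i x Hx))).
  assert (T3 := flat_total (g 0%nat) (g 1%nat) (g 2%nat) (g 4%nat) (g 5%nat) (g 6%nat) bt q n (fl P3) q_big (NDf P3) (Inf P3)).
  lapply T1; [clear T1; intros T1|].
  2:{ intros i x Hx. destruct (Inp P1 i x Hx) as [_ [Bx Ox]]. destruct (Hg i x (Inf P1 i x Hx) Bx) as [[W1 [W2 [W3 [W4 [W5 [W6 _]]]]]] _].
      splits; auto; lia. }
  lapply T2; [clear T2; intros T2|].
  2:{ intros i x Hx. destruct (Inp P2 i x Hx) as [_ [Bx Ox]]. destruct (Hg i x (Inf P2 i x Hx) Bx) as [_ [[W1 [W2 [W3 [W4 [W5 [W6 _]]]]]] _]].
      splits; auto; lia. }
  lapply T3; [clear T3; intros T3|].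
  2:{ intros i x Hx. destruct (Inp P3 i x Hx) as [Nd [Bx [N1 N2]]].
      destruct (Hg i x (Inf P3 i x Hx) Bx) as [[W1 [W2 [W3 [W4 [W5 [W6 _]]]]]] [[V1 [V2 [V3 [V4 [V5 [V6 _]]]]]] [D1 [D2 D3]]]].
      split; [|split; [assumption | split; [assumption | apply bt_unit, (Inf P3 i x Hx)]]].
      unfold flat_arcs. split; [auto|]. split; [intros s [Hs|Hs]; auto|]. auto. }
  set (kap := c * (rpow (1 / 8) r / rpow (2 ^ J / 4) (r - 1))) in *.
  assert (Hk : 0 < kap).
  { unfold kap. apply Rmult_lt_0_compat; [assumption|]. apply Rdiv_lt_0_compat; apply rpow_pos; lra. }
  assert (M1 : 1 <= INR M).
  { destruct (f_onto (f 0%nat) (f_in 0%nat)) as [t0 [Ht0 _]]. change 1 with (INR 1). apply le_INR. lia. }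
  apply Rle_trans with (sumL (fun i => scale i * sumL (fun x => ind (dn i x)) (X i)) (seq 0 n) +
     sumL (fun i => sumL (fun x => rpow (bt i x) r * scale i) (fl P1 i)) (seq 0 n) +
     sumL (fun i => sumL (fun x => rpow (bt i x) r * scale i) (fl P2 i)) (seq 0 n) +
     sumL (fun i => sumL (fun x => bt i x * scale i) (fl P3 i)) (seq 0 n)).
  { rewrite <- !sumL_plus. apply sumL_le. intros i _. unfold fl. rewrite !sumL_filter, <- sumL_scal, <- !sumL_plus.
    apply sumL_le. intros x Hx. pose proof (scale_pos i) as R0. destruct (bt_unit i x Hx) as [B0 B1].
    assert (Z1 : 0 <= rpow (bt i x) r * scale i) by (apply Rmult_le_pos; [apply rpow_ge0 | lra]).
    assert (Z2 : 0 <= bt i x * scale i) by (apply Rmult_le_pos; lra).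
    assert (Z3 : rpow (bt i x) r * scale i <= bt i x * scale i).
    { apply Rmult_le_compat_r; [lra|]. rewrite <- (rpow_1 (bt i x)) at 2 by assumption. apply rpow_exp_le; lra. }
    assert (Z4 : bt i x * scale i <= scale i) by nra.
    assert (Pos : forall P v, 0 <= v -> 0 <= ind P * v) by (intros; apply Rmult_le_pos; [apply ind_ge0 | assumption]).
    pose proof (Pos (P1 i x) _ Z1). pose proof (Pos (P2 i x) _ Z1). pose proof (Pos (P3 i x) _ Z2).
    pose proof (Pos (dn i x) (scale i) ltac:(lra)).
    destruct (classic (dn i x)) as [D|D]; [rewrite (ind_true (dn i x) D) in *; lra|].
    destruct (Rle_dec (bt i x) 0) as [Bz|Bz]; [rewrite (rpow_0 (bt i x) r Bz) in *; lra|].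
    apply Rnot_le_lt in Bz. destruct (Hg i x Hx Bz) as [[_ [_ [_ [_ [_ [_ [O1|O1]]]]]]] [[_ [_ [_ [_ [_ [_ O2]]]]]] _]].
    - rewrite (ind_true (P1 i x)) in * by (unfold P1; auto). lra.
    - destruct O2 as [O2|O2].
      + rewrite (ind_true (P2 i x)) in * by (unfold P2; auto). lra.
      + rewrite (ind_true (P3 i x)) in * by (unfold P3; auto). lra. }
  set (E0 := rpow 2 r * INR (S N0)) in *.
  assert (HE : 0 <= E0) by (apply Rmult_le_pos; [apply rpow_ge0 | apply pos_INR]).
  assert (HT : 2 * (2 * rho * INR T + rho) <= 14 * (rho * INR M)).
  { unfold T. rewrite mult_INR. simpl (INR 3). nra. }
  assert (Div : forall S, kap * S <= E0 * (2 * (2 * rho * INR T + rho)) -> S <= 14 * E0 / kap * (rho * INR M)).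
  { intros S HS. apply (Rmult_le_reg_l kap); [assumption|].
    replace (kap * (14 * E0 / kap * (rho * INR M))) with (E0 * (14 * (rho * INR M))) by (field; lra).
    eapply Rle_trans; [exact HS|]. apply Rmult_le_compat_l; assumption. }
  apply Div in T1. apply Div in T2.
  replace (28 * rpow 2 r * INR (S N0) / kap) with (2 * (14 * E0 / kap)) by (unfold E0; field; lra).
  assert (HD : 0 <= 14 * E0 / kap) by (apply Rmult_le_pos; [lra | left; apply Rinv_0_lt_compat; assumption]).
  set (D := 14 * E0 / kap) in *.
  pose proof (pos_INR m) as I1. pose proof (pos_INR q) as I2. pose proof (pos_INR N0) as I3. pose proof (pos_INR (length F)) as I4.
  set (u := rho * INR (length F)) in *. set (v := rho * INR M) in *.
  assert (U0 : 0 <= u) by (apply Rmult_le_pos; lra). assert (V0 : 0 <= v) by (apply Rmult_le_pos; lra).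
  replace (rho * (INR (length F) + INR M)) with (u + v) by (unfold u, v; ring).
  replace (64 * INR m * rho * INR (length F)) with (64 * INR m * u) in T0 by (unfold u; ring).
  replace (INR N0 * (4 * rho * INR (length F)) * (2 * (INR q + 1))) with (8 * INR N0 * (INR q + 1) * u) in T3 by (unfold u; ring).
  assert (0 <= INR m * v) by (apply Rmult_le_pos; assumption). assert (0 <= D * u) by (apply Rmult_le_pos; assumption).
  assert (0 <= INR N0 * (INR q + 1) * v) by (apply Rmult_le_pos; [apply Rmult_le_pos; lra | assumption]).
  unfold dn in *. lra.
Qed.

End Class.

End Residue_class.

(** [N0], [J], [m] and [q] are chosen from [A] alone, so the constant is uniform in the set, the
    mesh and the scales. *)
Lemma class_bound {p : R} {Hp : Exponent p} (A r c : R) : 1 < A -> 2 <= r -> 0 < c ->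
  (forall (a z b : lp p) dl, 0 < dl -> dist a z <= dl -> dist z b <= dl ->
    exists t, 0 <= t <= 1 /\ c * rpow (dist z (comb t a b)) r <= (dist a z + dist z b - dist a b) * rpow dl (r - 1)) ->
  exists J C, (1 <= J)%nat /\ 0 < C /\
  forall k0 rho (F : list (lp p)) f M X bt n, 0 < rho -> rho <= scale J k0 0 / 100 ->
    (forall t, dist (f t) (f (S t)) <= 2 * rho) -> (forall t, In (f t) F) -> (forall t, f (t + M)%nat = f t) ->
    (forall z, In z F -> exists t, (t < M)%nat /\ f t = z) ->
    (forall i, NoDup (X i)) -> (forall i, incl (X i) F) ->
    (forall i x y, In x (X i) -> In y (X i) -> x <> y -> scale J k0 i / 2 <= dist x y) ->
    (forall i x, In x (X i) -> exists z, In z F /\ (2 * A + 10) * scale J k0 i <= dist x z) ->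
    (forall i x, In x (X i) -> 0 <= bt i x <= 1) ->
    (forall i x, In x (X i) -> 0 < bt i x -> forall P Q, exists y, In y F /\ dist x y <= 2 * A * scale J k0 i /\
      far_line (bt i x * scale J k0 i) y P Q) ->
    sumL (fun i => sumL (fun x => rpow (bt i x) r * scale J k0 i) (X i)) (seq 0 n) <= C * (rho * (INR (length F) + INR M)).
Proof.
  intros HA Hr Hc Hex. set (K := 2 * A + 10). set (Lam := 2 * K + 10).
  assert (HK : 12 < K) by (unfold K; lra).
  destruct (INR_unbounded (16 * (4 * Lam + 2))) as [N0 HN0].
  destruct (half_pow_lt (/ (8 * (K + 2)))) as [J HJ]; [apply Rinv_0_lt_compat; lra|].
  destruct (half_pow_lt (/ 32 / (4 * Lam + 1))) as [m Hm]; [apply Rdiv_lt_0_compat; unfold Lam; lra|].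
  destruct (half_pow_lt (/ 4 / (2 * K + 4))) as [q Hq]; [apply Rdiv_lt_0_compat; lra|].
  assert (HJ' : 8 * (K + 2) <= 2 ^ J).
  { assert (P2 : 0 < 2 ^ J) by (apply pow_lt; lra).
    replace ((1 / 2) ^ J) with (/ 2 ^ J) in HJ by (rewrite <- pow_inv; f_equal; lra).
    apply Rnot_lt_le. intros Hlt. pose proof (Rinv_lt_contravar (2 ^ J) (8 * (K + 2)) ltac:(apply Rmult_lt_0_compat; lra) Hlt). lra. }
  assert (J1 : (1 <= J)%nat) by (destruct J; [simpl in HJ'; lra | lia]).
  exists J, (64 * INR m + 28 * rpow 2 r * INR (S N0) / (c * (rpow (1 / 8) r / rpow (2 ^ J / 4) (r - 1))) + 8 * INR N0 * (INR q + 1) + 1).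
  split; [assumption|].
  match goal with |- 0 < ?C + 1 /\ _ => assert (C0 : 0 <= C) end.
  { pose proof (pos_INR m). pose proof (pos_INR N0). pose proof (pos_INR q).
    apply Rplus_le_le_0_compat; [apply Rplus_le_le_0_compat; [lra|] | repeat apply Rmult_le_pos; lra].
    apply Rmult_le_pos; [repeat apply Rmult_le_pos; try lra; [apply rpow_ge0 | apply pos_INR]|].
    left. apply Rinv_0_lt_compat. apply Rmult_lt_0_compat; [assumption|]. apply Rdiv_lt_0_compat; apply rpow_pos; lra. }
  split; [lra|].
  intros k0 rho F f M X bt n H1 H2 H3 H4 H5 H6 H7 H8 H9 H10 H11 H12.
  eapply Rle_trans; [apply (class_sum A J N0 k0 rho F f M X) with (c := c) (m := m) (q := q); auto|].
  - fold K. fold Lam. lra.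
  - fold K. fold Lam. apply Rmult_lt_compat_l with (r := 4 * Lam + 1) in Hm; [|unfold Lam; lra].
    replace ((4 * Lam + 1) * (/ 32 / (4 * Lam + 1))) with (/ 32) in Hm by (field; unfold Lam; lra). lra.
  - fold K. apply Rmult_lt_compat_l with (r := 2 * K + 4) in Hq; [|lra].
    replace ((2 * K + 4) * (/ 4 / (2 * K + 4))) with (/ 4) in Hq by (field; lra). lra.
  - apply Rmult_le_compat_r; [|lra]. pose proof (pos_INR (length F)). pose proof (pos_INR M). apply Rmult_le_pos; lra.
Qed.

(** * Discretization of a connected set *)

Section Beta.
Context {p : R} {Hp : Exponent p}.

Lemma beta_le (E : seqR -> Prop) (x a v : lp p) rho tau : E x -> 0 < rho -> 0 <= tau -> (exists i, v i <> 0) ->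
  (forall z : lp p, E z -> dist z x <= rho -> exists t, dist z (add a (scal t v)) <= tau) ->
  exists b, beta p E (ball p x rho) = Fin b /\ 0 <= b <= tau / rho.
Proof.
  intros Ex Hr Ht Hv H. destruct (ball_diam x rho Hr) as [D [ED HD]].
  assert (K : Rbar_le (beta p E (ball p x rho)) (Fin (tau / rho))).
  { unfold beta. destruct (excluded_middle_informative _) as [_|N].
    2:{ simpl. apply Rmult_le_pos; [assumption | left; apply Rinv_0_lt_compat; assumption]. }
    eapply Rbar_le_trans; [apply (proj1 (proj2 (Einf_spec _ (beta_ge0 E (ball p x rho) D ED ltac:(lra)))))|].
    { exists a, v. split; [|reflexivity]. split; [apply crd_in | split; [apply crd_in | exact Hv]]. }
    rewrite ED. set (S := Esup _).
    assert (HS : Rbar_le S (Fin tau)).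
    { apply Esup_lub; [exact Ht|]. intros u [z [Ez [[Iz Dz] ->]]]. destruct (H (MkLp z Iz) Ez Dz) as [t Dt].
      eapply Rbar_le_trans; [apply (proj1 (proj2 (Einf_spec _ (fun w => dist_line_ge0 z a v w)))); exists t; reflexivity|].
      exact Dt. }
    pose proof (Esup_ge0 (fun u => exists x0, E x0 /\ ball p x rho x0 /\ u = dist_line p x0 a v)) as S0. fold S in S0.
    destruct S as [s|]; simpl in *; [|contradiction].
    apply Rle_trans with (s / rho).
    - apply Rmult_le_compat_l; [assumption|]. apply Rinv_le_contravar; lra.
    - apply Rmult_le_compat_r; [left; apply Rinv_0_lt_compat; assumption | assumption]. }
  assert (B0 : Rbar_le (Fin 0) (beta p E (ball p x rho))).
  { unfold beta. destruct (excluded_middle_informative _) as [_|N]; [|apply Rbar_le_refl].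
    apply (proj1 (Einf_spec _ (beta_ge0 E (ball p x rho) D ED ltac:(lra)))). }
  destruct (beta p E (ball p x rho)) as [b|]; simpl in *; [|contradiction]. exists b. auto.
Qed.

Lemma beta_le_radius (E : seqR -> Prop) (x : lp p) rho tau : E x -> 0 < rho -> 0 <= tau ->
  (forall z : lp p, E z -> dist z x <= rho -> dist z x <= tau) ->
  exists b, beta p E (ball p x rho) = Fin b /\ 0 <= b <= tau / rho.
Proof.
  intros Ex Hr Ht H. destruct (nonzero_vector (p := p)) as [v Hv]. apply (beta_le E x x v); auto.
  - exists 0%nat. assumption.
  - intros z Ez Dz. exists 0. replace (add x (scal 0 v)) with x by vec. auto.
Qed.

(** Otherwise the line through [P] and [Q] would show that beta is at most [b / 2]. If [P = Q], any
    line through [P] serves. *)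
Lemma beta_far (E : seqR -> Prop) (x : lp p) rho b : E x -> 0 < rho -> beta p E (ball p x rho) = Fin b -> 0 < b ->
  forall P Q : lp p, exists z : lp p, E z /\ dist x z <= rho /\ far_line (b / 2 * rho) z P Q.
Proof.
  intros Ex Hr Hb Hb0 P Q. apply NNPP. intros N.
  assert (exists v : lp p, (exists i, v i <> 0) /\ forall t, exists t', comb t P Q = add P (scal t' v)) as [v [Hv Lv]].
  { destruct (classic (exists i, sub Q P i <> 0)) as [Hv|Hv].
    - exists (sub Q P). split; [assumption|]. intros t. exists t. vec.
    - destruct (nonzero_vector (p := p)) as [v Hv']. exists v. split; [exists 0%nat; assumption|]. intros t. exists 0.
      assert (E0 : Q = P).
      { apply lp_ext. intros i. apply NNPP. intros Hi. apply Hv. exists i. simpl. unfold vsub. lra. }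
      rewrite E0. vec. }
  destruct (beta_le E x P v rho (b / 2 * rho) Ex Hr ltac:(nra) Hv) as [b' [Eb Hb']].
  - intros z Ez Dz. apply NNPP. intros N'. apply N. exists z. split; [assumption|]. split; [rewrite dist_sym; assumption|].
    intros t. apply Rnot_lt_le. intros Hlt. apply N'. destruct (Lv t) as [t' Et]. exists t'. rewrite <- Et. lra.
  - rewrite Hb in Eb. injection Eb as <-. replace (b / 2 * rho / rho) with (b / 2) in Hb' by (field; lra). lra.
Qed.

End Beta.

(** * Connected sets and chains of open sets *)

Section Connected.
Context {p : R} {Hp : Exponent p}.
Variable E : seqR -> Prop.
Hypothesis E_lp : forall x, E x -> in_lp p x.
Hypothesis E_conn : connected p E.

Lemma connected_reach (A B : lp p -> Prop) (x : lp p) : E x -> A x ->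
  (forall z : lp p, E z -> A z \/ B z) -> (forall z : lp p, E z -> ~ (A z /\ B z)) ->
  (forall z : lp p, E z -> A z -> exists r, 0 < r /\ forall y : lp p, E y -> dist y z < r -> A y) ->
  (forall z : lp p, E z -> B z -> exists r, 0 < r /\ forall y : lp p, E y -> dist y z < r -> B y) ->
  forall z : lp p, E z -> A z.
Proof.
  intros Ex Ax Hc Hd HA HB z Ez.
  destruct (E_conn (fun y => exists q : lp p, E q /\ A q /\ crd q = y) (fun y => exists q : lp p, E q /\ B q /\ crd q = y)) as [Q|Q].
  - intros y. split.
    + intros Ey. destruct (Hc (MkLp y (E_lp y Ey)) Ey); [left | right]; exists (MkLp y (E_lp y Ey)); auto.
    + intros [[q [Eq [_ <-]]]|[q [Eq [_ <-]]]]; assumption.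
  - intros y [[q [Eq [Aq <-]]] [q' [Eq' [Bq' Q]]]]. replace q' with q in * by (apply lp_ext; congruence). apply (Hd q Eq). auto.
  - intros y [q [Eq [Aq <-]]]. destruct (HA q Eq Aq) as [r [Hr H]]. exists r. split; [assumption|].
    intros w Ew Dw. exists (MkLp w (E_lp w Ew)). split; [assumption|]. split; [apply H; assumption | reflexivity].
  - intros y [q [Eq [Bq <-]]]. destruct (HB q Eq Bq) as [r [Hr H]]. exists r. split; [assumption|].
    intros w Ew Dw. exists (MkLp w (E_lp w Ew)). split; [assumption|]. split; [apply H; assumption | reflexivity].
  - exfalso. apply (Q x). exists x. auto.
  - destruct (Hc z Ez) as [|Bz]; [assumption|]. exfalso. apply (Q z). exists z. auto.
Qed.

(** Each [B i] lies within one class of linked points, so the class of [x] and its complement are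
    both relatively open. *)
Lemma connected_linked {I} (B : I -> lp p -> Prop) :
  (forall i (z : lp p), E z -> B i z -> exists r, 0 < r /\ forall y : lp p, E y -> dist y z < r -> B i y) ->
  (forall z : lp p, E z -> exists i, B i z) -> forall x z : lp p, E x -> E z -> linked (fun a b => exists i, B i a /\ B i b) x z.
Proof.
  intros Ho Hc x z Ex Ez. revert z Ez.
  assert (St : forall A : lp p -> Prop, (forall a b, A a -> (exists i, B i a /\ B i b) -> A b) ->
     forall z : lp p, E z -> A z -> exists r, 0 < r /\ forall y : lp p, E y -> dist y z < r -> A y).
  { intros A HA z Ez Az. destruct (Hc z Ez) as [i Bi]. destruct (Ho i z Ez Bi) as [r [Hr H]]. exists r. split; [assumption|].
    intros y Ey Dy. apply (HA z y Az). exists i. auto. }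
  set (G := fun a b : lp p => exists i, B i a /\ B i b).
  apply (connected_reach (linked G x) (fun z => ~ linked G x z) x Ex).
  - constructor.
  - intros. apply classic.
  - tauto.
  - apply St. intros a b Ha Hab. eapply linked_trans; [exact Ha|]. apply linked_edge, Hab.
  - apply St. intros a b Ha [i [H1 H2]] Hb. apply Ha. eapply linked_trans; [exact Hb|]. apply linked_edge. exists i. auto.
Qed.

End Connected.

Lemma linked_chain {V} (G : V -> V -> Prop) x y : (forall a b, G a b -> G b a) -> linked G x y ->
  exists (f : nat -> V) n, f 0%nat = x /\ f n = y /\ forall t, (t < n)%nat -> G (f t) (f (S t)).
Proof.
  intros Hs H. induction H as [x|x y z Hxy H [f [n [F0 [Fn Hf]]]]].
  - exists (fun _ => x), 0%nat. splits; auto. intros; lia.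
  - exists (fun t => match t with O => x | S t => f t end), (S n). splits; auto.
    intros [|t] Ht; [rewrite F0; destruct Hxy; auto | apply Hf; lia].
Qed.

Lemma half_pow_nodup (l : list nat) : NoDup l -> sumL (fun i => (1 / 2) ^ (i + 1)) l <= 1.
Proof.
  intros ND. eapply Rle_trans; [|apply (half_pow_sum (S (list_max l)))].
  replace (sumL (fun i => (1 / 2) ^ (i + 1)) l) with (sumL (fun j => (1 / 2) ^ j) (map S l)).
  2:{ rewrite sumL_map. apply sumL_ext. intros i _. f_equal. lia. }
  apply sumL_incl.
  - intros j _. apply pow_le. lra.
  - apply FinFun.Injective_map_NoDup; [intros a b; congruence | assumption].
  - intros j Hj. apply in_map_iff in Hj. destruct Hj as [i [<- Hi]]. apply in_seq.
    pose proof (proj1 (list_max_le l (list_max l)) (le_n _)) as Q. rewrite Forall_forall in Q. specialize (Q i Hi). lia.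
Qed.

Section Finite_length.
Context {p : R} {Hp : Exponent p}.
Variables (E : seqR -> Prop) (h : R).
Hypothesis E_lp : forall x, E x -> in_lp p x.
Hypothesis E_conn : connected p E.
Hypothesis E_len : H1 p E = Fin h.

(** The sets of an almost optimal cover are thickened by [e / 2^(i+1)] to make them open, at a total
    cost of at most [2 e]. *)
Lemma small_cover dl e : 0 < dl -> 0 < e -> exists (B : nat -> lp p -> Prop) (w : nat -> R),
  (forall i (z : lp p), B i z -> exists r, 0 < r /\ forall y : lp p, dist y z < r -> B i y) /\
  (forall z : lp p, E z -> exists i, B i z) /\ (forall i, 0 <= w i <= dl + 2 * e) /\
  (forall i y z, B i y -> B i z -> dist y z <= w i) /\ (forall l, NoDup l -> sumL w l <= h + 3 * e).
Proof.
  intros Hdl He.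
  assert (K : Rbar_le (H1_delta p dl E) (Fin h)).
  { rewrite <- E_len. apply Esup_ub. exists dl. auto. }
  pose proof (fun P0 => Einf_approx _ h e P0 K He) as Ap.
  destruct Ap as [v [[U [U1 [U2 [U3 Ev]]]] Hv]]; [intros q [U [_ [_ [_ ->]]]]; apply Esum_ge0|].
  set (d := fun i => match diam p (U i) with Fin q => q | PInf => 0 end).
  assert (Ed : forall i, diam p (U i) = Fin (d i) /\ 0 <= d i <= dl).
  { intros i. specialize (U3 i). unfold d.
    pose proof (Esup_ge0 (fun q => exists y z, U i y /\ U i z /\ q = Fin (lp_dist p y z))) as S0.
    change (Rbar_le (Fin 0) (diam p (U i))) in S0.
    destruct (diam p (U i)) as [q|]; simpl in *; [auto | contradiction]. }
  set (g := fun i => e * (1 / 2) ^ (i + 1)).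
  assert (Hg : forall i, 0 < g i <= e).
  { intros i. unfold g. assert (0 < (1 / 2) ^ (i + 1) <= 1); [|split; [apply Rmult_lt_0_compat; lra | nra]].
    split; [apply pow_lt; lra|]. pose proof (pow_incr (1 / 2) 1 (i + 1) ltac:(lra)) as Q0. rewrite pow1 in Q0. exact Q0. }
  exists (fun i z => exists u : lp p, U i u /\ dist z u < g i), (fun i => d i + 2 * g i). splits.
  - intros i z [u [Uu Du]]. exists (g i - dist z u). split; [lra|]. intros y Dy. exists u. split; [assumption|].
    pose proof (dist_triangle y z u). lra.
  - intros z Ez. destruct (U2 z Ez) as [i Ui]. exists i, z. split; [assumption|]. rewrite dist_refl. apply Hg.
  - intros i. pose proof (Ed i). pose proof (Hg i). lra.
  - intros i y z [u [Uu Du]] [u' [Uu' Du']].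
    assert (K2 : Rbar_le (Fin (dist u u')) (diam p (U i))) by (apply Esup_ub; exists u, u'; auto).
    rewrite (proj1 (Ed i)) in K2. simpl in K2.
    pose proof (dist_triangle y u z). pose proof (dist_triangle u u' z). rewrite (dist_sym u' z) in *. lra.
  - intros l ND. rewrite sumL_plus, sumL_scal. unfold g. rewrite sumL_scal.
    pose proof (half_pow_nodup l ND).
    assert (Rbar_le (Fin (sumL d l)) (Fin v)).
    { rewrite Ev. eapply Rbar_le_trans; [|apply Esup_ub; exists l; splits; [exact ND | apply Forall_forall; auto | reflexivity]].
      apply fold_Eplus_ge. intros i _. rewrite (proj1 (Ed i)). apply Rbar_le_refl. }
    simpl in *. nra.
Qed.

(* The balls of radius [s / 4] around the points are crossed by disjoint families of covering sets. *)
Lemma separated_count s (F : list (lp p)) : 0 < s -> NoDup F -> (forall x, In x F -> E x) ->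
  (forall x y, In x F -> In y F -> x <> y -> s <= dist x y) ->
  (forall x, In x F -> exists z : lp p, E z /\ s / 4 <= dist x z) -> s / 4 * INR (length F) <= h.
Proof.
  intros Hs ND FE Fsep Ffar. apply le_epsilon. intros eps Heps.
  (* [e <= s / 16] keeps the diameters at most [3 s / 16], so that no covering set meets two of the
     balls; [e <= eps / 3] bounds the loss. *)
  set (e := Rmin (s / 16) (eps / 3)).
  assert (He : 0 < e /\ e <= s / 16 /\ e <= eps / 3).
  { unfold e. splits; [apply Rmin_pos; lra | apply Rmin_l | apply Rmin_r]. }
  destruct (small_cover (s / 16) e) as [B [w [B1 [B2 [B3 [B4 B5]]]]]]; [lra | lra |].
  destruct (choice (fun x L => In x F -> NoDup L /\ s / 4 <= sumL w L /\ forall i, In i L -> exists y, B i y /\ dist x y < s / 4)) as [L HL].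
  { intros x. destruct (classic (In x F)) as [Hx|Hx]; [|exists nil; tauto].
    destruct (Ffar x Hx) as [z [Ez Dz]].
    destruct (linked_chain (fun a b => exists i, B i a /\ B i b) x z) as [f [n [F0 [Fn Hf]]]].
    { intros a b [i [Ba Bb]]. exists i. auto. }
    { apply (connected_linked E E_lp E_conn B); auto. intros i y _ By. destruct (B1 i y By) as [r [Hr Q]]. exists r. auto. }
    rewrite <- Fn in Dz. rewrite <- F0 in Dz.
    destruct (nat_first (fun t => s / 4 <= dist (f 0%nat) (f t)) 0 n ltac:(lia) Dz) as [m [M1 [M2 M3]]].
    destruct (choice (fun t i => (t < n)%nat -> B i (f t) /\ B i (f (S t)))) as [idx Hidx].
    { intros t. destruct (classic (t < n)%nat) as [Q|Q]; [|exists 0%nat; tauto]. destruct (Hf t Q) as [i Hi]. exists i. auto. }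
    exists (nodup Nat.eq_dec (map idx (seq 0 m))). intros _. splits.
    - apply NoDup_nodup.
    - eapply Rle_trans; [exact M2|]. apply (chain_cover dist dist_refl dist_triangle B); [lia | | |].
      + intros i _. apply B3.
      + intros i y y' _. apply B4.
      + intros t Ht. exists (idx t). split; [|apply Hidx; lia]. apply nodup_In, in_map_iff. exists t. split; [reflexivity|]. apply in_seq. lia.
    - intros i Hi. apply nodup_In, in_map_iff in Hi. destruct Hi as [t [<- Ht]]. apply in_seq in Ht.
      exists (f t). split; [apply Hidx; lia|]. rewrite <- F0. apply Rnot_le_lt, M3. lia. }
  apply Rle_trans with (sumL w (concat (map L F))).
  - rewrite sumL_concat, sumL_map, <- sumL_const. apply sumL_le. intros x Hx. apply HL, Hx.
  - eapply Rle_trans; [apply B5|lra].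
    apply NoDup_concat_map; [assumption | intros x Hx; apply HL, Hx|].
    intros x y i Hx Hy Ix Iy. apply NNPP. intros N. pose proof (Fsep x y Hx Hy N).
    destruct (proj2 (proj2 (HL x Hx)) i Ix) as [a [Ba Da]]. destruct (proj2 (proj2 (HL y Hy)) i Iy) as [b [Bb Db]].
    pose proof (B4 i a b Ba Bb). pose proof (B3 i). pose proof (dist_triangle x a y). pose proof (dist_triangle a b y).
    rewrite (dist_sym b y) in *. lra.
Qed.

(** The one-point set is separated at every [s]; here [s = 4 |x - y|]. *)
Lemma dist_le_length (x y : lp p) : E x -> E y -> dist x y <= h.
Proof.
  intros Ex Ey. destruct (Rle_lt_or_eq_dec _ _ (dist_nonneg x y)) as [D|D].
  - pose proof (separated_count (4 * dist x y) (x :: nil)) as K. simpl in K.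
    assert (4 * dist x y / 4 * 1 <= h); [|lra]. apply K.
    + lra.
    + constructor; [intros [] | constructor].
    + intros z [<-|[]]. assumption.
    + intros a b [<-|[]] [<-|[]] N. contradiction.
    + intros z [<-|[]]. exists y. split; [assumption | lra].
  - rewrite <- D. pose proof (Esup_ge0 (fun v => exists delta, 0 < delta /\ v = H1_delta p delta E)) as K.
    change (Rbar_le (Fin 0) (H1 p E)) in K. rewrite E_len in K. exact K.
Qed.

(** A separated set of maximal cardinality is dense. The length bounds the cardinality, and the
    points [u], [v] guarantee that the set leaves every ball that is counted. *)
Lemma finite_net rho (u v : lp p) : 0 < rho -> E u -> E v -> rho <= dist u v -> exists F : list (lp p), NoDup F /\
  (forall x, In x F -> E x) /\ (forall x y, In x F -> In y F -> x <> y -> rho <= dist x y) /\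
  (forall x : lp p, E x -> exists y, In y F /\ dist x y < rho) /\ rho / 4 * INR (length F) <= h.
Proof.
  intros Hr Eu Ev Huv.
  set (sep := fun F : list (lp p) => NoDup F /\ (forall x, In x F -> E x) /\ forall x y, In x F -> In y F -> x <> y -> rho <= dist x y).
  assert (Bd : forall F, sep F -> rho / 4 * INR (length F) <= h).
  { intros F [S1 [S2 S3]]. apply separated_count; auto. intros x Hx.
    pose proof (dist_triangle u x v) as Q. rewrite (dist_sym u x) in Q.
    destruct (Rle_dec (rho / 4) (dist x u)); [exists u | exists v]; split; auto. lra. }
  destruct (INR_unbounded (h / (rho / 4))) as [m Hm].
  assert (Bn : forall F, sep F -> (length F <= m)%nat).
  { intros F HF. apply INR_le. apply Rle_trans with (h / (rho / 4)); [|lra]. apply (Rmult_le_reg_l (rho / 4)); [lra|].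
    replace (rho / 4 * (h / (rho / 4))) with h by (field; lra). apply Bd, HF. }
  destruct (nat_last (fun n => exists F, sep F /\ length F = n) 0 m ltac:(lia)) as [n [N1 [[F [HF LF]] N3]]].
  { exists nil. split; [|reflexivity]. split; [constructor|]. split; [intros x [] | intros x y []]. }
  exists F. destruct HF as [S1 [S2 S3]]. splits; auto.
  - intros x Ex. apply NNPP. intros N.
    assert (Far : forall y, In y F -> rho <= dist x y).
    { intros y Hy. apply Rnot_lt_le. intros Q. apply N. exists y. auto. }
    assert (S' : sep (x :: F)).
    { split; [|split].
      - constructor; [|assumption]. intros Hx. specialize (Far x Hx). rewrite dist_refl in Far. lra.
      - intros y [<-|Hy]; auto.
      - intros y z [<-|Hy] [<-|Hz] Nyz; auto; [contradiction|]. rewrite dist_sym. auto. }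
    apply (N3 (S n)); [|exists (x :: F); split; [assumption | simpl; congruence]]. specialize (Bn _ S'). simpl in Bn. lia.
  - apply Bd. split; auto.
Qed.

Lemma net_linked rho (F : list (lp p)) : 0 < rho -> (forall x, In x F -> E x) ->
  (forall x : lp p, E x -> exists y, In y F /\ dist x y < rho) -> forall x y, In x F -> In y F ->
  linked (fun a b => In (a, b) (list_prod F F) /\ In a F /\ In b F /\ dist a b <= 2 * rho) x y.
Proof.
  intros Hr FE Fd x y Hx Hy.
  set (G := fun a b : lp p => In (a, b) (list_prod F F) /\ In a F /\ In b F /\ dist a b <= 2 * rho).
  assert (GI : forall (z a b : lp p), In a F -> In b F -> dist z a < rho -> dist z b < rho -> G a b).
  { intros z a b Ha Hb Da Db. unfold G. splits; auto; [apply in_prod; assumption|].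
    pose proof (dist_triangle a z b) as Q. rewrite (dist_sym a z) in Q. lra. }
  assert (Op : forall C : lp p -> Prop, forall z : lp p, (exists c, In c F /\ dist z c < rho /\ C c) ->
     exists r, 0 < r /\ forall y : lp p, E y -> dist y z < r -> exists c, In c F /\ dist y c < rho /\ C c).
  { intros C z [c [Hc [Dc Cc]]]. exists (rho - dist z c). split; [lra|]. intros q _ Dq. exists c. splits; auto.
    pose proof (dist_triangle q z c). lra. }
  assert (Ly : exists c, In c F /\ dist y c < rho /\ linked G x c).
  { apply (connected_reach E E_lp E_conn (fun z => exists c, In c F /\ dist z c < rho /\ linked G x c)
      (fun z => exists c, In c F /\ dist z c < rho /\ ~ linked G x c) x (FE x Hx)); [| | | | |apply FE, Hy].
    - exists x. rewrite dist_refl. splits; auto. constructor.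
    - intros z Ez. destruct (Fd z Ez) as [c [Hc Dc]]. destruct (classic (linked G x c)); [left | right]; exists c; auto.
    - intros z Ez [[c [Hc [Dc Lc]]] [c' [Hc' [Dc' Nc']]]]. apply Nc'. eapply linked_trans; [exact Lc|].
      apply linked_edge, (GI z); assumption.
    - intros z _. apply Op.
    - intros z _. apply Op. }
  destruct Ly as [c [Hc [Dc Lc]]]. eapply linked_trans; [exact Lc|]. apply linked_edge, (GI y); auto. rewrite dist_refl. lra.
Qed.

Lemma walk_steps_nth {V} (G : V -> V -> Prop) w x d i : walk_steps G x w -> (i < length w)%nat -> G (nth i (x :: w) d) (nth i w d).
Proof.
  revert x i. induction w as [|y w IH]; simpl; intros x i H Hi; [lia|].
  destruct H as [H1 H2]. destruct i; [assumption|]. apply (IH y i H2). lia.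
Qed.

Lemma nth_length_last {V} (w : list V) a d : nth (length w) (a :: w) d = last w a.
Proof. revert a. induction w as [|y w IH]; intros a; [reflexivity|]. rewrite last_cons. apply (IH y). Qed.

(** The closed walk has [x0] at both ends of its list, so the periodic continuation contains a step
    of length 0. The last bound follows from [M <= 3 |F|] and [rho |F| <= 4 h]. *)
Lemma periodic_walk rho (u v : lp p) : 0 < rho -> E u -> E v -> rho <= dist u v -> exists (F : list (lp p)) (f : nat -> lp p) M,
  (forall x : lp p, E x -> exists y, In y F /\ dist x y < rho) /\
  (forall t, dist (f t) (f (S t)) <= 2 * rho) /\ (forall t, In (f t) F) /\ (forall t, f (t + M)%nat = f t) /\
  (forall z, In z F -> exists t, (t < M)%nat /\ f t = z) /\ rho * (INR (length F) + INR M) <= 16 * h.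
Proof.
  intros Hr Eu Ev Huv. destruct (finite_net rho u v Hr Eu Ev Huv) as [F [F1 [F2 [F3 [F4 F5]]]]].
  destruct (F4 u Eu) as [x0 [Hx0 _]].
  destruct (tour_exists dist (fun a b => dist a b <= 2 * rho) (list_prod F F) F x0) as [w [W1 [W2 [W3 [W4 _]]]]];
    [exact dist_nonneg | exact dist_sym | exact F1 | exact Hx0 | exact (net_linked rho F Hr F2 F4) |
     intros a b; rewrite dist_sym; auto|].
  set (M := S (length w)). exists F, (fun t => nth (t mod M) (x0 :: w) x0), M.
  assert (HM : M <> 0%nat) by (unfold M; lia).
  assert (Lt : forall t, (t mod M < M)%nat) by (intros; apply Nat.mod_upper_bound, HM).
  splits.
  - assumption.
  - intros t. destruct (Nat.eq_dec (t mod M) (length w)) as [Q|Q].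
    + assert (E1 : 0%nat = (S t mod M)%nat).
      { apply (Nat.mod_unique (S t) M (S (t / M)) 0); [lia|]. pose proof (Nat.div_mod t M HM). unfold M in *. lia. }
      rewrite <- E1, Q. simpl (nth 0 _ _).
      rewrite nth_length_last, W2, dist_refl. lra.
    + assert (E1 : S (t mod M) = (S t mod M)%nat).
      { apply (Nat.mod_unique (S t) M (t / M)); [assert (Q' : (t mod M < S (length w))%nat) by exact (Lt t); change (S (t mod M) < S (length w))%nat; clear -Q Q'; lia|]. pose proof (Nat.div_mod t M HM). lia. }
      rewrite <- E1. change (nth (S (t mod M)) (x0 :: w) x0) with (nth (t mod M) w x0). apply (walk_steps_nth (fun a b => dist a b <= 2 * rho)); [assumption|].
      assert (Q' : (t mod M < S (length w))%nat) by exact (Lt t). clear -Q Q'. lia.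
  - intros t. apply W1. apply nth_In. apply Lt.
  - intros t. f_equal. rewrite <- (Nat.mul_1_l M) at 1. apply Nat.Div0.mod_add.
  - intros z Hz. apply W1 in Hz. destruct (In_nth _ _ x0 Hz) as [t [Ht Et]]. exists t. split; [exact Ht|].
    rewrite Nat.mod_small by exact Ht. exact Et.
  - unfold M. rewrite S_INR. apply le_INR in W4. rewrite mult_INR in W4. simpl (INR 2) in W4.
    assert (1 <= INR (length F)). { change 1 with (INR 1). apply le_INR. destruct F; [destruct Hx0 | simpl; lia]. }
    assert (rho * (INR (length F) + (INR (length w) + 1)) <= rho * (4 * INR (length F))) by (apply Rmult_le_compat_l; lra). lra.
Qed.

End Finite_length.

(** * Summation over all scales *)

Definition fiber {T} (l : list (Z * T)) (k : Z) : list T := map snd (filter (fun z => if dec (fst z = k) then true else false) l).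

Lemma in_fiber {T} (l : list (Z * T)) k x : In x (fiber l k) <-> In (k, x) l.
Proof.
  unfold fiber. rewrite in_map_iff. split.
  - intros [[k' x'] [<- H]]. apply in_filter_dec in H. destruct H as [H E]. simpl in E. subst k'. exact H.
  - intros H. exists (k, x). split; [reflexivity|]. apply in_filter_dec. auto.
Qed.

Lemma fiber_nodup {T} (l : list (Z * T)) k : NoDup l -> NoDup (fiber l k).
Proof.
  intros ND. apply NoDup_map_in; [|apply NoDup_filter, ND].
  intros [k1 x1] [k2 x2] H1 H2 E. apply in_filter_dec in H1, H2. simpl in *. destruct H1 as [_ ->], H2 as [_ ->]. congruence.
Qed.

Lemma sumL_fibers {T} (g : Z * T -> R) (l : list (Z * T)) : NoDup l -> (forall z, In z l -> 0 <= g z) ->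
  sumL g l <= sumL (fun k => sumL (fun x => g (k, x)) (fiber l k)) (nodup Z.eq_dec (map fst l)).
Proof.
  intros ND Hg. set (ll := map (fun k => map (pair k) (fiber l k)) (nodup Z.eq_dec (map fst l))).
  apply Rle_trans with (sumL g (concat ll)).
  - apply sumL_incl; [|assumption|].
    + intros z Hz. apply in_concat in Hz. destruct Hz as [q [Hq Hz]]. apply in_map_iff in Hq. destruct Hq as [k [<- _]].
      apply in_map_iff in Hz. destruct Hz as [x [<- Hx]]. apply Hg, in_fiber, Hx.
    + intros [k x] Hz. apply in_concat. exists (map (pair k) (fiber l k)). split.
      * apply in_map_iff. exists k. split; [reflexivity|]. apply nodup_In, in_map_iff. exists (k, x). auto.
      * apply in_map, in_fiber, Hz.
  - rewrite sumL_concat. unfold ll. rewrite sumL_map. apply Req_le, sumL_ext. intros k _. apply sumL_map.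
Qed.

Lemma list_pos_min {T} (g : T -> R) (l : list T) : (forall x, In x l -> 0 < g x) -> exists m, 0 < m /\ forall x, In x l -> m <= g x.
Proof.
  induction l as [|a l IH]; intros H.
  - exists 1. split; [lra | intros x []].
  - destruct IH as [m [Hm IH]]; [intros x Hx; apply H; right; assumption|]. exists (Rmin m (g a)). split.
    + apply Rmin_pos; [assumption | apply H; left; reflexivity].
    + intros x [<-|Hx]; [apply Rmin_r|]. eapply Rle_trans; [apply Rmin_l | apply IH, Hx].
Qed.

Lemma list_Z_bound {T} (g : T -> Z) (l : list T) : exists m, forall x, In x l -> (g x <= m)%Z.
Proof.
  induction l as [|a l [m IH]]; [exists 0%Z; intros x []|]. exists (Z.max m (g a)).
  intros x [<-|Hx]; [lia|]. specialize (IH x Hx). lia.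
Qed.

Lemma pw_le k k' : (k <= k')%Z -> pw k' <= pw k.
Proof.
  intros H. replace k' with (k + Z.of_nat (Z.to_nat (k' - k)))%Z by lia. rewrite pw_add.
  pose proof (pw_pos k). set (j := Z.to_nat (k' - k)).
  pose proof (pow_incr (1 / 2) 1 j ltac:(lra)) as Q. rewrite pow1 in Q. nra.
Qed.

(** As [1 / pw k] doubles with [k], the terms are increments of the bounded function
    [min (1 / pw k, 2 / c)]. *)
Lemma pw_geometric c (l : list Z) : 0 < c -> NoDup l -> (forall k, In k l -> c <= pw k) -> sumL (fun k => / pw k) l <= 2 / c.
Proof.
  intros Hc ND Hl. pose proof (fun k => pw_pos k) as P.
  pose proof (telescope (fun k => Rmin (/ pw k) (2 / c)) (2 / c) 1 l) as Q. rewrite Rmult_1_l in Q.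
  assert (C2 : 0 < 2 / c) by (apply Rdiv_lt_0_compat; lra).
  assert (St : forall k, / pw (k + 1) = 2 * / pw k).
  { intros k. rewrite (pw_succ k). field. apply Rgt_not_eq, P. }
  eapply Rle_trans; [|apply Q; [| | assumption]].
  - apply sumL_le. intros k Hk. change (Z.of_nat 1) with 1%Z. specialize (Hl k Hk). rewrite St.
    assert (/ pw k <= / c) by (apply Rinv_le_contravar; assumption).
    assert (0 < / pw k) by (apply Rinv_0_lt_compat, P).
    rewrite !Rmin_left by (unfold Rdiv; lra). lra.
  - intros k. apply Rle_min_compat_r. rewrite St. assert (0 < / pw k) by (apply Rinv_0_lt_compat, P). lra.
  - intros k. split; [apply Rmin_glb; [left; apply Rinv_0_lt_compat, P | lra] | apply Rmin_r].
Qed.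

(** * The necessary condition: all scales together *)

Section Necessity.
Context {p : R} {Hp : Exponent p}.
Variables (r A : R).
Hypothesis Hr : 2 <= r.
Hypothesis HA : 1 < A.

Section Set_E.
Variables (E : seqR -> Prop) (X : Z -> seqR -> Prop) (h D0 : R).
Hypothesis E_lp : forall x, E x -> in_lp p x.
Hypothesis E_conn : connected p E.
Hypothesis E_len : H1 p E = Fin h.
Hypothesis HX : is_multires p E A X.
Hypothesis HD : diam p E = Fin D0.
Hypothesis D0_ge0 : 0 <= D0.

Definition term (kx : Z * lp p) : R := rpow (@betaR p A E (fst kx) (snd kx)) r * pw (fst kx).

Lemma term_ge0 kx : 0 <= term kx.
Proof. apply Rmult_le_pos; [apply rpow_ge0 | left; apply pw_pos]. Qed.

Lemma beta_unit k (x : lp p) : X k x -> beta p E (ball p x (A * pw k)) = Fin (@betaR p A E k x) /\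
  0 <= @betaR p A E k x <= 1 /\ @betaR p A E k x * pw k <= D0.
Proof.
  intros Hx. pose proof (net_in_E A E X HX k x Hx) as Ex. pose proof (pw_pos k) as Pk.
  assert (R0 : 0 < A * pw k) by (apply Rmult_lt_0_compat; lra).
  destruct (beta_le_radius E x (A * pw k) (Rmin (A * pw k) D0) Ex R0) as [b [Eb Hb]].
  - apply Rmin_glb; lra.
  - intros z Ez Dz. apply Rmin_glb; [assumption|]. apply (diam_dist E D0 HD); assumption.
  - unfold betaR. rewrite Eb. split; [reflexivity|]. split.
    + split; [lra|]. apply Rle_trans with (A * pw k / (A * pw k)); [|right; field; lra].
      eapply Rle_trans; [apply Hb|]. apply Rmult_le_compat_r; [left; apply Rinv_0_lt_compat; assumption | apply Rmin_l].
    + apply Rle_trans with (D0 / (A * pw k) * pw k).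
      * apply Rmult_le_compat_r; [lra|]. eapply Rle_trans; [apply Hb|].
        apply Rmult_le_compat_r; [left; apply Rinv_0_lt_compat; assumption | apply Rmin_r].
      * replace (D0 / (A * pw k) * pw k) with (D0 * / A) by (field; lra).
        assert (/ A <= / 1) by (apply Rinv_le_contravar; lra). rewrite Rinv_1 in H. nra.
Qed.

Hypothesis D0_pos : 0 < D0.
Hypothesis D0_h : D0 <= h.

(** The summand 1 covers a net with a single point, around which the set may fail to leave the
    ball. *)
Lemma net_count k (L : list (lp p)) : NoDup L -> (forall x, In x L -> X k x) -> INR (length L) <= 1 + 4 * h / pw k.
Proof.
  intros ND HL. pose proof (pw_pos k) as Pk.
  assert (H4 : 0 <= 4 * h / pw k) by (apply Rmult_le_pos; [lra | left; apply Rinv_0_lt_compat; assumption]).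
  destruct L as [|x [|y L]]; [simpl; lra | simpl; lra |].
  assert (Q : pw k / 4 * INR (length (x :: y :: L)) <= h).
  { apply (separated_count E h E_lp E_conn E_len); auto.
    - intros z Hz. apply (net_in_E A E X HX k), HL, Hz.
    - intros a b Ha Hb N. apply (net_sep A E X HX k); auto.
    - intros z Hz. assert (exists w, In w (x :: y :: L) /\ z <> w) as [w [Hw N]].
      { destruct (classic (z = x)) as [->|N]; [|exists x; split; [left; reflexivity | assumption]].
        exists y. split; [right; left; reflexivity|]. intros ->. inversion ND as [|? ? Q _]. apply Q. left. reflexivity. }
      exists w. split; [apply (net_in_E A E X HX k), HL, Hw|].
      pose proof (net_sep A E X HX k z w (HL z Hz) (HL w Hw) N). lra. }
  apply Rle_trans with (4 * h / pw k); [|lra]. apply (Rmult_le_reg_l (pw k / 4)); [lra|].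
  replace (pw k / 4 * (4 * h / pw k)) with h by (field; lra). exact Q.
Qed.

(** A line through the centre gives [beta * pw k <= D0], so a term is at most [D0^2 / pw k]. The sum
    over the scales is geometric and dominated by the finest one, which is comparable to [D0]. *)
Lemma large_items kap (l : list (Z * lp p)) : 0 < kap -> NoDup l -> (forall kx, In kx l -> X (fst kx) (snd kx) /\ D0 <= kap * pw (fst kx)) ->
  sumL term l <= 2 * kap * (1 + 4 * kap) * h.
Proof.
  intros Hk ND Hl. eapply Rle_trans; [apply sumL_fibers; [assumption | intros; apply term_ge0]|].
  apply Rle_trans with (sumL (fun k => (1 + 4 * kap) * h * D0 * / pw k) (nodup Z.eq_dec (map fst l))).
  - apply sumL_le. intros k Hk'. apply nodup_In, in_map_iff in Hk'. destruct Hk' as [[k' x'] [Ek Hx']]. simpl in Ek. subst k'.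
    pose proof (proj2 (Hl _ Hx')) as Bk. simpl in Bk. pose proof (pw_pos k) as Pk.
    assert (HF : forall x, In x (fiber l k) -> X k x) by (intros x Hx; apply in_fiber in Hx; apply (Hl _ Hx)).
    pose proof (net_count k (fiber l k) (fiber_nodup l k ND) HF) as Cn.
    apply Rle_trans with (D0 * D0 / pw k * INR (length (fiber l k))).
    + rewrite <- sumL_const. apply sumL_le. intros x Hx. unfold term. simpl.
      destruct (beta_unit k x (HF x Hx)) as [_ [B1 B2]]. set (b := @betaR p A E k x) in *.
      assert (rpow b r <= b * b) by (rewrite <- rpow_2 by lra; apply rpow_exp_le; lra).
      apply (Rmult_le_reg_r (pw k)); [assumption|]. replace (D0 * D0 / pw k * pw k) with (D0 * D0) by (field; lra).
      apply Rle_trans with (b * b * pw k * pw k).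
      * apply Rmult_le_compat_r; [lra|]. apply Rmult_le_compat_r; lra.
      * replace (b * b * pw k * pw k) with ((b * pw k) * (b * pw k)) by ring.
        assert (0 <= b * pw k) by (apply Rmult_le_pos; lra). apply Rmult_le_compat; lra.
    + assert (Q : D0 / pw k <= kap).
      { apply (Rmult_le_reg_r (pw k)); [assumption|]. replace (D0 / pw k * pw k) with D0 by (field; lra). assumption. }
      assert (Q0 : 0 < D0 / pw k) by (apply Rdiv_lt_0_compat; assumption).
      apply Rle_trans with (D0 * D0 / pw k * (1 + 4 * h / pw k)).
      * apply Rmult_le_compat_l; [|assumption]. apply Rmult_le_pos; [nra | left; apply Rinv_0_lt_compat; assumption].
      * replace (D0 * D0 / pw k * (1 + 4 * h / pw k)) with (D0 / pw k * (D0 + 4 * h * (D0 / pw k))) by (field; lra).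
        replace ((1 + 4 * kap) * h * D0 * / pw k) with (D0 / pw k * (h + 4 * h * kap)) by (field; lra).
        apply Rmult_le_compat_l; [lra|]. assert (4 * h * (D0 / pw k) <= 4 * h * kap) by (apply Rmult_le_compat_l; lra). lra.
  - rewrite sumL_scal. pose proof (pw_geometric (D0 / kap) (nodup Z.eq_dec (map fst l))) as G.
    assert (0 < D0 / kap) by (apply Rdiv_lt_0_compat; assumption).
    apply Rle_trans with ((1 + 4 * kap) * h * D0 * (2 / (D0 / kap))).
    + apply Rmult_le_compat_l; [apply Rmult_le_pos; [apply Rmult_le_pos|]; lra|]. apply G; [assumption | apply NoDup_nodup|].
      intros k Hk'. apply nodup_In, in_map_iff in Hk'. destruct Hk' as [[k' x'] [Ek Hx']]. simpl in Ek. subst k'.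
      pose proof (proj2 (Hl _ Hx')) as Bk. simpl in Bk. apply (Rmult_le_reg_r kap); [assumption|].
      replace (D0 / kap * kap) with D0 by (field; lra). lra.
    + right. field. split; lra.
Qed.

Variables (J : nat) (C : R).
Hypothesis J_pos : (1 <= J)%nat.
Hypothesis C_pos : 0 < C.
Hypothesis HC : forall k0 rho (F : list (lp p)) f M X bt n, 0 < rho -> rho <= scale J k0 0 / 100 ->
    (forall t, dist (f t) (f (S t)) <= 2 * rho) -> (forall t, In (f t) F) -> (forall t, f (t + M)%nat = f t) ->
    (forall z, In z F -> exists t, (t < M)%nat /\ f t = z) ->
    (forall i, NoDup (X i)) -> (forall i, incl (X i) F) ->
    (forall i x y, In x (X i) -> In y (X i) -> x <> y -> scale J k0 i / 2 <= dist x y) ->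
    (forall i x, In x (X i) -> exists z, In z F /\ (2 * A + 10) * scale J k0 i <= dist x z) ->
    (forall i x, In x (X i) -> 0 <= bt i x <= 1) ->
    (forall i x, In x (X i) -> 0 < bt i x -> forall P Q, exists y, In y F /\ dist x y <= 2 * A * scale J k0 i /\
      far_line (bt i x * scale J k0 i) y P Q) ->
    sumL (fun i => sumL (fun x => rpow (bt i x) r * scale J k0 i) (X i)) (seq 0 n) <= C * (rho * (INR (length F) + INR M)).

(** Finitely many items occur, so the mesh [rho] can be small compared with all their scales and
    with all their positive values of [beta]. Moving each net point to the fine net then costs
    constants only, and the scales split into [J] residue classes counted from the finest. *)
Lemma small_items (l : list (Z * lp p)) : NoDup l -> (forall kx, In kx l -> X (fst kx) (snd kx) /\ 4 * (2 * A + 11) * pw (fst kx) <= D0) ->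
  sumL term l <= rpow 4 r * (INR J * (C * (16 * h))).
Proof.
  intros ND Hl.
  assert (exists u v : lp p, E u /\ E v /\ D0 / 2 < dist u v) as [u [v [Eu [Ev Duv]]]].
  { apply NNPP. intros N. assert (K : Rbar_le (Fin D0) (Fin (D0 / 2))); [|simpl in K; lra].
    rewrite <- HD at 1. apply Esup_lub; [simpl; lra|]. intros w [y [z [Ey [Ez ->]]]]. apply Rnot_lt_le. intros Q. apply N.
    exists (MkLp y (E_lp y Ey)), (MkLp z (E_lp z Ez)). auto. }
  destruct (list_Z_bound fst l) as [kmax Hkmax].
  destruct (list_Z_bound (fun kx => kmax - fst kx)%Z l) as [n0 Hn0]. set (n := S (Z.to_nat n0)).
  set (b := fun kx : Z * lp p => @betaR p A E (fst kx) (snd kx)).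
  destruct (list_pos_min (fun kx => if Rlt_dec 0 (b kx) then b kx / 4 * pw (fst kx) else 1) l) as [m [Hm1 Hm2]].
  { intros kx _. destruct (Rlt_dec 0 (b kx)); [|lra]. pose proof (pw_pos (fst kx)). apply Rmult_lt_0_compat; lra. }
  set (rho := Rmin (Rmin (pw kmax / 100) (D0 / 2)) m).
  assert (Hrho : 0 < rho /\ rho <= pw kmax / 100 /\ rho <= D0 / 2 /\ rho <= m).
  { pose proof (pw_pos kmax). pose proof (Rmin_l (Rmin (pw kmax / 100) (D0 / 2)) m). pose proof (Rmin_l (pw kmax / 100) (D0 / 2)).
    pose proof (Rmin_r (pw kmax / 100) (D0 / 2)). pose proof (Rmin_r (Rmin (pw kmax / 100) (D0 / 2)) m).
    unfold rho. splits; try lra. apply Rmin_pos; [apply Rmin_pos; lra | assumption]. }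
  clearbody rho. destruct Hrho as [R0 [R1 [R2 R3]]]. assert (Huv : rho <= dist u v) by lra.
  destruct (periodic_walk E h E_lp E_conn E_len rho u v R0 Eu Ev Huv) as [F [f [M [W1 [W2 [W3 [W4 [W5 W6]]]]]]]].
  destruct (choice (fun x y : lp p => E x -> In y F /\ dist x y < rho)) as [sh Hsh].
  { intros x. destruct (classic (E x)) as [Q|Q]; [|exists x; tauto]. destruct (W1 x Q) as [y Hy]. exists y. auto. }
  assert (Item : forall k x, In x (fiber l k) -> X k x /\ E x /\ 4 * (2 * A + 11) * pw k <= D0 /\ rho <= pw k / 100 /\
    (0 < b (k, x) -> rho <= b (k, x) / 4 * pw k)).
  { intros k x Hx. apply in_fiber in Hx. destruct (Hl _ Hx) as [X1 X2]. simpl in X1, X2. splits; auto.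
    - apply (net_in_E A E X HX k x X1).
    - pose proof (pw_le k kmax (Hkmax _ Hx)). lra.
    - intros Hb. specialize (Hm2 _ Hx). destruct (Rlt_dec 0 (b (k, x))); [|contradiction]. simpl in Hm2. lra. }
  assert (ShSep : forall k x y, In x (fiber l k) -> In y (fiber l k) -> x <> y -> pw k / 2 <= dist (sh x) (sh y)).
  { intros k x y Hx Hy N. destruct (Item k x Hx) as [X1 [X2 [_ [X4 _]]]]. destruct (Item k y Hy) as [Y1 [Y2 _]].
    pose proof (net_sep A E X HX k x y X1 Y1 N). destruct (Hsh x X2) as [_ Dx]. destruct (Hsh y Y2) as [_ Dy].
    pose proof (dist_triangle x (sh x) y). pose proof (dist_triangle (sh x) (sh y) y). rewrite (dist_sym (sh y) y) in *.
    pose proof (pw_pos k). lra. }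
  assert (ShInj : forall k x y, In x (fiber l k) -> In y (fiber l k) -> sh x = sh y -> x = y).
  { intros k x y Hx Hy Q. apply NNPP. intros N. pose proof (ShSep k x y Hx Hy N) as S1. rewrite Q, dist_refl in S1.
    pose proof (pw_pos k). lra. }
  destruct (choice (fun (ky : Z * lp p) x => In (snd ky) (map sh (fiber l (fst ky))) -> In x (fiber l (fst ky)) /\ sh x = snd ky)) as [inv Hinv].
  { intros [k y]. simpl. destruct (classic (In y (map sh (fiber l k)))) as [Q|Q]; [|exists y; tauto].
    apply in_map_iff in Q. destruct Q as [x [Q1 Q2]]. exists x. auto. }
  set (sc := fun c i => (kmax - Z.of_nat c - Z.of_nat J * Z.of_nat i)%Z).
  (* The division by 4: one factor 2 is lost in [beta_far], the other in moving the far point to the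
     fine net. *)
  assert (Class : forall c, sumL (fun i => sumL (fun x => rpow (b (sc c i, x) / 4) r * pw (sc c i)) (fiber l (sc c i))) (seq 0 n) <= C * (16 * h)).
  { intros c. pose proof (HC (kmax - Z.of_nat c) rho F f M (fun i => map sh (fiber l (sc c i)))
      (fun i y => b (sc c i, inv (sc c i, y)) / 4) n) as Q.
    eapply Rle_trans; [eapply Rle_trans; [|apply Q]|]; auto.
    - apply Req_le, sumL_ext. intros i _. rewrite sumL_map. apply sumL_ext. intros x Hx. unfold scale. fold (sc c i).
      destruct (Hinv (sc c i, sh x)) as [I1 I2]; [simpl; apply in_map, Hx|]. simpl in I1, I2.
      rewrite (ShInj (sc c i) _ x I1 Hx I2). reflexivity.
    - apply Rle_trans with (pw kmax / 100); [assumption|]. unfold scale. pose proof (pw_le (kmax - Z.of_nat c - Z.of_nat J * Z.of_nat 0) kmax ltac:(lia)). lra.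
    - intros i. apply NoDup_map_in; [apply ShInj | apply fiber_nodup, ND].
    - intros i y Hy. apply in_map_iff in Hy. destruct Hy as [x [<- Hx]]. apply Hsh. destruct (Item _ _ Hx) as [_ [Ex _]]. exact Ex.
    - intros i y y' Hy Hy' N. apply in_map_iff in Hy, Hy'. destruct Hy as [x [<- Hx]], Hy' as [x' [<- Hx']].
      apply ShSep; auto. intros ->. apply N. reflexivity.
    - intros i y Hy. apply in_map_iff in Hy. destruct Hy as [x [<- Hx]]. unfold scale. fold (sc c i). set (k := sc c i) in *.
      destruct (Item k x Hx) as [_ [Ex [S1 [S2 _]]]]. pose proof (pw_pos k) as Pk.
      assert (exists z : lp p, E z /\ D0 / 4 <= dist x z) as [z [Ez Dz]].
      { pose proof (dist_triangle u x v) as Q1. rewrite (dist_sym u x) in Q1.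
        destruct (Rle_dec (D0 / 4) (dist x u)); [exists u | exists v]; split; auto. lra. }
      exists (sh z). split; [apply Hsh, Ez|]. destruct (Hsh x Ex) as [_ Dx]. destruct (Hsh z Ez) as [_ Dz'].
      pose proof (dist_triangle x (sh x) z). pose proof (dist_triangle (sh x) (sh z) z). rewrite (dist_sym (sh z) z) in *. lra.
    - intros i y Hy. destruct (Hinv (sc c i, y) Hy) as [I1 _]. simpl in I1. destruct (Item _ _ I1) as [X1 _].
      destruct (beta_unit _ _ X1) as [_ [B1 _]]. unfold b. simpl. lra.
    - intros i y Hy Hb P0 Q0. destruct (Hinv (sc c i, y) Hy) as [I1 I2]. simpl in I1, I2. unfold scale. fold (sc c i).
      set (k := sc c i) in *. set (x := inv (k, y)) in *. destruct (Item k x I1) as [X1 [Ex [_ [S2 S3]]]].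
      destruct (beta_unit k x X1) as [B1 [B2 _]]. pose proof (pw_pos k) as Pk.
      assert (Hb' : 0 < b (k, x)) by lra. specialize (S3 Hb').
      destruct (beta_far E x (A * pw k) (b (k, x)) Ex ltac:(nra) B1 Hb' P0 Q0) as [z [Ez [Dz Fz]]].
      destruct (Hsh x Ex) as [_ Dx]. destruct (Hsh z Ez) as [Fz1 Dz'].
      exists (sh z). splits; [assumption | |].
      + rewrite <- I2. pose proof (dist_triangle (sh x) x (sh z)). pose proof (dist_triangle x z (sh z)).
        rewrite (dist_sym (sh x) x) in *. nra.
      + intros t. pose proof (Fz t) as F0. pose proof (dist_triangle z (sh z) (comb t P0 Q0)).
        assert (b (k, x) / 2 * pw k <= b (k, x) / 2 * (A * pw k)) by (apply Rmult_le_compat_l; nra). lra.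
    - apply Rmult_le_compat_l; [lra | exact W6]. }
  eapply Rle_trans; [apply sumL_fibers; [assumption | intros; apply term_ge0]|].
  set (phi := fun k => sumL (fun x => term (k, x)) (fiber l k)).
  apply Rle_trans with (sumL phi (map (fun ci => sc (fst ci) (snd ci)) (list_prod (seq 0 J) (seq 0 n)))).
  - apply sumL_incl; [intros k _; apply sumL_ge0; intros; apply term_ge0 | apply NoDup_nodup|].
    intros k Hk. apply nodup_In, in_map_iff in Hk. destruct Hk as [[k' x] [Ek Hx]]. simpl in Ek. subst k'.
    pose proof (Hkmax _ Hx) as Q1. pose proof (Hn0 _ Hx) as Q2. simpl in Q1, Q2.
    set (d := Z.to_nat (kmax - k)). assert (JN : J <> 0%nat) by lia. pose proof (Nat.div_mod d J JN) as Dm.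
    apply in_map_iff. exists (d mod J, d / J)%nat. split.
    + unfold sc. simpl fst. simpl snd. unfold d in *. lia.
    + apply in_prod; apply in_seq; [split; [lia | apply Nat.mod_upper_bound, JN]|].
      split; [lia|]. simpl. unfold n. apply Nat.lt_succ_r. eapply Nat.le_trans; [apply Nat.Div0.div_le_mono with (c := J); unfold d; apply Z2Nat.inj_le with (m := n0); lia|].
      rewrite <- (Nat.div_1_r (Z.to_nat n0)) at 2. apply Nat.div_le_compat_l. lia.
  - rewrite sumL_map, sumL_prod. apply Rle_trans with (sumL (fun _ => rpow 4 r * (C * (16 * h))) (seq 0 J)).
    + apply sumL_le. intros c _. cbn [fst snd].
      eapply Rle_trans; [|apply Rmult_le_compat_l; [apply rpow_ge0 | apply (Class c)]].
      rewrite <- sumL_scal. apply Req_le, sumL_ext. intros i _. unfold phi. rewrite <- sumL_scal. apply sumL_ext. intros x Hx.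
      destruct (Item _ _ Hx) as [X1 _]. destruct (beta_unit _ _ X1) as [_ [B1 _]]. unfold term, b. simpl.
      rewrite <- Rmult_assoc. f_equal. rewrite <- rpow_mul by lra. f_equal. field.
    + rewrite sumL_const, length_seq. right. ring.
Qed.

End Set_E.

Lemma terms_bound : @convex_norm p Hp r -> exists C, 0 < C /\ forall (E : seqR -> Prop) (X : Z -> seqR -> Prop) h D0 l,
  (forall x, E x -> in_lp p x) -> connected p E -> H1 p E = Fin h -> is_multires p E A X -> diam p E = Fin D0 ->
  0 < D0 -> D0 <= h -> NoDup l -> (forall kx : Z * lp p, In kx l -> X (fst kx) (snd kx)) -> sumL (term E) l <= C * h.
Proof.
  intros Hc. destruct (convex_excess r ltac:(lra) Hc) as [c [c_pos Hex]].
  destruct (class_bound A r c HA Hr c_pos Hex) as [J [C [J1 [C0 HC]]]].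
  set (kap := 4 * (2 * A + 11)). assert (Hk : 0 < kap) by (unfold kap; lra).
  exists (rpow 4 r * (INR J * (C * 16)) + 2 * kap * (1 + 4 * kap)).
  split.
  { apply Rplus_le_lt_0_compat; [|repeat apply Rmult_lt_0_compat; lra].
    apply Rmult_le_pos; [apply rpow_ge0|]. apply Rmult_le_pos; [apply pos_INR | lra]. }
  intros E X h D0 l E_lp E_conn E_len HX HD D0p D0h ND Hl.
  set (P := fun kx : Z * lp p => kap * pw (fst kx) <= D0).
  assert (Split : sumL (term E) l = sumL (term E) (filter (fun x => if dec (P x) then true else false) l) +
     sumL (term E) (filter (fun x => if dec (~ P x) then true else false) l)).
  { rewrite !sumL_filter, <- sumL_plus. apply sumL_ext. intros x _. destruct (classic (P x)) as [Q|Q].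
    - rewrite (ind_true (P x)), (ind_false (~ P x)) by tauto. ring.
    - rewrite (ind_false (P x)), (ind_true (~ P x)) by tauto. ring. }
  rewrite Split, Rmult_plus_distr_r. apply Rplus_le_compat.
  - replace (rpow 4 r * (INR J * (C * 16)) * h) with (rpow 4 r * (INR J * (C * (16 * h)))) by ring.
    apply (small_items E X h D0 E_lp E_conn E_len HX HD (Rlt_le _ _ D0p) D0p J C J1 C0 HC); [apply NoDup_filter, ND|].
    intros kx Hkx. apply in_filter_dec in Hkx. destruct Hkx as [H1 H2]. split; [apply Hl, H1 | exact H2].
  - apply (large_items E X h D0 E_lp E_conn E_len HX HD (Rlt_le _ _ D0p) D0p D0h kap); [assumption | apply NoDup_filter, ND|].
    intros kx Hkx. apply in_filter_dec in Hkx. destruct Hkx as [H1 H2]. split; [apply Hl, H1|]. unfold P in H2. lra.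
Qed.

Lemma necessity : @convex_norm p Hp r -> exists C, 0 < C /\ forall (E : seqR -> Prop) (X : Z -> seqR -> Prop),
  (exists x, E x) -> (forall x, E x -> in_lp p x) -> connected p E -> is_multires p E A X ->
  Rbar_le (S_beta p E r A X) (Emult (Fin C) (H1 p E)).
Proof.
  intros Hc. destruct (terms_bound Hc) as [C [C0 HC]]. exists (1 + 2 * A * C).
  assert (AC : 0 < A * C) by (apply Rmult_lt_0_compat; lra). split; [lra|].
  intros E X [x0 Ex0] E_lp E_conn HX.
  assert (H0 : Rbar_le (Fin 0) (H1 p E)) by apply Esup_ge0.
  destruct (H1 p E) as [h|] eqn:E_len.
  (* Infinite measure makes the right side infinite, because the constant is positive. *)
  2:{ simpl. destruct (Req_EM_T _ 0); [lra|]. destruct (S_beta p E r A X); exact I. }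
  simpl in H0.
  assert (K : Rbar_le (diam p E) (Fin h)).
  { apply Esup_lub; [exact H0|]. intros w [y [z [Ey [Ez ->]]]].
    apply (dist_le_length E h E_lp E_conn E_len (MkLp y (E_lp y Ey)) (MkLp z (E_lp z Ez))); assumption. }
  assert (K0 : Rbar_le (Fin 0) (diam p E)) by apply Esup_ge0.
  destruct (diam p E) as [D0|] eqn:HD; [|contradiction]. simpl in K, K0.
  unfold S_beta. rewrite HD.
  assert (Bound : Rbar_le (Esum (fun kx : Z * seqR => X (fst kx) (snd kx))
      (fun kx : Z * seqR => let Q := ball p (snd kx) (A * powerRZ 2 (- fst kx)) in
         Emult (Epow (beta p E Q) r) (diam p Q))) (Fin (2 * A * C * h))).
  2:{ destruct (Esum _ _) as [sg|]; simpl in Bound |- *; [lra | exact Bound]. }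
  apply Esup_lub; [simpl; apply Rmult_le_pos; lra|]. intros w [l [ND [Hl ->]]]. rewrite Forall_forall in Hl.
  set (lift := fun y : seqR => match dec (in_lp p y) with left H => MkLp y H | right _ => MkLp x0 (E_lp x0 Ex0) end).
  assert (Lift : forall kx, In kx l -> crd (lift (snd kx)) = snd kx).
  { intros kx Hkx. unfold lift. destruct (dec _) as [Q|Q]; [reflexivity|]. exfalso. apply Q, E_lp, (net_in_E A E X HX (fst kx)), Hl, Hkx. }
  set (L := map (fun kx => (fst kx, lift (snd kx))) l).
  assert (NDL : NoDup L).
  { apply NoDup_map_in; [|assumption]. intros [k y] [k' y'] Hy Hy' Q. simpl in Q. injection Q as Q1 Q2.
    pose proof (Lift _ Hy) as L1. pose proof (Lift _ Hy') as L2. simpl in L1, L2. rewrite <- L1, <- L2. congruence. }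
  assert (HL : forall kx : Z * lp p, In kx L -> X (fst kx) (snd kx)).
  { intros kx Hkx. apply in_map_iff in Hkx. destruct Hkx as [z [<- Hz]]. cbn [fst snd]. rewrite (Lift z Hz). apply Hl, Hz. }
  assert (D0_ge0 : 0 <= D0) by assumption.
  assert (Sum : sumL (term E) L <= C * h).
  (* For diameter 0 all values of [beta] vanish. *)
  { destruct D0_ge0 as [D0p|D0z].
    - apply (HC E X h D0 L); assumption.
    - apply Rle_trans with 0; [|apply Rmult_le_pos; lra]. rewrite <- (sumL_0 L). apply sumL_le. intros kx Hkx.
      destruct (beta_unit E X D0 HX HD ltac:(lra) (fst kx) (snd kx) (HL _ Hkx)) as [_ [B1 B2]].
      unfold term. pose proof (pw_pos (fst kx)). rewrite rpow_0; [lra|]. nra. }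
  eapply Rbar_le_trans; [apply (fold_Eplus_le _ (fun kx => 2 * A * term E (fst kx, lift (snd kx))))|].
  - intros kx Hkx. cbv zeta.
    destruct (beta_unit E X D0 HX HD D0_ge0 (fst kx) (lift (snd kx))) as [B1 [B2 _]].
    { rewrite (Lift kx Hkx). apply Hl, Hkx. }
    pose proof (pw_pos (fst kx)) as Pk.
    destruct (ball_diam (lift (snd kx)) (A * pw (fst kx))) as [D [ED HD']]; [apply Rmult_lt_0_compat; lra|].
    unfold term. cbn [fst snd]. rewrite (Lift kx Hkx) in *. rewrite B1, ED. simpl.
    replace (2 * A * (rpow (betaR A E (fst kx) (snd kx)) r * pw (fst kx))) with
      (rpow (@betaR p A E (fst kx) (snd kx)) r * (2 * (A * pw (fst kx)))) by ring.
    apply Rmult_le_compat_l; [apply rpow_ge0 | lra].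
  - simpl. rewrite sumL_scal. unfold L in Sum. rewrite sumL_map in Sum.
    replace (2 * A * C * h) with (2 * A * (C * h)) by ring. apply Rmult_le_compat_l; [lra | exact Sum].
Qed.

End Necessity.

Theorem theorem1p4 :
  (* (i) 1 < p <= 2 : sufficient condition with exponent p *)
  (forall p, 1 < p <= 2 -> forall A, 240 <= A -> exists C, 0 < C /\
    forall (E : seqR -> Prop) (X : Z -> seqR -> Prop),
      (exists x, E x) -> (forall x, E x -> in_lp p x) ->
      is_multires p E A X -> S_beta p E p A X <> PInf ->
      exists g, is_curve_param p g /\ (forall x, E x -> image01 g x) /\
        Rbar_le (H1 p (image01 g)) (Emult (Fin C) (S_beta p E p A X))) /\
  (* (ii) 1 < p <= 2 : necessary condition with exponent 2 *)
  (forall p, 1 < p <= 2 -> forall A, 1 < A -> exists C, 0 < C /\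
    forall (Sg : seqR -> Prop) (X : Z -> seqR -> Prop),
      (exists x, Sg x) -> (forall x, Sg x -> in_lp p x) -> connected p Sg ->
      is_multires p Sg A X ->
      Rbar_le (S_beta p Sg 2 A X) (Emult (Fin C) (H1 p Sg))) /\
  (* (iii) 2 <= p < oo : sufficient condition with exponent 2 *)
  (forall p, 2 <= p -> forall A, 240 <= A -> exists C, 0 < C /\
    forall (E : seqR -> Prop) (X : Z -> seqR -> Prop),
      (exists x, E x) -> (forall x, E x -> in_lp p x) ->
      is_multires p E A X -> S_beta p E 2 A X <> PInf ->
      exists g, is_curve_param p g /\ (forall x, E x -> image01 g x) /\
        Rbar_le (H1 p (image01 g)) (Emult (Fin C) (S_beta p E 2 A X))) /\
  (* (iv) 2 <= p < oo : necessary condition with exponent p *)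
  (forall p, 2 <= p -> forall A, 1 < A -> exists C, 0 < C /\
    forall (Sg : seqR -> Prop) (X : Z -> seqR -> Prop),
      (exists x, Sg x) -> (forall x, Sg x -> in_lp p x) -> connected p Sg ->
      is_multires p Sg A X ->
      Rbar_le (S_beta p Sg p A X) (Emult (Fin C) (H1 p Sg))).
Proof.
  splits.
  - intros p Hp A HA. assert (Ep : Exponent p) by exact (proj1 Hp).
    exact (sufficiency p A (proj1 Hp) (smooth_norm_le2 (proj2 Hp)) HA).
  - intros p Hp A HA. assert (Ep : Exponent p) by exact (proj1 Hp).
    exact (necessity 2 A (Rle_refl 2) HA (convex_norm_le2 (proj2 Hp))).
  - intros p Hp A HA. assert (Ep : Exponent p) by (unfold Exponent; lra).
    exact (sufficiency 2 A ltac:(lra) (smooth_norm_ge2 Hp) HA).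
  - intros p Hp A HA. assert (Ep : Exponent p) by (unfold Exponent; lra).
    exact (necessity p A Hp HA (convex_norm_ge2 Hp)).
Qed.
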